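(* Let $\mathfrak{o}$ be a compact discrete valuation ring (of arbitrary characteristic) with finite residue field $\mathbf{k}$ of cardinality $q$ and odd residue characteristic. (1) The set $\mathrm{Sh}_{\mathsf{GU}_3(\mathfrak{o})}$ of all unitary similarity class shadows consists of eight elements, classified by the eight types $\mathcal{G},\mathcal{L},\mathcal{J},\mathcal{T}_1,\mathcal{T}_2,\mathcal{T}_3,\mathcal{M},\mathcal{N}$ (one shadow of each type). (2) For all $\sigma,\tau\in\mathrm{Sh}_{\mathsf{GU}_3(\mathfrak{o})}$ there exists a polynomial $a_{\sigma,\tau}\in\mathbb{Z}[\frac16][t]$ such that the following holds: for every $\ell\in\mathbb{N}$ and every class $\mathcal{C}\in\mathrm{Ad}(\mathsf{GU}_3(\mathfrak{o}))\backslash\mathfrak{gu}_3(\mathfrak{o}_\ell)$ with unitary shadow $\sigma$, the number of classes $\widetilde{\mathcal{C}}\in\mathrm{Ad}(\mathsf{GU}_3(\mathfrak{o}))\backslash\mathfrak{gu}_3(\mathfrak{o}_{\ell+1})$ with unitary shadow $\tau$ lying above $\mathcal{C}$ is equal to $a_{\sigma,\tau}(q)$.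
   Context: Let $\mathfrak{p}$ be the valuation ideal of $\mathfrak{o}$, $\mathfrak{o}_\ell=\mathfrak{o}/\mathfrak{p}^\ell$. Let $\mathfrak{O}$ be the unramified quadratic extension of $\mathfrak{o}$ with valuation ideal $\mathfrak{P}$ and residue field $\mathbf{k}_2$, $\mathfrak{O}_\ell=\mathfrak{O}/\mathfrak{P}^\ell$, and let $\circ$ be the non-trivial Galois automorphism of $\mathfrak{O}|\mathfrak{o}$ and its induced maps on $\mathfrak{O}_\ell$, $\mathbf{k}_2$; for a matrix $A=(a_{ij})$ put $A^\circ=(a_{ji}^\circ)_{ij}$. For $(R,R')\in\{(\mathfrak{o},\mathfrak{O}),(\mathfrak{o}_\ell,\mathfrak{O}_\ell),(\mathbf{k},\mathbf{k}_2)\}$: $\mathsf{GU}_n(R)=\{A\in\mathsf{GL}_n(R')\mid A^\circ A=\mathrm{Id}_n\}$ and $\mathfrak{gu}_n(R)=\{A\in\mathfrak{gl}_n(R')\mid A^\circ+A=0\}$. $\mathrm{Ad}(\mathsf{GU}_3(\mathfrak{o}))\backslash\mathfrak{gu}_3(\mathfrak{o}_\ell)$ is the set of orbits under conjugation; a class $\widetilde{\mathcal{C}}$ in $\mathfrak{gu}_3(\mathfrak{o}_{\ell+1})$ lies above $\mathcal{C}$ in $\mathfrak{gu}_3(\mathfrak{o}_\ell)$ if its reduction modulo $\mathfrak{P}^\ell$ is $\mathcal{C}$. For $A\in\mathfrak{gu}_3(\mathfrak{o}_\ell)$ let $\mathrm{sh}_{\mathsf{GU}}(A)\le\mathsf{GU}_3(\mathbf{k})$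 and $\mathrm{sh}_{\mathfrak{gu}}(A)\le\mathfrak{gu}_3(\mathbf{k})$ be the images modulo $\mathfrak{P}$ of the centralisers of $A$ in $\mathsf{GU}_3(\mathfrak{o})$ and in $\mathfrak{gu}_3(\mathfrak{o})$. The unitary shadow of a class $\mathcal{C}$ is $\{(\mathrm{sh}_{\mathsf{GU}}(A),\mathrm{sh}_{\mathfrak{gu}}(A))\mid A\in\mathcal{C}\}$, and $\mathrm{Sh}_{\mathsf{GU}_3(\mathfrak{o})}$ is the set of all unitary shadows of classes in $\mathfrak{gu}_3(\mathfrak{o}_\ell)$, $\ell\in\mathbb{N}_0$. Types: a unitary shadow has the given type if it is the shadow of (the $\mathsf{GU}_3(\mathbf{k})$-class of) an element $A\in\mathfrak{gu}_3(\mathbf{k})$, i.e. is represented by the pair of centralisers of $A$ in $\mathsf{GU}_3(\mathbf{k})$ and $\mathfrak{gu}_3(\mathbf{k})$, whose minimal polynomial over $\mathbf{k}_2$ has the following form (with $\alpha,\alpha_i\in\mathfrak{gu}_1(\mathbf{k})$ unless said otherwise, differently named roots distinct): $\mathcal{G}$: $t-\alpha$; $\mathcal{L}$: $(t-\alpha_1)(t-\alpha_2)$; $\mathcal{J}$: $(t-\alpha)^2$; $\mathcal{T}_1$: $(t-\alpha_1)(t-\alpha_2)(t-\alpha_3)$; $\mathcal{T}_2$: $\prod_{i=1}^3(t-\alpha_i)$ with $\alpha_1\in\mathfrak{gu}_1(\mathbf{k})$ and distinct $\alpha_2,\alpha_3\in\mathbf{k}_2$ with $\alpha_2=-\alpha_3^\circ$;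 $\mathcal{T}_3$: an irreducible cubic; $\mathcal{M}$: $(t-\alpha_1)(t-\alpha_2)^2$; $\mathcal{N}$: $(t-\alpha)^3$. *)

(* Defs.v *)
From HB Require Import structures.
From mathcomp Require Import all_boot all_order all_algebra.
From mathcomp Require Import all_classical.
Set Implicit Arguments.
Unset Strict Implicit.
Unset Printing Implicit Defensive.
Import GRing.Theory.
Local Open Scope ring_scope.
Local Open Scope classical_set_scope.
Local Open Scope quotient_scope.

(* A domain in which every nonzero element is a unit times a power of a fixed
   nonzero non-unit. The uniformizer is part of the structure; the ideals
   videal l below do not depend on its choice. *)
HB.mixin Record isDVR R of GRing.IntegralDomain R := {
  uniformizer : R;
  uniformizer_neq0 : uniformizer != 0;
  uniformizer_nonunit : uniformizer \isn't a GRing.unit;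
  dvr_factor : forall x : R, x != 0 ->
    exists u n, u \is a GRing.unit /\ x = u * uniformizer ^+ n }.

#[short(type="dvrType")]
HB.structure Definition DVR := {R of isDVR R & GRing.IntegralDomain R}.

Section Quotients.
Variable R : dvrType.

(* The l-th power of the valuation ideal; l = 0 gives the whole ring. *)
Definition videal (l : nat) : {pred R} :=
  fun x => `[< exists y, x = uniformizer ^+ l * y >].

Lemma videalP l x : reflect (exists y, x = uniformizer ^+ l * y) (x \in videal l).
Proof. exact: asboolP. Qed.

Lemma videalMr l a x : x \in videal l -> a * x \in videal l.
Proof. by case/videalP=> y ->; apply/videalP; exists (a * y); rewrite mulrCA. Qed.

Lemma videal_zmod_closed l : zmod_closed (videal l).
Proof.
split; first by apply/videalP; exists 0; rewrite mulr0.
move=> x y /videalP[a ->] /videalP[b ->]; apply/videalP; exists (a - b).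
by rewrite mulrBr.
Qed.

HB.instance Definition _ l :=
  GRing.isZmodClosed.Build R (videal l) (videal_zmod_closed l).

(* MathComp's ring structure on quotients requires a proper ideal; here l = 0
   is allowed, so the quotient is only a possibly trivial ring. *)
Definition vquot (l : nat) := Quotient.quot (videal l : zmodClosed R).

HB.instance Definition _ l := GRing.Zmodule.on (vquot l).
HB.instance Definition _ l := EqQuotient.on (vquot l).

Lemma vquotP l (x y : R) :
  reflect (\pi_(vquot l) x = \pi_(vquot l) y) (x - y \in videal l).
Proof.
by rewrite (Quotient.idealrBE (videal l : zmodClosed R)); apply: eqP.
Qed.

Definition vquot_one l : vquot l := \pi_(vquot l) 1.
Definition vquot_mul l (x y : vquot l) : vquot l := \pi_(vquot l) (repr x * repr y).

Lemma vquot_piD l : {morph \pi_(vquot l) : x y / x + y}.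
Proof. exact: Quotient.pi_add. Qed.

Lemma vquot_pi0 l : \pi_(vquot l) 0 = 0 :> vquot l.
Proof. by apply: (addrI (\pi_(vquot l) 0)); rewrite -vquot_piD !addr0. Qed.

Lemma vquot_piM l x y :
  \pi_(vquot l) (x * y) = vquot_mul (\pi_(vquot l) x) (\pi_(vquot l) y).
Proof.
rewrite /vquot_mul; set x' := repr _; set y' := repr _; apply/vquotP.
have hx : x - x' \in videal l by apply/vquotP; rewrite reprK.
have hy : y - y' \in videal l by apply/vquotP; rewrite reprK.
have -> : x * y - x' * y' = y * (x - x') + x' * (y - y').
  by rewrite !mulrBr addrA [y * x]mulrC [y * x']mulrC subrK.
by apply: rpredD; apply: videalMr.
Qed.

Lemma vquot_mulA l : associative (@vquot_mul l).
Proof.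
elim/quotW=> x; elim/quotW=> y; elim/quotW=> z.
by rewrite -(vquot_piM l y z) -(vquot_piM l x y) -!(vquot_piM l _ _) mulrA.
Qed.

Lemma vquot_mulC l : commutative (@vquot_mul l).
Proof. by move=> x y; rewrite /vquot_mul mulrC. Qed.

Lemma vquot_mul1 l : left_id (vquot_one l) (@vquot_mul l).
Proof. by elim/quotW=> x; rewrite -(vquot_piM l 1 x) mul1r. Qed.

Lemma vquot_mulDl l : left_distributive (@vquot_mul l) +%R.
Proof.
elim/quotW=> x; elim/quotW=> y; elim/quotW=> z.
rewrite -(vquot_piD l x y) -(vquot_piM l x z) -(vquot_piM l y z).
by rewrite -(vquot_piM l (x + y) z) mulrDl vquot_piD.
Qed.

HB.instance Definition _ l := GRing.Zmodule_isComPzRing.Build (vquot l)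
  (@vquot_mulA l) (@vquot_mulC l) (@vquot_mul1 l) (@vquot_mulDl l).

Definition residue := vquot 1.

HB.instance Definition _ := GRing.ComPzRing.on residue.
HB.instance Definition _ := EqQuotient.on residue.

Lemma notin_videal1 x : (x \notin videal 1) = (x \is a GRing.unit).
Proof.
apply/idP/idP => [xV | xU].
  have [x0 | x0] := eqVneq x 0; first by rewrite x0 rpred0 in xV.
  have [u [[|n] [uU xE]]] := dvr_factor x x0; first by rewrite xE mulr1.
  case/negP: xV; apply/videalP; exists (u * uniformizer ^+ n).
  by rewrite xE exprS mulrCA expr1.
apply/negP => /videalP[y xE]; move: xU; rewrite xE expr1 unitrM => /andP[].
by rewrite (negPf uniformizer_nonunit).
Qed.

Lemma residue_oner_neq0 : 1 != 0 :> residue.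
Proof.
apply/eqP => h; have : 1 - 0 \in videal 1 by apply/vquotP; rewrite vquot_pi0.
by apply/negP; rewrite subr0 notin_videal1 unitr1.
Qed.

HB.instance Definition _ :=
  GRing.PzSemiRing_isNonZero.Build residue residue_oner_neq0.

Definition residue_inv (x : residue) : residue :=
  if x == 0 then 0 else \pi_residue (repr x)^-1.

Lemma residue_mulVf x : x != 0 -> residue_inv x * x = 1.
Proof.
move=> x0; rewrite /residue_inv (negPf x0) -[X in _ * X](@reprK _ residue).
transitivity (\pi_residue ((repr x)^-1 * repr x)); first by rewrite vquot_piM.
rewrite mulVr // -notin_videal1; apply: contraNN x0 => xV.
apply/eqP; rewrite -[x]reprK.
by rewrite -(vquot_pi0 1); apply/vquotP; rewrite subr0.
Qed.

Lemma residue_inv0 : residue_inv 0 = 0.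
Proof. by rewrite /residue_inv eqxx. Qed.

HB.instance Definition _ :=
  GRing.ComNzRing_isField.Build residue residue_mulVf residue_inv0.

Definition redmx l n (A : 'M[R]_n) : 'M[vquot l]_n :=
  map_mx \pi_(vquot l) A.

Definition vquot_red l (x : vquot l.+1) : vquot l := \pi_(vquot l) (repr x).

Lemma vquot_redE l x : vquot_red (\pi_(vquot l.+1) x) = \pi_(vquot l) x.
Proof.
apply/vquotP.
have /videalP[y yE] : repr (\pi_(vquot l.+1) x) - x \in videal l.+1.
  by apply/vquotP; rewrite reprK.
by apply/videalP; exists (uniformizer * y); rewrite yE exprSr mulrA.
Qed.

(* Compactness in the topology whose basic neighbourhoods of x are the
   x + P^n. *)
Definition vopen (U : set R) :=
  forall x, U x -> exists n, forall y, y - x \in videal n -> U y.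

Definition vcompact :=
  forall F : set (set R), F `<=` vopen -> \bigcup_(U in F) U = setT ->
    exists G : set (set R),
      [/\ G `<=` F, finite_set G & \bigcup_(U in G) U = setT].

End Quotients.

(* O is free of rank 2 over o, and a uniformizer of o is one of O. The residue
   field of o being finite, the residue extension is automatically separable.
   circ is the non-trivial automorphism of O over o. *)
Record unramified_quadratic (o O : dvrType) (iota : {rmorphism o -> O})
    (circ : {rmorphism O -> O}) : Prop := {
  uq_free : exists b1 b2 : O, forall x,
    exists! c : o * o, x = iota c.1 * b1 + iota c.2 * b2;
  uq_unramified : exists2 u : O,
    u \is a GRing.unit & iota uniformizer = u * uniformizer;
  uq_bij : bijective circ;
  uq_fix : forall a, circ (iota a) = iota a;
  uq_nontrivial : exists x, circ x != x }.

Section Unitary.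

Definition conjmx (R : pzRingType) (c : R -> R) n (A : 'M[R]_n) : 'M[R]_n :=
  (map_mx c A)^T.

Definition GU (R : comUnitRingType) (c : R -> R) n : set 'M[R]_n :=
  [set A | A \in unitmx /\ conjmx c A *m A = 1%:M].

Definition gu (R : pzRingType) (c : R -> R) n : set 'M[R]_n :=
  [set A | conjmx c A + A = 0].

(* Scalar version of gu c 1. *)
Definition gu1 (R : pzRingType) (c : R -> R) : set R := [set x | c x + x = 0].

End Unitary.

Section Classes.
Variables (O : dvrType) (circ : {rmorphism O -> O}).

(* The map induced by circ on O/P^l, see vquot_mapE below. *)
Definition vquot_map l (x : vquot O l) : vquot O l :=
  \pi_(vquot O l) (circ (repr x)).

Definition circ_res : residue O -> residue O := @vquot_map 1.

Definition gu_quot l : set 'M[vquot O l]_3 := @gu (vquot O l) (@vquot_map l) 3.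

Definition adGU l (g : 'M[O]_3) (A : 'M[vquot O l]_3) : 'M[vquot O l]_3 :=
  redmx l g *m A *m redmx l (invmx g).

Definition is_class l (C : set 'M[vquot O l]_3) : Prop :=
  exists2 A, gu_quot A & C = [set adGU g A | g in GU circ (n := 3)].

Definition above l (C' : set 'M[vquot O l.+1]_3) (C : set 'M[vquot O l]_3) :=
  [set map_mx (@vquot_red O l) A | A in C'] = C.

Definition shGU l (A : 'M[vquot O l]_3) : set 'M[residue O]_3 :=
  [set redmx 1 g | g in
    [set g | GU circ g /\ redmx l g *m A = A *m redmx l g]].

Definition shgu l (A : 'M[vquot O l]_3) : set 'M[residue O]_3 :=
  [set redmx 1 X | X in
    [set X | gu circ X /\ redmx l X *m A = A *m redmx l X]].

Definition shadow_type := set (set 'M[residue O]_3 * set 'M[residue O]_3).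

Definition shadow l (C : set 'M[vquot O l]_3) : shadow_type :=
  [set (shGU A, shgu A) | A in C].

Definition Sh : set shadow_type :=
  [set s | exists l (C : set 'M[vquot O l]_3), is_class C /\ s = shadow C].

End Classes.

Lemma vquot_mapE (o O : dvrType) (iota : {rmorphism o -> O})
    (circ : {rmorphism O -> O}) (H : unramified_quadratic iota circ) l x :
  vquot_map circ (\pi_(vquot O l) x) = \pi_(vquot O l) (circ x).
Proof.
rewrite /vquot_map; set y := repr _; apply/vquotP; rewrite -rmorphB.
have /videalP[z ->] : y - x \in videal l by apply/vquotP; rewrite reprK.
have [u uU uE] := uq_unramified H.
have piE : uniformizer = u^-1 * iota uniformizer :> O.
  by rewrite uE mulKr.
have circ_pi : circ uniformizer = circ u^-1 * u * uniformizer.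
  by rewrite -mulrA -uE -(uq_fix H) -rmorphM -piE.
rewrite rmorphM rmorphXn circ_pi exprMn.
apply/videalP; exists ((circ u^-1 * u) ^+ l * circ z).
by rewrite mulrAC mulrC.
Qed.

Inductive sh_type := tyG | tyL | tyJ | tyT1 | tyT2 | tyT3 | tyM | tyN.

Section Types.
Variables (O : dvrType) (circ : {rmorphism O -> O}).
Let k2 := residue O.
Let c : k2 -> k2 := circ_res circ.
Local Notation lin a := ('X - (a : k2)%:P).

Definition min_poly_of_type (X : sh_type) (p : {poly k2}) : Prop :=
  match X with
  | tyG => exists2 a, gu1 c a & p = lin a
  | tyL => exists a1 a2,
      [/\ gu1 c a1, gu1 c a2, a1 != a2 & p = lin a1 * lin a2]
  | tyJ => exists2 a, gu1 c a & p = lin a ^+ 2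
  | tyT1 => exists a1 a2 a3,
      [/\ [/\ gu1 c a1, gu1 c a2 & gu1 c a3], uniq [:: a1; a2; a3]
        & p = lin a1 * lin a2 * lin a3]
  | tyT2 => exists a1 a2 a3,
      [/\ gu1 c a1, uniq [:: a1; a2; a3], a2 = - c a3
        & p = lin a1 * lin a2 * lin a3]
  | tyT3 => size p = 4 /\ irreducible_poly p
  | tyM => exists a1 a2,
      [/\ gu1 c a1, gu1 c a2, a1 != a2 & p = lin a1 * lin a2 ^+ 2]
  | tyN => exists2 a, gu1 c a & p = lin a ^+ 3
  end.

Definition centGU (A : 'M[k2]_3) : set 'M[k2]_3 :=
  [set g | GU c g /\ g *m A = A *m g].

Definition centgu (A : 'M[k2]_3) : set 'M[k2]_3 :=
  [set X | gu c X /\ X *m A = A *m X].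

Definition res_shadow (A : 'M[k2]_3) : shadow_type O :=
  [set (centGU B, centgu B) | B in [set g *m A *m invmx g | g in GU c (n := 3)]].

Definition has_type (X : sh_type) (s : shadow_type O) : Prop :=
  exists A : 'M[k2]_3,
    [/\ gu c A, min_poly_of_type X (mxminpoly A) & s = res_shadow A].

End Types.

Definition Zinv6_poly (p : {poly rat}) : Prop :=
  forall i, exists m : nat, (6%:R ^+ m * p`_i \is a Num.int)%R.

(* Main.v *)
(* For a skew matrix A over the ring of integers let S_l(A) be the image mod p of
   its centraliser mod p^l. By the Cayley transform the two components of the
   shadow of A are the unitary and the skew part of S_l(A), and by induction on l
   this algebra is always the centraliser of a skew matrix over the residue field:
   A is scalar, or scalar plus a multiple of a rank one matrix, or commutes with a
   matrix that is cyclic mod p. Hence A can be replaced by a matrix congruent to it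
   mod p^l with S_{l+1}(A) = S_l(A) = S. For such A trace duality shows that the
   commutators [X, A] divisible by p^l have residues exhausting the orthogonal of
   S, so the class of A + p^l X only depends on the orbit of X mod p in the quotient
   by that orthogonal under the unitary part of S, and its shadow is given by the
   elements of S commuting with X modulo the orthogonal. Everything is thereby
   reduced to counting orbits over the residue field, done separately for scalar,
   diagonalisable rank one, nilpotent rank one, and cyclic matrices. *)
Require Import Defs.
From HB Require Import structures.
From mathcomp Require Import all_boot all_order all_algebra all_fingroup all_field.
From mathcomp Require Import ring zify.
Require Import Defs.
Set Implicit Arguments.
Unset Strict Implicit.
Unset Printing Implicit Defensive.
Import GRing.Theory.
Local Open Scope ring_scope.

(** * Involutions on matrices and quadratic extensions of finite fields *)

(** Two facts make the counts depend on types alone: the centraliser of a skew matrix over [F]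
    determines its type, and skew matrices of equal type have unitarily conjugate centralisers. The
    obstacle in the second is to turn linear conjugacy into unitary conjugacy. For cyclic matrices
    the defect of a conjugator [P] is the symmetric unit [st P * P] of a commutative centraliser; it
    is removed by writing it as a norm [z * st z], and surjectivity of that norm follows from
    Hilbert 90 by comparing orders of finite groups. For rank one matrices an explicit form of
    Witt's theorem does the same. Oddness of the residue characteristic enters through projections
    to skew matrices and through the Cayley transform; it also gives [q > 2], so that the [q + 1]
    elements of norm one cannot all be excluded by the three eigenvalues of a matrix. The
    denominator 6 comes from unordered triples of roots, together with the factors 1/2 for pairs of
    conjugate roots and 1/3 for irreducible cubics. *)

(** Kept abstract because it is instantiated by the conjugate transpose, over the integers and over
    the residue field, and by the adjoint [wstar] of the antidiagonal form. *)
Record star_axiom (R : comUnitRingType) (c : R -> R) (st : 'M[R]_3 -> 'M[R]_3)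
    : Prop := {
  stD : {morph st : x y / x + y};
  stM : forall x y, st (x * y) = st y * st x;
  stK : involutive st;
  stZ : forall a x, st (a *: x) = c a *: st x }.

Section StarTheory.
Variables (R : comUnitRingType) (c : {rmorphism R -> R}).
Variable st : 'M[R]_3 -> 'M[R]_3.
Hypothesis S : star_axiom c st.
Implicit Types x y g : 'M[R]_3.

Lemma st0 : st 0 = 0.
Proof. by apply: (addrI (st 0)); rewrite -(stD S) !addr0. Qed.
Lemma stN x : st (- x) = - st x.
Proof. by apply: (addrI (st x)); rewrite -(stD S) !subrr st0. Qed.
Lemma stB x y : st (x - y) = st x - st y.
Proof. by rewrite (stD S) stN. Qed.
Lemma st1 : st 1 = 1.
Proof. by have := stM S (st 1) 1; rewrite mulr1 !(stK S) mulr1. Qed.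
Lemma st_scal a : st a%:A = (c a)%:A.
Proof. by rewrite (stZ S) st1. Qed.
Lemma stX x n : st (x ^+ n) = st x ^+ n.
Proof. by elim: n => [|n IH]; rewrite ?expr0 ?st1 // exprS (stM S) IH -exprSr. Qed.
Lemma st_unit x : (st x \is a GRing.unit) = (x \is a GRing.unit).
Proof.
suff h y : y \is a GRing.unit -> st y \is a GRing.unit.
  by apply/idP/idP => [/h|/h //]; rewrite (stK S).
move=> /unitrP[z [zy yz]]; apply/unitrP; exists (st z).
by rewrite -!(stM S) zy yz st1.
Qed.
Lemma stV x : x \is a GRing.unit -> st x^-1 = (st x)^-1.
Proof.
move=> ux; apply: (mulrI (x := st x)); first by rewrite st_unit.
by rewrite -(stM S) mulVr // st1 divrr ?st_unit.
Qed.

Lemma skew_half x : 2%:R \is a @GRing.unit R ->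
  st ((2%:R^-1 : R) *: (x - st x)) + (2%:R^-1 : R) *: (x - st x) = 0.
Proof.
move=> u2; have c2 : c 2%:R^-1 = 2%:R^-1 by rewrite rmorphV // rmorph_nat.
by rewrite (stZ S) c2 -scalerDr stB (stK S) -opprB addNr scaler0.
Qed.

Lemma half_skew x : 2%:R \is a @GRing.unit R -> st x + x = 0 ->
  (2%:R^-1 : R) *: (x - st x) = x.
Proof.
move=> u2 /eqP; rewrite addr_eq0 => /eqP ->.
by rewrite opprK -mulr2n -scaler_nat scalerA mulVr // scale1r.
Qed.

End StarTheory.

Lemma conjmx_star (R : comUnitRingType) (c : {rmorphism R -> R}) :
  involutive c -> star_axiom c (@conjmx R c 3).
Proof.
move=> cK; split=> [x y|x y|x|a x]; apply/matrixP=> i j; rewrite !mxE ?cK //.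
- by rewrite rmorphD.
- rewrite rmorph_sum; apply: eq_bigr => k _.
  by rewrite !mxE rmorphM mulrC.
- by rewrite rmorphM.
Qed.

Lemma ord3P (P : 'I_3 -> Prop) : P 0 -> P 1 -> P 2 -> forall i, P i.
Proof.
move=> h0 h1 h2 [[|[|[|//]]] hi].
- by rewrite (_ : Ordinal hi = 0) //; apply: val_inj.
- by rewrite (_ : Ordinal hi = 1) //; apply: val_inj.
- by rewrite (_ : Ordinal hi = 2) //; apply: val_inj.
Qed.

Lemma sum3 (V : nmodType) (f : 'I_3 -> V) : \sum_i f i = f 0 + f 1 + f 2.
Proof.
rewrite !big_ord_recr big_ord0 /= add0r; congr (f _ + f _ + f _); exact: val_inj.
Qed.

(** The quadratic extension is recorded by cardinalities instead of a subfield: only counting and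
    the two eigenspaces of [c] are ever used. *)
Record qext (F : finFieldType) (c : {rmorphism F -> F}) (q : nat) : Prop := {
  qcK : involutive c;
  qcF : #|F| = (q ^ 2)%N;
  qkp : #|[pred x | c x == x]| = q;
  q2 : 2%:R != 0 :> F }.

Section Fin.
Variables (F : finFieldType) (c : {rmorphism F -> F}) (q : nat).
Hypothesis Q : qext c q.
Local Notation M := 'M[F]_3.
Let cK := qcK Q.

(** [kp] is the fixed field of [c], and [sk] its eigenspace for -1, a line over [kp]; [sk] is the
    scalar version of skew matrices. *)
Definition kp : {set F} := [set x | c x == x].
Definition sk : {set F} := [set x | c x + x == 0].

Lemma kpE x : (x \in kp) = (c x == x). Proof. by rewrite inE. Qed.
Lemma skE x : (x \in sk) = (c x == - x).
Proof. by rewrite inE addr_eq0. Qed.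

Lemma card_kp : #|kp| = q.
Proof. by rewrite -[RHS](qkp Q); apply: eq_card => x; rewrite !inE. Qed.

Lemma q_gt1 : (1 < q)%N.
Proof.
have : (1 < #|F|)%N by apply: finNzRing_gt1.
by rewrite (qcF Q); case: q => [|[|]].
Qed.

Lemma kp_opp x : x \in kp -> - x \in kp.
Proof. by rewrite !kpE rmorphN => /eqP ->. Qed.
Lemma kpD x y : x \in kp -> y \in kp -> x + y \in kp.
Proof. by rewrite !kpE rmorphD => /eqP -> /eqP ->. Qed.
Lemma kpM x y : x \in kp -> y \in kp -> x * y \in kp.
Proof. by rewrite !kpE rmorphM => /eqP -> /eqP ->. Qed.
Lemma skN x : x \in sk -> - x \in sk.
Proof. by rewrite !skE rmorphN => /eqP ->. Qed.
Lemma skD x y : x \in sk -> y \in sk -> x + y \in sk.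
Proof. by rewrite !skE rmorphD => /eqP -> /eqP ->; rewrite opprD. Qed.
Lemma sk_kpM x y : x \in sk -> y \in kp -> x * y \in sk.
Proof. by rewrite !skE kpE rmorphM => /eqP -> /eqP ->; rewrite mulNr. Qed.
Lemma sk_skM x y : x \in sk -> y \in sk -> x * y \in kp.
Proof. by rewrite !skE kpE rmorphM => /eqP -> /eqP ->; rewrite mulrNN. Qed.
Lemma skV x : x \in sk -> x^-1 \in sk.
Proof. by rewrite !skE fmorphV => /eqP ->; rewrite invrN. Qed.
Lemma sk_kp0 x : x \in sk -> x \in kp -> x = 0.
Proof.
rewrite skE kpE => /eqP -> /eqP h; apply/eqP.
have : x *+ 2 == 0 by rewrite mulr2n -{1}h addNr.
by rewrite -mulr_natr mulf_eq0 (negPf (q2 Q)) orbF.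
Qed.

Lemma ex_delta : exists2 d, d \in sk & d != 0.
Proof.
have [x hx] : exists x, c x != x.
  apply/existsP; rewrite -negb_forall; apply/forallP => h.
  have : #|kp| = #|F| by apply: eq_card => x; rewrite kpE h.
  rewrite card_kp (qcF Q); have := q_gt1; nia.
exists (x - c x); last by rewrite subr_eq0 eq_sym.
by rewrite skE rmorphB cK opprB.
Qed.

Lemma card_sk : #|sk| = q.
Proof.
have [d ds d0] := ex_delta; rewrite -card_kp.
have -> : sk = [set d * x | x in kp].
  apply/setP=> y; apply/idP/imsetP => [ys|[x xk ->]]; last exact: sk_kpM.
  exists (d^-1 * y); last by rewrite mulVKf.
  by apply: sk_skM => //; apply: skV.
by rewrite card_imset //; apply: mulfI.
Qed.

Lemma q_gt2 : (2 < q)%N.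
Proof.
have [d ds d0] := ex_delta.
have : (#|d |: (- d |: [set (0%R : F)])| <= #|sk|)%N.
  apply: subset_leq_card; apply/subsetP => x.
  rewrite !in_setU1 in_set1 => /or3P[] /eqP -> //; first exact: skN.
  by rewrite skE rmorph0 oppr0.
rewrite card_sk (_ : #|_| = 3) //; apply/eqP.
have nd : - d != d.
  apply: contra d0 => /eqP h; apply/eqP; apply: sk_kp0 => //.
  by move: ds; rewrite skE kpE h.
by rewrite !cardsU1 cards1 !inE oppr_eq0 (negPf d0) (eq_sym d) (negPf nd).
Qed.

(* The q + 1 elements -1 and (1 + t d)/(1 - t d) of norm one. *)
Lemma norm1_avoid (s : seq F) : (size s <= 3)%N ->
  exists l, [/\ l * c l = 1, l \notin s & exists2 w, w != 0 & l = w / c w].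
Proof.
move=> ss; have [d ds d0] := ex_delta.
have cd : c d = - d by apply/eqP; rewrite -skE.
have ne t e : t \in kp -> c e = e -> e != 0 -> e - t * d != 0.
  move=> tk ce e0; rewrite subr_eq0; apply: contra e0 => /eqP h.
  by apply/eqP/sk_kp0; rewrite ?kpE ?ce // h mulrC; apply: sk_kpM.
have ne1 t : t \in kp -> 1 - t * d != 0.
  by move=> tk; apply: ne => //; rewrite ?rmorph1 ?oner_neq0.
have ne2 t : t \in kp -> 1 + t * d != 0.
  by move=> tk; have := ne1 (- t); rewrite mulNr opprK; apply; apply: kp_opp.
pose f t := (1 + t * d) / (1 - t * d).
have cw t : t \in kp -> c (1 + t * d) = 1 - t * d.
  by rewrite kpE => /eqP tk; rewrite rmorphD rmorphM rmorph1 tk cd mulrN.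
have cw' t : t \in kp -> c (1 - t * d) = 1 + t * d.
  by move=> tk; rewrite -cw // cK.
pose L := -1 |: [set f t | t in kp].
have Lq : #|L| = q.+1.
  rewrite cardsU1 card_in_imset ?card_kp; last first.
    move=> t u tk uk; rewrite /f => /eqP.
    rewrite eqr_div ?ne1 // => /eqP h; apply: (mulIf d0).
    have h2 : (t * d - u * d) * 2%:R = 0 by move: h => /eqP; rewrite -subr_eq0 => /eqP <-; ring.
    apply/eqP; rewrite -subr_eq0; move/eqP: h2.
    by rewrite mulf_eq0 (negPf (q2 Q)) orbF.
  suff -> : -1 \notin [set f t | t in kp] by [].
  apply/imsetP => -[t tk] /(congr1 (fun z => z * (1 - t * d))).
  rewrite /f divfK ?ne1 // => h; case/eqP: (q2 Q).
  have -> : 2%:R = 1 + t * d - -1 * (1 - t * d) by ring.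
  by rewrite h subrr.
have [l lL ls] : exists2 l, l \in L & l \notin s.
  apply/exists_inP; rewrite -negb_forall_in; apply/forall_inP => h.
  have : (#|L| <= size s)%N.
    apply: leq_trans (card_size s); apply: subset_leq_card.
    by apply/subsetP => x /h.
  rewrite Lq; have := q_gt2; lia.
exists l; move: lL; rewrite !inE => /orP[/eqP le|/imsetP[t tk le]].
  split=> //; first by rewrite le rmorphN1 mulrNN mulr1.
  by exists d => //; rewrite le cd invrN mulrN divff.
split=> //; last by exists (1 + t * d); rewrite ?ne2 // le /f cw.
rewrite le /f fmorph_div cw // cw' //.
by rewrite mulrA divfK ?ne1 // divff ?ne2.
Qed.

(** [1 + l x] is singular exactly when [-1/l] is an eigenvalue of [x], so at most three [l] are
    excluded. The form [w / c w] of [l] is what Hilbert 90 and lifting to the integers require. *)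
Lemma norm1_unit (x : M) :
  exists l, [/\ l * c l = 1, 1 + l *: x \is a GRing.unit
    & exists2 w, w != 0 & l = w / c w].
Proof.
pose s := [seq l <- enum F | root (char_poly x) (- l^-1)].
have ss : (size s <= 3)%N.
  have /= := @max_poly_roots _ (char_poly x) [seq - l^-1 | l <- s].
  rewrite size_char_poly size_map ltnS; apply.
  - exact: monic_neq0 (char_poly_monic x).
  - by apply/allP => y /mapP[l]; rewrite mem_filter => /andP[h _] ->.
  - rewrite map_inj_uniq; first exact/filter_uniq/enum_uniq.
    by move=> a b /oppr_inj /invr_inj.
have [l [l1 ls lw]] := norm1_avoid ss; exists l; split=> //.
have l0 : l != 0 by apply: contra_eq_neq l1 => ->; rewrite mul0r eq_sym oner_neq0.
move: ls; rewrite mem_filter mem_enum andbT.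
apply: contraR => nu; rewrite -eigenvalue_root_char; apply/eigenvalueP.
have : \det (1 + l *: x) == 0 by rewrite -[_ == 0]negbK -unitfE; exact: nu.
case/det0P => v v0 vE; exists v => //.
have vE' : v *m x *m 1 = - l^-1 *: v.
  apply: (scalerI l0); move/eqP: vE; rewrite mulmxDr !mulmx1 -scalemxAr addr_eq0 => /eqP vE.
  by rewrite scalerA mulrN divff // scaleN1r [in RHS]vE opprK.
by rewrite -vE' mulmx1.
Qed.

End Fin.

(** The Herbrand quotient of a finite group is 1. The map [w / s w] has kernel the fixed points [P]
    and, by Hilbert 90, image the kernel [U] of the norm, so [|G| = |P| |U|]; also
    [|G| = |norm G| |U|]. Hence the image of the norm, contained in [P], is all of [P]. *)
Lemma herbrand (gT : finGroupType) (G : {group gT}) (s : gT -> gT) :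
  abelian G -> {in G &, {morph s : x y / (x * y)%g}} ->
  {in G, forall x, s x \in G} -> {in G, forall x, s (s x) = x} ->
  (forall z, z \in G -> (z * s z = 1)%g -> exists2 w, w \in G & z = (w * (s w)^-1)%g) ->
  forall u, u \in G -> s u = u -> exists2 z, z \in G & u = (z * s z)%g.
Proof.
move=> cGG sM sG sK h90.
have cG x y : x \in G -> y \in G -> (x * y = y * x)%g.
  by move=> xG yG; apply: (centsP cGG).
have fM : {in G &, {morph (fun w => w * (s w)^-1)%g : x y / (x * y)%g}}.
  move=> x y xG yG; rewrite /= sM // invMg -!mulgA; congr mulg.
  by rewrite mulgA (cG (y * (s y)^-1)%g) ?groupM ?groupV ?sG.
have gM : {in G &, {morph (fun z => z * s z)%g : x y / (x * y)%g}}.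
  move=> x y xG yG; rewrite /= sM // -!mulgA; congr mulg; rewrite !mulgA; congr mulg.
  by rewrite cG ?sG.
pose f := Morphism fM; pose g := Morphism gM.
pose P := [set x in G | s x == x]; pose U := [set x in G | x * s x == 1]%g.
have kerf : ('ker f)%g = P.
  apply/setP=> x; rewrite !inE /=; case: (x \in G) => //=.
  by rewrite -eq_mulgV1 eq_sym.
have kerg : ('ker g)%g = U by apply/setP=> x; rewrite !inE.
have imf : (f @* G)%g = U.
  apply/setP=> x; rewrite morphimEdom; apply/imsetP/idP => [[w wG ->]|].
    rewrite inE /= groupM ?groupV ?sG //= sM ?groupV ?sG //.
    have -> : s (s w)^-1%g = (w^-1)%g.
      apply: (mulgI (s (s w))); rewrite -sM ?groupV ?sG // mulgV sK // mulgV.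
      by apply: (mulgI (s 1%g)); rewrite -sM // !mulg1.
    by rewrite mulgA mulgKV mulgV.
  rewrite inE => /andP[xG /eqP /(h90 _ xG)[w wG ->]]; by exists w.
have img : (g @* G)%g \subset P.
  apply/subsetP => x; rewrite morphimEdom => /imsetP[w wG ->].
  by rewrite inE /= groupM ?sG //= sM ?sG // sK // cG ?sG.
have cf : (#|U| * #|P| = #|G|)%N.
  by rewrite mulnC -imf -kerf card_morphim setIid Lagrange ?(normal_sub (ker_normal _)).
have cg : (#|(g @* G)%g| * #|U| = #|G|)%N.
  by rewrite mulnC -kerg card_morphim setIid Lagrange ?(normal_sub (ker_normal _)).
have U0 : (0 < #|U|)%N by rewrite -imf cardG_gt0.
have /eqP gP : (g @* G)%g == P.
  rewrite eqEcard img -(leq_pmul2r U0) cg mulnC cf; exact: leqnn.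
move=> u uG su; have : u \in P by rewrite inE uG su eqxx.
by rewrite -gP morphimEdom => /imsetP[z zG ->]; exists z.
Qed.

(** * Counting by fibres and duality for the trace form *)

Lemma card_fibres (T R : finType) (W : {set T}) (f : T -> R) n :
  (forall x, x \in W -> #|[set y in W | f y == f x]| = n) ->
  #|W| = (#|f @: W| * n)%N.
Proof.
move=> h; rewrite -sum1_card (partition_big_imset f) /= -sum_nat_const.
apply: eq_bigr => r /imsetP[x xW ->].
by rewrite -(h x xW) -sum1_card; apply: eq_bigl => y; rewrite !inE.
Qed.

Section AddFibres.
Variables (T R : finZmodType) (W : {set T}) (f : T -> R).
Hypothesis W0 : 0 \in W.
Hypothesis WB : forall x y, x \in W -> y \in W -> x - y \in W.

Lemma subset_addr x y : x \in W -> y \in W -> x + y \in W.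
Proof. by move=> xW yW; rewrite -[y]opprK WB // -sub0r WB. Qed.

Lemma card_additive : {in W &, {morph f : x y / x - y}} ->
  #|W| = (#|f @: W| * #|[set x in W | f x == 0%R]|)%N.
Proof.
move=> fB; apply: card_fibres => x xW.
rewrite -[RHS](card_imset _ (addrI x)); apply: eq_card => y.
rewrite [LHS]inE; apply/andP/imsetP => [[yW /eqP fy]|[k]].
  exists (y - x); last by rewrite addrCA subrr addr0.
  by rewrite inE WB //= fB // fy subrr.
rewrite inE => /andP[kW /eqP fk] ->; split; first exact: subset_addr.
by rewrite -subr_eq0 -fB ?subset_addr // addrC addKr fk.
Qed.
End AddFibres.

Section Perp.
Variables (F : finFieldType).
Local Notation M := 'M[F]_3.
Implicit Types S : {set M}.

Definition perp S : {set M} := [set y | [forall x in S, \tr (x * y) == 0]].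

Lemma perpP S y : reflect (forall x, x \in S -> \tr (x * y) = 0) (y \in perp S).
Proof. by rewrite inE; apply: (iffP forall_inP) => h x /h /eqP. Qed.

Lemma trM x y : \tr (x * y : M) = \tr (y * x).
Proof. exact: mxtrace_mulC. Qed.

Lemma trD (x y : M) : \tr (x + y) = \tr x + \tr y. Proof. exact: mxtraceD. Qed.
Lemma trB (x y : M) : \tr (x - y) = \tr x - \tr y. Proof. exact: raddfB. Qed.

Lemma tr_nondeg (y : M) : (forall x : M, \tr (x * y) = 0) -> y = 0.
Proof.
move=> h; apply/matrixP => i j; have := h (delta_mx j i).
rewrite /mxtrace (bigD1 j) //= big1 ?addr0 => [|k kj].
  rewrite !mxE (bigD1 i) //= big1 ?addr0 => [|k ki]; last first.
    by rewrite !mxE (negPf ki) andbF mul0r.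
  by rewrite !mxE !eqxx mul1r.
by rewrite !mxE big1 // => l _; rewrite !mxE (negPf kj) mul0r.
Qed.

(** Pairs [(x, y)] with [x] in [S] and [tr (x y) = 0] are counted in both orders; a nonzero linear
    form on a space has a kernel of index [n = |F|]. *)
Lemma card_perp S : 0 \in S -> {in S &, forall x y, x - y \in S} ->
  (forall a x, x \in S -> a *: x \in S) -> (#|S| * #|perp S| = #|[set: M]|)%N.
Proof.
move=> S0 SB SZ; set n := #|F|.
have n1 : (1 < n)%N by apply: finNzRing_gt1.
have ker (W : {set M}) (f : M -> F) : 0 \in W -> {in W &, forall x y, x - y \in W} ->
    (forall a x, x \in W -> a *: x \in W) -> {morph f : x y / x - y} ->
    (forall a x, f (a *: x) = a * f x) -> (exists2 x, x \in W & f x != 0) ->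
    #|W| = (n * #|[set x in W | f x == 0%R]|)%N.
  move=> W0 WB WZ fB fZ [w wW fw].
  rewrite (@card_additive _ _ W f) //.
  congr (_ * _)%N; rewrite /n -cardsT; apply: eq_card => a; rewrite inE.
  by apply/imsetP; exists ((a / f w) *: w); rewrite ?WZ // fZ divfK.
have sw : (\sum_(x in S) #|[set y : M | \tr (x * y) == 0%R]| =
           \sum_(y : M) #|[set x in S | \tr (x * y) == 0%R]|)%N.
  under eq_bigr do rewrite -sum1_card.
  rewrite (exchange_big_dep predT) //=; apply: eq_bigr => y _.
  by rewrite -sum1_card; apply: eq_bigl => x; rewrite !inE.
set m := #|[set: M]|.
have l0 : (n * #|[set y : M | \tr ((0 : M) * y) == 0%R]| = n * m)%N.
  congr (_ * _)%N; apply: eq_card => y; rewrite !inE mul0r mxtrace0; exact/eqP.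
have l1 x : x != 0 -> (n * #|[set y : M | \tr (x * y) == 0%R]| = m)%N.
  move=> x0; rewrite /m (ker setT (fun y => \tr (x * y))).
  - by congr (_ * _)%N; apply: eq_card => y; rewrite !inE.
  - by rewrite inE.
  - by move=> y z _ _; rewrite inE.
  - by move=> y z _; rewrite inE.
  - by move=> y z; rewrite mulrBr trB.
  - by move=> a y; rewrite -scalerAr mxtraceZ.
  - apply/exists_inP; apply: contraR x0; rewrite negb_exists_in.
    move=> /forall_inP h; apply/eqP/tr_nondeg => y; rewrite trM; apply/eqP.
    by have := h y (in_setT _); rewrite negbK.
have r0 y : y \in perp S -> #|[set x in S | \tr (x * y) == 0%R]| = #|S|.
  move=> /perpP yS; apply: eq_card => x; rewrite inE andb_idr // => xS.
  by rewrite yS.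
have r1 y : y \notin perp S -> (n * #|[set x in S | \tr (x * y) == 0%R]| = #|S|)%N.
  move=> yS; rewrite -(ker S (fun x => \tr (x * y))) //.
  - by move=> x z; rewrite mulrBl trB.
  - by move=> a x; rewrite -scalerAl mxtraceZ.
  - by move: yS; rewrite inE negb_forall_in => /exists_inP[x xS h]; exists x.
have L : (n * \sum_(x in S) #|[set y : M | \tr (x * y) == 0%R]| =
   n * m + (#|S| - 1) * m)%N.
  rewrite (bigD1 0) //= mulnDr l0; congr addn; rewrite big_distrr /=.
  rewrite (eq_bigr (fun=> m)) => [|x /andP[_ x0]]; last exact: l1.
  rewrite sum_nat_const; congr (_ * _)%N.
  rewrite (cardD1 0 S) S0 add1n subn1 /=; apply: eq_card => x.
  by rewrite !inE andbC.
have R' : (n * \sum_(y : M) #|[set x in S | \tr (x * y) == 0%R]| =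
   n * (#|perp S| * #|S|) + (m - #|perp S|) * #|S|)%N.
  rewrite (bigID (mem (perp S))) /= mulnDr; congr (_ * _ + _)%N.
    rewrite (eq_bigr (fun=> #|S|)) => [|y /r0 //].
    by rewrite sum_nat_const.
  rewrite big_distrr /= (eq_bigr (fun=> #|S|)) => [|y /r1 //].
  rewrite sum_nat_const /m cardsT -(cardsC (perp S)) addKn; congr (_ * _)%N.
  by apply: eq_card => y; rewrite in_setC.
(* After cancelling [m |S|], both counts carry the nonzero factor [n - 1]. *)
have := congr1 (muln n) sw; rewrite L R'.
have pm : (#|perp S| <= m)%N by apply: subset_leq_card; apply/subsetP => ?; rewrite inE.
have S1 : (0 < #|S|)%N by apply/card_gt0P; exists 0.
nia.
Qed.

End Perp.

(** * Surjectivity of the norm on commutative algebras with involution *)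

Section NormSurj.
Variables (F : finFieldType) (c : {rmorphism F -> F}) (q : nat).
Hypothesis Q : qext c q.
Local Notation M := 'M[F]_3.
Variable st : M -> M.
Hypothesis S : star_axiom c st.

(** Hilbert 90 is checked for the unit group of the commutative algebra [E], and [herbrand] turns it
    into surjectivity onto the symmetric units. *)
Lemma norm_surj (E : {set M}) (u : M) :
  1 \in E -> {in E &, forall x y, x + y \in E} -> {in E &, forall x y, x * y \in E} ->
  (forall a x, x \in E -> a *: x \in E) -> {in E, forall x, st x \in E} ->
  {in E &, forall x y, x * y = y * x} ->
  u \in E -> u \is a GRing.unit -> st u = u ->
  exists2 z, z \in E /\ z \is a GRing.unit & u = z * st z.
Proof.
move=> E1 ED EM EZ Es EC uE uu su.
pose G := [set x : {unit M} | val x \in E].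
have Gg : group_set G.
  apply/group_setP; split; first by rewrite inE.
  by move=> x y; rewrite !inE => xE yE; exact: EM.
pose s (x : {unit M}) := insubd (1%g : {unit M}) (st (val x)).
have sE x : val (s x) = st (val x).
  by rewrite /s insubdK // -topredE /= (st_unit S); exact: (valP x).
have gE (x y : {unit M}) : val (x * y)%g = val x * val y by [].
have vV (x : {unit M}) : val (x^-1)%g = (val x)^-1 by [].
have cGG : abelian (Group Gg).
  apply/centsP => x xG y yG; apply: val_inj; rewrite !gE EC //.
    by move: xG; rewrite inE.
  by move: yG; rewrite inE.
pose uU := insubd (1%g : {unit M}) u.
have uUE : val uU = u by rewrite insubdK.
have [] := @herbrand _ (Group Gg) s cGG _ _ _ _ uU.
- move=> x y; rewrite !inE => xE yE; apply: val_inj.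
  by rewrite sE !gE !sE (stM S) EC //; apply: Es.
- by move=> x; rewrite !inE sE => /Es.
- by move=> x _; apply: val_inj; rewrite !sE (stK S).
- move=> z; rewrite inE => zE /(congr1 val); rewrite gE sE => zz.
  have [l [l1 lu [w w0 lw]]] := norm1_unit Q (val z).
  (* Since [l = w / c w], this is [c w + w z]; when [z * st z = 1] one gets [z * st y = y], the
     element asked for by Hilbert 90. The choice of [l] makes it invertible. *)
  pose y := c w *: (1 + l *: val z).
  have yE : y \in E by apply/EZ/ED => //; apply: EZ.
  have yu : y \is a GRing.unit by rewrite scaler_unit // unitfE fmorph_eq0.
  have yv : val (insubd (1%g : {unit M}) y : {unit M}) = y by rewrite insubdK.
  exists (insubd (1%g : {unit M}) y); first by rewrite inE yv.
  apply: val_inj; rewrite gE vV sE yv.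
  apply: (mulIr (x := st y)); rewrite ?(st_unit S) // mulrVK ?(st_unit S) //.
  rewrite /y scalerDr scalerA lw mulrC divfK ?fmorph_eq0 //.
  rewrite (stD S) !(stZ S) (st1 S) (qcK Q) mulrDr -!scalerAr mulr1 zz addrC.
  by [].
- by rewrite inE uUE.
- by apply: val_inj; rewrite sE uUE.
move=> z; rewrite inE => zE /(congr1 val); rewrite gE sE uUE => ->.
by exists (val z) => //; split=> //; exact: (valP z).
Qed.
End NormSurj.

(** * Krylov bases and cyclic matrices *)

Lemma det3 (R : comNzRingType) (A : 'M[R]_3) :
  \det A = A 0 0 * (A 1 1 * A 2 2 - A 1 2 * A 2 1)
         - A 0 1 * (A 1 0 * A 2 2 - A 1 2 * A 2 0)
         + A 0 2 * (A 1 0 * A 2 1 - A 1 1 * A 2 0).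
Proof.
rewrite (expand_det_row _ 0) sum3 /cofactor !(expand_det_row _ 0).
rewrite !big_ord_recr !big_ord0 /= /cofactor !det_mx11 !mxE /=.
pose a m n := A (inord m) (inord n).
have eA i j : A i j = a (val i) (val j) by rewrite /a !inord_val.
rewrite !eA /= /bump /= !addn0 !add0n !addn1 !expr0 !expr1 /=; ring.
Qed.

Definition rows3 (R : Type) (u v w : 'rV[R]_3) : 'M[R]_3 :=
  \matrix_(i, j) (if val i == 0%N then u else if val i == 1%N then v else w) 0 j.

Definition krylov (R : pzRingType) (u : 'rV[R]_3) (B : 'M[R]_3) : 'M[R]_3 :=
  rows3 u (u *m B) (u *m B *m B).

Lemma mul_rows3 (R : pzSemiRingType) (t u v w : 'rV[R]_3) :
  t *m rows3 u v w = t 0 0 *: u + t 0 1 *: v + t 0 2 *: w.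
Proof. by apply/rowP=> j; rewrite mxE sum3 !mxE /=. Qed.

Lemma rows3_mul (R : pzSemiRingType) n (u v w : 'rV[R]_3) (B : 'M[R]_(3, n)) :
  rows3 u v w *m B = \matrix_(i, j) (if val i == 0%N then u *m B else
     if val i == 1%N then v *m B else w *m B) 0 j.
Proof.
apply/matrixP => i j; rewrite !mxE; under eq_bigr do rewrite mxE.
by case: (val i == 0)%N; last case: (val i == 1)%N; rewrite mxE.
Qed.

Lemma rows3_unit (F : fieldType) (u v w : 'rV[F]_3) :
  (forall a b d, a *: u + b *: v + d *: w = 0 -> [/\ a = 0, b = 0 & d = 0]) ->
  rows3 u v w \in unitmx.
Proof.
move=> h; rewrite -row_free_unit; apply: inj_row_free => t.
rewrite mul_rows3 => /h[t0 t1 t2]; apply/rowP => j; rewrite mxE.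
by elim/ord3P: j.
Qed.

Lemma rows3_unitP (F : fieldType) (u v w : 'rV[F]_3) :
  rows3 u v w \in unitmx ->
  forall a b d, a *: u + b *: v + d *: w = 0 -> [/\ a = 0, b = 0 & d = 0].
Proof.
move=> h a b d e.
pose t : 'rV[F]_3 := \row_j (if val j == 0%N then a else if val j == 1%N then b else d).
have : t *m rows3 u v w = 0 by rewrite mul_rows3 !mxE.
move/(congr1 (mulmx^~ (invmx (rows3 u v w)))); rewrite mulmxK // mul0mx => /rowP t0.
by split; [have := t0 0 | have := t0 1 | have := t0 2]; rewrite !mxE.
Qed.

Lemma rows3_basis (F : fieldType) (u v w t : 'rV[F]_3) :
  rows3 u v w \in unitmx -> exists a b d, t = a *: u + b *: v + d *: w.
Proof.
move=> h; pose s := t *m invmx (rows3 u v w); exists (s 0 0), (s 0 1), (s 0 2).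
by rewrite -mul_rows3 mulmxKV.
Qed.

Lemma rows3_complete (F : fieldType) (u v : 'rV[F]_3) :
  (forall a b, a *: u + b *: v = 0 -> a = 0 /\ b = 0) ->
  exists w, rows3 u v w \in unitmx.
Proof.
move=> h.
have : ~~ ((1%:M : 'M[F]_3) <= col_mx u v)%MS.
  apply/negP => /mxrankS; rewrite mxrank1 => /leq_trans/(_ (rank_leq_row _)) //.
case/row_subPn => i hi; exists (row i 1%:M); apply: rows3_unit => a b d e.
have d0 : d = 0.
  apply/eqP; apply: contraR hi => d0.
  have -> : row i 1%:M = (- (d^-1 * a)) *: u + (- (d^-1 * b)) *: v.
    apply: (scalerI d0); rewrite scalerDr !scalerA !mulrN !mulrA divff // !mul1r.
    by rewrite !scaleNr -opprD; apply/eqP; rewrite -addr_eq0 addrC e.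
  by rewrite addmx_sub // scalemx_sub // -[X in (X <= _)%MS]mul1mx;
    apply/submxP; [exists (row_mx 1 0) | exists (row_mx 0 1)];
    rewrite mul_row_col !mul0mx !mul1mx ?addr0 ?add0r.
by move: e; rewrite d0 scale0r addr0 => /h[-> ->].
Qed.

(** If the three unit vectors and the all-one vector are eigenvectors, then [B] is diagonal with
    equal entries. *)
Lemma scalar_or_moves (F : fieldType) (B : 'M[F]_3) :
  (exists a, B = a%:M) \/
  exists u : 'rV_3, forall a b, a *: u + b *: (u *m B) = 0 -> a = 0 /\ b = 0.
Proof.
have indep (u : 'rV_3) : ~~ (u *m B <= u)%MS ->
    forall a b, a *: u + b *: (u *m B) = 0 -> a = 0 /\ b = 0.
  move=> h a b e; have b0 : b = 0.
    apply/eqP; apply: contraR h => b0; apply/sub_rVP.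
    exists (- (b^-1 * a)); apply: (scalerI b0).
    rewrite scalerA mulrN mulrA divff // mul1r scaleNr.
    by apply/eqP; rewrite -addr_eq0 addrC e.
  split=> //; move/eqP: e; rewrite b0 scale0r addr0 scaler_eq0.
  by case/orP=> /eqP // u0; move: h; rewrite u0 mul0mx sub0mx.
pose o : 'rV[F]_3 := const_mx 1.
case: (boolP (o *m B <= o)%MS) => [/sub_rVP[a ha]|/indep h]; last by right; exists o.
case: (boolP [forall i, row i 1%:M *m B <= row i (1%:M : 'M_3)]%MS) => [/forallP h|]; last first.
  by rewrite negb_forall => /existsP[i /indep h]; right; exists (row i 1%:M).
have /fin_all_exists[b hb] : forall i : 'I_3, exists b, row i B = b *: row i 1%:M.
  by move=> i; have /sub_rVP[b hb] := h i; exists b; rewrite -hb -row_mul mul1mx.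
have E i j : B i j = b i * (i == j)%:R.
  by have /rowP/(_ j) := hb i; rewrite !mxE.
left; exists a; apply/matrixP => i j; rewrite !mxE E.
have [->|//] := eqVneq i j; last by rewrite mulr0.
have /rowP/(_ j) := ha; rewrite !mxE mulr1 (bigD1 j) //= big1 => [|k kj].
  by rewrite mxE mul1r addr0 E eqxx => ->; rewrite mulr1n.
by rewrite mxE mul1r E (negPf kj) mulr0.
Qed.

Lemma krylov_unit_coef (F : fieldType) (B C : 'M[F]_3) (t u v w : 'rV[F]_3) :
  rows3 u v w \in unitmx -> \det C != 0 -> krylov t B = C *m rows3 u v w ->
  krylov t B \in unitmx.
Proof. by move=> h C0 ->; rewrite unitmx_mul h unitmxE unitfE C0. Qed.

(** Take [u] with [u] and [v = u B] independent. If [u] is not cyclic, the plane they span is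
    invariant and [B] acts on the quotient by a scalar [s]; then either [w] or [u + w] is cyclic for
    a suitable complement [w], or [B - s] has rank at most one. *)
Lemma cyclic_or_rank1 (F : fieldType) (B : 'M[F]_3) :
  (exists a (x : 'cV_3) (y : 'rV_3), B = a%:M + x *m y) \/
  exists t, krylov t B \in unitmx.
Proof.
case: (scalar_or_moves B) => [[a ->]|[u hu]].
  by left; exists a, 0, 0; rewrite mul0mx addr0.
move: hu; have [v vE] : exists v, u *m B = v by exists (u *m B).
rewrite vE => hu.
case: (boolP (rows3 u v (v *m B) \in unitmx)) => [h|nu]; first by right; exists u; rewrite /krylov vE.
have [w0 hw0] := rows3_complete hu.
have [x [y [z vB]]] := rows3_basis (v *m B) hw0.
have z0 : z = 0.
  apply/eqP; apply: contraR nu => z0; apply: rows3_unit => a b d.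
  rewrite vB !scalerDr !scalerA => e.
  have /(rows3_unitP hw0)[] : (a + d * x) *: u + (b + d * y) *: v + (d * z) *: w0 = 0.
    by rewrite !scalerDl -e; apply/rowP => j; rewrite !mxE; ring.
  move=> h1 h2 /eqP; rewrite mulf_eq0 (negPf z0) orbF => /eqP d0.
  by move: h1 h2; rewrite d0 !mul0r !addr0.
rewrite z0 scale0r addr0 in vB.
have [p [r [s wB0]]] := rows3_basis (w0 *m B) hw0.
(* As [u B = v], subtracting [r u] removes the [v]-component of [w B]. *)
pose w := w0 - r *: u.
have hw : rows3 u v w \in unitmx.
  apply: rows3_unit => a b d e.
  have /(rows3_unitP hw0)[] : (a - d * r) *: u + b *: v + d *: w0 = 0.
    by rewrite -e; apply/rowP => j; rewrite !mxE; ring.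
  by move=> h1 h2 h3; move: h1; rewrite h3 mul0r subr0.
have wB : w *m B = (p + s * r) *: u + s *: w.
  by rewrite mulmxBl wB0 -scalemxAl vE; apply/rowP => j; rewrite !mxE; ring.
clear wB0 hw0; clearbody w; set p' := p + s * r in wB.
have [p0|p0] := eqVneq p' 0; last first.
  right; exists w; pose C : 'M[F]_3 := \matrix_(i, j) (
    if val i == 0%N then (if val j == 2%N then 1 else 0) else
    if val i == 1%N then (if val j == 0%N then p' else if val j == 1%N then 0 else s) else
     (if val j == 0%N then s * p' else if val j == 1%N then p' else s * s)).
  apply: (@krylov_unit_coef _ _ C _ u v w) => //.
    rewrite det3 !mxE /=.
    rewrite (_ : _ + _ = p' * p'); last by ring.
    by rewrite mulf_neq0.
  rewrite /krylov wB mulmxDl -!scalemxAl vE wB; apply/matrixP => i j.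
  by rewrite !mxE sum3 !mxE; elim/ord3P: i => /=; rewrite ?mxE; ring.
rewrite p0 scale0r add0r in wB.
(* This is the characteristic polynomial of [B] on the plane of [u, v], evaluated at the eigenvalue
   [s] of [w]. *)
have [X0|X0] := eqVneq (s * s - y * s - x) 0; last first.
  right; exists (u + w); pose C : 'M[F]_3 := \matrix_(i, j) (
    if val i == 0%N then (if val j == 1%N then 0 else 1) else
    if val i == 1%N then (if val j == 0%N then 0 else if val j == 1%N then 1 else s) else
     (if val j == 0%N then x else if val j == 1%N then y else s * s)).
  apply: (@krylov_unit_coef _ _ C _ u v w) => //.
    rewrite det3 !mxE /=.
    by rewrite (_ : _ + _ = s * s - y * s - x) //; ring.
  rewrite /krylov mulmxDl wB vE mulmxDl -!scalemxAl wB vB; apply/matrixP => i j.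
  by rewrite !mxE sum3 !mxE; elim/ord3P: i => /=; rewrite ?mxE; ring.
(* In the basis [u, v, w] the matrix [B - s] sends [u] to [v - s u], [v] to [(y - s)(v - s u)] and
   [w] to 0. *)
left; pose X : 'cV[F]_3 := \col_i (if val i == 0%N then 1 else if val i == 1%N then y - s else 0).
exists s, (invmx (rows3 u v w) *m X), (v - s *: u).
have xE : x = s * s - y * s by apply/eqP; rewrite eq_sym -subr_eq0 X0.
apply: (can_inj (mulKmx hw)); rewrite (mulmxDr (rows3 u v w)) !mulmxA mulmxV // mul1mx mul_mx_scalar.
rewrite rows3_mul vE vB wB; apply/matrixP => i j.
by rewrite !mxE big_ord1 !mxE xE; elim/ord3P: i => /=; rewrite ?mxE; ring.
Qed.

(** The polynomial in [B] that agrees with [Y] on [t] differs from [Y] only by commutators of [Y]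
    with [B] and [B ^+ 2]. Over the integers this gives that a matrix commuting with [B] mod [p^l]
    is a polynomial in [B] mod [p^l]. *)
Lemma krylov_poly (R : comUnitRingType) (t : 'rV[R]_3) (B Y : 'M[R]_3) :
  krylov t B \in unitmx -> exists a b d,
    Y - (a%:A + b *: B + d *: B ^+ 2) =
      (krylov t B)^-1 * rows3 0 (t *m (B * Y - Y * B)) (t *m (B ^+ 2 * Y - Y * B ^+ 2)).
Proof.
move=> K; set s := (t *m Y) *m invmx (krylov t B).
exists (s 0 0), (s 0 1), (s 0 2); set P := _ + _ + _.
have BP : B * P = P * B.
  by rewrite /P !mulrDl !mulrDr -!scalerAl -!scalerAr mulr1 mul1r -exprS -exprSr.
have tP : t *m P = t *m Y.
  rewrite -[in RHS](mulmxKV K (t *m Y)) -/s mul_rows3.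
  by rewrite /P !mulmxDr -!scalemxAr mulmx1 expr2 -mulmxE !mulmxA.
apply: (mulrI (x := krylov t B)); rewrite // mulVKr //.
have E X : krylov t B * X = \matrix_(i, j) (if val i == 0%N then t *m X else
     if val i == 1%N then t *m B *m X else t *m B *m B *m X) 0 j by apply: rows3_mul.
rewrite E; apply/matrixP => i j; rewrite !mxE; elim/ord3P: i => /=.
- by rewrite mulmxBr tP subrr.
- rewrite -mulmxA; congr ((_ : 'rV_3) 0 j); rewrite !mulmxE mulrBr BP -mulmxE !mulmxBr.
  by rewrite (mulmxA _ P) tP -!mulmxA.
- rewrite -!mulmxA; congr ((_ : 'rV_3) 0 j); rewrite !mulmxE mulrA -expr2.
  have -> : B ^+ 2 * (Y - P) = B ^+ 2 * Y - P * B ^+ 2.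
    by rewrite mulrBr; congr (_ - _); rewrite expr2 -[LHS]mulrA BP [LHS]mulrA BP -mulrA.
  by rewrite -mulmxE !mulmxBr (mulmxA _ P) tP -!mulmxA.
Qed.

Definition cent (F : finFieldType) (B : 'M[F]_3) : {set 'M[F]_3} :=
  [set x | x * B == B * x].

Lemma centP (F : finFieldType) (B x : 'M[F]_3) : reflect (x * B = B * x) (x \in cent B).
Proof. by rewrite inE; exact: eqP. Qed.

Section Cent.
Variables (F : finFieldType) (B : 'M[F]_3).
Lemma cent1 : 1 \in cent B. Proof. by apply/centP; rewrite mul1r mulr1. Qed.
Lemma cent0 : 0 \in cent B. Proof. by apply/centP; rewrite mul0r mulr0. Qed.
Lemma cent_self : B \in cent B. Proof. exact/centP. Qed.
Lemma centD : {in cent B &, forall x y, x + y \in cent B}.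
Proof. by move=> x y /centP xB /centP yB; apply/centP; rewrite mulrDl mulrDr xB yB. Qed.
Lemma centB : {in cent B &, forall x y, x - y \in cent B}.
Proof. by move=> x y /centP xB /centP yB; apply/centP; rewrite mulrBl mulrBr xB yB. Qed.
Lemma centM : {in cent B &, forall x y, x * y \in cent B}.
Proof.
by move=> x y /centP xB /centP yB; apply/centP; rewrite -mulrA yB !mulrA xB.
Qed.
Lemma centZ a x : x \in cent B -> a *: x \in cent B.
Proof. by move=> /centP xB; apply/centP; rewrite -scalerAl -scalerAr xB. Qed.
Lemma centV x : x \in cent B -> x^-1 \in cent B.
Proof.
move=> /centP xB; apply/centP; case: (boolP (x \is a GRing.unit)) => [ux|nu].
  by apply: (mulrI ux); apply: (mulIr ux); rewrite mulVKr // -!mulrA mulVr // mulr1 xB.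
by rewrite invr_out.
Qed.
Lemma cent_st (c : F -> F) st : star_axiom c st -> st B + B = 0 ->
  {in cent B, forall x, st x \in cent B}.
Proof.
move=> S /eqP; rewrite addr_eq0 => /eqP sB x /centP xB; apply/centP.
have : st (x * B) = st (B * x) by rewrite xB.
by rewrite !(stM S) sB mulNr mulrN => /oppr_inj ->.
Qed.
End Cent.

Lemma horner_mx_sum3 (R : comNzRingType) (B : 'M[R]_3) (p : {poly R}) : (size p <= 3)%N ->
  horner_mx B p = (p`_0)%:A + p`_1 *: B + p`_2 *: B ^+ 2.
Proof.
move=> sp; have pE : p = (p`_0)%:P + p`_1 *: 'X + p`_2 *: 'X^2.
  apply/polyP => i; rewrite !coefD !coefZ coefX coefXn coefC.
  case: i => [|[|[|i]]] /=; rewrite ?mulr0 ?mulr1 ?addr0 ?add0r //.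
  by rewrite nth_default // (leq_trans sp).
rewrite {1}pE !rmorphD /= horner_mx_C (horner_mxZ B p`_1) (horner_mxZ B p`_2) horner_mx_X rmorphXn /= horner_mx_X.
by rewrite -scalemx1.
Qed.

Lemma poly3 (R : nzRingType) (a b d : R) : exists2 p : {poly R},
  (size p <= 3)%N & [/\ p`_0 = a, p`_1 = b & p`_2 = d].
Proof. by exists (\poly_(i < 3) [:: a; b; d]`_i); rewrite ?size_poly // !coef_poly. Qed.

Definition cyclic_mx (F : finFieldType) (B : 'M[F]_3) := exists t, krylov t B \in unitmx.

Section Cyclic.
Variables (F : finFieldType).
Implicit Types B : 'M[F]_3.

Lemma horner_cent B p : horner_mx B p \in cent B.
Proof.
by apply/centP; have := @comm_horner_mx _ _ _ _ p (erefl (B *m B)).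
Qed.

Lemma cyclic_cent B x : cyclic_mx B -> x \in cent B ->
  exists2 p : {poly F}, (size p <= 3)%N & x = horner_mx B p.
Proof.
move=> [t K] /centP xB; have [a [b [d]]] := krylov_poly x K.
have x2B : x * B ^+ 2 = B ^+ 2 * x by rewrite expr2 mulrA xB -!mulrA xB.
rewrite xB x2B !subrr mulmx0 => e.
have e0 : rows3 0 0 0 = 0 :> 'M[F]_3.
  by apply/matrixP => i j; rewrite !mxE !if_same mxE.
have [p sp [p0 p1 p2]] := poly3 a b d; exists p; rewrite ?horner_mx_sum3 // p0 p1 p2.
by apply/eqP; rewrite -subr_eq0 e e0 mulr0.
Qed.

Lemma cyclic_cent_comm B : cyclic_mx B -> {in cent B &, forall x y, x * y = y * x}.
Proof.
move=> cB x y /(cyclic_cent cB)[p _ ->] /(cyclic_cent cB)[r _ ->].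
exact: comm_horner_mx2.
Qed.

Lemma krylov_horner (t : 'rV_3) B (p : {poly F}) : (size p <= 3)%N -> t *m horner_mx B p =
  (\row_j p`_j) *m krylov t B.
Proof.
move=> sp; rewrite horner_mx_sum3 // mul_rows3 !mxE /= !mulmxDr -!scalemxAr mulmx1.
by rewrite expr2 -mulmxE mulmxA.
Qed.

Lemma cyclic_minpoly B : cyclic_mx B -> mxminpoly B = char_poly B.
Proof.
move=> [t K]; apply/eqP; rewrite -eqp_monic ?mxminpoly_monic ?char_poly_monic //.
rewrite -dvdp_size_eqp ?mxminpoly_dvd_char // size_char_poly eqn_leq.
rewrite -[X in (_ <= X)%N](size_char_poly B).
rewrite dvdp_leq ?mxminpoly_dvd_char ?monic_neq0 ?char_poly_monic //=.
rewrite ltnNge; apply/negP => h.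
have := krylov_horner t B h; rewrite mx_root_minpoly mulmx0 => /esym.
move/(congr1 (mulmx^~ (invmx (krylov t B)))); rewrite mulmxK // mul0mx => /rowP e.
case/eqP: (monic_neq0 (mxminpoly_monic B)); apply/polyP => i; rewrite coef0.
case: (ltnP i 3) => [i3|/(leq_trans h)/(nth_default 0) //].
by have := e (Ordinal i3); rewrite !mxE.
Qed.

Lemma cyclic_companion B t : krylov t B \in unitmx ->
  krylov t B * B = \matrix_(i < 3, j < 3) (if val i == 2%N then - (char_poly B)`_j else
    (val j == (val i).+1)%:R) * krylov t B.
Proof.
move=> K; set f := char_poly B.
have B3 : B ^+ 3 = - ((f`_0)%:A + f`_1 *: B + f`_2 *: B ^+ 2).
  pose g := 'X^3 - f.
  have sf : size f = 4 by exact: size_char_poly.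
  have f3 : f`_3 = 1 by have /monicP := char_poly_monic B; rewrite lead_coefE sf.
  have sg : (size g <= 3)%N.
    apply/leq_sizeP => i; rewrite leq_eqVlt coefB coefXn => /orP[/eqP <-|i3].
      by rewrite eqxx f3 subrr.
    by rewrite gtn_eqF // nth_default ?sf // subrr.
  have := horner_mx_sum3 B sg; rewrite !coefB !coefXn /= !sub0r.
  rewrite rmorphB /= rmorphXn /= horner_mx_X (Cayley_Hamilton B) subr0 => ->.
  by rewrite !scaleNr -!opprD.
have E X : krylov t B * X = \matrix_(i, j) (if val i == 0%N then t *m X else
     if val i == 1%N then t *m B *m X else t *m B *m B *m X) 0 j by apply: rows3_mul.
rewrite E; apply/matrixP => i j; rewrite [LHS]mxE [RHS]mxE sum3 !mxE.
elim/ord3P: i => /=; rewrite ?mul0r ?mul1r ?add0r ?addr0; [by rewrite mxE..|].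
rewrite -!mulmxA mulmxE -expr2 -exprS B3.
by rewrite mulmxN !mulmxDr -!scalemxAr mulmx1 expr2 -mulmxE mulmxA !mxE !mulNr -!opprD.
Qed.

(** In their Krylov bases both matrices become the same companion matrix. *)
Lemma cyclic_similar B B' : cyclic_mx B -> cyclic_mx B' -> char_poly B = char_poly B' ->
  exists2 P, P \is a GRing.unit & P * B = B' * P.
Proof.
move=> [t K] [t' K'] fE; exists ((krylov t' B')^-1 * krylov t B).
  by rewrite unitrMl // unitrV.
rewrite -mulrA cyclic_companion // fE.
apply: (mulrI (x := krylov t' B')); rewrite // !mulrA mulrV // mul1r.
by rewrite cyclic_companion // mulrK.
Qed.

End Cyclic.

Section CyclicStar.
Variables (F : finFieldType) (c : {rmorphism F -> F}) (q : nat).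
Hypothesis Q : qext c q.
Local Notation M := 'M[F]_3.
Variable st : M -> M.
Hypothesis S : star_axiom c st.

Lemma uni_unit g : st g * g = 1 -> g \is a GRing.unit.
Proof. by move=> h; have /mulmx1_unit[] : st g *m g = 1%:M by []. Qed.

Lemma uni_inv g : st g * g = 1 -> g^-1 = st g.
Proof. by move=> h; apply: (mulIr (uni_unit h)); rewrite h mulVr // uni_unit. Qed.

Lemma uni_r g : st g * g = 1 -> g * st g = 1.
Proof. by move=> h; rewrite -uni_inv // mulrV // uni_unit. Qed.

(** For any conjugator [P], the unit [st P * P] is symmetric and commutes with [B], so it is a norm
    [z * st z] from the commutative algebra [cent B]; then [P * z^-1] is unitary and still
    conjugates. *)
Lemma cyclic_uni_similar (B B' : M) : st B + B = 0 -> st B' + B' = 0 ->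
  cyclic_mx B -> cyclic_mx B' -> char_poly B = char_poly B' ->
  exists2 g, st g * g = 1 & g * B = B' * g.
Proof.
move=> sB sB' cB cB' fE; have [P uP PB] := cyclic_similar cB cB' fE.
have eN X : st X + X = 0 -> st X = - X by move/eqP; rewrite addr_eq0 => /eqP.
have uC : st P * P \in cent B.
  apply/centP; rewrite -mulrA PB mulrA.
  have := congr1 st PB; rewrite !(stM S) (eN B sB) (eN B' sB') mulNr mulrN => /oppr_inj e.
  by rewrite -e mulrA.
have uE : st P * P \is a GRing.unit by rewrite unitrMl // (st_unit S).
have uS : st (st P * P) = st P * P by rewrite (stM S) (stK S).
have [z [zE uz] uz2] := norm_surj Q S (cent1 B) (@centD _ B)
  (@centM _ B) (@centZ _ B) (cent_st S sB) (cyclic_cent_comm cB) uC uE uS.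
have zsC : st z \in cent B by apply: (cent_st S sB).
have zz : z * st z = st z * z by apply: (cyclic_cent_comm cB).
exists (P * z^-1).
  rewrite (stM S) (stV S) // mulrA -(mulrA _ (st P)) uz2 zz.
  by rewrite !mulrA mulVr ?(st_unit S) // mul1r mulrV.
by rewrite mulrA -PB -!mulrA; congr (_ * _); apply/centP/centV.
Qed.
End CyclicStar.

(** * Types of skew matrices over a finite field *)

Definition regular_type (X : sh_type) : bool :=
  match X with tyG | tyL | tyJ => false | _ => true end.

Section Types.
Variables (F : fieldType) (c : F -> F).
Local Notation lin a := ('X - (a : F)%:P).

(** A copy of [min_poly_of_type] over any field with a map; for the residue field the two are
    convertible. *)
Definition mptype (X : sh_type) (p : {poly F}) : Prop :=
  match X with
  | tyG => exists2 a, gu1 c a & p = lin a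
  | tyL => exists a1 a2,
      [/\ gu1 c a1, gu1 c a2, a1 != a2 & p = lin a1 * lin a2]
  | tyJ => exists2 a, gu1 c a & p = lin a ^+ 2
  | tyT1 => exists a1 a2 a3,
      [/\ [/\ gu1 c a1, gu1 c a2 & gu1 c a3], uniq [:: a1; a2; a3]
        & p = lin a1 * lin a2 * lin a3]
  | tyT2 => exists a1 a2 a3,
      [/\ gu1 c a1, uniq [:: a1; a2; a3], a2 = - c a3
        & p = lin a1 * lin a2 * lin a3]
  | tyT3 => size p = 4 /\ irreducible_poly p
  | tyM => exists a1 a2,
      [/\ gu1 c a1, gu1 c a2, a1 != a2 & p = lin a1 * lin a2 ^+ 2]
  | tyN => exists2 a, gu1 c a & p = lin a ^+ 3
  end.

End Types.

Lemma leq_card_fibres (T R : finType) (W : {set T}) (f : T -> R) n :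
  (forall x, x \in W -> #|[set y in W | f y == f x]| <= n)%N ->
  (#|W| <= #|f @: W| * n)%N.
Proof.
move=> h; rewrite -sum1_card (partition_big_imset f) /= -sum_nat_const.
apply: leq_sum => r /imsetP[x xW ->].
by apply: leq_trans (h x xW); rewrite -sum1_card; apply: eq_leq; apply: eq_bigl => y; rewrite !inE.
Qed.

(** * Roots of skew quadratics and cubics *)

Section Cubics.
Variables (F : finFieldType) (c : {rmorphism F -> F}) (q : nat).
Hypothesis Q : qext c q.
Let cK := qcK Q.
Local Notation sk := (sk c).
Local Notation kp := (kp c).

Lemma gu1P a : reflect (gu1 c a) (a \in sk).
Proof. by rewrite inE; apply: eqP. Qed.

Lemma sqr_fibre (W : {set F}) x : (#|[set y in W | y ^+ 2 == x ^+ 2]| <= 2)%N.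
Proof.
apply: (@leq_trans #|[set x; - x]|); last by rewrite cards2; case: (_ != _).
by apply: subset_leq_card; apply/subsetP => y; rewrite !inE eqf_sqr => /andP[].
Qed.

(* An element of the fixed field is a square t ^+ 2 or d ^+ 2 * t ^+ 2 with t
   fixed, d a nonzero skew element. *)
Lemma kp_sqrt x : x \in kp -> exists s, s ^+ 2 = x.
Proof.
move=> xk; have [d ds d0] := ex_delta Q.
pose W1 := kp :\ 0; pose W2 := sk :\ 0.
pose S1 := [set y ^+ 2 | y in W1]; pose S2 := [set y ^+ 2 | y in W2].
have k0 : 0 \in kp by rewrite kpE rmorph0.
have s0 : 0 \in sk by rewrite skE rmorph0 oppr0.
have h1 : (q.-1 <= #|S1| * 2)%N.
  have -> : q.-1 = #|W1| by rewrite -(card_kp Q) (cardsD1 0) k0.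
  by apply: leq_card_fibres => y _; exact: sqr_fibre.
have h2 : (q.-1 <= #|S2| * 2)%N.
  have -> : q.-1 = #|W2| by rewrite -(card_sk Q) (cardsD1 0) s0.
  by apply: leq_card_fibres => y _; exact: sqr_fibre.
have dis : S1 :&: S2 = set0.
  apply/setP => y; rewrite !inE; apply/negP => /andP[/imsetP[u]].
  rewrite 2!inE => /andP[u0 uk] -> /imsetP[v]; rewrite 2!inE => /andP[v0 vs] /eqP.
  rewrite eqf_sqr => /orP[] /eqP e; case/eqP: u0; apply: (sk_kp0 Q) => //.
    by rewrite e.
  by rewrite e; apply: skN.
have sub : S1 :|: S2 \subset W1.
  apply/subsetP => y; rewrite inE => /orP[] /imsetP[u]; rewrite 2!inE => /andP[u0 uk] ->.
    by rewrite 2!inE expf_neq0 // expr2 kpM.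
  by rewrite 2!inE expf_neq0 // expr2 sk_skM.
have cW1 : #|W1| = q.-1 by rewrite -(card_kp Q) [in RHS](cardsD1 0) k0.
(* The squares of nonzero fixed and of nonzero skew elements are disjoint sets of at least
   [(q - 1)/2] elements each, so together they fill the nonzero fixed elements. *)
have /eqP e : S1 :|: S2 == W1.
  by rewrite eqEcard sub cW1 cardsU dis cards0 subn0; lia.
have [->|x0] := eqVneq x 0; first by exists 0; rewrite expr0n.
have : x \in W1 by rewrite 2!inE x0.
by rewrite -e inE => /orP[] /imsetP[s _ ->]; exists s.
Qed.

(** The discriminant lies in the fixed field, all of whose elements are squares in [F]. *)
Lemma skew_quad_split u w : u \in sk -> w \in kp ->
  exists r s, 'X^2 + u *: 'X + w%:P = ('X - r%:P) * ('X - s%:P).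
Proof.
move=> us wk; have two := q2 Q.
have k4 : 4%:R \in kp by rewrite kpE rmorph_nat.
have [e eE] : exists e, e ^+ 2 = u ^+ 2 - 4%:R * w.
  by apply: kp_sqrt; rewrite expr2 kpD ?sk_skM ?kp_opp ?kpM.
exists ((- u + e) / 2%:R), ((- u - e) / 2%:R).
have four : 4%:R != 0 :> F by rewrite -[4%N]/(2 * 2)%N natrM mulf_neq0.
have -> : w = ((- u + e) / 2%:R) * ((- u - e) / 2%:R).
  have -> : (- u + e) / 2%:R * ((- u - e) / 2%:R) = (u ^+ 2 - e ^+ 2) / 4%:R.
    by field; rewrite two four.
  by rewrite eE; field.
have -> : u *: 'X = - ((- u + e) / 2%:R + (- u - e) / 2%:R)%:P * 'X.
  by rewrite -rmorphN mul_polyC; congr (_ *: _); field; rewrite two.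
rewrite polyCM polyCD; ring.
Qed.

Definition cubic (a b d : F) : {poly F} := 'X^3 + a *: 'X^2 + b *: 'X + d%:P.

Lemma cubic_coef a b d : [/\ (cubic a b d)`_0 = d, (cubic a b d)`_1 = b,
  (cubic a b d)`_2 = a, (cubic a b d)`_3 = 1 & size (cubic a b d) = 4].
Proof.
have sz : size (cubic a b d) = 4.
  rewrite /cubic -!addrA size_polyDl ?size_polyXn //.
  rewrite (leq_ltn_trans (size_polyD _ _)) // gtn_max.
  rewrite (leq_ltn_trans (size_scale_leq _ _)) ?size_polyXn //=.
  rewrite (leq_ltn_trans (size_polyD _ _)) // gtn_max.
  rewrite (leq_ltn_trans (size_scale_leq _ _)) ?size_polyX //=.
  by rewrite (leq_ltn_trans (size_polyC_leq1 _)).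
by split=> //; rewrite !coefD !coefZ coefX !coefXn coefC /= ?mulr0 ?mulr1 ?add0r ?addr0.
Qed.

Lemma monic_cubic (p : {poly F}) : p \is monic -> size p = 4 ->
  p = cubic p`_2 p`_1 p`_0.
Proof.
move=> /monicP; rewrite lead_coefE => l s; rewrite s /= in l.
apply/polyP => i; rewrite !coefD !coefZ coefX !coefXn coefC.
case: i => [|[|[|[|i]]]] /=; rewrite ?mulr0 ?mulr1 ?addr0 ?add0r //.
by rewrite nth_default ?s.
Qed.

Lemma cubic_monic a b d : cubic a b d \is monic.
Proof.
by have [_ _ _ h3 s] := cubic_coef a b d; apply/monicP; rewrite lead_coefE s.
Qed.

Lemma cubic_inj a b d a' b' d' : cubic a b d = cubic a' b' d' -> [/\ a = a', b = b' & d = d'].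
Proof.
move=> e; have [h0 h1 h2 _ _] := cubic_coef a b d.
have [h0' h1' h2' _ _] := cubic_coef a' b' d'.
by rewrite e in h0 h1 h2; split; [rewrite -h2 h2' | rewrite -h1 h1' | rewrite -h0 h0'].
Qed.

Lemma cubic_roots (x y z : F) : ('X - x%:P) * ('X - y%:P) * ('X - z%:P) =
  cubic (- (x + y + z)) (x * y + x * z + y * z) (- (x * y * z)).
Proof. rewrite /cubic -!mul_polyC !(polyCN, polyCD, polyCM); ring. Qed.

Lemma root_lin3 (x y z t : F) : root (('X - x%:P) * ('X - y%:P) * ('X - z%:P)) t =
  [|| t == x, t == y | t == z].
Proof. by rewrite !rootM !root_XsubC orbA. Qed.

(** Coefficients that are alternately skew and fixed make the map [t -> - c t] permute the roots. *)
Lemma cubic_skew_root a b d t : a \in sk -> b \in kp -> d \in sk ->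
  root (cubic a b d) t -> root (cubic a b d) (- c t).
Proof.
rewrite !skE kpE => /eqP as_ /eqP bk /eqP ds.
rewrite /root /cubic !(hornerD, hornerZ, hornerXn, hornerX, hornerC) => /eqP e; apply/eqP; apply: oppr_inj.
rewrite oppr0 -[RHS](rmorph0 c) -[in RHS]e !rmorphD !rmorphM /= ?rmorphXn /= as_ bk ds.
by rewrite -/(c t); ring.
Qed.

Lemma cubic_factor a b d t : root (cubic a b d) t ->
  cubic a b d = ('X - t%:P) * ('X^2 + (a + t) *: 'X + (b + t * (a + t))%:P).
Proof.
rewrite /root /cubic !(hornerD, hornerZ, hornerXn, hornerX, hornerC) => /eqP e.
have -> : d = - (t * (b + t * (a + t)))  by apply/eqP; rewrite -addr_eq0 -e; apply/eqP; ring.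
by rewrite -!mul_polyC !(polyCD, polyCM, polyCN); ring.
Qed.

(** If the root [t] is skew, the quotient by [X - t] is a skew quadratic and splits; otherwise
    [- c t] is a second root and the third factor is linear. *)
Lemma skew_cubic_split a b d t : a \in sk -> b \in kp -> d \in sk ->
  root (cubic a b d) t ->
  exists x y z, cubic a b d = ('X - x%:P) * ('X - y%:P) * ('X - z%:P).
Proof.
move=> as_ bk ds rt; have fE := cubic_factor rt.
have [ts|tns] := boolP (t \in sk).
  have [] := @skew_quad_split (a + t) (b + t * (a + t)).
  - exact: skD.
  - by apply: kpD => //; apply: sk_skM => //; apply: skD.
  by move=> r [s rs]; exists t, r, s; rewrite fE rs mulrA.
have := cubic_skew_root as_ bk ds rt; rewrite fE rootM root_XsubC.
have -> /= : (- c t == t) = false by apply: contraNF tns; rewrite skE -eqr_oppLR.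
set t' := - c t; move: (a + t) (b + _) fE => u w fE.
rewrite /root !(hornerD, hornerZ, hornerXn, hornerX, hornerC) => /eqP e; exists t, t', (- (u + t')).
rewrite -mulrA; congr (_ * _).
have -> : w = - (t' * (t' + u)) by apply/eqP; rewrite -addr_eq0 -e; apply/eqP; ring.
by rewrite -!mul_polyC !(polyCD, polyCM, polyCN); ring.
Qed.

(** The partner [- c x] of the non-skew root [x] is another root; since the sum of the roots is
    skew, the remaining one is skew. *)
Lemma skew_cubic_T2 a b d x y z : a \in sk -> b \in kp -> d \in sk -> x \notin sk ->
  cubic a b d = ('X - x%:P) * ('X - y%:P) * ('X - z%:P) ->
  mptype c tyT2 (cubic a b d).
Proof.
move=> as_ bk ds xs fE.
have wl y' z' : cubic a b d = ('X - x%:P) * ('X - y'%:P) * ('X - z'%:P) -> - c x = y' ->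
    mptype c tyT2 (cubic a b d).
  move=> {}fE ey; have := fE; rewrite cubic_roots => /cubic_inj[ea _ _].
  have zs : z' \in sk.
    have -> : z' = - a + (c x - x) by rewrite ea -ey; ring.
    by rewrite skD ?skN // skE rmorphB cK opprB.
  have ys : y' \notin sk.
    by apply: contra xs; rewrite -ey !skE rmorphN cK opprK => /eqP ->.
  exists z', y', x; split=> //; first exact/gu1P.
    rewrite /= !inE !negb_or andbT -andbA; apply/and3P; split=> //.
    - by apply: contraNneq ys => <-.
    - by apply: contraNneq xs => <-.
    - by rewrite -ey; apply: contraNneq xs => e; rewrite skE -{2}e opprK.
  by rewrite fE; ring.
have : root (cubic a b d) x by rewrite fE root_lin3 eqxx.
move/(cubic_skew_root as_ bk ds); rewrite fE root_lin3 => /or3P[] /eqP e.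
- by case/negP: xs; rewrite skE -eqr_oppLR e.
- by rewrite -fE; apply: (wl y z).
- by rewrite -fE; apply: (wl z y) => //; rewrite fE; ring.
Qed.

Lemma skew_cubic_type a b d : a \in sk -> b \in kp -> d \in sk ->
  exists2 X, regular_type X & mptype c X (cubic a b d).
Proof.
move=> as_ bk ds; have [_ _ _ _ sz] := cubic_coef a b d.
case: (boolP [exists t, root (cubic a b d) t]) => [/existsP[t rt]|nr]; last first.
  exists tyT3; first by [].
  split=> //; apply: cubic_irreducible => [|t]; first by rewrite sz.
  by apply: contra nr => h; apply/existsP; exists t.
have [x [y [z fE]]] := skew_cubic_split as_ bk ds rt.
have [xs|xs] := boolP (x \in sk); last by exists tyT2; last exact: skew_cubic_T2 fE.
have [ys|ys] := boolP (y \in sk); last first.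
  by exists tyT2 => //; apply: (@skew_cubic_T2 a b d y x z) => //; rewrite fE; ring.
have [zs|zs] := boolP (z \in sk); last first.
  by exists tyT2 => //; apply: (@skew_cubic_T2 a b d z x y) => //; rewrite fE; ring.
move: xs ys zs => /gu1P xs /gu1P ys /gu1P zs.
have [exy|xy] := eqVneq x y.
  have [exz|xz] := eqVneq x z.
    by exists tyN => //; exists x => //; rewrite fE -exy -exz; ring.
  exists tyM => //; exists z, x; split=> //; first by rewrite eq_sym.
  by rewrite fE -exy; ring.
have [exz|xz] := eqVneq x z.
  exists tyM => //; exists y, x; split=> //; first by rewrite eq_sym.
  by rewrite fE -exz; ring.
have [eyz|yz] := eqVneq y z.
  by exists tyM => //; exists x, y; split=> //; rewrite fE -eyz; ring.
by exists tyT1 => //; exists x, y, z; split=> //; rewrite /= !inE negb_or xy xz yz.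
Qed.
End Cubics.

(** * Hermitian rank one matrices and the three shapes of skew matrices *)

Section RankOne.
Variables (R : comUnitRingType) (c : {rmorphism R -> R}).
Hypothesis cK : involutive c.
Implicit Types (u v w : 'rV[R]_3) (e : R).
Local Notation star := (@conjmx R c 3).

Definition vstar v : 'cV[R]_3 := (map_mx c v)^T.
Definition hnorm v : R := (v *m vstar v) 0 0.
Definition rank1 e v : 'M[R]_3 := e *: (vstar v *m v).

Lemma vstD u v : vstar (u + v) = vstar u + vstar v.
Proof. by rewrite /vstar map_mxD linearD. Qed.
Lemma vstZ e v : vstar (e *: v) = c e *: vstar v.
Proof. by rewrite /vstar map_mxZ linearZ. Qed.
Lemma star_outer u v : star (vstar u *m v) = vstar v *m u.
Proof.
apply/matrixP => i j; rewrite !mxE !big_ord1 !mxE rmorphM cK mulrC //.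
Qed.
Lemma vst_mul v (g : 'M_3) : vstar (v *m g) = star g *m vstar v.
Proof. by rewrite /vstar map_mxM trmx_mul. Qed.
Lemma mx11_hnorm v : v *m vstar v = (hnorm v)%:M.
Proof. exact: mx11_scalar. Qed.
Lemma rk1_sqr e v : rank1 e v * rank1 e v = (e * hnorm v) *: rank1 e v.
Proof.
rewrite /rank1 -scalerAl -scalerAr -mulmxE -mulmxA (mulmxA v) mx11_hnorm.
by rewrite mul_scalar_mx -!scalemxAr !scalerA; congr (_ *: _); ring.
Qed.
Lemma rk1_conj e v (g : 'M_3) : star g * rank1 e v * g = rank1 e (v *m g).
Proof.
by rewrite /rank1 vst_mul -scalerAr -scalerAl -!mulmxE !mulmxA.
Qed.
Lemma rk1Z e a v : rank1 e (a *: v) = rank1 (e * (a * c a)) v.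
Proof.
rewrite /rank1 vstZ -scalemxAr -scalemxAl !scalerA; congr (_ *: _); ring.
Qed.
Lemma hnormZ a v : hnorm (a *: v) = a * c a * hnorm v.
Proof. by rewrite /hnorm vstZ -scalemxAr -scalemxAl scalerA mxE; congr (_ * _); ring. Qed.
Lemma hnorm_tr v : \tr (vstar v *m v) = hnorm v.
Proof. by rewrite mxtrace_mulC mx11_hnorm mxtrace_scalar mulr1n. Qed.
Lemma c_hnorm v : c (hnorm v) = hnorm v.
Proof.
rewrite /hnorm !mxE rmorph_sum; apply: eq_bigr => i _.
by rewrite !mxE rmorphM cK mulrC.
Qed.

End RankOne.

Section Types2.
Variables (F : finFieldType) (c : {rmorphism F -> F}) (q : nat).
Hypothesis Q : qext c q.
Let cK := qcK Q.
Local Notation M := 'M[F]_3.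
Local Notation sk := (sk c).
Local Notation kp := (kp c).
Local Notation star := (@conjmx F c 3).
Let S : star_axiom c star := conjmx_star cK.
Local Notation rk1 := (rank1 c).
Local Notation vst := (vstar c).
Local Notation hnorm := (hnorm c).

Lemma vst_eq0 v : (vst v == 0) = (v == 0).
Proof. by rewrite /vstar -[0 in LHS]trmx0 (inj_eq trmx_inj) map_mx_eq0. Qed.

Lemma krylov_indep (t : 'rV[F]_3) (B : M) a b d : krylov t B \in unitmx ->
  a%:A + b *: B + d *: B ^+ 2 = 0 -> [/\ a = 0, b = 0 & d = 0].
Proof.
move=> K e; apply: (rows3_unitP K).
have := congr1 (mulmx t) e; rewrite mulmx0 !mulmxDr -!scalemxAr mulmx1.
by rewrite expr2 -mulmxE mulmxA.
Qed.

(** Applying the involution to the Cayley-Hamilton relation gives a second monic cubic relation up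
    to sign, and the independence of [1, B, B ^+ 2] identifies the coefficients. *)
Lemma cyclic_skew_cubic st (B : M) : star_axiom c st -> st B + B = 0 -> cyclic_mx B ->
  exists a b d, [/\ a \in sk, b \in kp, d \in sk & char_poly B = cubic a b d].
Proof.
move=> T sB [t K]; set f := char_poly B.
have fE : f = cubic f`_2 f`_1 f`_0.
  by apply: monic_cubic; rewrite ?char_poly_monic ?size_char_poly.
exists f`_2, f`_1, f`_0; rewrite -fE.
have : horner_mx B f = 0 by exact: Cayley_Hamilton.
have Bs : st B = - B by apply/eqP; rewrite -addr_eq0 sB.
rewrite {1}fE /cubic !rmorphD /= (horner_mxZ B f`_2) (horner_mxZ B f`_1) horner_mx_C.
rewrite !rmorphXn /= horner_mx_X -scalemx1 => e.
have := congr1 st e; rewrite (st0 T) !(stD T) !(stZ T) !(stX T) Bs (st1 T) => e'.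
have : ((f`_0 + c f`_0)%:A + (f`_1 - c f`_1) *: B + (f`_2 + c f`_2) *: B ^+ 2) = 0.
  rewrite -[RHS](addr0 0) -{1}e -e' !sqrrN exprNn -signr_odd /= expr1 mulN1r.
  by rewrite !scalerDl !scalerN !scaleNr; apply/matrixP => i j; rewrite !mxE; ring.
case/(krylov_indep K) => h0 h1 h2; split=> //.
- by rewrite skE -addr_eq0 addrC h2.
- by rewrite kpE eq_sym -subr_eq0 h1.
- by rewrite skE -addr_eq0 addrC h0.
Qed.

Lemma rank_rk1 (x : 'cV[F]_3) (y : 'rV[F]_3) : (\rank (x *m y) <= 1)%N.
Proof. by apply: leq_trans (mxrankM_maxr _ _) _; apply: rank_leq_row. Qed.

(** If [B = a + x y] is skew, the scalar [c a + a] has rank at most 2 as a 3 by 3 matrix, so it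
    vanishes. Then [x y] is skew, which makes [x] a multiple of the conjugate transpose of [y]. *)
Lemma skew_trichotomy (B : M) : star B + B = 0 ->
  [\/ exists2 a, a \in sk & B = a%:M,
      exists a e v, [/\ a \in sk, e \in sk, e != 0, v != 0 & B = a%:M + rk1 e v]
    | cyclic_mx B].
Proof.
move=> sB; case: (cyclic_or_rank1 B) => [[a [x [y BE]]]|cB]; last by constructor 3.
have sBE : star B = - B by apply/eqP; rewrite -addr_eq0 sB.
have xyE : star (x *m y) = vst y *m (map_mx c x)^T by rewrite /conjmx map_mxM trmx_mul.
have as_ : a \in sk.
  rewrite skE -addr_eq0; apply/eqP/eqP; apply: contraT => a0.
  have e : (c a + a)%:M = - (vst y *m (map_mx c x)^T + x *m y) :> M.
    have := sB; rewrite BE -scalemx1 (stD S) (stZ S) (st1 S) addrACA -scalerDl xyE.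
    by move/eqP; rewrite addr_eq0 scalemx1 => /eqP.
  have : (\rank ((c a + a)%:M : M) <= 2)%N.
    rewrite e mxrank_opp; apply: leq_trans (mxrank_add _ _) _.
    exact: (leq_add (rank_rk1 _ _) (rank_rk1 _ _)).
  by rewrite mxrank_unit // unitmxE det_scalar unitfE expf_neq0.
have sN : star (x *m y) = - (x *m y).
  have -> : x *m y = B - a%:M by rewrite BE addrC addKr.
  rewrite (stB S) sBE -scalemx1 (stZ S) (st1 S); move: as_; rewrite skE => /eqP ->.
  by rewrite scaleNr opprK opprB addrC.
have [y0|y0] := eqVneq y 0.
  by constructor 1; exists a => //; rewrite BE y0 mulmx0 addr0.
have [j yj] : exists j, y 0 j != 0.
  apply/existsP; apply: contraR y0; rewrite negb_exists => /forallP h.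
  by apply/eqP/rowP => j; rewrite mxE; apply/eqP; have := h j; rewrite negbK.
pose e := - c (x j 0) / y 0 j.
have xE : x = e *: vst y.
  apply/colP => i; apply: (mulIf yj).
  have := congr1 (fun A : M => A i j) sN; rewrite xyE !mxE !big_ord1 !mxE => h.
  by apply: oppr_inj; rewrite -h /e; field.
have BE' : B = a%:M + rk1 e y by rewrite BE xE /rank1 scalemxAl.
have [e0|e0] := eqVneq e 0.
  by constructor 1; exists a => //; rewrite BE' /rank1 e0 scale0r addr0.
constructor 2; exists a, e, y; split=> //.
move: sN; rewrite xE -scalemxAl (stZ S) star_outer // -scaleNr => /eqP.
rewrite -subr_eq0 -scalerBl scaler_eq0 => /orP[|/eqP h]; first by rewrite subr_eq0 skE.
case/eqP: y0; apply/rowP => k; rewrite mxE.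
have := congr1 (fun A : M => A j k) h; rewrite !mxE big_ord1 !mxE => /eqP.
by rewrite mulf_eq0 fmorph_eq0 (negPf yj) => /eqP.
Qed.

End Types2.

Section Types3.
Variables (F : finFieldType) (c : {rmorphism F -> F}) (q : nat).
Hypothesis Q : qext c q.
Let cK := qcK Q.
Local Notation M := 'M[F]_3.
Local Notation sk := (sk c).
Local Notation kp := (kp c).
Local Notation star := (@conjmx F c 3).
Let S : star_axiom c star := conjmx_star cK.
Local Notation rk1 := (rank1 c).
Local Notation vst := (vstar c).
Local Notation hnorm := (hnorm c).
Local Notation lin a := ('X - (a : F)%:P).

Definition matrix_type X (B : M) := mptype c X (mxminpoly B).

Definition type_deg X : nat := match X with tyG => 2 | tyL | tyJ => 3 | _ => 4 end.

Lemma mptype_size X (p : {poly F}) : mptype c X p -> size p = type_deg X.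
Proof.
case: X => /=.
- by case=> a _ ->; rewrite size_XsubC.
- by case=> a [b [_ _ _ ->]]; rewrite size_mul ?polyXsubC_eq0 // !size_XsubC.
- by case=> a _ ->; rewrite size_exp_XsubC.
- case=> a [b [d [_ _ ->]]].
  by rewrite !size_mul ?mulf_neq0 ?polyXsubC_eq0 // !size_XsubC.
- case=> a [b [d [_ _ _ ->]]].
  by rewrite !size_mul ?mulf_neq0 ?polyXsubC_eq0 // !size_XsubC.
- by case.
- case=> a [b [_ _ _ ->]].
  by rewrite size_mul ?expf_neq0 ?polyXsubC_eq0 // size_exp_XsubC size_XsubC.
- by case=> a _ ->; rewrite size_exp_XsubC.
Qed.

Lemma mxminpoly_eq (B : M) (p : {poly F}) : p \is monic -> horner_mx B p = 0 ->
  (size p <= size (mxminpoly B))%N -> mxminpoly B = p.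
Proof.
move=> mp Bp sp; have d := mxminpoly_min Bp.
apply/eqP; rewrite -eqp_monic ?mxminpoly_monic // -dvdp_size_eqp //.
by rewrite eqn_leq sp dvdp_leq // monic_neq0.
Qed.

Lemma mxminpoly_scalar a : mxminpoly (a%:M : M) = lin a.
Proof.
apply: mxminpoly_eq; rewrite ?monicXsubC //.
  by rewrite rmorphB /= horner_mx_X horner_mx_C subrr.
by rewrite size_XsubC size_mxminpoly ltnS mxminpoly_nonconstant.
Qed.

Lemma rk1_neq0 e v : e != 0 -> v != 0 -> rk1 e v != 0.
Proof.
move=> e0 v0; rewrite /rank1 scaler_eq0 (negPf e0) /=.
have [j vj] : exists j, v 0 j != 0.
  apply/existsP; apply: contraR v0; rewrite negb_exists => /forallP h.
  by apply/eqP/rowP => j; rewrite mxE; apply/eqP; have := h j; rewrite negbK.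
apply: contra vj => /eqP/matrixP/(_ j j); rewrite !mxE big_ord1 !mxE => /eqP.
by rewrite mulf_eq0 fmorph_eq0 orbb.
Qed.

Lemma rk1_nonscalar a e v : e != 0 -> v != 0 -> ~~ is_scalar_mx (a%:M + rk1 e v).
Proof.
move=> e0 v0; apply/negP => /is_scalar_mxP[b h].
have N : rk1 e v = (b - a)%:M by rewrite raddfB /= -h addrC addKr.
have : (\rank (rk1 e v) <= 1)%N.
  by rewrite /rank1 mxrank_scale_nz // rank_rk1.
have := rk1_neq0 e0 v0; rewrite N => ba.
rewrite mxrank_unit // unitmxE det_scalar unitfE expf_neq0 //.
by apply: contra ba => /eqP ->; rewrite raddf0.
Qed.

Lemma mxminpoly_rk1 a e v : e != 0 -> v != 0 ->
  mxminpoly (a%:M + rk1 e v) = lin a * lin (a + e * hnorm v).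
Proof.
move=> e0 v0; apply: mxminpoly_eq; first by rewrite rpredM ?monicXsubC.
  have E1 : a%:M + rk1 e v - a%:M = rk1 e v by rewrite addrC addKr.
  have E2 : a%:M + rk1 e v - (a + e * hnorm v)%:M = rk1 e v - (e * hnorm v)%:M.
    by rewrite raddfD /= opprD addrA E1.
  rewrite rmorphM !rmorphB /= !horner_mx_X !horner_mx_C E1 E2.
  by rewrite mulrBr rk1_sqr // -mulmxE mul_mx_scalar subrr.
rewrite size_monicM ?monicXsubC ?polyXsubC_eq0 // !size_XsubC size_mxminpoly.
by rewrite ltnS ltnNge mxminpoly_linear_is_scalar rk1_nonscalar.
Qed.

Lemma skew_mtype_scalar a : a \in sk -> matrix_type tyG a%:M.
Proof. by move=> /gu1P as_; exists a => //; rewrite mxminpoly_scalar. Qed.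

Lemma skew_mtype_rk1 a e v : a \in sk -> e \in sk -> e != 0 -> v != 0 ->
  matrix_type (if hnorm v == 0 then tyJ else tyL) (a%:M + rk1 e v).
Proof.
move=> as_ es e0 v0; have hE := mxminpoly_rk1 a e0 v0; rewrite /matrix_type hE.
case: ifP => [/eqP ->|/negbT h0].
  by exists a; [exact/gu1P | rewrite mulr0 addr0].
exists a, (a + e * hnorm v); split=> //; first exact/gu1P.
  by apply/gu1P/skD => //; apply: sk_kpM; rewrite // kpE c_hnorm.
by rewrite eq_sym -subr_eq0 addrC addKr mulf_neq0.
Qed.

Lemma skew_mtype_cyclic st (B : M) : star_axiom c st -> st B + B = 0 -> cyclic_mx B ->
  exists2 X, regular_type X & matrix_type X B.
Proof.
move=> T sB cB; rewrite /matrix_type cyclic_minpoly //.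
have [a [b [d [as_ bk ds ->]]]] := cyclic_skew_cubic T sB cB.
exact: (skew_cubic_type Q).
Qed.

Lemma mtype_exists (B : M) : star B + B = 0 -> exists X, matrix_type X B.
Proof.
move=> sB; case: (skew_trichotomy Q sB) => [[a as_ ->]|[a [e [v [as_ es e0 v0 ->]]]]|cB].
- by exists tyG; apply: skew_mtype_scalar.
- by eexists; apply: skew_mtype_rk1.
- by have [X _ h] := skew_mtype_cyclic S sB cB; exists X.
Qed.

Lemma mtype_size X B : matrix_type X B -> size (mxminpoly B) = type_deg X.
Proof. exact: mptype_size. Qed.

Lemma mtypeG_inv B : star B + B = 0 -> matrix_type tyG B -> exists2 a, a \in sk & B = a%:M.
Proof.
move=> sB /mtype_size /= h.
case: (skew_trichotomy Q sB) => [//|[a [e [v [as_ es e0 v0 BE]]]]|cB].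
  by have := mtype_size (skew_mtype_rk1 as_ es e0 v0); rewrite -BE h; case: ifP.
by move: h; rewrite cyclic_minpoly // size_char_poly.
Qed.

Lemma mtypeLJ_inv X B : star B + B = 0 -> matrix_type X B -> type_deg X = 3%N ->
  exists a e v, [/\ a \in sk, e \in sk, e != 0, v != 0 & B = a%:M + rk1 e v /\
    X = if hnorm v == 0 then tyJ else tyL].
Proof.
move=> sB mB X3; have := mtype_size mB; rewrite X3 => h.
case: (skew_trichotomy Q sB) => [[a _ BE]|[a [e [v [as_ es e0 v0 BE]]]]|cB].
- by move: h; rewrite BE mxminpoly_scalar size_XsubC.
- exists a, e, v; split=> //; split=> //.
  move: mB; rewrite /matrix_type BE mxminpoly_rk1 //.
  case: (X) X3 => //= _; last first.
    case=> b _ pE; case: eqVneq => // h0.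
    have ra : root (lin a * lin (a + e * hnorm v)) (a + e * hnorm v).
      by rewrite rootM !root_XsubC eqxx orbT.
    have rb : root (lin a * lin (a + e * hnorm v)) a by rewrite rootM !root_XsubC eqxx.
    move: ra rb; rewrite pE !rootE !horner_exp !hornerXsubC !expf_eq0 /= !subr_eq0.
    move=> /eqP <- /eqP /esym /eqP.
    by rewrite -subr_eq0 addrC addKr mulf_eq0 (negPf e0) (negPf h0).
  case=> a1 [a2 [_ _ a12 pE]]; case: eqVneq => // h0.
  move: pE; rewrite h0 mulr0 addr0 => pE.
  have r1 : root (lin a * lin a) a1 by rewrite pE rootM !root_XsubC eqxx.
  have r2 : root (lin a * lin a) a2 by rewrite pE rootM !root_XsubC eqxx orbT.
  move: r1 r2 a12; rewrite !rootM !root_XsubC !orbb => /eqP -> /eqP ->.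
  by rewrite eqxx.
- by move: h; rewrite cyclic_minpoly // size_char_poly.
Qed.

Lemma mtype_reg_inv X B : star B + B = 0 -> matrix_type X B -> regular_type X -> cyclic_mx B.
Proof.
move=> sB mB rX; have := mtype_size mB.
have -> : type_deg X = 4 by case: X {mB} rX.
case: (skew_trichotomy Q sB) => [[a _ ->]|[a [e [v [as_ es e0 v0 ->]]]]|//].
  by rewrite mxminpoly_scalar size_XsubC.
by rewrite mxminpoly_rk1 // size_mul ?polyXsubC_eq0 // !size_XsubC.
Qed.

End Types3.

(** * The type is determined by the centraliser *)

Section TypeUnique.
Variables (F : finFieldType) (c : {rmorphism F -> F}) (q : nat).
Hypothesis Q : qext c q.
Let cK := qcK Q.
Local Notation M := 'M[F]_3.
Local Notation sk := (sk c).
Local Notation kp := (kp c).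
Local Notation star := (@conjmx F c 3).
Let S : star_axiom c star := conjmx_star cK.
Local Notation rk1 := (rank1 c).
Local Notation vst := (vstar c).
Local Notation hnorm := (hnorm c).
Local Notation lin a := ('X - (a : F)%:P).
Local Notation mtype := (matrix_type c).

Lemma rank_vst v : v != 0 -> \rank (vst v) = 1%N.
Proof.
move=> v0; apply/eqP; rewrite eqn_leq rank_leq_col lt0n mxrank_eq0.
by rewrite (vst_eq0 c).
Qed.

(** Products [z *m y] with [v z = 0] and [y v* = 0] commute with [v* v]. The frame provides two such
    products that do not commute with each other. *)
Lemma rk1_frame (v : 'rV[F]_3) : v != 0 -> exists (y0 : 'rV[F]_3) (a0 a1 : 'cV[F]_3),
  [/\ y0 *m vst v = 0, v *m a0 = 0, v *m a1 = 0 &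
  [/\ y0 *m a0 = 1%:M, y0 *m a1 = 0 & a1 != 0]].
Proof.
move=> v0; pose Y := kermx (vst v); pose A := (kermx v^T)^T.
have YE : Y *m vst v = 0 by exact: mulmx_ker.
have AE : v *m A = 0 by apply: trmx_inj; rewrite trmx_mul trmxK mulmx_ker trmx0.
have rY : \rank Y = 2%N by rewrite mxrank_ker rank_vst.
have rA : \rank A = 2%N.
  rewrite mxrank_tr mxrank_ker mxrank_tr.
  suff -> : \rank v = 1%N by [].
  by apply/eqP; rewrite eqn_leq rank_leq_row lt0n mxrank_eq0.
(* Both factors have rank 2, and a zero product would force the ranks to add up to at most 3. *)
have : Y *m A != 0.
  apply/eqP => /mulmx0_rank_max; by rewrite rY rA.
case/matrix0Pn => i [j h]; set t := (Y *m A) i j in h.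
pose y0 := t^-1 *: row i Y; pose a0 := col j A.
have e0 : y0 *m a0 = 1%:M.
  rewrite /y0 /a0 -scalemxAl; apply/matrixP => k l; rewrite !ord1 [LHS]mxE.
  have -> : (row i Y *m col j A) 0 0 = t.
    by rewrite /t !mxE; apply: eq_bigr => m _; rewrite !mxE.
  by rewrite mulVf // mxE.
pose K := (kermx ((col_mx v y0)^T))^T.
have KE : col_mx v y0 *m K = 0 by apply: trmx_inj; rewrite trmx_mul trmxK mulmx_ker trmx0.
have : K != 0.
  rewrite -mxrank_eq0 mxrank_tr mxrank_ker subn_eq0 -ltnNge mxrank_tr.
  exact: leq_ltn_trans (rank_leq_row _) _.
case/matrix0Pn => k [l hk]; exists y0, a0, (col l K).
have : col_mx v y0 *m col l K = 0 by rewrite colE mulmxA KE mul0mx.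
rewrite mul_col_mx -[0 in RHS]col_mx0 => /eq_col_mx[e1 e2].
split=> //.
- by rewrite /y0 -scalemxAl -row_mul YE row0 scaler0.
- by rewrite /a0 colE mulmxA AE mul0mx.
split=> //; apply: contraNneq hk => h'.
by have /colP/(_ k) := h'; rewrite mxE => ->; rewrite mxE.
Qed.

Lemma cent_rk1 a e v y (z : 'cV[F]_3) : v *m z = 0 -> y *m vst v = 0 ->
  z *m y \in cent (a%:M + rk1 e v).
Proof.
move=> vz yv; apply/centP; rewrite -mulmxE mulmxDr mulmxDl scalar_mxC; congr (_ + _).
rewrite /rank1 -scalemxAl -scalemxAr !mulmxA -(mulmxA z) yv -(mulmxA (vst v)) vz.
by rewrite !mulmx0 !mul0mx.
Qed.

Lemma cent_rk1_noncomm a e v : v != 0 ->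
  exists x y, [/\ x \in cent (a%:M + rk1 e v), y \in cent (a%:M + rk1 e v) & x * y != y * x].
Proof.
move=> /rk1_frame[y0 [a0 [a1 [yv va0 va1 [ya0 ya1 n1]]]]].
exists (a1 *m y0), (a0 *m y0); split; try exact: cent_rk1.
rewrite -!mulmxE !mulmxA -(mulmxA a1) ya0 -(mulmxA a0) ya1 mulmx0 mul0mx mulmx1.
apply: contra n1 => /eqP /(congr1 (mulmx^~ a0)).
by rewrite -mulmxA ya0 mulmx1 mul0mx => ->.
Qed.

Lemma cent_full_scalar (B : M) : cent B = setT -> exists a, B = a%:M.
Proof.
move=> h; have hc x : x * B = B * x by apply/centP; rewrite h inE.
exists (B 0 0); apply/matrixP => i j; rewrite mxE.
have := congr1 (fun A : M => A 0 j) (hc (delta_mx 0 i)); rewrite -mulmxE !mxE.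
rewrite (bigD1 i) //= big1 => [|k ki]; last by rewrite mxE (negPf ki) andbF mul0r.
rewrite (bigD1 0) //= big1 => [|k k0]; last by rewrite mxE (negPf k0) mulr0.
by rewrite !mxE !eqxx mul1r !addr0 /= => ->; rewrite eq_sym mulr_natr.
Qed.

(** These properties tell apart the centralisers of the regular types: three copies of [F] (T1, or
    T2 when the involution exchanges two of them), a cubic field (T3), [F] times dual numbers (M),
    and [F[t]/(t^3)] (N). *)
Definition has_zero_div (E : {set M}) :=
  exists x y, [/\ x \in E, y \in E & [/\ x != 0, y != 0 & x * y = 0]].
Definition has_isotropic (E : {set M}) := exists x, [/\ x \in E, x != 0 & x * star x = 0].
Definition has_square_zero (E : {set M}) := exists x, [/\ x \in E, x != 0 & x * x = 0].
Definition has_cube_zero (E : {set M}) :=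
  exists x, [/\ x \in E, x * x != 0 & x * x * x = 0].

Lemma horner_eq0 (B : M) (p : {poly F}) : (horner_mx B p == 0) = (mxminpoly B %| p).
Proof. by rewrite dvd_mxminpoly. Qed.

Lemma horner_neq0 (B : M) (p : {poly F}) : p != 0 -> (size p < size (mxminpoly B))%N -> horner_mx B p != 0.
Proof.
by move=> p0 sp; rewrite horner_eq0; apply/negP => /(dvdp_leq p0); rewrite leqNgt sp.
Qed.

Lemma dvd_lin3 (x y z : F) (p : {poly F}) : uniq [:: x; y; z] ->
  (lin x * lin y * lin z %| p) = [&& root p x, root p y & root p z].
Proof.
move=> u; have -> : lin x * lin y * lin z = \prod_(t <- [:: x; y; z]) lin t.
  by rewrite !big_cons big_nil mulr1 mulrA.
apply/idP/idP => [d|h].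
  by rewrite !(root_dvdp d) // root_prod_XsubC !inE eqxx ?orbT.
by apply: uniq_roots_dvdp; rewrite ?uniq_rootsE //= !andbA andbT -andbA.
Qed.

Lemma reg_size X (B : M) : mtype X B -> regular_type X -> size (mxminpoly B) = 4.
Proof. by move=> /mptype_size ->; case: X. Qed.

Lemma horner_star (B : M) (p : {poly F}) : star B + B = 0 -> (size p <= 3)%N ->
  exists p' : {poly F}, star (horner_mx B p) = horner_mx B p' /\
    forall t, t \in sk -> p'.[t] = c p.[t].
Proof.
move=> sB sp; exists ((c p`_0)%:P - c p`_1 *: 'X + c p`_2 *: 'X^2).
have Bs : star B = - B by apply/eqP; rewrite -addr_eq0 sB.
split.
  rewrite (horner_mx_sum3 B sp) !(stD S) !(stZ S) (st1 S) (stX S) Bs sqrrN.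
  rewrite !rmorphD rmorphN /= (horner_mxZ B (c p`_1)) (horner_mxZ B (c p`_2)) horner_mx_C.
  by rewrite rmorphXn /= horner_mx_X -scalemx1 scalerN.
move=> t; rewrite skE => /eqP ct.
rewrite (horner_coef_wide _ sp) sum3 /= !rmorphD !rmorphM !rmorphXn /= ct.
rewrite !(hornerD, hornerN, hornerZ, hornerXn, hornerX, hornerC).
ring.
Qed.

Lemma horner_lin (B : M) a : horner_mx B (lin a) = B - a%:M.
Proof. by rewrite rmorphB /= horner_mx_X horner_mx_C. Qed.

Lemma star_lin (B : M) a : star B + B = 0 -> star (B - a%:M) = - (B - (- c a)%:M).
Proof.
move/eqP; rewrite addr_eq0 => /eqP sB.
by rewrite (stB S) sB -[a%:M]scalemx1 (stZ S) (st1 S) scalemx1 raddfN opprK opprD.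
Qed.

Lemma no_square_zero (B : M) x y z : cyclic_mx B -> uniq [:: x; y; z] ->
  mxminpoly B = lin x * lin y * lin z -> ~ has_square_zero (cent B).
Proof.
move=> cB u mE [n [/(cyclic_cent cB)[p sp ->] p0 pp]].
case/eqP: p0; apply/eqP; move/eqP: pp; rewrite -rmorphM /= !horner_eq0 mE !dvd_lin3 //.
by rewrite !rootM !orbb.
Qed.

Lemma T1_no_isotropic (B : M) : star B + B = 0 -> cyclic_mx B -> mtype tyT1 B ->
  ~ has_isotropic (cent B).
Proof.
move=> sB cB [x [y [z [[/(gu1P c) xs /(gu1P c) ys /(gu1P c) zs] u mE]]]] [n [/(cyclic_cent cB)[p sp ->] p0 pp]].
have [p' [p'E p'v]] := horner_star sB sp.
case/eqP: p0; apply/eqP; move/eqP: pp; rewrite p'E -rmorphM /= !horner_eq0 mE !dvd_lin3 //.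
have h t : t \in sk -> root (p * p') t = root p t.
  by move=> ts; rewrite rootM (rootE p') p'v // fmorph_eq0 -rootE orbb.
by rewrite !h.
Qed.

Lemma T3_no_zero_div (B : M) : cyclic_mx B -> mtype tyT3 B -> ~ has_zero_div (cent B).
Proof.
move=> cB [_ [m1 irr]] [u [w [/(cyclic_cent cB)[p _ ->] /(cyclic_cent cB)[r _ ->] [p0 r0 pr]]]].
move/eqP: pr; rewrite -rmorphM /= horner_eq0; rewrite !horner_eq0 in p0 r0.
have [g1|g1] := eqVneq (size (gcdp (mxminpoly B) p)) 1%N.
  by rewrite Gauss_dvdpr ?(negPf r0) // /coprimep g1.
have := irr _ g1 (dvdp_gcdl _ _) => /eqp_dvdl e.
by case/negP: p0; rewrite -e dvdp_gcdr.
Qed.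

Lemma M_no_cube_zero (B : M) : cyclic_mx B -> mtype tyM B -> ~ has_cube_zero (cent B).
Proof.
move=> cB [x [y [_ _ xy mE]]] [n [/(cyclic_cent cB)[p _ ->] p0 pp]].
case/eqP: p0; apply/eqP; move/eqP: pp; rewrite -!rmorphM /= !horner_eq0 mE => d.
have rp t : root (lin x * lin y ^+ 2) t -> lin t %| p.
  by move=> /(root_dvdp d); rewrite !rootM !orbb dvdp_XsubCl.
have dx : lin x %| p by apply: rp; rewrite rootM !root_XsubC eqxx.
have dy : lin y %| p by apply: rp; rewrite rootM expr2 rootM !root_XsubC eqxx !orbT.
by rewrite expr2 mulrA; apply: dvdp_mul => //; rewrite Gauss_dvdp ?dx // coprimep_XsubC root_XsubC eq_sym.
Qed.

Lemma lin_size3 (x y : F) : size (lin x * lin y) = 3%N.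
Proof. by rewrite size_mul ?polyXsubC_eq0 // !size_XsubC. Qed.

Lemma M_square_zero (B : M) : mtype tyM B -> has_square_zero (cent B).
Proof.
move=> mB; have sz := reg_size mB isT; case: mB => [x [y [_ _ xy mE]]].
exists (horner_mx B (lin x * lin y)); split; first exact: horner_cent.
  by apply: horner_neq0; rewrite ?sz ?lin_size3 // mulf_neq0 ?polyXsubC_eq0.
apply/eqP; rewrite -rmorphM /= horner_eq0 mE; apply/dvdpP; exists (lin x); ring.
Qed.

Lemma N_square_zero (B : M) : mtype tyN B -> has_square_zero (cent B).
Proof.
move=> mB; have sz := reg_size mB isT; case: mB => [x _ mE].
exists (horner_mx B (lin x * lin x)); split; first exact: horner_cent.
  by apply: horner_neq0; rewrite ?sz ?lin_size3 // mulf_neq0 ?polyXsubC_eq0.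
apply/eqP; rewrite -rmorphM /= horner_eq0 mE; apply/dvdpP; exists (lin x); ring.
Qed.

Lemma N_cube_zero (B : M) : mtype tyN B -> has_cube_zero (cent B).
Proof.
move=> mB; have sz := reg_size mB isT; case: mB => [x _ mE].
exists (horner_mx B (lin x)); split; first exact: horner_cent.
  by rewrite -rmorphM; apply: horner_neq0; rewrite ?sz ?lin_size3 // mulf_neq0 ?polyXsubC_eq0.
by apply/eqP; rewrite -!rmorphM /= horner_eq0 mE; apply/dvdpP; exists 1; ring.
Qed.

Lemma lin3_zero_div (B : M) x y z : mxminpoly B = lin x * lin y * lin z ->
  has_zero_div (cent B).
Proof.
move=> mE; have sz : size (mxminpoly B) = 4.
  by rewrite mE !size_mul ?mulf_neq0 ?polyXsubC_eq0 // !size_XsubC.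
exists (horner_mx B (lin x * lin y)), (horner_mx B (lin z)).
split; try exact: horner_cent; split.
- by apply: horner_neq0; rewrite ?sz ?lin_size3 // mulf_neq0 ?polyXsubC_eq0.
- by apply: horner_neq0; rewrite ?sz ?size_XsubC ?polyXsubC_eq0.
- by apply/eqP; rewrite -rmorphM /= horner_eq0 mE.
Qed.

Lemma T2_isotropic (B : M) : star B + B = 0 -> mtype tyT2 B -> has_isotropic (cent B).
Proof.
move=> sB mB; have sz := reg_size mB isT; case: mB => [x [y [z [/(gu1P c) xs u yE mE]]]].
exists (horner_mx B (lin x * lin y)); split; first exact: horner_cent.
  by apply: horner_neq0; rewrite ?sz ?lin_size3 // mulf_neq0 ?polyXsubC_eq0.
have cy : - c y = z by rewrite yE rmorphN cK opprK.
have cx : - c x = x by move: xs; rewrite skE => /eqP ->; rewrite opprK.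
have -> : star (horner_mx B (lin x * lin y)) = horner_mx B (lin x * lin z).
  rewrite !rmorphM /= !horner_lin (stM S) !star_lin // cx cy mulrNN.
  by rewrite -!horner_lin -!rmorphM /= mulrC.
apply/eqP; rewrite -rmorphM /= horner_eq0 mE; apply/dvdpP; exists (lin x); ring.
Qed.

Lemma square_zero_div E : has_square_zero E -> has_zero_div E.
Proof. by case=> x [xE x0 xx]; exists x, x. Qed.

(** For isotropic [v] the matrix [v* v] is nilpotent and central in the centraliser; this separates
    J from L. *)
Lemma J_square_zero a e v : e != 0 -> v != 0 -> hnorm v = 0 ->
  exists n, [/\ n \in cent (a%:M + rk1 e v), {in cent (a%:M + rk1 e v), forall x, x * n = n * x},
    n != 0 & n * n = 0].
Proof.
move=> e0 v0 h0; exists (rk1 e v); split.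
- by apply/centP; rewrite mulrDl mulrDr -!mulmxE scalar_mxC.
- move=> x /centP; rewrite mulrDl mulrDr -!mulmxE scalar_mxC => /addrI //.
- exact: (rk1_neq0 c).
- by rewrite rk1_sqr // h0 mulr0 scale0r.
Qed.

(** A central [n] commutes with all [z *m y] of the frame, hence acts as a scalar [mu] on the kernel
    of [v]; being of square zero it has [mu = 0]. So [n] is a multiple of the idempotent [E] and
    vanishes. *)
Lemma L_no_square_zero a e v : e != 0 -> v != 0 -> hnorm v != 0 ->
  ~ exists n, [/\ n \in cent (a%:M + rk1 e v), {in cent (a%:M + rk1 e v), forall x, x * n = n * x},
    n != 0 & n * n = 0].
Proof.
move=> e0 v0 h0 [n [nC nc n0 nn]]; case/eqP: n0.
have [y0 [a0 [a1 [yv va0 va1 [ya0 ya1 n1]]]]] := rk1_frame v0.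
pose mu := (y0 *m n *m a0) 0 0.
have nA (z : 'cV_3) : v *m z = 0 -> n *m z = mu *: z.
  move=> vz; have := nc _ (cent_rk1 a e vz yv) => /(congr1 (mulmx^~ a0)).
  rewrite -!mulmxE -!mulmxA ya0 mulmx1 => <-.
  by rewrite (mulmxA y0) [y0 *m n *m a0]mx11_scalar -/mu mul_mx_scalar.
pose E : M := (hnorm v)^-1 *: (vst v *m v).
have vE : v *m E = v.
  by rewrite -scalemxAr mulmxA mx11_hnorm mul_scalar_mx scalerA mulVf // scale1r.
have nE : n * (1 - E) = mu *: (1 - E).
  apply/matrixP => i j.
  have /nA/colP/(_ i) : v *m col j (1 - E) = 0.
    by rewrite colE mulmxA mulmxBr mulmx1 vE subrr mul0mx.
  have colx (X : M) : (col j X) i 0 = X i j by rewrite mxE.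
  by rewrite colE mulmxA -!colE colx => ->; rewrite mxE colx [RHS]mxE.
have E1 : 1 - E != 0.
  apply: contraNneq n1 => e1; have e2 : 1%:M = E by apply: subr0_eq.
  have := mul1mx a1; rewrite e2 => <-.
  by rewrite -scalemxAl -mulmxA va1 mulmx0 scaler0.
have mu0 : mu = 0.
  apply/eqP; have : n * (n * (1 - E)) == 0 by rewrite mulrA nn mul0r.
  by rewrite nE -scalerAr nE scalerA scaler_eq0 (negPf E1) orbF mulf_eq0 orbb.
have EC : E \in cent (a%:M + rk1 e v).
  apply/centP; rewrite -!mulmxE mulmxDr mulmxDl scalar_mxC; congr (_ + _).
  by rewrite /E /rank1 -!scalemxAl -!scalemxAr !scalerA mulrC.
have nEE : n = n * E.
  by apply/eqP; rewrite -subr_eq0 -{1}[n]mulr1 -mulrBr nE mu0 scale0r.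
have EE : E * E = E.
  by rewrite {1}/E -scalerAl -mulmxE -mulmxA vE.
have [nu nuE] : exists nu, n = nu *: E.
  exists ((v *m n *m vst v) 0 0 / hnorm v).
  have e3 : n = E * n * E by rewrite (nc E EC) -mulrA EE -nEE.
  rewrite {1}e3 /E -!mulmxE -scalemxAl -scalemxAl -scalemxAr.
  have -> : vst v *m v *m n *m (vst v *m v) = (v *m n *m vst v) 0 0 *: (vst v *m v).
    have -> : vst v *m v *m n *m (vst v *m v) = vst v *m (v *m n *m vst v) *m v.
      by rewrite !mulmxA.
    set w := v *m n *m vst v; rewrite {1}(mx11_scalar w).
    by rewrite mul_mx_scalar -scalemxAl.
  by rewrite !scalerA; congr (_ *: _); field.
apply/eqP; rewrite nuE; move: nn; rewrite nuE -scalerAl -scalerAr EE scalerA => /eqP.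
rewrite scaler_eq0 mulf_eq0 orbb => /orP[/eqP ->|/eqP ->]; by rewrite ?scale0r ?scaler0.
Qed.

Lemma cent_scalar a : cent (a%:M : M) = setT.
Proof. by apply/setP => x; rewrite in_setT; apply/centP; rewrite -!mulmxE scalar_mxC. Qed.

Definition regular_fact X (E : {set M}) : Prop :=
  match X with
  | tyT1 => [/\ has_zero_div E, ~ has_isotropic E & ~ has_square_zero E]
  | tyT2 => [/\ has_zero_div E, has_isotropic E & ~ has_square_zero E]
  | tyT3 => ~ has_zero_div E
  | tyM => has_square_zero E /\ ~ has_cube_zero E
  | tyN => has_square_zero E /\ has_cube_zero E
  | _ => False
  end.

Lemma mtype_regular_fact X (B : M) : star B + B = 0 -> mtype X B -> regular_type X ->
  regular_fact X (cent B).
Proof.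
move=> sB mB rX; have cB := mtype_reg_inv Q sB mB rX; case: X mB rX => // mB _ /=.
- split; [|exact: T1_no_isotropic|]; case: mB => [x [y [z [_ u mE]]]].
    exact: lin3_zero_div mE.
  exact: no_square_zero mE.
- split; [|exact: T2_isotropic|]; case: mB => [x [y [z [_ u _ mE]]]].
    exact: lin3_zero_div mE.
  exact: no_square_zero mE.
- exact: T3_no_zero_div.
- by split; [exact: M_square_zero | exact: M_no_cube_zero].
- by split; [exact: N_square_zero | exact: N_cube_zero].
Qed.

Lemma regular_fact_inj X X' E : regular_fact X E -> regular_fact X' E -> X = X'.
Proof.
have := @square_zero_div E.
by case: X; case: X' => //=; repeat (let H := fresh in intro H);
  repeat match goal with H : and3 _ _ _ |- _ => case: H => ? ? ? end; tauto.
Qed.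

Lemma mtype_comm_regular X (B : M) : star B + B = 0 -> mtype X B ->
  {in cent B &, forall x y, x * y = y * x} -> regular_type X.
Proof.
move=> sB mB comm.
have nc a e v : v != 0 -> B <> a%:M + rk1 e v.
  move=> v0 BE; have [x [y [xC yC /eqP[]]]] := cent_rk1_noncomm a e v0.
  by apply: comm; rewrite BE.
case: (X) mB => // mB.
- have [a _ BE] := mtypeG_inv Q sB mB.
  case: (@nc a 0 (const_mx 1)); last by rewrite BE /rank1 scale0r addr0.
  by apply/eqP => /rowP/(_ 0); rewrite !mxE => /eqP; rewrite oner_eq0.
- have [//|a [e [v [_ _ _ v0 [BE _]]]]] := mtypeLJ_inv Q sB mB.
  by case: (nc a e v v0).
- have [//|a [e [v [_ _ _ v0 [BE _]]]]] := mtypeLJ_inv Q sB mB.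
  by case: (nc a e v v0).
Qed.

Lemma mtype_full_scalar X (B : M) : star B + B = 0 -> mtype X B ->
  cent B = setT -> X = tyG.
Proof.
move=> sB mB /cent_full_scalar[a BE]; have := mptype_size mB.
by rewrite BE mxminpoly_scalar size_XsubC; case: X {mB}.
Qed.

(** Commutativity of the centraliser singles out the regular types, which [regular_fact] tells
    apart; a full centraliser means G; a central nilpotent separates J from L. *)
Lemma type_unique X X' (B B' : M) : star B + B = 0 -> star B' + B' = 0 ->
  mtype X B -> mtype X' B' -> cent B = cent B' -> X = X'.
Proof.
move=> sB sB' mB mB' CC.
have full (Y : sh_type) (C : M) : star C + C = 0 -> mtype Y C -> Y = tyG -> cent C = setT.
  by move=> sC mC YG; rewrite YG in mC; have [a _ ->] := mtypeG_inv Q sC mC; apply: cent_scalar.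
case: (boolP (regular_type X)) => rX.
  have cB := mtype_reg_inv Q sB mB rX.
  have rX' : regular_type X'.
    by apply: (mtype_comm_regular sB' mB'); rewrite -CC; apply: cyclic_cent_comm.
  apply: (@regular_fact_inj _ _ (cent B)); first exact: mtype_regular_fact.
  by rewrite CC; apply: mtype_regular_fact.
case: (boolP (regular_type X')) => rX'.
  have cB' := mtype_reg_inv Q sB' mB' rX'.
  case/negP: rX; apply: (mtype_comm_regular sB mB); rewrite CC; exact: cyclic_cent_comm.
have [EX|nX] : X = tyG \/ type_deg X = 3%N by case: (X) rX; auto.
  by rewrite EX; symmetry; apply: (mtype_full_scalar sB' mB'); rewrite -CC; apply: full EX.
have [EX|nX'] : X' = tyG \/ type_deg X' = 3%N by case: (X') rX'; auto.
  by rewrite EX; apply: (mtype_full_scalar sB mB); rewrite CC; apply: full EX.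
have [a [e [v [_ _ e0 v0 [BE ->]]]]] := mtypeLJ_inv Q sB mB nX.
have [a' [e' [v' [_ _ e0' v0' [BE' ->]]]]] := mtypeLJ_inv Q sB' mB' nX'.
rewrite BE BE' in CC.
case: eqVneq => h; case: eqVneq => h' //.
  by case: (L_no_square_zero (a := a') e0' v0' h'); rewrite -CC; apply: J_square_zero.
by case: (L_no_square_zero (a := a) e0 v0 h); rewrite CC; apply: J_square_zero.
Qed.

End TypeUnique.

(** * Unitary conjugacy over a finite field *)

Section Witt.
Variables (F : finFieldType) (c : {rmorphism F -> F}) (q : nat).
Hypothesis Q : qext c q.
Let cK := qcK Q.
Local Notation M := 'M[F]_3.
Local Notation sk := (sk c).
Local Notation kp := (kp c).
Local Notation star := (@conjmx F c 3).
Let S : star_axiom c star := conjmx_star cK.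
Local Notation rk1 := (rank1 c).
Local Notation vst := (vstar c).
Local Notation hnorm := (hnorm c).
Implicit Types u v w : 'rV[F]_3.

(** This is [norm_surj] for the algebra of scalar matrices. *)
Lemma norm_kp t : t \in kp -> t != 0 -> exists s, t = s * c s.
Proof.
move=> tk t0; pose E : {set M} := [set a%:M | a in F].
have EP x : reflect (exists a, x = a%:M) (x \in E).
  by apply: (iffP imsetP) => [[a _ ->]|[a ->]]; exists a.
have ut : t%:M \is a @GRing.unit M.
  by rewrite -[_ \is a _]/(t%:M \in unitmx) unitmxE det_scalar unitfE expf_neq0.
have [] := @norm_surj F c q Q star S E t%:M _ _ _ _ _ _ _ ut.
- by apply/EP; exists 1.
- by move=> x y /EP[a ->] /EP[b ->]; apply/EP; exists (a + b); rewrite raddfD.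
- by move=> x y /EP[a ->] /EP[b ->]; apply/EP; exists (a * b); rewrite -mulmxE -scalar_mxM.
- by move=> a x /EP[b ->]; apply/EP; exists (a * b); rewrite scale_scalar_mx.
- by move=> x /EP[a ->]; apply/EP; exists (c a); rewrite -scalemx1 (stZ S) (st1 S) scalemx1.
- by move=> x y /EP[a ->] /EP[b ->]; rewrite -!mulmxE -!scalar_mxM mulrC.
- by apply/EP; exists t.
- by rewrite -scalemx1 (stZ S) (st1 S); move: tk; rewrite kpE => /eqP ->.
move=> z [/EP[s ->] _]; rewrite -[s%:M]scalemx1 (stZ S) (st1 S) !scalemx1 => /matrixP/(_ 0 0).
by rewrite -mulmxE -scalar_mxM !mxE !mulr1n => ->; exists s.
Qed.

Definition hform u v : F := (u *m vst v) 0 0.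

Lemma hformC u v : c (hform u v) = hform v u.
Proof.
rewrite /hform !mxE rmorph_sum; apply: eq_bigr => i _.
by rewrite !mxE rmorphM cK mulrC.
Qed.
Lemma hformDl u v w : hform (u + v) w = hform u w + hform v w.
Proof. by rewrite /hform mulmxDl mxE. Qed.
Lemma hformDr u v w : hform u (v + w) = hform u v + hform u w.
Proof. by rewrite /hform vstD mulmxDr mxE. Qed.
Lemma hformZl a u v : hform (a *: u) v = a * hform u v.
Proof. by rewrite /hform -scalemxAl mxE. Qed.
Lemma hformZr a u v : hform u (a *: v) = c a * hform u v.
Proof. by rewrite /hform vstZ -scalemxAr mxE. Qed.
Lemma hformE v : hform v v = hnorm v. Proof. by []. Qed.
Lemma hnormD u v : hnorm (u + v) = hnorm u + hnorm v + hform u v + hform v u.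
Proof. by rewrite -!hformE hformDl !hformDr; ring. Qed.

(** The map [1 - mu^-1 u* u] with [u = v - v'] sends [v] to [v']; it is unitary because equal norms
    give [hnorm u = mu + c mu]. *)
Lemma quasi_reflection v v' : hnorm v = hnorm v' -> hform v (v - v') != 0 ->
  exists2 g, star g * g = 1 & v *m g = v'.
Proof.
move=> hv; set u := v - v'; set mu := hform v u => mu0.
exists (1 - mu^-1 *: (vst u *m u)); last first.
  rewrite mulmxBr mulmx1 -scalemxAr mulmxA [v *m vst u]mx11_scalar -/(hform v u).
  by rewrite mul_scalar_mx scalerA mulVf // scale1r opprB addrC subrK.
have hu : hnorm u = mu + c mu.
  rewrite /mu hformC -hformE /u !(hformDl, hformDr) -!scaleN1r !(hformZl, hformZr) !hformE.
  by rewrite rmorphN1 hv; ring.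
have cmu0 : c mu != 0 by rewrite fmorph_eq0.
rewrite (stB S) (st1 S) (stZ S) star_outer //; set U : M := vst u *m u.
have UU : U * U = hnorm u *: U.
  by rewrite -mulmxE /U -mulmxA (mulmxA u) mx11_hnorm mul_scalar_mx -scalemxAr.
rewrite mulrBl mul1r mulrBr mulr1 -scalerAl -scalerAr UU !scalerA.
have E x y z : 1 - x *: U - (y *: U - z *: U) = 1 + (z - y - x) *: U.
  by rewrite !scalerBl opprB -addrA; congr (_ + _); rewrite addrC.
rewrite E (_ : _ - _ - _ = 0) ?scale0r ?addr0 // hu fmorphV.
by field; rewrite mu0 cmu0.
Qed.

(** Replacing [v'] by [l v'] with [l] of norm one keeps its norm. One value of [l] is excluded to
    make [v - l v'] non-orthogonal to [v], and the scalar is divided out at the end. *)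
Lemma witt_nonorth v v' : hnorm v = hnorm v' -> (hform v v' != 0) || (hnorm v != 0) ->
  exists2 g, star g * g = 1 & v *m g = v'.
Proof.
move=> hv hne.
have [l [l1 ls _]] := @norm1_avoid F c q Q [:: c (hnorm v / hform v v')] isT.
have l0 : l != 0 by apply: contra_eq_neq l1 => ->; rewrite mul0r eq_sym oner_neq0.
have [||g gu gv] := @quasi_reflection v (l *: v').
- by rewrite hnormZ l1 mul1r.
- rewrite -scaleN1r hformDr !hformZr rmorphN1 mulN1r hformE subr_eq0.
  apply: contra ls => /eqP e; rewrite inE.
  have [h0|h0] := eqVneq (hform v v') 0; last by rewrite e mulfK // cK.
  by move: hne; rewrite e h0 mulr0 eqxx.
exists (l^-1 *: g); last by rewrite -scalemxAr gv scalerA mulVf // scale1r.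
rewrite (stZ S) -scalerAl -scalerAr gu scalerA fmorphV -invfM mulrC.
by rewrite -[l * c l]mulrC mulrC l1 invr1 scale1r.
Qed.

Lemma hform_delta v i : hform (delta_mx 0 i) v = c (v 0 i).
Proof.
by rewrite /hform -rowE !mxE.
Qed.

(** The remaining case has [v] and [v'] isotropic and orthogonal; it is handled in two moves through
    an isotropic [z] orthogonal to neither. *)
Lemma witt v v' : v != 0 -> v' != 0 -> hnorm v = hnorm v' ->
  exists2 g, star g * g = 1 & v *m g = v'.
Proof.
move=> v0 v0' hv; case: (boolP ((hform v v' != 0) || (hnorm v != 0))); first exact: witt_nonorth.
rewrite negb_or !negbK => /andP[/eqP vv' /eqP hv0].
have nz w : w != 0 -> exists j, w 0 j != 0.
  move=> w0; apply/existsP; apply: contraR w0; rewrite negb_exists => /forallP h.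
  by apply/eqP/rowP => j; rewrite mxE; apply/eqP; have := h j; rewrite negbK.
have [z0 z1 z2] : exists2 z, hform z v != 0 & hform z v' != 0.
  have [i vi] := nz _ v0; have [j vj] := nz _ v0'.
  have di : hform (delta_mx 0 i) v != 0 by rewrite hform_delta fmorph_eq0.
  have dj : hform (delta_mx 0 j) v' != 0 by rewrite hform_delta fmorph_eq0.
  have [hi|hi] := eqVneq (hform (delta_mx 0 i) v') 0; last by exists (delta_mx 0 i).
  have [hj|hj] := eqVneq (hform (delta_mx 0 j) v) 0; last by exists (delta_mx 0 j).
  by exists (delta_mx 0 i + delta_mx 0 j); rewrite hformDl ?hi ?hj ?addr0 ?add0r.
have z1' : hform v z0 != 0 by rewrite -hformC fmorph_eq0.
(* Adding a multiple of [v] does not change the products of [z0] with [v] and [v']; this multiple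
   makes the vector isotropic. *)
pose x := - (hnorm z0 / (2%:R * hform v z0)); pose z := z0 + x *: v.
have hz : hnorm z = 0.
  rewrite /z hnormD hnormZ hv0 mulr0 hformZl hformZr /x rmorphN fmorph_div rmorphM rmorph_nat.
  rewrite (c_hnorm cK) (hformC v z0); field; by rewrite z1 z1' (q2 Q).
have zv : hform z v != 0 by rewrite /z hformDl hformZl hformE hv0 mulr0 addr0.
have zv' : hform z v' != 0 by rewrite /z hformDl hformZl vv' mulr0 addr0.
have [||g gu gv] := @witt_nonorth v z; first by rewrite hv0 hz.
  by rewrite -hformC fmorph_eq0 zv.
have [||g' gu' gv'] := @witt_nonorth z v'; first by rewrite hz -hv hv0.
  by rewrite zv'.
exists (g * g'); last by rewrite -mulmxE mulmxA gv.
by rewrite (stM S) mulrA -(mulrA _ _ g) gu mulr1.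
Qed.

(** The quotient [e' / e] is fixed, hence a norm [s c(s)]; absorbing [s] into [v'] makes the
    coefficients equal, and Witt's theorem moves [v] to [s v']. *)
Lemma rk1_similar e e' v v' : e \in sk -> e' \in sk -> e != 0 -> e' != 0 -> v != 0 -> v' != 0 ->
  e * hnorm v = e' * hnorm v' ->
  exists2 g, star g * g = 1 & star g * rk1 e v * g = rk1 e' v'.
Proof.
move=> es es' e0 e0' v0 v0' tr.
have tk : e' / e \in kp by apply: sk_skM => //; apply: skV.
have [s sE] := norm_kp tk (mulf_neq0 e0' (invr_neq0 e0)).
have s0 : s != 0.
  apply: contraTneq (mulf_neq0 e0' (invr_neq0 e0)) => s0.
  by rewrite sE s0 mul0r eqxx.
have e'E : e' = e * (s * c s) by rewrite -sE; field.
have [||g gu gv] := @witt v (s *: v') v0.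
- by rewrite scaler_eq0 negb_or s0.
- by apply: (mulfI e0); rewrite tr hnormZ e'E; ring.
by exists g => //; rewrite rk1_conj // gv rk1Z // -e'E.
Qed.

End Witt.

Lemma horner_mx_comp (R : comNzRingType) (B : 'M[R]_3) (p r : {poly R}) :
  horner_mx B (p \Po r) = horner_mx (horner_mx B r) p.
Proof.
elim/poly_ind: p => [|p a IH]; first by rewrite comp_poly0 !rmorph0.
by rewrite comp_polyD comp_polyM comp_polyX comp_polyC !rmorphD !rmorphM /= IH !horner_mx_C horner_mx_X.
Qed.

Lemma horner_affine (R : comNzRingType) (B : 'M[R]_3) r s :
  horner_mx B (r *: 'X + s%:P) = r *: B + s%:M.
Proof. by rewrite rmorphD /= (horner_mxZ B r) horner_mx_X horner_mx_C. Qed.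

(** * Equal types have unitarily conjugate centralisers *)

Section Conj.
Variables (F : finFieldType) (c : {rmorphism F -> F}) (q : nat).
Hypothesis Q : qext c q.
Let cK := qcK Q.
Local Notation M := 'M[F]_3.
Local Notation sk := (sk c).
Local Notation kp := (kp c).
Local Notation star := (@conjmx F c 3).
Let S : star_axiom c star := conjmx_star cK.
Local Notation rk1 := (rank1 c).
Local Notation vst := (vstar c).
Local Notation hnorm := (hnorm c).
Local Notation lin a := ('X - (a : F)%:P).
Local Notation mtype := (matrix_type c).

(** [B] and [B'] may have different eigenvalues, so it is only asked that a unitary conjugate of [B]
    have the centraliser of [B']. *)
Definition cent_similar (B B' : M) := exists B'' g, [/\ star B'' + B'' = 0,
  cent B'' = cent B', star g * g = 1 & g * B = B'' * g].

Lemma cent_rk1E a e v : e != 0 -> cent (a%:M + rk1 e v) = cent (rk1 1 v).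
Proof.
move=> e0; apply/setP => x; apply/centP/centP; rewrite mulrDl mulrDr -!mulmxE scalar_mxC.
  move/addrI; rewrite /rank1 -!scalemxAr -!scalemxAl !scale1r.
  exact: (scalerI e0).
rewrite /rank1 -!scalemxAr -!scalemxAl !scale1r => h; congr (_ + _).
by rewrite h.
Qed.

Lemma conj_LJ X B B' : type_deg X = 3%N -> star B + B = 0 -> star B' + B' = 0 ->
  mtype X B -> mtype X B' -> cent_similar B B'.
Proof.
move=> X3 sB sB' mB mB'.
have [a [e [v [as_ es e0 v0 [BE XE]]]]] := mtypeLJ_inv Q sB mB X3.
have [a' [e' [v' [as_' es' e0' v0' [BE' XE']]]]] := mtypeLJ_inv Q sB' mB' X3.
(* Rescaling [e'] leaves the centraliser unchanged; this factor matches the traces of the rank one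
   parts. *)
pose t := if hnorm v' == 0 then 1 else (e * hnorm v) / (e' * hnorm v').
have hk w : hnorm w \in kp by rewrite kpE (c_hnorm cK).
have h0 : (hnorm v == 0) = (hnorm v' == 0).
  by move: XE; rewrite XE'; do 2!case: (_ == _).
have [tk t0] : t \in kp /\ t != 0.
  rewrite /t; case: ifP => h'; first by rewrite kpE rmorph1 eqxx oner_neq0.
  split; last by rewrite mulf_neq0 ?invr_neq0 ?mulf_neq0 ?h0 ?h'.
  by apply: sk_skM; [exact: sk_kpM | apply/skV/sk_kpM].
have es'' : t * e' \in sk by rewrite mulrC sk_kpM.
have e0'' : t * e' != 0 by rewrite mulf_neq0.
have tr : e * hnorm v = (t * e') * hnorm v'.
  rewrite /t; move: h0; case: (eqVneq (hnorm v') 0) => [-> /eqP ->|h _]; first by rewrite !mulr0.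
  by field; rewrite h e0'.
have [g gu gE] := rk1_similar Q es es'' e0 e0'' v0 v0' tr.
have gur : g * star g = 1 by apply: (uni_r gu).
exists (a%:M + rk1 (t * e') v'), (star g); split.
- rewrite (stD S) -scalemx1 (stZ S) (st1 S) addrACA -scalerDl /rank1 (stZ S) star_outer //.
  rewrite -scalerDl; move: as_ es''; rewrite !skE => /eqP -> /eqP ->.
  by rewrite !addNr !scale0r addr0.
- by rewrite BE' !cent_rk1E.
- by rewrite (stK S).
- rewrite BE -gE mulrDr mulrDl -!mulrA gur mulr1; congr (_ + _).
  by rewrite -!mulmxE scalar_mxC.
Qed.

(** It suffices to find a skew [B''] with the centraliser of [B'] that is a root of the
    characteristic polynomial of [B]: then [B] and [B''] are cyclic with equal characteristic
    polynomials. *)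
Lemma conj_regular X B B' B'' : regular_type X -> star B + B = 0 -> star B'' + B'' = 0 ->
  mtype X B -> cent B'' = cent B' -> cyclic_mx B' ->
  horner_mx B'' (char_poly B) = 0 -> cent_similar B B'.
Proof.
move=> rX sB sB'' mB CC cB' hB; exists B''.
have cB := mtype_reg_inv Q sB mB rX.
have [X' mX'] := mtype_exists Q sB''.
have rX' : regular_type X'.
  by apply: (mtype_comm_regular Q sB'' mX'); rewrite CC; apply: cyclic_cent_comm.
have cB'' := mtype_reg_inv Q sB'' mX' rX'.
have fE : char_poly B = char_poly B''.
  rewrite -(cyclic_minpoly cB''); symmetry.
  by apply: mxminpoly_eq; rewrite ?char_poly_monic // cyclic_minpoly // !size_char_poly.
by have [g gu gE] := cyclic_uni_similar Q S sB sB'' cB cB'' fE; exists g.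
Qed.

Lemma cent_horner_eq (B' : M) (p r : {poly F}) :
  horner_mx (horner_mx B' p) r = B' -> cent (horner_mx B' p) = cent B'.
Proof.
move=> e; apply/setP => x; apply/centP/centP => h.
  rewrite -[in LHS]e -[in RHS]e -!mulmxE.
  by apply: (@comm_mx_horner _ _ x (horner_mx B' p) r); exact: h.
by rewrite -!mulmxE; apply: (@comm_mx_horner _ _ x B' p); exact: h.
Qed.

Lemma conj_affine X B B' r s : regular_type X -> star B + B = 0 -> star B' + B' = 0 ->
  mtype X B -> cyclic_mx B' -> r \in kp -> r != 0 -> s \in sk ->
  horner_mx (r *: B' + s%:M) (char_poly B) = 0 -> cent_similar B B'.
Proof.
move=> rX sB sB' mB cB' rk r0 ss hB.
have sE : star B' = - B' by apply/eqP; rewrite -addr_eq0 sB'.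
apply: (conj_regular rX sB _ mB _ cB' hB).
  move: rk ss; rewrite skE kpE => /eqP rk /eqP ss.
  rewrite -scalemx1 (stD S) !(stZ S) (st1 S) rk ss sE scalerN scaleNr.
  by rewrite -opprD addNr.
apply/setP => x; apply/centP/centP; rewrite mulrDl mulrDr -!mulmxE scalar_mxC.
  by move/addIr; rewrite -scalemxAl -scalemxAr => /(scalerI r0).
by rewrite -scalemxAl -scalemxAr => ->.
Qed.

Lemma conj_M B B' : star B + B = 0 -> star B' + B' = 0 ->
  mtype tyM B -> mtype tyM B' -> cent_similar B B'.
Proof.
move=> sB sB' mB mB'; have cB := mtype_reg_inv Q sB mB isT.
have cB' := mtype_reg_inv Q sB' mB' isT.
have [x [y [/(gu1P c) xs /(gu1P c) ys xy mE]]] := mB.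
have [x' [y' [/(gu1P c) xs' /(gu1P c) ys' xy' mE']]] := mB'.
have d0 : x - y != 0 by rewrite subr_eq0.
have d0' : x' - y' != 0 by rewrite subr_eq0.
(* The affine map [t -> r t + s] sends [x'] to [x] and [y'] to [y]; [r] is fixed as a quotient of
   skew elements, so [r B' + s] is skew. *)
pose r := (x - y) / (x' - y'); pose s := x - r * x'.
have r0 : r != 0 by rewrite mulf_neq0 ?invr_neq0.
have rk : r \in kp by apply: sk_skM; [|apply: skV]; apply: skD => //; apply: skN.
have ss : s \in sk by apply: skD => //; apply: skN; rewrite mulrC sk_kpM.
have sE : s = x - r * x' by [].
have yE : y = s + r * y' by rewrite /s /r; field.
clearbody r s; apply: (@conj_affine tyM B B' r s isT sB sB' mB cB' rk r0 ss).
rewrite -horner_affine -horner_mx_comp -(cyclic_minpoly cB) mE; apply/eqP; rewrite horner_eq0 mE'.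
rewrite comp_polyM rmorphXn /= !comp_polyB !comp_polyX !comp_polyC.
have -> : r *: 'X + s%:P - x%:P = r *: lin x'.
  by rewrite scalerBr -!mul_polyC sE !(polyCB, polyCM); ring.
have -> : r *: 'X + s%:P - y%:P = r *: lin y'.
  by rewrite yE scalerBr -!mul_polyC !(polyCD, polyCM); ring.
by rewrite exprZn -scalerAl -scalerAr scalerA dvdpZr ?dvdpp // mulf_neq0 ?expf_neq0.
Qed.

Lemma conj_N B B' : star B + B = 0 -> star B' + B' = 0 ->
  mtype tyN B -> mtype tyN B' -> cent_similar B B'.
Proof.
move=> sB sB' mB mB'; have cB := mtype_reg_inv Q sB mB isT.
have cB' := mtype_reg_inv Q sB' mB' isT.
have [x /(gu1P c) xs mE] := mB.
have [x' /(gu1P c) xs' mE'] := mB'.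
apply: (@conj_affine tyN B B' 1 (x - x')) => //; rewrite ?kpE ?rmorph1 ?oner_neq0 //.
  by apply: skD => //; apply: skN.
rewrite -horner_affine -horner_mx_comp -(cyclic_minpoly cB) mE; apply/eqP; rewrite horner_eq0 mE'.
rewrite rmorphXn /= comp_polyB comp_polyX comp_polyC.
have -> : 1 *: 'X + (x - x')%:P - x%:P = lin x' by rewrite scale1r polyCB; ring.
exact: dvdpp.
Qed.

Lemma interpolate3 (x y z a b d : F) : uniq [:: x; y; z] ->
  exists2 p : {poly F}, (size p <= 3)%N & [/\ p.[x] = a, p.[y] = b & p.[z] = d].
Proof.
rewrite /= !inE negb_or andbT => /andP[/andP[xy xz] yz].
pose L u v w t : {poly F} := (t / ((u - v) * (u - w))) *: (lin v * lin w).
exists (L x y z a + L y x z b + L z x y d).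
  have sL u v w t : (size (L u v w t) <= 3)%N.
    by apply: leq_trans (size_scale_leq _ _) _; rewrite lin_size3.
  apply: leq_trans (size_polyD _ _) _; rewrite geq_max sL andbT.
  by apply: leq_trans (size_polyD _ _) _; rewrite geq_max !sL.
have xy' : x - y != 0 by rewrite subr_eq0.
have xz' : x - z != 0 by rewrite subr_eq0.
have yz' : y - z != 0 by rewrite subr_eq0.
have yx' : y - x != 0 by rewrite subr_eq0 eq_sym.
have zx' : z - x != 0 by rewrite subr_eq0 eq_sym.
have zy' : z - y != 0 by rewrite subr_eq0 eq_sym.
by split; rewrite !(hornerD, hornerZ, hornerM, hornerN, hornerX, hornerC); field;
  rewrite ?xy' ?xz' ?yz' ?yx' ?zx' ?zy'.
Qed.

Lemma horner_star_all (B : M) (p : {poly F}) : star B + B = 0 -> (size p <= 3)%N ->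
  exists p' : {poly F}, star (horner_mx B p) = horner_mx B p' /\ forall t, p'.[t] = c p.[- c t].
Proof.
move=> sB sp; exists ((c p`_0)%:P - c p`_1 *: 'X + c p`_2 *: 'X^2).
have Bs : star B = - B by apply/eqP; rewrite -addr_eq0 sB.
split.
  rewrite (horner_mx_sum3 B sp) !(stD S) !(stZ S) (st1 S) (stX S) Bs sqrrN.
  rewrite !rmorphD rmorphN /= (horner_mxZ B (c p`_1)) (horner_mxZ B (c p`_2)) horner_mx_C.
  by rewrite rmorphXn /= horner_mx_X -scalemx1 scalerN.
move=> t.
rewrite (horner_coef_wide _ sp) sum3 /= !rmorphD !rmorphM !rmorphXn /= !rmorphN /= cK.
rewrite !(hornerD, hornerN, hornerZ, hornerXn, hornerX, hornerC).
ring.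
Qed.

(** The candidate [B''] is [p(B')] with [p] interpolating the eigenvalues of [B] at those of [B'].
    The last hypothesis makes it skew; the inverse interpolation [r] shows that it has the same
    centraliser. *)
Lemma conj_split X B B' x y z x' y' z' : regular_type X ->
  star B + B = 0 -> star B' + B' = 0 -> mtype X B -> cyclic_mx B' ->
  uniq [:: x; y; z] -> uniq [:: x'; y'; z'] ->
  mxminpoly B = lin x * lin y * lin z -> mxminpoly B' = lin x' * lin y' * lin z' ->
  (forall p : {poly F}, p.[x'] = x -> p.[y'] = y -> p.[z'] = z ->
     [/\ c p.[- c x'] = - x, c p.[- c y'] = - y & c p.[- c z'] = - z]) ->
  cent_similar B B'.
Proof.
move=> rX sB sB' mB cB' u u' mE mE' hc; have cB := mtype_reg_inv Q sB mB rX.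
have [p sp [px py pz]] := interpolate3 x y z u'.
have [r sr [rx ry rz]] := interpolate3 x' y' z' u.
have [hx hy hz] := hc p px py pz.
have [p' [p'E p'v]] := horner_star_all sB' sp.
apply: (@conj_regular X B B' (horner_mx B' p)) => //.
- rewrite p'E -rmorphD; apply/eqP; rewrite horner_eq0 mE' dvd_lin3 //.
  by rewrite !rootE !hornerD !p'v hx hy hz px py pz !addNr !eqxx.
- apply: (@cent_horner_eq _ _ r); apply/eqP; rewrite -subr_eq0 -{2}(horner_mx_X B').
  rewrite -horner_mx_comp -rmorphB horner_eq0 mE' dvd_lin3 //.
  by rewrite !rootE !hornerD !hornerN !horner_comp px py pz !hornerX rx ry rz !subrr !eqxx.
- apply/eqP; rewrite -horner_mx_comp -(cyclic_minpoly cB) horner_eq0 mE' mE dvd_lin3 //.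
  rewrite !rootE !horner_comp px py pz !hornerM !hornerXsubC !subrr.
  by rewrite !mulr0 !mul0r !eqxx.
Qed.

Lemma conj_T1 B B' : star B + B = 0 -> star B' + B' = 0 ->
  mtype tyT1 B -> mtype tyT1 B' -> cent_similar B B'.
Proof.
move=> sB sB' mB mB'; have cB' := mtype_reg_inv Q sB' mB' isT.
have [x [y [z [[/(gu1P c) xs /(gu1P c) ys /(gu1P c) zs] u mE]]]] := mB.
have [x' [y' [z' [[/(gu1P c) xs' /(gu1P c) ys' /(gu1P c) zs'] u' mE']]]] := mB'.
apply: (@conj_split tyT1 _ _ _ _ _ _ _ _ isT sB sB' mB cB' u u' mE mE') => p px py pz.
move: xs ys zs xs' ys' zs'; rewrite !skE => /eqP xs /eqP ys /eqP zs /eqP xs' /eqP ys' /eqP zs'.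
by rewrite xs' ys' zs' !opprK px py pz.
Qed.

Lemma conj_T2 B B' : star B + B = 0 -> star B' + B' = 0 ->
  mtype tyT2 B -> mtype tyT2 B' -> cent_similar B B'.
Proof.
move=> sB sB' mB mB'; have cB' := mtype_reg_inv Q sB' mB' isT.
have [x [y [z [/(gu1P c) xs u yz mE]]]] := mB.
have [x' [y' [z' [/(gu1P c) xs' u' yz' mE']]]] := mB'.
apply: (@conj_split tyT2 _ _ _ _ _ _ _ _ isT sB sB' mB cB' u u' mE mE') => p px py pz.
move: xs xs'; rewrite !skE => /eqP xs /eqP xs'.
rewrite xs' !opprK px -yz' py; split=> //.
  have -> : - c y' = z' by rewrite yz' rmorphN cK opprK.
  by rewrite pz yz opprK.
by rewrite yz rmorphN cK.
Qed.

End Conj.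

Lemma odd_involution_fixed (T : finType) (A : {set T}) (s : T -> T) :
  {in A, forall x, s x \in A} -> {in A, forall x, s (s x) = x} -> odd #|A| ->
  exists2 x, x \in A & s x = x.
Proof.
have [n] := ubnP #|A|; elim: n A => // n IH A; rewrite ltnS => An sA ss oA.
have [x xA] : exists x, x \in A by apply/card_gt0P; case: #|A| oA.
have [sx|sx] := eqVneq (s x) x; first by exists x.
pose A' := A :\ x :\ s x.
have sxA : s x \in A :\ x by rewrite !inE sx sA.
have c1 := cardsD1 (s x) (A :\ x); have c2 := cardsD1 x A.
rewrite sxA in c1; rewrite xA c1 in c2.
have [||||y yA' yy] := IH A'.
- by apply: leq_trans An; rewrite c2 /A'; lia.
- move=> y; rewrite !inE => /and3P[y1 y2 yA]; rewrite sA // andbT.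
  apply/andP; split; first by apply: contra y2 => /eqP e; rewrite -(ss y yA) e ss.
  by apply: contra y1 => /eqP e; rewrite -(ss y yA) e.
- by move=> y; rewrite !inE => /and3P[_ _ /ss].
- by move: oA; rewrite c2 !oddD /=; case: odd.
by exists y => //; move: yA'; rewrite !inE => /and3P[].
Qed.

Section SameDegree.
Variables (F : finFieldType) (f h : {poly F}).
Hypotheses (fI : monic_irreducible_poly f) (hI : monic_irreducible_poly h).
Local Notation K := {poly %/ h with hI}.

Lemma in_qpoly_eq0 (p : {poly F}) : (in_qpoly h p == 0) = (h %| p).
Proof.
rewrite -val_eqE /= -Pdiv.IdomainMonic.modpE ?monic_mk_monic // mk_monicE //.
Qed.

End SameDegree.

Section SameDegree2.
Variables (F : finFieldType) (f h : {poly F}).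
Hypotheses (fI : monic_irreducible_poly f) (hI : monic_irreducible_poly h).
Hypothesis sz : size f = size h.
Local Notation K := {poly %/ h with hI}.

Lemma irreducible_dvd_Xn : f %| 'X^(#|F| ^ (size f).-1) - 'X.
Proof.
rewrite -(in_qpoly_eq0 fI) rmorphB rmorphXn /= subr_eq0; apply/eqP.
by rewrite -(card_qfpoly fI) -[RHS](@expf_card {poly %/ f with fI}).
Qed.

Definition toK : {poly F} -> {poly K} := map_poly (qfpoly_const hI).

(** Since [f] and [h] have equal degree, [f] divides [X^|K| - X], the product of all linear factors
    over [K]; so it has as many distinct roots there as its degree. *)
Lemma card_roots_irreducible : #|[set x : K | root (toK f) x]| = (size f).-1.
Proof.
have toKE p : toK p = map_poly (qpolyC h) p by [].
have szK (p : {poly F}) : size (toK p) = size p.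
  exact: (size_map_poly (qpolyC h)).
have : toK f %| \prod_(x <- enum K) ('X - x%:P).
  rewrite (big_enum _ _ predT) /= -(finField_genPoly {poly %/ h with hI}) card_qfpoly -sz.
  have [g gE] := dvdpP _ _ irreducible_dvd_Xn.
  have -> : 'X^(#|F| ^ (size f).-1) - 'X = toK ('X^(#|F| ^ (size f).-1) - 'X).
    by rewrite toKE rmorphB /= map_polyXn map_polyX.
  by rewrite gE; apply/dvdpP; exists (toK g); rewrite toKE rmorphM.
case/dvdp_prod_XsubC => m; set s := mask m _ => e.
have us : uniq s by rewrite mask_uniq ?enum_uniq.
have -> : #|[set x : K | root (toK f) x]| = size s.
  rewrite -(card_uniqP us); apply: eq_card => x.
  by rewrite inE (eqp_root e) root_prod_XsubC.
by have := eqp_size e; rewrite szK size_prod_XsubC => ->.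
Qed.

End SameDegree2.

Section ConjT3.
Variables (F : finFieldType) (c : {rmorphism F -> F}) (q : nat).
Hypothesis Q : qext c q.
Let cK := qcK Q.
Local Notation M := 'M[F]_3.
Local Notation sk := (sk c).
Local Notation kp := (kp c).
Local Notation star := (@conjmx F c 3).
Let S : star_axiom c star := conjmx_star cK.
Local Notation lin a := ('X - (a : F)%:P).
Local Notation mtype := (matrix_type c).

(** Evaluation at [B'] identifies [cent B'] with the field defined by its minimal polynomial, where
    the roots are already counted. *)
Lemma card_roots_cent (B' : M) (f : {poly F}) : cyclic_mx B' ->
  monic_irreducible_poly f -> monic_irreducible_poly (mxminpoly B') ->
  size f = 4%N -> #|[set x in cent B' | horner_mx x f == 0]| = 3%N.
Proof.
move=> cB' fI hI sf; set h := mxminpoly B' in hI.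
have sh : size h = 4%N by rewrite /h cyclic_minpoly // size_char_poly.
have := card_roots_irreducible fI hI (etrans sf (esym sh)); rewrite sf /= => e; apply: etrans e.
pose th (x : {poly %/ h with hI}) : M := horner_mx B' (val x).
have thI : injective th.
  move=> x y /eqP; rewrite -subr_eq0 -rmorphB horner_eq0 -/h => d.
  apply/val_inj/eqP; rewrite -subr_eq0; apply: contraLR d => n0.
  apply/negP => /(dvdp_leq n0); rewrite leqNgt.
  have sx (z : {poly %/ h}) : (size (val z) < size h)%N.
    by apply: leq_trans (size_mk_monic z) _; rewrite (mk_monicE hI).
  rewrite (leq_ltn_trans (size_polyD _ _)) // gtn_max size_polyN !sx //.
rewrite -[RHS](card_imset _ thI); apply: eq_card => X.
apply/idP/imsetP => [|[x]].
  rewrite inE => /andP[/(cyclic_cent cB')[p sp ->] ].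
  rewrite -horner_mx_comp horner_eq0 -/h -(in_qpoly_eq0 hI) in_qpoly_comp_horner => r.
  exists (in_qpoly h p : {poly %/ h with hI}); first by rewrite inE.
  rewrite /th; congr horner_mx; symmetry; apply: in_qpoly_small.
  by rewrite (mk_monicE hI) sh; exact: sp.
rewrite inE => r ->; apply/andP; split; first exact: horner_cent.
rewrite /th.
rewrite -horner_mx_comp horner_eq0 -/h -(in_qpoly_eq0 hI) in_qpoly_comp_horner.
have -> : in_qpoly h (val x) = x.
  by apply/val_inj/in_qpoly_small/size_mk_monic.
by rewrite inE in r; exact: r.
Qed.

(** The map [X -> - star X] is an involution on the three roots of the characteristic polynomial of
    [B] in the field [cent B']. As three is odd it has a fixed point, which is a skew root
    generating that field. *)
Lemma conj_T3 B B' : star B + B = 0 -> star B' + B' = 0 ->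
  mtype tyT3 B -> mtype tyT3 B' -> cent_similar c B B'.
Proof.
move=> sB sB' mB mB'; have cB := mtype_reg_inv Q sB mB isT.
have cB' := mtype_reg_inv Q sB' mB' isT.
have [s4 irr] := mB; have [_ irr'] := mB'.
have cf := cyclic_minpoly cB; set f := char_poly B in cf.
have [a [b [d [as_ bk ds fE]]]] := cyclic_skew_cubic S sB cB.
have nr t : ~~ root f t.
  apply/negP; rewrite -dvdp_XsubCl -cf => /(irr.2 _ _); rewrite size_XsubC => /(_ isT).
  by move/eqp_size; rewrite size_XsubC s4.
have c3 : #|[set x in cent B' | horner_mx x f == 0]| = 3%N.
  apply: card_roots_cent => //; last by rewrite -cf.
    by split; [rewrite -cf; exact: irr | exact: char_poly_monic].
  by split => //; exact: mxminpoly_monic.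
set A := [set x in _ | _] in c3.
have hN X : horner_mx (- star X) f = - star (horner_mx X f).
  have hf Y : horner_mx Y f = Y ^+ 3 + a *: Y ^+ 2 + b *: Y + d%:A.
    rewrite /f fE /cubic !rmorphD /= (horner_mxZ Y a) (horner_mxZ Y b) horner_mx_C.
    by rewrite !rmorphXn /= horner_mx_X -scalemx1.
  rewrite !hf !(stD S) !(stZ S) !(stX S) (st1 S).
  move: as_ bk ds; rewrite !skE kpE => /eqP -> /eqP -> /eqP ->.
  rewrite sqrrN exprNn -signr_odd /= expr1 mulN1r scalerN !scaleNr !opprD !opprK.
  by [].
have [X] : exists2 x, x \in A & - star x = x.
  apply: odd_involution_fixed; last by rewrite c3.
    move=> X; rewrite !inE hN => /andP[/eqP XC /eqP ->]; rewrite (st0 S) oppr0 eqxx andbT.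
    have sC : star X \in cent B' by apply: (cent_st S sB'); apply/centP.
    by rewrite mulNr mulrN; move/centP: sC => ->.
  by move=> X _; rewrite (stN S) (stK S) opprK.
rewrite inE => /andP[XC /eqP fX] sX.
have sX' : star X + X = 0 by rewrite -{2}sX addrN.
have mX : mxminpoly X %| f by apply: mxminpoly_min.
have cX : cyclic_mx X.
  case: (skew_trichotomy Q sX') => [[x _ XE]|[x [e [v [_ _ e0 v0 XE]]]]|//].
    case/negP: (nr x); apply: (root_dvdp mX).
    by rewrite XE mxminpoly_scalar root_XsubC.
  case/negP: (nr x); apply: (root_dvdp mX).
  by rewrite XE mxminpoly_rk1 // rootM root_XsubC eqxx.
have B'C : B' \in cent X by apply/centP; move/centP: XC => ->.
have CC : cent X = cent B'.
  have [r _ B'E] := cyclic_cent cX B'C.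
  apply/setP => x; apply/idP/idP => [xC|xC].
    by rewrite B'E; apply/centP; apply: (cyclic_cent_comm cX) => //; apply: horner_cent.
  by apply/centP; apply: (cyclic_cent_comm cB').
exact: (conj_regular Q (X := tyT3) isT sB sX' mB CC cB' fX).
Qed.

Lemma mtype_cent_similar X B B' : star B + B = 0 -> star B' + B' = 0 ->
  mtype X B -> mtype X B' -> cent_similar c B B'.
Proof.
move=> sB sB'; case: X => mB mB'.
- have [a _ BE] := mtypeG_inv Q sB mB; have [a' _ BE'] := mtypeG_inv Q sB' mB'.
  exists B, 1; split=> //; first by rewrite BE BE' !cent_scalar.
    by rewrite (st1 S) mulr1.
  by rewrite mul1r mulr1.
- exact: (conj_LJ Q _ sB sB' mB mB').
- exact: (conj_LJ Q _ sB sB' mB mB').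
- exact: (conj_T1 Q sB sB' mB mB').
- exact: (conj_T2 Q sB sB' mB mB').
- exact: (conj_T3 sB sB' mB mB').
- exact: (conj_M Q sB sB' mB mB').
- exact: (conj_N Q sB sB' mB mB').
Qed.

End ConjT3.

(** * The antidiagonal hermitian form and explicit regular matrices *)

Definition mat9 (R : nmodType) (a b d e f g h k l : R) : 'M[R]_3 :=
  \matrix_(i, j) (if val i == 0%N then (if val j == 0%N then a else if val j == 1%N then b else d)
    else if val i == 1%N then (if val j == 0%N then e else if val j == 1%N then f else g)
    else (if val j == 0%N then h else if val j == 1%N then k else l)).

Lemma mat9_eq (R : nmodType) (A B : 'M[R]_3) :
  A 0 0 = B 0 0 -> A 0 1 = B 0 1 -> A 0 2 = B 0 2 ->
  A 1 0 = B 1 0 -> A 1 1 = B 1 1 -> A 1 2 = B 1 2 ->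
  A 2 0 = B 2 0 -> A 2 1 = B 2 1 -> A 2 2 = B 2 2 -> A = B.
Proof. by move=> *; apply/matrixP; elim/ord3P; elim/ord3P. Qed.

Lemma mulE3 (R : pzSemiRingType) (A B : 'M[R]_3) i j :
  (A *m B) i j = A i 0 * B 0 j + A i 1 * B 1 j + A i 2 * B 2 j.
Proof. by rewrite mxE sum3. Qed.

(* The adjoint involution of the antidiagonal hermitian form. *)
Definition wstar (R : nmodType) (c : R -> R) (A : 'M[R]_3) : 'M[R]_3 :=
  mat9 (c (A 2 2)) (c (A 1 2)) (c (A 0 2)) (c (A 2 1)) (c (A 1 1)) (c (A 0 1))
       (c (A 2 0)) (c (A 1 0)) (c (A 0 0)).

Section Conjugation.
Variables (F : finFieldType) (c : {rmorphism F -> F}).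
Local Notation M := 'M[F]_3.

(* The involution st transported along x |-> P x P^-1. *)
Definition st_conj (P : M) (st : M -> M) (x : M) : M := P^-1 * st (P * x * P^-1) * P.

Variables (P : M) (st : M -> M).
Hypothesis uP : P \is a GRing.unit.

Lemma conjM x y : P * (x * y) * P^-1 = (P * x * P^-1) * (P * y * P^-1).
Proof. by rewrite -!mulrA mulKr // !mulrA. Qed.
Lemma conjD x y : P * (x + y) * P^-1 = P * x * P^-1 + P * y * P^-1.
Proof. by rewrite mulrDr mulrDl. Qed.
Lemma conjB x y : P * (x - y) * P^-1 = P * x * P^-1 - P * y * P^-1.
Proof. by rewrite mulrBr mulrBl. Qed.
Lemma conj1 : P * 1 * P^-1 = 1. Proof. by rewrite mulr1 mulrV. Qed.
Lemma conj0 : P * 0 * P^-1 = 0 :> M. Proof. by rewrite mulr0 mul0r. Qed.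
Lemma conjK x : P^-1 * (P * x * P^-1) * P = x.
Proof. by rewrite -!mulrA mulVr // mulr1 mulKr. Qed.
Lemma conjVK x : P * (P^-1 * x * P) * P^-1 = x.
Proof. by rewrite -!mulrA mulrV // mulr1 mulVKr. Qed.
Lemma conj_inj : injective (fun x => P * x * P^-1).
Proof. by move=> x y /= e; rewrite -[x]conjK e conjK. Qed.
Lemma conj_tr x : \tr (P * x * P^-1) = \tr x.
Proof. by rewrite trM mulrA mulVr // mul1r. Qed.
Lemma st_conjE x : P * st_conj P st x * P^-1 = st (P * x * P^-1).
Proof. by rewrite /st_conj conjVK. Qed.
Lemma st_conj_skew x : st_conj P st x + x = 0 <-> st (P * x * P^-1) + P * x * P^-1 = 0.
Proof.
rewrite -st_conjE -conjD; split=> [->|e]; first exact: conj0.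
by apply: conj_inj; rewrite e conj0.
Qed.
Lemma st_conj_uni x : st_conj P st x * x = 1 <-> st (P * x * P^-1) * (P * x * P^-1) = 1.
Proof.
rewrite -st_conjE -conjM; split=> [->|e]; first exact: conj1.
by apply: conj_inj; rewrite e conj1.
Qed.
Lemma cent_conj B x : (P * x * P^-1 \in cent (P * B * P^-1)) = (x \in cent B).
Proof. by rewrite !inE -!conjM (inj_eq conj_inj). Qed.
Lemma horner_conj B p : horner_mx (P * B * P^-1) p = P * horner_mx B p * P^-1.
Proof.
elim/poly_ind: p => [|p a IH]; first by rewrite !rmorph0 conj0.
rewrite !rmorphD !rmorphM /= IH !horner_mx_X !horner_mx_C conjD conjM; congr (_ + _).
by rewrite (_ : P * a%:M = a%:M * P) ?mulrK //; exact: scalar_mxC.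
Qed.
Lemma mxminpoly_conj' B : mxminpoly (P * B * P^-1) = mxminpoly B.
Proof.
apply/eqP; rewrite -eqp_monic ?mxminpoly_monic //; apply/andP; split; apply: mxminpoly_min.
  by rewrite horner_conj mx_root_minpoly conj0.
by apply: conj_inj; rewrite -horner_conj mx_root_minpoly conj0.
Qed.
Lemma mtype_conj X B : matrix_type c X (P * B * P^-1) <-> matrix_type c X B.
Proof. by rewrite /matrix_type mxminpoly_conj'. Qed.

End Conjugation.

Section Realize.
Variables (F : finFieldType) (c : {rmorphism F -> F}) (q : nat).
Hypothesis Q : qext c q.
Let cK := qcK Q.
Local Notation M := 'M[F]_3.
Local Notation sk := (sk c).
Local Notation kp := (kp c).
Local Notation star := (@conjmx F c 3).
Let S : star_axiom c star := conjmx_star cK.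
Local Notation mtype := (matrix_type c).

(** The standard and the antidiagonal forms are equivalent: with [l] of norm -1, the matrix [P]
    satisfies [star P * P = w], the antidiagonal permutation matrix, and
    [wstar x = w * star x * w]. *)
Lemma wstar_conj : exists2 P : M, P \is a GRing.unit &
  forall x, wstar c x = st_conj P star x.
Proof.
have [l l1] : exists l, l * c l = -1.
  have [||s e] := norm_kp Q (t := -1); last by exists s.
    by rewrite kpE rmorphN1.
  by rewrite oppr_eq0 oner_eq0.
have l1' : c l * l = -1 by rewrite mulrC.
have two := q2 Q; set h := 2%:R^-1 : F.
have hh : h + h = 1 by rewrite /h; field.
have ch : c h = h by rewrite /h fmorphV rmorph_nat.
pose P : M := mat9 1 0 h l 0 (- l * h) 0 1 0.
pose w : M := mat9 0 0 1 0 1 0 1 0 0.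
have PP : star P * P = w.
  rewrite /P /w; apply: mat9_eq; rewrite -mulmxE mulE3 !mxE /= ?rmorphM ?rmorphN ?rmorph0 ?rmorph1 ?ch;
   rewrite ?(mulNr, mulrN, mul0r, mulr0, mul1r, mulr1, addr0, add0r, opprK) //;
   rewrite ?mulrA ?l1' ?mulN1r ?opprK ?addrN ?subrr ?hh //.
  - by rewrite (mulrAC (c l)) l1' mulN1r opprK.
  - by rewrite (mulrAC (c l)) l1' mulN1r mulNr addrN.
have ww : w * w = 1.
  by apply: mat9_eq; rewrite -mulmxE mulE3 !mxE /= ?(mul0r, mulr0, mul1r, addr0, add0r).
have uP : P \is a GRing.unit.
  have : (w * star P) *m P = 1%:M by rewrite mulmxE -mulrA PP ww.
  by case/mulmx1_unit.
have uw : w \is a GRing.unit by rewrite -PP unitrMl // (st_unit S).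
have wV : w^-1 = w by apply: (mulrI uw); rewrite mulrV // ww.
exists P => // x; rewrite /st_conj !(stM S) (stV S) //.
have -> : P^-1 * ((star P)^-1 * (star x * star P)) * P = w * star x * w.
  by rewrite -{1}wV -PP invrM ?(st_unit S) // !mulrA.
apply: mat9_eq; rewrite -!mulmxE !mulE3 !mxE /= ?(mul0r, mulr0, mul1r, mulr1, addr0, add0r) //.
Qed.

Lemma wstar_star : star_axiom c (wstar c).
Proof.
have [P uP wE] := wstar_conj.
split=> [x y|x y|x|a x]; rewrite !wE.
- by rewrite /st_conj conjD (stD S) mulrDr mulrDl.
- by apply: (conj_inj uP); rewrite /= (conjM uP (st_conj _ _ _)) !(st_conjE _ uP) -(stM S) conjM.
- by apply: (conj_inj uP); rewrite /= !(st_conjE _ uP) (stK S).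
- by rewrite /st_conj -scalerAr -scalerAl (stZ S) -scalerAr -scalerAl.
Qed.

(** For the antidiagonal form a matrix close to a companion matrix is skew, so each skew cubic is
    realised explicitly and then transported by [P]. *)
Lemma regular_realize st a b d : star_axiom c st -> (exists2 P : M, P \is a GRing.unit &
    forall x, wstar c x = st_conj P st x) ->
  a \in sk -> b \in kp -> d \in sk ->
  exists B, [/\ st B + B = 0, cyclic_mx B & mxminpoly B = cubic a b d].
Proof.
move=> T [P uP wE] as_ bk ds; have two := q2 Q.
have [g gk bE] : exists2 g, c g = g & b = - (g + g).
  exists (- (b / 2%:R)); last by field.
  by rewrite rmorphN fmorph_div rmorph_nat; move: bk; rewrite kpE => /eqP ->.
(* Skewness forces two equal entries [g] up to sign; each contributes [- g] to the linear
   coefficient, whence [b = - (g + g)]. *)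
pose X : M := mat9 0 g d 1 (- a) (- g) 0 (-1) 0.
have sX : wstar c X + X = 0.
  move: as_ ds; rewrite !skE => /eqP as_ /eqP ds.
  by apply: mat9_eq; rewrite !mxE /= ?rmorphN ?rmorph0 ?rmorph1 ?gk ?as_ ?ds ?opprK ?addr0 ?addNr ?addrN.
have cX : krylov (delta_mx 0 2) X \in unitmx.
  have -> : krylov (delta_mx 0 2) X = mat9 0 0 1 0 (-1) 0 (-1) a g.
    rewrite /krylov -rowE; apply: mat9_eq; rewrite !mxE //= sum3 !mxE /=; ring.
  rewrite unitmxE unitfE det3 !mxE /=.
  by rewrite (_ : _ + _ = -1) ?oppr_eq0 ?oner_neq0 //; ring.
have hX : horner_mx X (cubic a b d) = 0.
  rewrite /cubic !rmorphD /= (horner_mxZ X a) (horner_mxZ X b) horner_mx_C.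
  rewrite !rmorphXn /= horner_mx_X -scalemx1 !exprS expr0 mulr1.
  have XX : X * X = mat9 g (- (a * g) - d) (- (g * g)) (- a) (g + a * a + g) (d + a * g) (-1) a g.
    by apply: mat9_eq; rewrite -mulmxE mulE3 !mxE /=; ring.
  by rewrite XX bE; apply: mat9_eq; rewrite !mxE sum3 !mxE /=; ring.
have PX : P * X * P^-1 = P *m X *m invmx P by [].
have cB : cyclic_mx (P * X * P^-1).
  exists (delta_mx 0 2 *m invmx P).
  have -> : krylov (delta_mx 0 2 *m invmx P) (P * X * P^-1) = krylov (delta_mx 0 2) X *m invmx P.
    rewrite PX /krylov rows3_mul !mulmxA mulmxKV //.
    by rewrite -!mulmxA (mulmxA (invmx P)) mulVmx // mul1mx !mulmxA.
  by rewrite unitmx_mul cX unitmx_inv.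
exists (P * X * P^-1); split=> //.
  by apply/(st_conj_skew _ uP); rewrite -wE.
apply: mxminpoly_eq; first exact: cubic_monic.
  by rewrite horner_conj // hX conj0.
rewrite cyclic_minpoly // size_char_poly; by have [_ _ _ _ ->] := cubic_coef a b d.
Qed.
End Realize.

(** * Counting skew cubics *)

(* Six times the polynomials a_{sigma, tau}. *)
Definition count6 (X Y : sh_type) : {poly int} :=
  match X, Y with
  | tyG, tyG | tyG, tyJ | tyG, tyN => 6%:R *: 'X
  | tyG, tyL | tyG, tyM => 6%:R *: ('X ^+ 2 - 'X)
  | tyG, tyT1 => 'X * ('X - 1) * ('X - 2%:R)
  | tyG, tyT2 => 3%:R *: ('X ^+ 3 - 'X ^+ 2)
  | tyG, tyT3 => 2%:R *: ('X ^+ 3 - 'X)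
  | tyL, tyL | tyL, tyM | tyJ, tyJ => 6%:R *: 'X ^+ 2
  | tyL, tyT1 | tyL, tyT2 => 3%:R *: ('X ^+ 3 - 'X ^+ 2)
  | tyJ, tyM => 6%:R *: ('X ^+ 3 - 'X ^+ 2)
  | tyJ, tyN => 6%:R *: ('X ^+ 2 - 'X)
  | tyT1, tyT1 | tyT2, tyT2 | tyT3, tyT3 | tyM, tyM | tyN, tyN => 6%:R *: 'X ^+ 3
  | _, _ => 0
  end.

Lemma card_offdiag (T : finType) (A : {set T}) :
  (#|[set a : T * T | [&& a.1 \in A, a.2 \in A & a.1 != a.2]]| + #|A| = #|A| * #|A|)%N.
Proof.
rewrite -cardsX -(cardsID [set a : T * T | a.1 != a.2] (setX A A)); congr (_ + _)%N.
  by apply: eq_card => a; rewrite !inE andbA.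
have -> : setX A A :\: [set a | a.1 != a.2] = [set (x, x) | x in A].
  apply/setP => -[x y]; rewrite !inE negbK /=; apply/andP/imsetP => [[/eqP <- /andP[xA _]]|[z zA [-> ->]]].
    by exists x.
  by rewrite eqxx zA.
by rewrite card_imset // => x y [].
Qed.

Section CountCubics.
Variables (F : finFieldType) (c : {rmorphism F -> F}) (q : nat).
Hypothesis Q : qext c q.
Let cK := qcK Q.
Local Notation M := 'M[F]_3.
Local Notation sk := (sk c).
Local Notation kp := (kp c).
Local Notation star := (@conjmx F c 3).
Let S : star_axiom c star := conjmx_star cK.
Local Notation mtype := (matrix_type c).
Local Notation lin a := ('X - (a : F)%:P).

Definition tcub (t : F * F * F) := cubic t.1.1 t.1.2 t.2.
Definition coef3 (p : {poly F}) : F * F * F := (p`_2, p`_1, p`_0).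
Definition SK3 : {set F * F * F} := [set t | [&& t.1.1 \in sk, t.1.2 \in kp & t.2 \in sk]].

Lemma tcubK : cancel tcub coef3.
Proof. by case=> [[a b] d]; have [h0 h1 h2 _ _] := cubic_coef a b d; rewrite /coef3 h0 h1 h2. Qed.

Lemma coef3K p : p \is monic -> size p = 4%N -> tcub (coef3 p) = p.
Proof. by move=> mp sp; rewrite [RHS](monic_cubic mp sp). Qed.

Lemma card_SK3 : #|SK3| = (q ^ 3)%N.
Proof.
have -> : SK3 = setX (setX sk kp) sk by apply/setP => t; rewrite !inE andbA.
by rewrite !cardsX (card_sk Q) (card_kp Q) !expnS expn0 muln1 mulnA.
Qed.

Definition polyA (A : {set F}) := \prod_(a in A) lin a.

Lemma polyA_root A t : root (polyA A) t = (t \in A).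
Proof. by rewrite /polyA -big_enum root_prod_XsubC mem_enum. Qed.

Lemma polyA_inj : injective polyA.
Proof. by move=> A B e; apply/setP => t; rewrite -!polyA_root e. Qed.

Lemma polyA_size A : size (polyA A) = #|A|.+1.
Proof. by rewrite /polyA -big_enum size_prod_XsubC cardE. Qed.

Lemma polyA_monic A : polyA A \is monic.
Proof. by apply: monic_prod => i _; apply: monicXsubC. Qed.

Lemma lin3P x y z : lin x * lin y * lin z \is monic /\ size (lin x * lin y * lin z) = 4%N.
Proof.
by rewrite !size_mul ?mulf_neq0 ?polyXsubC_eq0 // !size_XsubC !rpredM ?monicXsubC.
Qed.

Lemma coef3_lin3 x y z :
  coef3 (lin x * lin y * lin z) = (- (x + y + z), x * y + x * z + y * z, - (x * y * z)).
Proof. by rewrite cubic_roots; have [h0 h1 h2 _ _] := cubic_coef (- (x + y + z)) (x * y + x * z + y * z) (- (x * y * z)); rewrite /coef3 h0 h1 h2. Qed.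

Lemma SK3_lin3 x y z : x \in sk -> (y \in sk /\ z \in sk) \/ y = - c z ->
  coef3 (lin x * lin y * lin z) \in SK3.
Proof.
move=> xs [[ys zs]|yE]; rewrite coef3_lin3 inE /=.
  apply/and3P; split; first exact: skN (skD (skD xs ys) zs).
    exact: kpD (kpD (sk_skM xs ys) (sk_skM xs zs)) (sk_skM ys zs).
  by apply: skN; rewrite mulrC; apply: sk_kpM => //; exact: sk_skM.
have cz : c y = - z by rewrite yE rmorphN cK.
have cz' : c z = - y by rewrite yE opprK.
move: xs; rewrite !skE kpE => /eqP xs.
by rewrite !(rmorphN, rmorphD, rmorphM) /= xs cz cz'; apply/and3P; split; apply/eqP; ring.
Qed.

(** Split cubics are parametrised by their roots: unordered triples for T1, a skew root and one of
    two conjugate roots for T2, simple and double root for M. Irreducible cubics are obtained as the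
    complement, in [cubS]. *)
Definition cubT (Y : sh_type) : {set F * F * F} :=
  match Y with
  | tyT1 => [set coef3 (polyA A) | A in [set A : {set F} | (A \subset sk) && (#|A| == 3%N)]]
  | tyT2 => [set coef3 (lin a.1 * lin a.2 * lin (- c a.2)) | a in setX sk (~: sk)]
  | tyM => [set coef3 (lin a.1 * lin a.2 * lin a.2) |
      a in [set a : F * F | [&& a.1 \in sk, a.2 \in sk & a.1 != a.2]]]
  | tyN => [set coef3 (lin a * lin a * lin a) | a in sk]
  | _ => set0
  end.

Lemma polyA3 (A : {set F}) : #|A| = 3%N ->
  exists x y z, [/\ uniq [:: x; y; z], A = [set x; y; z] & polyA A = lin x * lin y * lin z].
Proof.
move=> A3; have : size (enum A) = 3%N by rewrite -cardE.
case e : (enum A) => [|x [|y [|z [|]]]] // _; exists x, y, z; split.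
- by rewrite -e enum_uniq.
- by apply/setP => t; rewrite -mem_enum e !inE orbA.
- have -> : polyA A = \prod_(a <- enum A) lin a by rewrite big_enum.
  by rewrite e !big_cons big_nil mulr1 mulrA.
Qed.

Lemma polyA_set3 x y z : uniq [:: x; y; z] ->
  polyA [set x; y; z] = lin x * lin y * lin z /\ #|[set x; y; z]| = 3%N.
Proof.
move=> u; have c3 : #|[set x; y; z]| = 3%N.
  rewrite -[RHS]/(size [:: x; y; z]) -(card_uniqP u).
  by apply: eq_card => t; rewrite !inE orbA.
split=> //; apply/eqP; rewrite -eqp_monic ?polyA_monic //; last by case: (lin3P x y z).
rewrite eqp_sym -dvdp_size_eqp; first by case: (lin3P x y z) => _ ->; rewrite polyA_size c3.
by rewrite dvd_lin3 // !polyA_root !inE !eqxx !orbT.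
Qed.

Lemma skNc y : (- c y \in sk) = (y \in sk).
Proof. by rewrite !skE rmorphN cK opprK eq_sym. Qed.

Lemma skNcE y : (- c y == y) = (y \in sk).
Proof. by rewrite skE eqr_oppLR. Qed.

Lemma cubTP Y t : regular_type Y -> Y <> tyT3 ->
  t \in cubT Y <-> mptype c Y (tcub t).
Proof.
move=> rY nT3; case: Y rY nT3 => // _ _; split.
- case/imsetP=> A; rewrite inE => /andP[/subsetP As /eqP /polyA3[x [y [z [u AE pE]]]]] ->.
  rewrite pE coef3K; try by case: (lin3P x y z).
  by exists x, y, z; split=> //; split; apply/gu1P/As; rewrite AE !inE eqxx ?orbT.
- case=> x [y [z [[/(gu1P c) xs /(gu1P c) ys /(gu1P c) zs] u pE]]].
  have [AE A3] := polyA_set3 u; apply/imsetP; exists [set x; y; z].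
    rewrite inE A3 eqxx andbT; apply/subsetP => w.
    by rewrite -polyA_root AE root_lin3 => /or3P[] /eqP ->.
  by rewrite AE -pE tcubK.
- case/imsetP=> -[x y]; rewrite in_setX in_setC /= => /andP[xs ys] ->.
  rewrite coef3K; try by case: (lin3P x y (- c y)).
  exists x, (- c y), y; split=> //; [exact/gu1P| |by ring].
  rewrite /= !inE negb_or andbT -andbA skNcE ys andbT; apply/andP; split.
    by apply: contraNneq ys => e; rewrite -skNc -e.
  by apply: contraNneq ys => <-.
- case=> x [y [z [/(gu1P c) xs u yE pE]]]; apply/imsetP; exists (x, z).
    rewrite in_setX in_setC xs /= -skNcE -yE.
    by move: u; rewrite /= !inE => /and3P[].
  by apply: (can_inj tcubK); rewrite coef3K; [rewrite pE yE /=; ring|case: (lin3P x z (- c z))..].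
- case/imsetP=> -[x y]; rewrite inE => /and3P[xs ys xy] ->.
  rewrite coef3K; try by case: (lin3P x y y).
  by exists x, y; split=> //; [exact/gu1P|exact/gu1P|ring].
- case=> x [y [/(gu1P c) xs /(gu1P c) ys xy pE]]; apply/imsetP; exists (x, y).
    by rewrite inE xs ys.
  by apply: (can_inj tcubK); rewrite coef3K; [rewrite pE /=; ring|case: (lin3P x y y)..].
- case/imsetP=> x xs ->; rewrite coef3K; try by case: (lin3P x x x).
  by exists x; [exact/gu1P|ring].
- case=> x /(gu1P c) xs pE; apply/imsetP; exists x => //.
  by apply: (can_inj tcubK); rewrite coef3K; [rewrite pE /=; ring|case: (lin3P x x x)..].
Qed.

Lemma cubT_SK3 Y : cubT Y \subset SK3.
Proof.
apply/subsetP => t; case: Y => /=; rewrite ?in_set0 //.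
- case/imsetP=> A; rewrite inE => /andP[/subsetP As /eqP /polyA3[x [y [z [u AE ->]]]]] ->.
  have h w : w \in [:: x; y; z] -> w \in sk by move=> hw; apply: As; rewrite AE !inE orbA in hw *.
  by apply: SK3_lin3; [|left; split]; apply: h; rewrite !inE eqxx ?orbT.
- case/imsetP=> -[x y]; rewrite in_setX in_setC /= => /andP[xs ys] ->.
  by rewrite (_ : _ * _ = lin x * lin (- c y) * lin y); [apply: SK3_lin3; auto|ring].
- by case/imsetP=> -[x y]; rewrite inE => /and3P[xs ys xy] ->; apply: SK3_lin3; auto.
- by case/imsetP=> x xs ->; apply: SK3_lin3; auto.
Qed.

Lemma card_cubT1 : (6 * #|cubT tyT1| = q * (q - 1) * (q - 2))%N.
Proof.
rewrite card_in_imset => [|A B]; last first.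
  rewrite !inE => /andP[_ /eqP A3] /andP[_ /eqP B3] /(congr1 tcub).
  by rewrite !coef3K ?polyA_monic ?polyA_size ?A3 ?B3 // => /polyA_inj.
rewrite cards_draws (card_sk Q) -[6%N]/(3`!) mulnC bin_ffact.
by rewrite !ffactnS ffactn0 muln1 -!subn1 -subnDA mulnA.
Qed.

(** The parametrisation is two to one: the conjugate roots [y] and [- c y] give the same cubic. *)
Lemma card_cubT2 : (2 * #|cubT tyT2| = q * (q * q - q))%N.
Proof.
have -> : (q * (q * q - q) = #|setX sk (~: sk)|)%N.
  by rewrite cardsX (card_sk Q) cardsCs setCK (card_sk Q) (qcF Q) expnS expn1.
rewrite mulnC; symmetry; apply: card_fibres => -[x y]; rewrite in_setX in_setC /= => /andP[xs ys].
have ny : - c y != y by rewrite skNcE.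
have xy : x != y by apply: contraNneq ys => <-.
have xcy : x != - c y by apply: contraNneq ys => e; rewrite -skNc -e.
transitivity #|[set (x, y); (x, - c y)]|; last first.
  by rewrite cards2 xpair_eqE eqxx /= eq_sym ny.
apply: eq_card => -[z w]; rewrite in_set2 inE in_setX in_setC /=.
apply/andP/orP => [[/andP[zs ws] /eqP /(congr1 tcub)]|].
  rewrite !coef3K; try by case: (lin3P z w (- c w)); try by case: (lin3P x y (- c y)).
  move=> e; have rt t : [|| t == z, t == w | t == - c w] = [|| t == x, t == y | t == - c y].
    by rewrite -!root_lin3 e.
  have zx : z = x.
    have := rt z; rewrite eqxx => /esym /or3P[] /eqP // zE.
      by case/negP: ys; rewrite -zE.
    by case/negP: ys; rewrite -skNc -zE.
  have := rt w; rewrite eqxx orbT => /esym /or3P[] /eqP wE.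
  - by case/negP: ws; rewrite wE.
  - by left; rewrite zx wE !eqxx.
  - by right; rewrite zx wE !eqxx.
case=> /eqP[-> ->]; first by rewrite xs ys.
rewrite xs skNc ys; split=> //; apply/eqP; congr coef3.
by have -> : - c (- c y) = y; [rewrite rmorphN cK opprK | ring].
Qed.

Lemma card_cubM : (#|cubT tyM| + q = q * q)%N.
Proof.
rewrite -(card_sk Q) -(card_offdiag sk); congr (_ + _)%N.
apply: card_in_imset => -[x y] [z w].
rewrite !in_set /= => /and3P[_ _ xy] /and3P[_ _ zw] /(congr1 tcub).
rewrite !coef3K; try by case: (lin3P x y y); try by case: (lin3P z w w).
move=> e; have rt t : (t == x) || (t == y) = (t == z) || (t == w).
  by have := root_lin3 x y y t; rewrite e root_lin3 !orbb => ->.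
have [xz|xz] := eqVneq x z.
  by have := rt y; rewrite eqxx orbT -xz eq_sym (negPf xy) /= => /esym /eqP ->.
have := rt x; rewrite eqxx (negPf xz) /= => /esym /eqP xw.
have := rt y; rewrite eqxx orbT -xw [y == x]eq_sym (negPf xy) orbF => /esym /eqP yz.
have : lin x * lin y * (lin y - lin x) = 0 by rewrite mulrBr e -yz -xw; ring.
move/eqP; rewrite !mulf_eq0 !polyXsubC_eq0 /= subr_eq0 => /eqP e'.
by case/eqP: xy; apply/eqP; rewrite -root_XsubC e' root_XsubC.
Qed.

Lemma card_cubN : #|cubT tyN| = q.
Proof.
rewrite -[RHS](card_sk Q); apply: card_in_imset => x y _ _ /(congr1 tcub).
rewrite !coef3K; try by case: (lin3P x x x); try by case: (lin3P y y y).
have := root_lin3 x x x x; rewrite eqxx => h e; move: h.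
by rewrite e root_lin3 !orbb => /eqP.
Qed.

Lemma SK3_realize t : t \in SK3 ->
  exists B, [/\ star B + B = 0, cyclic_mx B & mxminpoly B = tcub t].
Proof.
rewrite inE => /and3P[h1 h2 h3].
exact: (regular_realize Q S (wstar_conj Q) h1 h2 h3).
Qed.

(** A cubic is realised as the minimal polynomial of a skew matrix, so the uniqueness of the type of
    a matrix applies. *)
Lemma cubic_type_unique X X' t : t \in SK3 ->
  mptype c X (tcub t) -> mptype c X' (tcub t) -> X = X'.
Proof.
move=> /SK3_realize[B [sB cB mE]] h h'.
by apply: (type_unique Q sB sB) => //; rewrite /matrix_type mE.
Qed.

Definition cubS (Y : sh_type) : {set F * F * F} :=
  if Y is tyT3 then SK3 :\: (cubT tyT1 :|: cubT tyT2 :|: (cubT tyM :|: cubT tyN)) else cubT Y.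

Lemma cubSP Y t : regular_type Y ->
  t \in cubS Y <-> t \in SK3 /\ mptype c Y (tcub t).
Proof.
move=> rY; have sub := subsetP (cubT_SK3 Y).
have [->|nT3] : Y = tyT3 \/ Y <> tyT3 by case: (Y); auto; right.
  rewrite inE !in_setU !negb_or; split.
    case/andP=> /andP[/andP[n1 n2] /andP[n3 n4]] tS; split=> //.
    have [X rX mX] : exists2 X, regular_type X & mptype c X (tcub t).
      by move: tS; rewrite inE => /and3P[? ? ?]; apply: (skew_cubic_type Q).
    by case: X rX mX => // _ mX; [case/negP: n1|case/negP: n2|case/negP: n3|case/negP: n4]; apply/cubTP.
  case=> tS mt; rewrite tS andbT.
  have nt X : regular_type X -> X <> tyT3 -> t \notin cubT X.
    move=> rX nX; apply/negP => /(cubTP _ rX nX) h; apply: nX.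
    exact: (cubic_type_unique tS h mt).
  by rewrite !nt.
have -> : cubS Y = cubT Y by case: (Y) nT3.
rewrite cubTP //; split=> [h|[]//]; split=> //.
by apply: sub; apply/cubTP.
Qed.

Lemma cubT_disjoint X X' : regular_type X -> regular_type X' -> X <> tyT3 -> X' <> tyT3 -> X <> X' ->
  cubT X :&: cubT X' = set0.
Proof.
move=> rX rX' nX nX' nXX; apply/setP => t; rewrite in_set0 inE; apply/negP => /andP[h h'].
have tS : t \in SK3 by exact: (subsetP (cubT_SK3 X)).
by apply: nXX; apply: (cubic_type_unique tS); apply/cubTP.
Qed.

Lemma card_cubT3 :
  (#|cubS tyT3| + (#|cubT tyT1| + #|cubT tyT2| + (#|cubT tyM| + #|cubT tyN|)) = q ^ 3)%N.
Proof.
have dU (A B : {set F * F * F}) : A :&: B = set0 -> #|A :|: B| = (#|A| + #|B|)%N.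
  by move=> e; rewrite -cardsUI e cards0 addn0.
rewrite -(@dU (cubT tyT1)) ?cubT_disjoint // -(@dU (cubT tyM)) ?cubT_disjoint //.
rewrite -dU; last by rewrite setIUr !setIUl !cubT_disjoint // !setU0.
set U := _ :|: _; have US : U \subset SK3 by rewrite !subUset !cubT_SK3.
by rewrite -card_SK3 /cubS -/U cardsD (setIidPr US) subnK // subset_leq_card.
Qed.

Lemma card_cubS Y : regular_type Y ->
  (6 * #|cubS Y|)%:Z = (count6 tyG Y).[q%:Z].
Proof.
(* Writing [q = k + 3] removes the truncated subtractions. *)
have [k qE] : exists k, q = k.+3 by exists (q - 3)%N; have := q_gt2 Q; lia.
have := card_cubT1; have := card_cubT2; have := card_cubM; have := card_cubN.
have := card_cubT3; rewrite !expnS expn0 muln1.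
have e1 : (k.+3 - 1 = k.+2)%N by lia.
have e2 : (k.+3 - 2 = k.+1)%N by lia.
have e3 : (k.+3 * k.+3 - k.+3 = k.+3 * k.+2)%N.
  by rewrite -[X in (_ - X)%N]muln1 -mulnBr subn1.
rewrite qE e1 e2 e3 => h5 h4 h3 h2 h1 rY.
move: h1 h2 h3 h4 h5.
case: Y rY => // _;
  rewrite ?[cubS tyT1]/(cubT tyT1) ?[cubS tyT2]/(cubT tyT2) ?[cubS tyM]/(cubT tyM)
    ?[cubS tyN]/(cubT tyN);
  move: #|cubT tyT1| #|cubT tyT2| #|cubT tyM| #|cubT tyN| #|cubS tyT3| => n1 n2 n3 n4 n5 h1 h2 h3 h4 h5;
  rewrite /count6 !(hornerE, hornerXn) ?exprS ?expr0; lia.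
Qed.

End CountCubics.

(** * Lifting one level: the rows of the table of polynomials *)

From mathcomp Require Import boolp.

Section Row.
Variables (F : finFieldType) (c : {rmorphism F -> F}).
Local Notation M := 'M[F]_3.
Implicit Types (S : {set M}) (st : M -> M).

(* If S is the residual centraliser of A at levels l and l + 1, then that of
   A + p^l X at level l + 1 is stab S x with x = X mod p, and equiv describes
   conjugacy of two such lifts: see stab_lift and conj_lift. *)
Definition stab S (x : M) : {set M} := [set s in S | s * x - x * s \in perp S].
Definition equiv st S (x y : M) : Prop :=
  exists2 h, st h * h = 1 /\ h \in S & h * x - y * h \in perp S.
Definition typed st Y S : Prop := exists B, [/\ st B + B = 0, matrix_type c Y B & S = cent B].
Definition typed_set st S Y : {set M} :=
  [set x | `[< st x + x = 0 /\ typed st Y (stab S x) >]].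
(** The number of equivalence classes is expressed as the size of the image of a complete invariant
    with finitely many values, so no quotient is formed. *)
Definition counted st S Y (N : nat) : Prop := exists (T : finType) (I : M -> T),
  (forall x y, x \in typed_set st S Y -> y \in typed_set st S Y ->
     (equiv st S x y <-> I x = I y)) /\ #|I @: typed_set st S Y| = N.
(** One row of the table, for a residual centraliser [S] of type [X]. The first clause, that each
    lift has a type, is what keeps the induction on levels going. *)
Definition row (q : nat) st S X : Prop :=
  (forall x, st x + x = 0 -> exists Y, typed st Y (stab S x)) /\
  forall Y, exists2 N, counted st S Y N & (6 * N)%:Z = (count6 X Y).[q%:Z].

Lemma typed_setP st S Y x :
  reflect (st x + x = 0 /\ typed st Y (stab S x)) (x \in typed_set st S Y).
Proof. by rewrite inE; apply: asboolP. Qed.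

Lemma stabP S x s : reflect (s \in S /\ s * x - x * s \in perp S) (s \in stab S x).
Proof. exact: setIdP. Qed.

Section Transport.
Variables (P : M) (st : M -> M).
Hypothesis uP : P \is a GRing.unit.
Variables S S' : {set M}.
Hypothesis SS' : forall x, (P * x * P^-1 \in S) = (x \in S').

Lemma conj_perp x : (P * x * P^-1 \in perp S) = (x \in perp S').
Proof.
apply/perpP/perpP => h y yS.
  by rewrite -(conj_tr uP) (conjM uP) h // SS'.
by rewrite -(conjVK uP y) -(conjM uP) (conj_tr uP) h // -SS' (conjVK uP).
Qed.

Lemma conj_stab x y : (P * y * P^-1 \in stab S (P * x * P^-1)) = (y \in stab S' x).
Proof. by apply/stabP/stabP; rewrite SS' -!(conjM uP) -(conjB P) conj_perp. Qed.

Lemma typed_conj Y x : typed st Y (stab S (P * x * P^-1)) <->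
  typed (st_conj P st) Y (stab S' x).
Proof.
split=> -[B [sB mB SE]].
  exists (P^-1 * B * P); split.
  - by apply/(st_conj_skew _ uP); rewrite (conjVK uP).
  - by apply: (proj1 (mtype_conj c uP Y _)); rewrite (conjVK uP).
  - by apply/setP => y; rewrite -conj_stab SE -[RHS](cent_conj uP) (conjVK uP).
exists (P * B * P^-1); split.
- by apply/(st_conj_skew _ uP).
- exact: (proj2 (mtype_conj c uP Y B) mB).
- by apply/setP => y; rewrite -(conjVK uP y) (cent_conj uP) conj_stab SE.
Qed.

Lemma typed_set_conj Y x : (P * x * P^-1 \in typed_set st S Y) =
  (x \in typed_set (st_conj P st) S' Y).
Proof.
by apply/typed_setP/typed_setP => -[/(st_conj_skew _ uP) h /typed_conj].
Qed.

Lemma equiv_conj x y : equiv st S (P * x * P^-1) (P * y * P^-1) <->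
  equiv (st_conj P st) S' x y.
Proof.
split=> -[h [h1 hS] hp].
  exists (P^-1 * h * P).
    by split; [apply/(st_conj_uni _ uP); rewrite (conjVK uP) | rewrite -SS' (conjVK uP)].
  by rewrite -conj_perp (conjB P) (conjM uP _ x) (conjM uP y) (conjVK uP).
exists (P * h * P^-1); first by split; [apply/(st_conj_uni _ uP) | rewrite SS'].
by rewrite -!(conjM uP) -(conjB P) conj_perp.
Qed.

Lemma row_conj q X : row q (st_conj P st) S' X -> row q st S X.
Proof.
case=> ex cn; split=> [x sx|Y].
  have [|Y] := ex (P^-1 * x * P); first by apply/(st_conj_skew _ uP); rewrite (conjVK uP).
  by move/typed_conj; rewrite (conjVK uP) => h; exists Y.
have [N [T [I [hI cI]]] NE] := cn Y; exists N => //.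
exists T, (fun x => I (P^-1 * x * P)); split=> [x y|].
  rewrite -{1 2}[x](conjVK uP) -{1 2}[y](conjVK uP) !typed_set_conj => xD yD.
  by rewrite equiv_conj hI.
rewrite -cI; apply: eq_card => t; apply/imsetP/imsetP => -[x xD ->].
  by exists (P^-1 * x * P) => //; rewrite -typed_set_conj (conjVK uP).
by exists (P * x * P^-1); rewrite ?typed_set_conj // (conjK uP).
Qed.

End Transport.

Section Bimodule.
Variable B : M.
Let S := cent B.

Lemma perp_cent0 : 0 \in perp S.
Proof. by apply/perpP => x _; rewrite mulr0 mxtrace0. Qed.
Lemma perp_centB x y : x \in perp S -> y \in perp S -> x - y \in perp S.
Proof.
by move=> /perpP hx /perpP hy; apply/perpP => z zS; rewrite mulrBr trB hx ?hy ?subrr.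
Qed.
Lemma perp_centD x y : x \in perp S -> y \in perp S -> x + y \in perp S.
Proof.
by move=> /perpP hx /perpP hy; apply/perpP => z zS; rewrite mulrDr trD hx ?hy ?addr0.
Qed.
Lemma perp_centZ a x : x \in perp S -> a *: x \in perp S.
Proof. by move=> /perpP hx; apply/perpP => z zS; rewrite -scalerAr mxtraceZ hx ?mulr0. Qed.
Lemma perp_centMl s x : s \in S -> x \in perp S -> s * x \in perp S.
Proof.
by move=> sS /perpP hx; apply/perpP => z zS; rewrite mulrA hx // centM.
Qed.
Lemma perp_centMr s x : s \in S -> x \in perp S -> x * s \in perp S.
Proof.
move=> sS /perpP hx; apply/perpP => z zS.
by rewrite mulrA trM mulrA hx // centM.
Qed.

End Bimodule.
End Row.

Section StabSpecial.
Variable F : finFieldType.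
Local Notation M := 'M[F]_3.

(** By cyclicity of the trace, a commutator [s x - x s] is orthogonal to everything that commutes
    with [s]. *)
Lemma stab_cyclic_comm (B x : M) : cyclic_mx B -> stab (cent B) x = cent B.
Proof.
move=> cB; have comm := cyclic_cent_comm cB.
apply/setP => s; apply/stabP/idP => [[//]|sS]; split=> //; apply/perpP => y yS.
by rewrite mulrBr trB mulrA (comm y s) // [y * (x * s)]mulrA [\tr (y * x * s)]trM mulrA subrr.
Qed.

Lemma stab_setT (x : M) : stab [set: M] x = cent x.
Proof.
have p0 (y : M) : y \in perp [set: M] -> y = 0.
  by move/perpP => h; apply: tr_nondeg => z; apply: h; rewrite inE.
apply/setP => s; apply/stabP/centP => [[_ h]|e].
  by have /eqP := p0 _ h; rewrite subr_eq0 => /eqP.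
by split; rewrite ?in_setT // e subrr; apply/perpP => z _; rewrite mulr0 mxtrace0.
Qed.

End StabSpecial.

(** * Lifts of scalar matrices *)

Section RowScalar.
Variables (F : finFieldType) (c : {rmorphism F -> F}) (q : nat).
Hypothesis Q : qext c q.
Let cK := qcK Q.
Local Notation M := 'M[F]_3.
Local Notation sk := (sk c).
Local Notation kp := (kp c).
Local Notation star := (@conjmx F c 3).
Let S : star_axiom c star := conjmx_star cK.
Local Notation mtype := (matrix_type c).
Local Notation rk1 := (rank1 c).
Local Notation hnorm := (hnorm c).
Local Notation lin a := ('X - (a : F)%:P).

Lemma horner6Xn (n q0 : nat) : (6%:R *: 'X ^+ n : {poly int}).[q0%:Z] = (6 * q0 ^ n)%:Z.
Proof. by rewrite hornerZ hornerXn PoszM -!natz natrX. Qed.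

Lemma horner6X (q0 : nat) : (6%:R *: 'X : {poly int}).[q0%:Z] = (6 * q0)%:Z.
Proof. by rewrite hornerZ hornerX PoszM. Qed.

Lemma horner6XX (q0 : nat) : (6%:R *: ('X ^+ 2 - 'X) : {poly int}).[q0%:Z] = (6 * (q0 ^ 2 - q0))%:Z.
Proof.
rewrite hornerZ hornerD hornerN hornerXn hornerX PoszM -subzn; last by case: q0 => // k; rewrite expnS leq_pmulr // expn_gt0.
by rewrite -!natz natrX.
Qed.

(** The trace is added to the minimal polynomial because, in type L, the latter does not tell which
    eigenvalue is double. *)
Definition class_inv (x : M) : F * F * F * F := (coef3 (mxminpoly x), \tr x).

Lemma coef3_lin a : coef3 (lin a) = (0, 1, - a).
Proof. by rewrite /coef3 !coefB !coefX !coefC /= !subr0 sub0r. Qed.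

Lemma coef3_lin2 a b : coef3 (lin a * lin b) = (1, - (a + b), a * b).
Proof.
have -> : lin a * lin b = 'X^2 - (a + b) *: 'X + (a * b)%:P.
  by rewrite -mul_polyC polyCD polyCM; ring.
rewrite /coef3 !coefD !coefN !coefZ !coefXn !coefX !coefC /= !mulr0 !mulr1.
by rewrite !subr0 !addr0 !add0r.
Qed.

Lemma tr_scalar_rk1 a e v : \tr (a%:M + rk1 e v) = a *+ 3 + e * hnorm v.
Proof. by rewrite trD mxtrace_scalar /rank1 mxtraceZ hnorm_tr. Qed.

Lemma class_inv_conj (x y h : M) : h \is a GRing.unit -> h * x = y * h -> class_inv x = class_inv y.
Proof.
move=> uh e; have -> : y = h * x * h^-1 by rewrite e mulrK.
by rewrite /class_inv (mxminpoly_conj' uh) (conj_tr uh).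
Qed.

Lemma class_inv_rk1 a e v : e != 0 -> v != 0 ->
  class_inv (a%:M + rk1 e v) = (1, - (a + (a + e * hnorm v)), a * (a + e * hnorm v), a *+ 3 + e * hnorm v).
Proof. by move=> e0 v0; rewrite /class_inv mxminpoly_rk1 // coef3_lin2 tr_scalar_rk1. Qed.

Lemma class_inv_cyclic (x : M) t : cyclic_mx x -> mxminpoly x = tcub t ->
  class_inv x = (t, - t.1.1).
Proof.
move=> cx mE; rewrite /class_inv mE tcubK; congr pair.
have := char_poly_trace x isT; rewrite -(cyclic_minpoly cx) mE /=.
by have [_ _ -> _ _] := cubic_coef t.1.1 t.1.2 t.2 => ->; rewrite opprK.
Qed.

Lemma conj_of_class_inv Y (x y : M) : star x + x = 0 -> star y + y = 0 ->
  mtype Y x -> mtype Y y -> class_inv x = class_inv y ->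
  exists2 h, star h * h = 1 & h * x = y * h.
Proof.
move=> sx sy mx my.
case: (boolP (regular_type Y)) => rY.
  have cx := mtype_reg_inv Q sx mx rY; have cy := mtype_reg_inv Q sy my rY.
  move=> e; apply: (cyclic_uni_similar Q S sx sy cx cy).
  rewrite -(cyclic_minpoly cx) -(cyclic_minpoly cy).
  rewrite -(coef3K (mxminpoly_monic x) (reg_size mx rY)) -(coef3K (mxminpoly_monic y) (reg_size my rY)).
  exact: (congr1 (fun z : F * F * F * F => tcub z.1) e).
have [YG|Y3] : Y = tyG \/ type_deg Y = 3%N by case: (Y) rY; auto.
  rewrite YG in mx my.
  have [a _ ->] := mtypeG_inv Q sx mx; have [b _ ->] := mtypeG_inv Q sy my.
  rewrite /class_inv !mxminpoly_scalar !coef3_lin => -[/oppr_inj -> _].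
  by exists 1; rewrite ?(st1 S) ?mulr1 ?mul1r.
have [a [e [v [as_ es e0 v0 [xE _]]]]] := mtypeLJ_inv Q sx mx Y3.
have [b [f [w [bs fs f0 w0 [yE _]]]]] := mtypeLJ_inv Q sy my Y3.
rewrite xE yE !class_inv_rk1 // => -[/oppr_inj h1 _ h2].
(* The trace minus the sum of the two roots of the minimal polynomial is the double eigenvalue. *)
have ab : a = b.
  have e1 : a *+ 3 + e * hnorm v = a + (a + (a + e * hnorm v)) by ring.
  have e2 : b *+ 3 + f * hnorm w = b + (b + (b + f * hnorm w)) by ring.
  by move: h2; rewrite e1 e2 h1 => /addIr.
move: h1; rewrite ab => /addrI /addrI tr.
have [g gu gE] := rk1_similar Q es fs e0 f0 v0 w0 tr.
exists (star g); first by rewrite (stK S) (uni_r gu).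
rewrite -gE mulrDr mulrDl -!mulrA (uni_r gu) mulr1; congr (_ + _).
by rewrite -!mulmxE scalar_mxC.
Qed.

Lemma isotropic_exists : exists2 v : 'rV[F]_3, v != 0 & hnorm v = 0.
Proof.
have [l l1] : exists l, -1 = l * c l.
  by apply: (norm_kp Q); rewrite ?kpE ?rmorphN1 // oppr_eq0 oner_eq0.
exists (delta_mx 0 0 + l *: delta_mx 0 1).
  apply/eqP => /rowP/(_ 0); rewrite !mxE /= mulr0 addr0 => /eqP; exact/negP/oner_neq0.
rewrite hnormD hnormZ -l1 hformZl hformZr -!(hformE c) !hform_delta !mxE /= !rmorph0 !rmorph1 !mulr0.
by ring.
Qed.

Lemma hnorm_delta i : hnorm (delta_mx 0 i) = 1.
Proof. by rewrite -(hformE c) hform_delta !mxE !eqxx rmorph1. Qed.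

Lemma delta_neq0 i : delta_mx 0 i != 0 :> 'rV[F]_3.
Proof. by apply/eqP => /rowP/(_ i); rewrite !mxE !eqxx => /eqP; exact/negP/oner_neq0. Qed.

Lemma skew_rk1 a e v : a \in sk -> e \in sk -> star (a%:M + rk1 e v) + (a%:M + rk1 e v) = 0.
Proof.
rewrite !skE => /eqP as_ /eqP es.
rewrite (stD S) -scalemx1 (stZ S) (st1 S) addrACA -scalerDl /rank1 (stZ S) star_outer //.
by rewrite -scalerDl as_ es !addNr !scale0r addr0.
Qed.

Lemma skew_scalar a : a \in sk -> star (a%:M : M) + a%:M = 0.
Proof.
by rewrite skE => /eqP as_; rewrite -scalemx1 (stZ S) (st1 S) as_ -scalerDl addNr scale0r.
Qed.

Definition skew_of_type Y : {set M} := [set x | `[< star x + x = 0 /\ mtype Y x >]].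

Lemma skew_of_typeP Y x : reflect (star x + x = 0 /\ mtype Y x) (x \in skew_of_type Y).
Proof. by rewrite inE; apply: asboolP. Qed.

Lemma card_class_inv Y : (6 * #|class_inv @: skew_of_type Y|)%:Z = (count6 tyG Y).[q%:Z].
Proof.
case: (boolP (regular_type Y)) => rY.
  rewrite -(card_cubS Q rY); congr (Posz (6 * _)).
  rewrite -(card_imset _ (_ : injective (fun t : F * F * F => (t, - t.1.1)))); last by move=> t u [].
  apply: eq_card => z; apply/imsetP/imsetP => [[x /skew_of_typeP[sx mx] ->]|[t /(cubSP Q _ rY)[tS mt] ->]].
    have cx := mtype_reg_inv Q sx mx rY.
    have [a [b [d [as_ bk ds fE]]]] := cyclic_skew_cubic S sx cx.
    have mE : mxminpoly x = tcub (a, b, d) by rewrite cyclic_minpoly.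
    exists (a, b, d); last exact: class_inv_cyclic.
    by apply/(cubSP Q _ rY); rewrite -mE inE as_ bk ds.
  have [B [sB cB mE]] := SK3_realize Q tS.
  exists B; last by rewrite (class_inv_cyclic cB mE).
  by apply/skew_of_typeP; split=> //; rewrite /matrix_type mE.
have cc (n : nat) : (6 * n)%:Z = 6%:R * n%:Z by [].
case: Y rY => // _.
- have -> : class_inv @: skew_of_type tyG = (fun a => class_inv a%:M) @: sk.
    apply/setP => z; apply/imsetP/imsetP => [[x /skew_of_typeP[sx mx] ->]|[a as_ ->]].
      by have [a as_ ->] := mtypeG_inv Q sx mx; exists a.
    by exists a%:M => //; apply/skew_of_typeP; split; [exact: skew_scalar|exact: skew_mtype_scalar].
  have fI : injective (fun a => class_inv (a%:M : M)).
    by move=> a b; rewrite /class_inv !mxminpoly_scalar !coef3_lin => -[/oppr_inj].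
  have -> : #|(fun a => class_inv (a%:M : M)) @: sk| = #|sk| by exact: card_imset fI.
  by rewrite (card_sk Q) /count6 horner6X.
(* Pairs consisting of the double and the simple eigenvalue. *)
- pose W := [set a : F * F | [&& a.1 \in sk, a.2 \in sk & a.1 != a.2]].
  pose f (a : F * F) := (1, - (a.1 + a.2), a.1 * a.2, a.1 + (a.1 + a.2)) : F * F * F * F.
  have -> : class_inv @: skew_of_type tyL = f @: W.
    apply/setP => z; apply/imsetP/imsetP => [[x /skew_of_typeP[sx mx] ->]|[[a b]]].
      have [a [e [v [as_ es e0 v0 [xE LE]]]]] := mtypeLJ_inv Q sx mx erefl.
      have h0 : hnorm v != 0 by move: LE; case: eqVneq.
      exists (a, a + e * hnorm v); last by rewrite xE class_inv_rk1 // /f /=; congr pair; ring.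
      rewrite inE /= as_ skD ?sk_kpM ?kpE ?c_hnorm //=.
      by rewrite eq_sym -subr_eq0 addrC addKr mulf_neq0.
    rewrite inE /= => /and3P[as_ bs ab] ->.
    have e0 : b - a != 0 by rewrite subr_eq0 eq_sym.
    have es : b - a \in sk by rewrite skD ?skN.
    exists (a%:M + rk1 (b - a) (delta_mx 0 0)).
      apply/skew_of_typeP; split; first exact: skew_rk1.
      by have := skew_mtype_rk1 Q as_ es e0 (delta_neq0 0); rewrite hnorm_delta oner_eq0.
    rewrite class_inv_rk1 ?delta_neq0 // hnorm_delta mulr1 (addrC a (b - a)) subrK /f /=.
    by rewrite opprD; congr (_, _, _, _); ring.
  rewrite card_in_imset.
    have := card_offdiag sk; rewrite -/W (card_sk Q) => h.
    by rewrite /count6 horner6XX; congr (Posz (6 * _)); rewrite -mulnn -h addnK.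
  move=> [a b] [a' b'] _ _ /= [] /oppr_inj h1 _; rewrite h1 => /addIr e.
  by move: h1; rewrite e => /addrI ->.
- pose f a : F * F * F * F := (1, - (a + a), a * a, a *+ 3).
  have [v v0 hv] := isotropic_exists.
  have [d ds d0] := ex_delta Q.
  have -> : class_inv @: skew_of_type tyJ = f @: sk.
    apply/setP => z; apply/imsetP/imsetP => [[x /skew_of_typeP[sx mx] ->]|[a as_ ->]].
      have [a [e [w [as_ es e0 w0 [xE LE]]]]] := mtypeLJ_inv Q sx mx erefl.
      have h0 : hnorm w = 0 by move: LE; case: eqVneq.
      by exists a => //; rewrite xE class_inv_rk1 // h0 mulr0 !addr0.
    exists (a%:M + rk1 d v); last by rewrite class_inv_rk1 // hv mulr0 !addr0.
    apply/skew_of_typeP; split; first exact: skew_rk1.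
    by have := skew_mtype_rk1 Q as_ ds d0 v0; rewrite hv eqxx.
  have fI : injective f.
    move=> a b /(congr1 (fun z : F * F * F * F => z.1.1.2)).
    rewrite /f /= => /oppr_inj; rewrite -!mulr2n -(mulr_natr a) -(mulr_natr b).
    exact: (mulIf (q2 Q)).
  have cf : #|f @: sk| = #|sk|.
    exact: (card_imset (mem sk) fI).
  by rewrite cf (card_sk Q) /count6 horner6X.
Qed.

(** Here [S] is the full matrix algebra, with zero orthogonal: stabilisers are centralisers and
    equivalence is unitary conjugacy, so the row counts the unitary classes of skew matrices over
    [F]. *)
Lemma row_scalar B : star B + B = 0 -> mtype tyG B -> row c q star (cent B) tyG.
Proof.
move=> sB mB; have [b _ BE] := mtypeG_inv Q sB mB.
have SE : cent B = [set: M] by rewrite BE cent_scalar.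
rewrite SE.
have p0 (y : M) : y \in perp [set: M] -> y = 0.
  by move/perpP => h; apply: tr_nondeg => x; apply: h; rewrite inE.
have stE := @stab_setT F.
have DE Y : typed_set c star [set: M] Y = skew_of_type Y.
  apply/setP => x; apply/typed_setP/skew_of_typeP => -[sx].
    rewrite stE => -[C [sC mC CE]].
    have [X mX] := mtype_exists Q sx.
    by split; [exact: sx | rewrite -(type_unique Q sx sC mX mC CE)].
  by move=> mx; split; [exact: sx | rewrite stE; exists x].
split=> [x sx|Y].
  by have [X mX] := mtype_exists Q sx; exists X, x; rewrite stE.
exists #|class_inv @: skew_of_type Y|; last exact: card_class_inv.
exists (F * F * F * F)%type, class_inv; rewrite DE; split; last by [].
move=> x y.
move=> /skew_of_typeP[sx mx] /skew_of_typeP[sy my]; split.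
  case=> h [hu _] /p0 /eqP; rewrite subr_eq0 => /eqP e; exact: class_inv_conj (uni_unit hu) e.
move=> e; have [h hu hE] := conj_of_class_inv sx sy mx my e.
exists h; first by split; [exact: hu | exact: in_setT].
by rewrite hE subrr; apply/perpP => z _; rewrite mulr0 mxtrace0.
Qed.

End RowScalar.

(** * Lifts of cyclic matrices *)

Section RowRegular.
Variables (F : finFieldType) (c : {rmorphism F -> F}) (q : nat).
Hypothesis Q : qext c q.
Let cK := qcK Q.
Local Notation M := 'M[F]_3.
Local Notation star := (@conjmx F c 3).
Let S : star_axiom c star := conjmx_star cK.
Local Notation mtype := (matrix_type c).

Definition skew_part (W : {set M}) : {set M} := [set x in W | star x + x == 0].

(** For a nonzero skew scalar [d], the space [W] is the direct sum of its skew part and [d] times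
    it. *)
Lemma card_skew_part (W : {set M}) :
  {in W &, forall x y, x + y \in W} -> (forall a x, x \in W -> a *: x \in W) ->
  {in W, forall x, star x \in W} -> #|W| = (#|skew_part W| * #|skew_part W|)%N.
Proof.
move=> WD WZ Ws; have [d ds d0] := ex_delta Q.
have cd : c d = - d by apply/eqP; rewrite -skE.
have two := q2 Q; have u2 : 2%:R \is a @GRing.unit F by rewrite unitfE.
rewrite -cardsX; pose f (p : M * M) := p.1 + d *: p.2.
have sN x : star x + x = 0 -> star x = - x by move/eqP; rewrite addr_eq0 => /eqP.
have WB : {in W &, forall x y, x - y \in W} by move=> x y xW yW; rewrite -scaleN1r WD ?WZ.
rewrite -(card_in_imset (f := f)); last first.
  move=> [x y] [z t]; rewrite !inE /= => /andP[/andP[_ /eqP /sN sx] /andP[_ /eqP /sN sy]].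
  move=> /andP[/andP[_ /eqP /sN sz] /andP[_ /eqP /sN st]] e; have := congr1 star e.
  rewrite /f /= !(stD S) !(stZ S) cd sx sy sz st !scalerN !scaleNr !opprK => e'.
  have : (x + d *: y) - (- x + d *: y) = (z + d *: t) - (- z + d *: t) by rewrite e' (_ : x + d *: y = z + d *: t).
  rewrite (_ : x + _ - _ = 2%:R *: x); last by rewrite scaler_nat mulr2n; apply/matrixP => i j; rewrite !mxE; ring.
  rewrite (_ : z + _ - _ = 2%:R *: z); last by rewrite scaler_nat mulr2n; apply/matrixP => i j; rewrite !mxE; ring.
  move=> /(scalerI two) xz.
  by move: e; rewrite /f /= xz => /addrI /(scalerI d0) ->.
apply: eq_card => x; apply/idP/imsetP => [xW|[[y z]]]; last first.
  by rewrite !inE /= => /andP[/andP[yW _] /andP[zW _]] ->; rewrite WD ?WZ.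
exists ((2%:R^-1 : F) *: (x - star x), (2%:R * d)^-1 *: (x + star x)).
  rewrite !inE /= !WZ ?WB ?WD ?Ws //= (skew_half S) // eqxx /=.
  rewrite (stZ S) (stD S) (stK S) fmorphV rmorphM rmorph_nat cd mulrN invrN scaleNr.
  by rewrite [star x + x]addrC addNr.
rewrite /f /= scalerA (_ : d * _ = 2%:R^-1); last by field; rewrite two d0.
by rewrite -scalerDr addrACA addNr addr0 -mulr2n -scaler_nat scalerA mulVf // scale1r.
Qed.

Lemma card_cyclic_cent (B : M) : cyclic_mx B -> #|cent B| = (#|F| ^ 3)%N.
Proof.
move=> cB; have [t K] := cB.
pose f (p : F * F * F) : M := p.1.1%:A + p.1.2 *: B + p.2 *: B ^+ 2.
have fI : injective f.
  move=> [[a b] d] [[a' b'] d'] /eqP; rewrite -subr_eq0 /f /= => /eqP e.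
  have [] := @krylov_indep F t B (a - a') (b - b') (d - d') K.
    by rewrite -e !scalerBl; apply/matrixP => i j; rewrite !mxE; ring.
  by move=> /subr0_eq -> /subr0_eq -> /subr0_eq ->.
transitivity #|[set: F * F * F]|; last by rewrite cardsT !card_prod !expnS expn0 muln1 mulnA.
rewrite -(card_imset _ fI); apply: eq_card => x; apply/idP/imsetP.
  move=> /(cyclic_cent cB)[p sp ->]; exists (p`_0, p`_1, p`_2); first by rewrite inE.
  by rewrite horner_mx_sum3.
by case=> p _ ->; rewrite /f !centD ?centZ ?cent1 ?cent_self // expr2 centM ?cent_self.
Qed.

Lemma star_tr (x : M) : \tr (star x) = c (\tr x).
Proof. by rewrite /conjmx mxtrace_tr trace_map_mx. Qed.

Lemma perp_star B : star B + B = 0 -> {in perp (cent B), forall x, star x \in perp (cent B)}.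
Proof.
move=> sB x /perpP h; apply/perpP => y yS.
have -> : y * star x = star (x * star y) by rewrite (stM S) (stK S).
by rewrite star_tr trM h ?rmorph0 // (cent_st S sB).
Qed.

(** As [S] is commutative, stabilisers equal [S], and equivalence is congruence modulo the
    orthogonal of [S]. The skew parts have [q ^ 9] and [q ^ 6] elements, leaving [q ^ 3] classes,
    all of type [X]. *)
Lemma row_regular X B : regular_type X -> star B + B = 0 -> mtype X B ->
  row c q star (cent B) X.
Proof.
move=> rX sB mB; have cB := mtype_reg_inv Q sB mB rX.
have stE x : stab (cent B) x = cent B := stab_cyclic_comm x cB.
split=> [x sx|Y]; first by exists X, B; rewrite stE.
have DX x : (x \in typed_set c star (cent B) X) = (star x + x == 0).
  apply/typed_setP/eqP => [[]//|sx]; split=> //; rewrite stE; by exists B.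
have DY : Y <> X -> typed_set c star (cent B) Y = set0.
  move=> YX; apply/setP => x; rewrite in_set0; apply/typed_setP => -[sx].
  rewrite stE => -[C [sC mC CE]]; apply: YX; symmetry.
  exact: (type_unique Q sB sC mB mC CE).
have [YX|YX] := pselect (Y = X); last first.
  exists 0%N; last first.
    by case: (X) rX YX => // _; case: (Y) => //= _; rewrite horner0.
  by exists F, (fun=> 0); rewrite DY // imset0 cards0; split=> // x y; rewrite in_set0.
rewrite YX; exists (q ^ 3)%N; last first.
  by case: (X) rX => //= _; rewrite horner6Xn.
(* The traces against the basis [1, B, B ^+ 2] of [S]; their common kernel is the orthogonal of
   [S]. *)
pose I (x : M) : 'rV[F]_3 := \row_(i < 3) \tr (B ^+ i * x).
have IB : {morph I : x y / x - y} by move=> x y; apply/rowP => i; rewrite !mxE mulrBr trB.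
have I0 x : (I x == 0) = (x \in perp (cent B)).
  apply/eqP/perpP => [/rowP h y /(cyclic_cent cB)[p sp ->]|h].
    have := h 0; have := h (inord 1); have := h (inord 2).
    rewrite !mxE !inordK // expr0 expr1 mul1r => h2 h1 h0.
    by rewrite horner_mx_sum3 // !mulrDl !trD -!scalerAl !mxtraceZ mul1r h0 h1 h2 !mulr0 !addr0.
  apply/rowP => i; rewrite !mxE h //.
  by case: i => -[|[|[|]]] //= _; rewrite ?expr0 ?expr1 ?expr2 ?centM ?cent1 ?cent_self.
exists 'rV[F]_3, I; split=> [x y _ _|].
  split=> [[h [hu hS] hp]|e].
    have uh := uni_unit hu.
    apply/eqP; rewrite -subr_eq0 -IB I0.
    have -> : x - y = h^-1 * ((h * x - y * h) - (h * y - y * h)).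
      by rewrite opprB addrA subrK -mulrBr mulKr.
    apply: perp_centMl; first exact: centV.
    apply: perp_centB => //.
    by have : h \in stab (cent B) y by [rewrite stE]; case/stabP.
  exists 1; first by split; [rewrite (st1 S) mulr1 | exact: cent1].
  by rewrite mul1r mulr1 -I0 IB e subrr.
have q0 : (0 < q)%N by apply: ltnW (q_gt1 Q).
have kT : #|skew_part setT| = (q ^ 9)%N.
  have := @card_skew_part setT; rewrite cardsT card_mx (qcF Q) -expnM => h.
  have {h} : (q ^ (2 * (3 * 3)) = #|skew_part setT| ^ 2)%N.
    by rewrite -mulnn; apply: h => [x y _ _|a x _|x _]; exact: in_setT.
  by rewrite mulnC expnM => /eqP; rewrite eqn_exp2r // => /eqP ->.
have kP : #|skew_part (perp (cent B))| = (q ^ 6)%N.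
  have := card_perp (cent0 B) (@centB _ B) (@centZ _ B).
  rewrite (card_cyclic_cent cB) cardsT card_mx (qcF Q) -!expnM => h1.
  have {h1} h1 : #|perp (cent B)| = (q ^ 12)%N.
    apply/eqP; rewrite -(eqn_pmul2l (m := q ^ (2 * 3))) ?expn_gt0 ?q0 // h1 -expnD //.
  have := @card_skew_part (perp (cent B)); rewrite h1 => h.
  have {h} : (q ^ (6 * 2) = #|skew_part (perp (cent B))| ^ 2)%N.
    rewrite -mulnn; apply: h => [x y|a x|]; last exact: perp_star.
      exact: perp_centD.
    exact: perp_centZ.
  by rewrite expnM => /eqP; rewrite eqn_exp2r // => /eqP ->.
have DE : typed_set c star (cent B) X = skew_part setT.
  by apply/setP => x; rewrite DX !inE.
have := @card_additive _ _ (skew_part setT) I; rewrite DE.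
have -> : [set x in skew_part setT | I x == 0] = skew_part (perp (cent B)).
  by apply/setP => x; apply/setIdP/setIdP => [[/setIdP[_ h1]]|[h1 h2]]; [rewrite I0 | split; [apply/setIdP; split; rewrite ?in_setT | rewrite I0]].
rewrite kT kP -[9%N]/(3 + 6)%N expnD => h.
have : (q ^ 3 * q ^ 6 = #|I @: skew_part setT| * q ^ 6)%N.
  apply: h => [|x y|x y _ _]; last exact: IB.
    by apply/setIdP; rewrite in_setT (st0 S) addr0.
  rewrite !inE /= => /eqP hx /eqP hy.
  by rewrite (stB S) addrACA hx -opprD hy subr0.
by move/eqP; rewrite eqn_pmul2r ?expn_gt0 ?q0 // => /eqP ->.
Qed.

End RowRegular.

(** * Lifts of diagonalisable rank one matrices: a 1 by 1 and a 2 by 2 block *)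

Section RowL.
Variables (F : finFieldType) (c : {rmorphism F -> F}) (q : nat).
Hypothesis Q : qext c q.
Let cK := qcK Q.
Local Notation M := 'M[F]_3.
Local Notation sk := (sk c).
Local Notation kp := (kp c).
Local Notation star := (@conjmx F c 3).
Let S : star_axiom c star := conjmx_star cK.
Local Notation mtype := (matrix_type c).
Local Notation rk1 := (rank1 c).
Local Notation lin a := ('X - (a : F)%:P).
Local Notation B0 d := (0%:M + rk1 d (delta_mx 0 0)).

Lemma skew_entry (x : M) i j : star x + x = 0 -> c (x j i) = - x i j.
Proof. by move=> /matrixP/(_ i j); rewrite !mxE => /eqP; rewrite addr_eq0 => /eqP. Qed.

Lemma skew_entries (x : M) : (forall i j, c (x j i) = - x i j) -> star x + x = 0.
Proof. by move=> h; apply/matrixP => i j; rewrite !mxE h addNr. Qed.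

Lemma skew_diag (x : M) i : star x + x = 0 -> x i i \in sk.
Proof. by move=> sx; rewrite skE (skew_entry i i sx). Qed.

Lemma sk_avoid (s : seq F) : (size s <= 2)%N -> exists2 y, y \in sk & y \notin s.
Proof.
move=> s2; have [/subsetP h|/subsetPn[y ys yn]] := boolP (sk \subset s); last by exists y.
have : (#|sk| <= #|s|)%N by apply/subset_leq_card/subsetP.
by rewrite (card_sk Q) => h1; have := leq_trans (q_gt2 Q) (leq_trans h1 (leq_trans (card_size s) s2)).
Qed.

Lemma sk0 : 0 \in sk.
Proof. by rewrite skE rmorph0 oppr0. Qed.

Lemma mulrE3 (A B : M) i j : (A * B) i j = A i 0 * B 0 j + A i 1 * B 1 j + A i 2 * B 2 j.
Proof. exact: mulE3. Qed.

Lemma subrE3 (A B : M) i j : (A - B) i j = A i j - B i j.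
Proof. by rewrite !mxE. Qed.

Lemma B0E d : B0 d = mat9 d 0 0 0 0 0 0 0 0.
Proof.
apply/matrixP; elim/ord3P; elim/ord3P;
  by rewrite !mxE big_ord1 !mxE /= ?rmorph1 ?rmorph0 ?(mulr0, mulr1, mul0r, addr0, add0r).
Qed.

Section Fixed.
Variable d : F.
Hypotheses (ds : d \in sk) (d0 : d != 0).
Let C := cent (B0 d).

Lemma B0_skew : star (B0 d) + B0 d = 0.
Proof. by apply: (skew_rk1 Q) => //; exact: sk0. Qed.

Lemma B0_type : mtype tyL (B0 d).
Proof.
have := skew_mtype_rk1 Q sk0 ds d0 (delta_neq0 F 0).
by rewrite hnorm_delta oner_eq0.
Qed.

Lemma mem_blockP (s : M) : reflect [/\ s 0 1 = 0, s 0 2 = 0, s 1 0 = 0 & s 2 0 = 0] (s \in C).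
Proof.
rewrite /C B0E; apply: (iffP (centP _ _)) => [/matrixP e|[h1 h2 h3 h4]].
  have z x : x * d = 0 \/ d * x = 0 -> x = 0.
    by case=> /eqP; rewrite mulf_eq0 (negPf d0) ?orbF /= => /eqP.
  move: (e 0 1) (e 0 2) (e 1 0) (e 2 0); rewrite !mulrE3 !mxE /= !(mulr0, mul0r, addr0).
  by move=> e1 e2 e3 e4; split; apply: z; auto.
apply: mat9_eq; rewrite !mulrE3 !mxE /= ?h1 ?h2 ?h3 ?h4 !(mulr0, mul0r, addr0) //; exact: mulrC.
Qed.

Lemma perp_blockP (y : M) :
  reflect [/\ y 0 0 = 0, y 1 1 = 0, y 1 2 = 0, y 2 1 = 0 & y 2 2 = 0] (y \in perp C).
Proof.
apply: (iffP (perpP _ _)) => [h|[h1 h2 h3 h4 h5] x /mem_blockP[e1 e2 e3 e4]].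
  have h' a1 a2 a3 a4 a5 : a1 * y 0 0 + (a2 * y 1 1 + a3 * y 2 1) + (a4 * y 1 2 + a5 * y 2 2) = 0.
    have := h (mat9 a1 0 0 0 a2 a3 0 a4 a5); rewrite /mxtrace sum3 !mulrE3 !mxE /= !(mul0r, addr0, add0r).
    by apply; apply/mem_blockP; rewrite !mxE.
  have g a1 a2 a3 a4 a5 := h' a1 a2 a3 a4 a5.
  move: (g 1 0 0 0 0) (g 0 1 0 0 0) (g 0 0 1 0 0) (g 0 0 0 1 0) (g 0 0 0 0 1).
  by rewrite !(mul0r, mul1r, addr0, add0r).
by rewrite /mxtrace sum3 !mulrE3 e1 e2 e3 e4 h1 h2 h3 h4 h5 !(mul0r, mulr0, addr0).
Qed.

(* The entry a at (0, 0) is chosen off the spectrum of the lower block, so that the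
   centraliser of bl a x is already block diagonal. *)
Definition bl (a : F) (x : M) : M := mat9 a 0 0 0 (x 1 1) (x 1 2) 0 (x 2 1) (x 2 2).

(** Modulo the orthogonal of [C] only the diagonal blocks of [x] and [y] survive. The scalar blocks
    commute, so the condition concerns the lower blocks alone and [a] is arbitrary. *)
Lemma perp_bl (s x y : M) : s \in C -> x 0 0 = y 0 0 ->
  (s * x - y * s \in perp C) <-> forall a, s * bl a x = bl a y * s.
Proof.
move=> /mem_blockP[h1 h2 h3 h4] xy; split=> [/perp_blockP|/(_ 0)/matrixP e].
  rewrite !subrE3 !mulrE3 h1 h2 h3 h4.
  move=> [_ e1 e2 e3 e4] a; move: e1 e2 e3 e4; rewrite !(mul0r, mulr0, addr0, add0r).
  move=> /subr0_eq e1 /subr0_eq e2 /subr0_eq e3 /subr0_eq e4.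
  apply: mat9_eq; rewrite !mulrE3 !mxE /= ?h1 ?h2 ?h3 ?h4 !(mul0r, mulr0, addr0, add0r) //; exact: mulrC.
move: (e 1 1) (e 1 2) (e 2 1) (e 2 2); rewrite !mulrE3 !mxE /= h1 h2 h3 h4 !(mul0r, mulr0, addr0, add0r).
move=> e1 e2 e3 e4; apply/perp_blockP.
rewrite !subrE3 !mulrE3 h1 h2 h3 h4 !(mul0r, mulr0, addr0, add0r).
by rewrite e1 e2 e3 e4 xy mulrC !subrr.
Qed.

Lemma perp_bl00 (s x y : M) : s \in C -> s \is a GRing.unit -> s * x - y * s \in perp C -> x 0 0 = y 0 0.
Proof.
move=> /mem_blockP[h1 h2 h3 h4] us /perp_blockP[].
rewrite !subrE3 !mulrE3 h1 h2 h3 h4 !(mul0r, mulr0, addr0, add0r).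
move=> /subr0_eq e _ _ _ _.
have s0 : s 0 0 != 0.
  move: us; rewrite unitmxE unitfE det3 h1 h2 !mul0r subr0 addr0.
  by apply: contraNneq => ->; rewrite mul0r.
by apply: (mulfI s0); rewrite e mulrC.
Qed.

(** The characteristic polynomial of the lower block of [x], evaluated at [a]. *)
Definition chi (x : M) a := (a - x 1 1) * (a - x 2 2) - x 1 2 * x 2 1.

(** The off-diagonal blocks of [s] are killed by [a] minus a lower block; multiplying by the
    adjugate leaves [chi] times each entry. *)
Lemma bl_block (s : M) a (x y : M) : chi x a != 0 -> chi y a != 0 -> s * bl a x = bl a y * s -> s \in C.
Proof.
move=> cx cy /matrixP e; apply/mem_blockP.
move: (e 0 1) (e 0 2) (e 1 0) (e 2 0).
rewrite !mulrE3 !mxE /= !(mul0r, mulr0, addr0, add0r) => e1 e2 e3 e4.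
have E1 : a * s 0 1 - s 0 1 * x 1 1 - s 0 2 * x 2 1 = 0 by rewrite -e1; ring.
have E2 : a * s 0 2 - s 0 1 * x 1 2 - s 0 2 * x 2 2 = 0 by rewrite -e2; ring.
have E3 : s 1 0 * a - y 1 1 * s 1 0 - y 1 2 * s 2 0 = 0 by rewrite e3; ring.
have E4 : s 2 0 * a - y 2 1 * s 1 0 - y 2 2 * s 2 0 = 0 by rewrite e4; ring.
split.
- apply: (mulfI cx); rewrite mulr0.
  have -> : chi x a * s 0 1 = (a - x 2 2) * (a * s 0 1 - s 0 1 * x 1 1 - s 0 2 * x 2 1)
     + x 2 1 * (a * s 0 2 - s 0 1 * x 1 2 - s 0 2 * x 2 2) by rewrite /chi; ring.
  by rewrite E1 E2 !mulr0 addr0.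
- apply: (mulfI cx); rewrite mulr0.
  have -> : chi x a * s 0 2 = (a - x 1 1) * (a * s 0 2 - s 0 1 * x 1 2 - s 0 2 * x 2 2)
     + x 1 2 * (a * s 0 1 - s 0 1 * x 1 1 - s 0 2 * x 2 1) by rewrite /chi; ring.
  by rewrite E1 E2 !mulr0 addr0.
- apply: (mulfI cy); rewrite mulr0.
  have -> : chi y a * s 1 0 = (a - y 2 2) * (s 1 0 * a - y 1 1 * s 1 0 - y 1 2 * s 2 0)
     + y 1 2 * (s 2 0 * a - y 2 1 * s 1 0 - y 2 2 * s 2 0) by rewrite /chi; ring.
  by rewrite E3 E4 !mulr0 addr0.
- apply: (mulfI cy); rewrite mulr0.
  have -> : chi y a * s 2 0 = (a - y 1 1) * (s 2 0 * a - y 2 1 * s 1 0 - y 2 2 * s 2 0)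
     + y 2 1 * (s 1 0 * a - y 1 1 * s 1 0 - y 1 2 * s 2 0) by rewrite /chi; ring.
  by rewrite E3 E4 !mulr0 addr0.
Qed.

(** For skew [x] this says that the lower block is scalar, as [x 2 1] vanishes with [x 1 2]. *)
Definition lows (x : M) := (x 1 2 == 0) && (x 1 1 == x 2 2).

Lemma stab_lows (x : M) : star x + x = 0 -> lows x -> stab C x = C.
Proof.
move=> sx /andP[/eqP e1 /eqP e2].
have e3 : x 2 1 = 0.
  by apply: oppr_inj; rewrite -(skew_entry 2 1 sx) e1 rmorph0 oppr0.
apply/setP => s; apply/stabP/idP => [[]//|sC]; split=> //.
apply/(perp_bl sC) => // a; have [h1 h2 h3 h4] := elimT (mem_blockP s) sC.
apply: mat9_eq; rewrite !mulrE3 !mxE /= ?h1 ?h2 ?h3 ?h4 ?e1 ?e2 ?e3 !(mul0r, mulr0, addr0, add0r) //; exact: mulrC.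
Qed.

Lemma stab_bl (x : M) a : chi x a != 0 -> stab C x = cent (bl a x).
Proof.
move=> ca; apply/setP => s; apply/stabP/centP => [[sC h]|h].
  by move: h => /(perp_bl sC (erefl _)).
have sC := bl_block ca ca h; split=> //; apply/(perp_bl sC) => // b.
have [h1 h2 h3 h4] := elimT (mem_blockP s) sC; move: h => /matrixP e.
move: (e 1 1) (e 1 2) (e 2 1) (e 2 2); rewrite !mulrE3 !mxE /= h1 h2 h3 h4 !(mul0r, mulr0, addr0, add0r).
move=> e1 e2 e3 e4.
apply: mat9_eq; rewrite !mulrE3 !mxE /= ?h1 ?h2 ?h3 ?h4 !(mul0r, mulr0, addr0, add0r) //; exact: mulrC.
Qed.

Lemma bl_skew (x : M) a : star x + x = 0 -> a \in sk -> star (bl a x) + bl a x = 0.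
Proof.
rewrite skE => sx /eqP as_; apply: skew_entries.
by elim/ord3P; elim/ord3P; rewrite !mxE /= ?rmorph0 ?oppr0 // (skew_entry _ _ sx).
Qed.

Lemma bl_cyclic (x : M) a : star x + x = 0 -> chi x a != 0 -> ~~ lows x -> cyclic_mx (bl a x).
Proof.
move=> sx ca; rewrite negb_and => nl.
have [e1|e1] := eqVneq (x 1 2) 0.
  have e3 : x 2 1 = 0.
    by apply: oppr_inj; rewrite -(skew_entry 2 1 sx) e1 rmorph0 oppr0.
  move: nl; rewrite e1 eqxx /= => nl.
  (* The matrix is diagonal with distinct entries, so the all-one vector is cyclic. *)
  exists (const_mx 1); rewrite unitmxE unitfE.
  have -> : \det (krylov (const_mx 1) (bl a x)) = chi x a * (x 2 2 - x 1 1).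
    by rewrite det3 !mxE /= !sum3 !mxE /= !sum3 !mxE /= /chi e1 e3; ring.
  by rewrite mulf_neq0 // subr_eq0 eq_sym.
exists (\row_j (j != 2)%:R); rewrite unitmxE unitfE.
have -> : \det (krylov (\row_j (j != 2)%:R) (bl a x)) = chi x a * x 1 2.
  by rewrite det3 !mxE /= !sum3 !mxE /= !sum3 !mxE /= /chi; ring.
by rewrite mulf_neq0.
Qed.

Lemma bl_char (x : M) a al be : x 1 1 + x 2 2 = al + be -> x 1 1 * x 2 2 - x 1 2 * x 2 1 = al * be ->
  char_poly (bl a x) = lin a * lin al * lin be.
Proof.
move=> tE dE; rewrite /char_poly det3 !mxE /=.
have -> : lin a * lin al * lin be = lin a * ('X^2 - (al + be)%:P * 'X + (al * be)%:P).
  by rewrite polyCD polyCM; ring.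
rewrite -tE -dE polyCB polyCD !polyCM; ring.
Qed.

Lemma chi_roots (x : M) a al be : x 1 1 + x 2 2 = al + be -> x 1 1 * x 2 2 - x 1 2 * x 2 1 = al * be ->
  chi x a = (a - al) * (a - be).
Proof.
move=> tE dE.
have -> : (a - al) * (a - be) = a ^+ 2 - a * (al + be) + al * be by ring.
by rewrite -tE -dE /chi; ring.
Qed.

(** The possible root pairs of a skew quadratic: two skew roots, or two roots exchanged by
    [t -> - c t]. *)
Definition rpair al be := (al \in sk) && (be \in sk) || (be == - c al).

Lemma low_roots (x : M) : star x + x = 0 -> exists al be,
  [/\ rpair al be, x 1 1 + x 2 2 = al + be & x 1 1 * x 2 2 - x 1 2 * x 2 1 = al * be].
Proof.
move=> sx; have s1 := skew_diag 1 sx; have s2 := skew_diag 2 sx.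
have s3 := skew_entry 1 2 sx; have s4 := skew_entry 2 1 sx.
have us : - (x 1 1 + x 2 2) \in sk by rewrite skN ?skD.
have wk : x 1 1 * x 2 2 - x 1 2 * x 2 1 \in kp.
  rewrite kpE rmorphB !rmorphM s3 s4 (skew_entry 1 1 sx) (skew_entry 2 2 sx); apply/eqP; ring.
have [al [be e]] := skew_quad_split Q us wk; exists al, be.
have cf i := congr1 (fun p : {poly F} => p`_i) e.
have e' : ('X - al%:P) * ('X - be%:P) = 'X^2 - (al + be) *: 'X + (al * be)%:P.
  by rewrite -mul_polyC polyCD polyCM; ring.
move: (cf 0%N) (cf 1%N); rewrite e' !coefD !coefN !coefZ !coefXn !coefX !coefC /= !mulr0 !mulr1.
rewrite !addr0 !add0r oppr0 add0r => dE /oppr_inj tE; split=> //.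
have ev a : a ^+ 2 - (x 1 1 + x 2 2) * a + (x 1 1 * x 2 2 - x 1 2 * x 2 1) = (a - al) * (a - be).
  by rewrite tE dE; ring.
have : (- c al - al) * (- c al - be) = 0.
  rewrite -ev; have := congr1 c (ev al).
  move: wk; rewrite kpE => /eqP wk.
  rewrite subrr mul0r rmorph0 rmorphD rmorphB wk rmorphXn rmorphM rmorphD.
  by rewrite (skew_entry 1 1 sx) (skew_entry 2 2 sx) => <-; ring.
move/eqP; rewrite mulf_eq0 /rpair => /orP[h|h]; last by rewrite -(subr_eq0 be) -opprB oppr_eq0 h orbT.
have als : al \in sk by rewrite skE -eqr_oppLR -subr_eq0.
by rewrite als (_ : be = x 1 1 + x 2 2 - al) ?skD ?skN // tE addrC addKr.
Qed.

(** The type of a lift whose lower block is not scalar and has eigenvalues [al] and [be]. *)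
Definition tau (al be : F) := if al == be then tyM else if al \in sk then tyT1 else tyT2.

Lemma tau_type a al be : a \in sk -> rpair al be -> a != al -> a != be ->
  mptype c (tau al be) (lin a * lin al * lin be).
Proof.
move=> as_ r n1 n2; rewrite /tau; have [e|n3] := eqVneq al be.
  have als : al \in sk.
    by case/orP: r => [/andP[]//|]; rewrite -e skE -eqr_oppLR eq_sym.
  by exists a, al; split; rewrite ?expr2 ?mulrA -?e //; apply/(gu1P c).
case: ifP => als.
  have bes : be \in sk by case/orP: r => [/andP[]//|/eqP ->]; rewrite (skNc Q).
  by exists a, al, be; split; [split; apply/(gu1P c)|rewrite /= !inE negb_or n1 n2 n3|].
exists a, al, be; split=> //; first exact/(gu1P c).
  by rewrite /= !inE negb_or n1 n2 n3.
by move: r; rewrite /rpair als /= => /eqP ->; rewrite rmorphN cK opprK.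
Qed.

Lemma rowL_type (x : M) al be : star x + x = 0 -> rpair al be ->
  x 1 1 + x 2 2 = al + be -> x 1 1 * x 2 2 - x 1 2 * x 2 1 = al * be ->
  typed c star (if lows x then tyL else tau al be) (stab C x).
Proof.
move=> sx r tE dE; case: ifP => lx.
  by exists (B0 d); rewrite stab_lows //; split; [exact: B0_skew | exact: B0_type|].
(* There are [q > 2] skew scalars, so one of them avoids both eigenvalues. *)
have [a as_] := @sk_avoid [:: al; be] isT; rewrite !inE negb_or => /andP[n1 n2].
have ca : chi x a != 0 by rewrite (chi_roots a tE dE) mulf_neq0 // subr_eq0.
exists (bl a x); split; [exact: bl_skew| |exact: stab_bl].
rewrite /matrix_type cyclic_minpoly; last by apply: bl_cyclic => //; rewrite lx.
by rewrite (bl_char a tE dE); apply: tau_type.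
Qed.

Definition linv (x : M) : F * F * F := (x 0 0, x 1 1 + x 2 2, x 1 1 * x 2 2 - x 1 2 * x 2 1).

Lemma bl_shift (h : M) a a' x y : h \in C -> h * bl a x = bl a y * h -> h * bl a' x = bl a' y * h.
Proof.
move=> hC e; have [h1 h2 h3 h4] := elimT (mem_blockP h) hC; move: e => /matrixP e.
move: (e 1 1) (e 1 2) (e 2 1) (e 2 2); rewrite !mulrE3 !mxE /= h1 h2 h3 h4 !(mul0r, mulr0, addr0, add0r).
move=> e1 e2 e3 e4.
apply: mat9_eq; rewrite !mulrE3 !mxE /= ?h1 ?h2 ?h3 ?h4 !(mul0r, mulr0, addr0, add0r) //; exact: mulrC.
Qed.

Lemma linv_equiv (x y : M) : equiv star C x y -> linv x = linv y.
Proof.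
case=> h [hu hC] hp; have uh := uni_unit hu.
have x00 := perp_bl00 hC uh hp; move/(perp_bl hC x00): hp => e.
have yE a : bl a y = h * bl a x * h^-1 by rewrite e mulrK.
(* The trace of [bl 0 x] and the determinant of [bl 1 x] are those of the lower block. *)
have tE := conj_tr uh (bl 0 x); have := congr1 (fun z : M => \det z) (e 1).
rewrite -!mulmxE !det_mulmx mulrC => /(mulIf _) dE.
have {}dE : \det (bl 1 x) = \det (bl 1 y) by apply: dE; rewrite -unitfE -unitmxE.
move: tE; rewrite -yE /mxtrace !sum3 !mxE /= !add0r => tE.
move: dE; rewrite !det3 !mxE /= !mul0r !mul1r subr0 addr0 => dE.
by move: dE; rewrite subr0 addr0 /linv x00 tE => ->.
Qed.

(** Equal types exclude mixing scalar with non-scalar lower blocks. In the non-scalar case the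
    matrices [bl a x] and [bl a y] are cyclic with equal characteristic polynomials, and a unitary
    conjugator lies in [C] by [bl_block]. *)
Lemma equiv_linv Y (x y : M) : x \in typed_set c star C Y -> y \in typed_set c star C Y ->
  linv x = linv y -> equiv star C x y.
Proof.
move=> /typed_setP[sx [Bx [sBx mBx xE]]] /typed_setP[sy [By [sBy mBy yE]]] [x00 tE dE].
have [al [be [r tx dx]]] := low_roots sx.
have ty : y 1 1 + y 2 2 = al + be by rewrite -tE.
have dy : y 1 1 * y 2 2 - y 1 2 * y 2 1 = al * be by rewrite -dE.
have [B1 [sB1 mB1 B1E]] := rowL_type sx r tx dx.
have [B2 [sB2 mB2 B2E]] := rowL_type sy r ty dy.
have YX : Y = if lows x then tyL else tau al be.
  by apply: (type_unique Q sBx sB1 mBx mB1); rewrite -xE B1E.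
have YY : Y = if lows y then tyL else tau al be.
  by apply: (type_unique Q sBy sB2 mBy mB2); rewrite -yE B2E.
have ll : lows x = lows y.
  have tL : tau al be <> tyL by rewrite /tau; case: ifP => // _; case: ifP.
  by move: YX YY; case: (lows x); case: (lows y) => // -> // e; case: tL.
have [lx|lx] := boolP (lows x).
  have C1 : 1 \in C by apply: cent1.
  exists 1; first by rewrite (st1 S) mulr1.
  apply/(perp_bl C1 x00) => a; rewrite mul1r mulr1.
  have ly : lows y by rewrite -ll.
  move: lx ly => /andP[/eqP x1 /eqP x2] /andP[/eqP y1 /eqP y2].
  have x3 : x 2 1 = 0 by apply: oppr_inj; rewrite -(skew_entry 2 1 sx) x1 rmorph0 oppr0.
  have y3 : y 2 1 = 0 by apply: oppr_inj; rewrite -(skew_entry 2 1 sy) y1 rmorph0 oppr0.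
  have xy : x 2 2 = y 2 2.
    apply: (mulfI (q2 Q)); rewrite !mulr_natl !mulr2n -{1}x2 -{1}y2; exact: tE.
  by rewrite /bl x1 x2 x3 y1 y2 y3 xy.
have [a as_] := @sk_avoid [:: al; be] isT; rewrite !inE negb_or => /andP[n1 n2].
have cx : chi x a != 0 by rewrite (chi_roots a tx dx) mulf_neq0 // subr_eq0.
have cy : chi y a != 0 by rewrite (chi_roots a ty dy) mulf_neq0 // subr_eq0.
have kx := bl_cyclic sx cx lx.
have ky : cyclic_mx (bl a y) by apply: bl_cyclic => //; rewrite -ll.
have fE : char_poly (bl a x) = char_poly (bl a y) by rewrite (bl_char a tx dx) (bl_char a ty dy).
have [h hu hE] := cyclic_uni_similar Q S (bl_skew sx as_) (bl_skew sy as_) kx ky fE.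
have hC := bl_block cx cy hE.
exists h; first by split.
apply/(perp_bl hC x00) => a'; exact: (bl_shift a' hC hE).
Qed.

(** The first coordinate is the (0, 0) entry, the other two are the ordered eigenvalues of the lower
    block. L and M share the double eigenvalue and differ by the lower block being scalar or not;
    [lsym] forgets the order. *)
Definition lpairs Y : {set F * F * F} :=
  match Y with
  | tyL | tyM => [set w | [&& w.1.1 \in sk, w.1.2 \in sk & w.2 == w.1.2]]
  | tyT1 => [set w | [&& w.1.1 \in sk, w.1.2 \in sk, w.2 \in sk & w.1.2 != w.2]]
  | tyT2 => [set w | [&& w.1.1 \in sk, w.1.2 \notin sk & w.2 == - c w.1.2]]
  | _ => set0
  end.
Definition lsym (w : F * F * F) := (w.1.1, w.1.2 + w.2, w.1.2 * w.2).

Lemma rpair_diag al : rpair al al -> al \in sk.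
Proof. by case/orP => [/andP[]//|]; rewrite skE -eqr_oppLR eq_sym. Qed.

Lemma lpairs_tau a al be : a \in sk -> rpair al be -> (a, al, be) \in lpairs (tau al be).
Proof.
move=> as_ r; rewrite /tau; have [e|n] := eqVneq al be.
  by rewrite inE /= as_ e eqxx andbT; apply: rpair_diag; rewrite -{1}e.
case: ifP => als; rewrite inE /= as_ als /=; last by move: r; rewrite /rpair als.
by rewrite n andbT; case/orP: r => [/andP[]//|/eqP ->]; rewrite (skNc Q).
Qed.

Lemma lpairs_inv Y w : w \in lpairs Y ->
  [/\ w.1.1 \in sk, rpair w.1.2 w.2 & Y = tau w.1.2 w.2 \/ Y = tyL /\ w.2 = w.1.2].
Proof.
case: w => [[a al] be] /=; case: Y; rewrite /= ?in_set0 // inE /= => /and3P[-> als].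
- by move=> /eqP ->; rewrite /rpair als; split; auto.
- by case/andP=> bes n; rewrite /rpair als bes /tau (negPf n) als; split; auto.
- move=> /eqP ->; rewrite /rpair eqxx orbT /tau (negPf als).
  have -> : (al == - c al) = false by apply/negbTE; move: als; rewrite skE -eqr_oppLR eq_sym.
  by split; auto.
- by move=> /eqP ->; rewrite /rpair als /tau eqxx; split; auto.
Qed.

Lemma rpair_sk al be : rpair al be -> al + be \in sk.
Proof.
case/orP => [/andP[h1 h2]|/eqP ->]; first exact: skD.
by rewrite skE rmorphD rmorphN cK opprD opprK addrC.
Qed.

Lemma rpair_kp a al be : a \in sk -> rpair al be -> (a - al) * (a - be) \in kp.
Proof.
move=> as_; case/orP => [/andP[h1 h2]|/eqP ->]; first by apply: sk_skM; rewrite skD ?skN.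
move: as_; rewrite kpE skE => /eqP as_; rewrite rmorphM !rmorphB rmorphN cK as_.
by apply/eqP; ring.
Qed.

Lemma linv_image Y : linv @: typed_set c star C Y = lsym @: lpairs Y.
Proof.
apply/setP => t; apply/imsetP/imsetP => [[x /typed_setP[sx [B [sB mB xE]]] ->]|[w wY ->]].
  have [al [be [r tx dx]]] := low_roots sx.
  have [B1 [sB1 mB1 B1E]] := rowL_type sx r tx dx.
  have -> : Y = if lows x then tyL else tau al be.
    by apply: (type_unique Q sB sB1 mB mB1); rewrite -xE B1E.
  exists (x 0 0, al, be); last by rewrite /linv tx dx.
  have as_ := skew_diag 0 sx.
  case: ifP => [/andP[/eqP x1 /eqP x2]|_]; last exact: lpairs_tau.
  have ab : al = be.
    have e : (al - be) ^+ 2 = 0.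
      have -> : (al - be) ^+ 2 = (al + be) ^+ 2 - 4%:R * (al * be) by ring.
      by rewrite -tx -dx x1 x2; ring.
    by apply/eqP; rewrite -subr_eq0 -sqrf_eq0 e.
  by rewrite inE /= as_ -ab eqxx andbT; apply: rpair_diag; rewrite {2}ab.
have [as_ r YE] := lpairs_inv wY; case: w as_ r YE {wY} => [[a al] be] /= as_ r YE.
have ts := rpair_sk r.
have [[LY ba]|NL] : (Y = tyL /\ be = al) \/ Y = tau al be by case: YE; auto.
  have als : al \in sk by apply: rpair_diag; rewrite -{2}ba.
  pose x := mat9 a 0 0 0 al 0 0 0 al.
  have sx : star x + x = 0.
    move: as_ als; rewrite !skE => /eqP as_ /eqP als; apply: skew_entries.
    by elim/ord3P; elim/ord3P; rewrite !mxE /= ?rmorph0 ?oppr0.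
  exists x; last by rewrite /linv /lsym ba !mxE /= mul0r subr0.
  apply/typed_setP; split; first exact: sx.
  exists (B0 d); rewrite LY; split; [exact: B0_skew|exact: B0_type|apply: stab_lows => //].
  by rewrite /lows !mxE /= !eqxx.
(* With [p] off both roots, [(p - al) * (p - be)] is a nonzero norm [l * c l]; the block with
   diagonal [p, al + be - p] and off-diagonal [l, - c l] is skew, non-scalar, of determinant
   [al * be]. *)
have [p ps] := @sk_avoid [:: al; be] isT; rewrite !inE negb_or => /andP[n1 n2].
have n0 : (p - al) * (p - be) != 0 by rewrite mulf_neq0 // subr_eq0.
have [l lE] := norm_kp Q (rpair_kp ps r) n0.
have l0 : l != 0 by apply: contraNneq n0 => l0; rewrite lE l0 mul0r.
pose x := mat9 a 0 0 0 p l 0 (- c l) (al + be - p).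
have sx : star x + x = 0.
  have : al + be - p \in sk by rewrite skD ?skN.
  move: as_ ps; rewrite !skE => /eqP as_ /eqP ps h; apply: skew_entries.
  by elim/ord3P; elim/ord3P; rewrite !mxE /= ?rmorph0 ?oppr0 ?rmorphN ?cK ?opprK //; apply/eqP/h.
have tx : x 1 1 + x 2 2 = al + be by rewrite !mxE /= addrC subrK.
have dx : x 1 1 * x 2 2 - x 1 2 * x 2 1 = al * be.
  by rewrite !mxE /= mulrN opprK -lE; ring.
exists x; last by rewrite /linv tx dx !mxE.
apply/typed_setP; split; first exact: sx.
have := rowL_type sx r tx dx.
have -> : lows x = false by rewrite /lows !mxE /= (negPf l0).
by rewrite NL.
Qed.

Lemma lsym_eq (w v : F * F * F) : (lsym w == lsym v) = (w == v) || (w == (v.1.1, v.2, v.1.2)).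
Proof.
case: w v => [[a al] be] [[a' al'] be']; rewrite /lsym /=.
apply/eqP/orP => [[-> e1 e2]|[/eqP[-> -> ->]|/eqP[-> -> ->]]] //; last first.
  by rewrite addrC mulrC.
have : (al - al') * (al - be') = 0.
  have -> : (al - al') * (al - be') = al * al - al * (al' + be') + al' * be' by ring.
  by rewrite -e1 -e2; ring.
move/eqP; rewrite mulf_eq0 !subr_eq0 => /orP[] /eqP h; [left|right]; rewrite h in e1 *.
  by move: e1 => /addrI ->.
by move: e1; rewrite addrC => /addIr ->.
Qed.

Lemma lpairs_swap Y w : w \in lpairs Y -> (w.1.1, w.2, w.1.2) \in lpairs Y.
Proof.
case: w => [[a al] be]; case: Y; rewrite /= ?in_set0 // inE /= => /and3P[as_ als h]; rewrite inE /= as_; move: h.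
- by move=> /eqP ->; rewrite als eqxx.
- by rewrite als => /andP[-> n]; rewrite eq_sym n.
- by move=> /eqP ->; rewrite (skNc Q) als rmorphN cK opprK eqxx.
- by move=> /eqP ->; rewrite als eqxx.
Qed.

Lemma card_lsym Y : (6 * #|lsym @: lpairs Y|)%:Z = (count6 tyL Y).[q%:Z].
Proof.
have fib (n : nat) : (forall w, w \in lpairs Y -> #|[set w; (w.1.1, w.2, w.1.2)]| = n) ->
    #|lpairs Y| = (#|lsym @: lpairs Y| * n)%N.
  move=> h; apply: card_fibres => w wY; rewrite -(h w wY); apply: eq_card => v.
  rewrite !inE lsym_eq; apply: andb_idl => /orP[] /eqP -> //; exact: lpairs_swap.
have cc : (3%:R *: ('X ^+ 3 - 'X ^+ 2) : {poly int}).[q%:Z] = (3 * (q * (q * q - q)))%:Z.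
  have h1 := q_gt1 Q.
  rewrite hornerZ hornerD hornerN !hornerXn PoszM PoszM -subzn; last by rewrite leq_pmulr // ltnW.
  by rewrite PoszM; ring.
have diag : #|[set w : F * F * F | [&& w.1.1 \in sk, w.1.2 \in sk & w.2 == w.1.2]]| = (q * q)%N.
  rewrite -{1}(card_sk Q) -(card_sk Q) -cardsX.
  rewrite -(card_imset _ (_ : injective (fun p : F * F => (p.1, p.2, p.2)))); last by move=> [a b] [a' b'] [-> ->].
  apply: eq_card => -[[a al] be]; rewrite inE /=; apply/and3P/imsetP => [[h1 h2 /eqP ->]|[[p r]]].
    by exists (a, al) => //; rewrite inE /= h1 h2.
  by rewrite inE /= => /andP[h1 h2] [-> -> ->]; rewrite h1 h2 eqxx.
have two (w : F * F * F) : w.1.2 != w.2 -> #|[set w; (w.1.1, w.2, w.1.2)]| = 2%N.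
  case: w => [[a al] be] /= n; rewrite cards2; case: eqP => // -[e _].
  by rewrite e eqxx in n.
case: Y fib => //=; rewrite ?horner0 ?imset0 ?cards0 // => fib.
- have := fib 1%N; rewrite diag muln1 => <-; last first.
    move=> [[a al] be]; rewrite inE /= => /and3P[_ _ /eqP ->].
    by rewrite setUid cards1.
  by rewrite horner6Xn -mulnn.
- have := fib 2%N; rewrite cc => h; congr Posz.
  have {h} := h (fun w => _); rewrite -[LHS]/(_) => h.
  have {}h : #|lpairs tyT1| = (#|lsym @: lpairs tyT1| * 2)%N.
    by apply: h => w; rewrite inE => /and4P[_ _ _]; exact: two.
  have : #|lpairs tyT1| = (q * (q * q - q))%N.
    have o := card_offdiag sk; rewrite (card_sk Q) in o.
    rewrite -o addnK -{1}(card_sk Q) -cardsX.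
    rewrite -(card_imset _ (_ : injective (fun p : F * (F * F) => (p.1, p.2.1, p.2.2)))); last by move=> [a [b e]] [a' [b' e']] [-> -> ->].
    apply: eq_card => -[[a al] be]; rewrite inE /=; apply/and4P/imsetP => [[h1 h2 h3 h4]|[[p [r s]]]].
      by exists (a, (al, be)) => //; apply/setXP; split; rewrite // inE /= h2 h3.
    by move=> /setXP[h1]; rewrite inE /= => /and3P[h2 h3 h4] [-> -> ->].
  by rewrite h => <-; rewrite [(_ * 2)%N]mulnC mulnA.
- have h : #|lpairs tyT2| = (#|lsym @: lpairs tyT2| * 2)%N.
    apply: fib => -[[a al] be]; rewrite inE /= => /and3P[_ als /eqP ->]; apply: two => /=.
    by move: als; rewrite skE -eqr_oppLR eq_sym.
  rewrite cc; congr Posz.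
  have : #|lpairs tyT2| = (q * (q * q - q))%N.
    have o : (#|~: sk| = q * q - q)%N.
      by have := cardsC sk; rewrite (card_sk Q) (qcF Q) => /(congr1 (subn^~ q)); rewrite addKn -mulnn.
    rewrite -o -{1}(card_sk Q) -cardsX.
    rewrite -(card_imset _ (_ : injective (fun p : F * F => (p.1, p.2, - c p.2)))); last by move=> [a b] [a' b'] [-> ->].
    apply: eq_card => -[[a al] be]; rewrite inE /=; apply/and3P/imsetP => [[h1 h2 /eqP ->]|[[p r]]].
      by exists (a, al) => //; apply/setXP; split; rewrite // in_setC.
    by move=> /setXP[h1]; rewrite in_setC => h2 [-> -> ->].
  by rewrite h => <-; rewrite [(_ * 2)%N]mulnC mulnA.
- have := fib 1%N; rewrite diag muln1 => <-; last first.
    move=> [[a al] be]; rewrite inE /= => /and3P[_ _ /eqP ->].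
    by rewrite setUid cards1.
  by rewrite horner6Xn -mulnn.
Qed.

Lemma row_block : row c q star C tyL.
Proof.
split=> [x sx|Y].
  have [al [be [r tx dx]]] := low_roots sx.
  by exists (if lows x then tyL else tau al be); exact: rowL_type.
exists #|linv @: typed_set c star C Y|; last by rewrite linv_image card_lsym.
exists (F * F * F)%type, linv; split; last by [].
by move=> x y xY yY; split; [exact: linv_equiv | exact: (equiv_linv xY yY)].
Qed.

End Fixed.

Lemma st_conj_uni_id (g : M) : star g * g = 1 -> st_conj g star = star.
Proof.
move=> gu; apply: boolp.funext => x; have ug := uni_unit gu.
have hV : g^-1 = star g by apply: uni_inv.
rewrite /st_conj hV !(stM S) (stK S) !mulrA gu mul1r -!mulrA gu mulr1 //.
Qed.

Lemma row_similar X (B B' : M) : cent_similar c B B' -> row c q star (cent B) X ->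
  row c q star (cent B') X.
Proof.
move=> [B'' [g [_ CE gu gE]]]; have ug := uni_unit gu => h.
apply: (row_conj ug (S' := cent B)); last by rewrite st_conj_uni_id.
move=> x; rewrite -CE -[RHS](cent_conj ug); congr (_ \in cent _).
by rewrite gE mulrK.
Qed.

Lemma row_L B : star B + B = 0 -> mtype tyL B -> row c q star (cent B) tyL.
Proof.
move=> sB mB; have [d ds d0] := ex_delta Q.
apply: (row_similar (B := B0 d)); last exact: row_block.
exact: (mtype_cent_similar Q (B0_skew ds) sB (B0_type ds d0) mB).
Qed.

End RowL.

(** * Lifts of nilpotent rank one matrices *)

Section RowJ.
Variables (F : finFieldType) (c : {rmorphism F -> F}) (q : nat).
Hypothesis Q : qext c q.
Let cK := qcK Q.
Local Notation M := 'M[F]_3.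
Local Notation sk := (sk c).
Local Notation kp := (kp c).
Local Notation star := (@conjmx F c 3).
Local Notation st := (@wstar F c).
Let T : star_axiom c st := wstar_star Q.
Local Notation mtype := (matrix_type c).
Local Notation lin a := ('X - (a : F)%:P).

Lemma wskew_entries (x : M) : st x + x = 0 ->
  [/\ c (x 2 2) = - x 0 0, c (x 1 2) = - x 0 1, c (x 0 2) = - x 0 2 & c (x 2 1) = - x 1 0] /\
  [/\ c (x 1 1) = - x 1 1, c (x 1 0) = - x 2 1 & c (x 2 0) = - x 2 0].
Proof.
move=> /matrixP e; move: (e 0 0) (e 0 1) (e 0 2) (e 1 0) (e 1 1) (e 2 1) (e 2 0); rewrite !mxE /=.
by do 7![move=> /eqP; rewrite addr_eq0 => /eqP ?].
Qed.

Lemma wskew_mat9 a b e f g h p : c a = - h -> c h = - a -> c b = - g -> c g = - b -> c e = - e ->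
  c f = - f -> c p = - p -> forall k l, c k = - l -> c l = - k ->
  st (mat9 a b e k f g p l h) + mat9 a b e k f g p l h = 0.
Proof.
move=> h1 h2 h3 h4 h5 h6 h7 k l h8 h9; apply: mat9_eq; rewrite !mxE /= ?h1 ?h2 ?h3 ?h4 ?h5 ?h6 ?h7 ?h8 ?h9 addNr //.
Qed.

Section Fixed.
Variable d : F.
Hypotheses (ds : d \in sk) (d0 : d != 0).
(** For the antidiagonal form this corner matrix is skew and its centraliser is upper triangular,
    which is why this row is computed for [wstar] and transported afterwards. *)
Let B1 : M := mat9 0 0 d 0 0 0 0 0 0.
Let C := cent B1.

Let cd : c d = - d. Proof. by apply/eqP; rewrite -skE. Qed.

Lemma B1_skew : st B1 + B1 = 0.
Proof. by apply: wskew_mat9; rewrite ?rmorph0 ?oppr0. Qed.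

Lemma mem_parP (s : M) :
  reflect [/\ s 1 0 = 0, s 2 0 = 0, s 2 1 = 0 & s 2 2 = s 0 0] (s \in C).
Proof.
rewrite /C /B1; apply: (iffP (centP _ _)) => [/matrixP e|[h1 h2 h3 h4]].
  have z x : x * d = 0 \/ d * x = 0 -> x = 0.
    by case=> /eqP; rewrite mulf_eq0 (negPf d0) ?orbF /= => /eqP.
  move: (e 1 2) (e 2 2) (e 0 1) (e 0 2); rewrite !mulrE3 !mxE /= !(mulr0, mul0r, addr0, add0r).
  move=> e1 e2 e3 e4; split; try by apply: z; auto.
  by apply: (mulfI d0); rewrite -e4 mulrC.
apply: mat9_eq; rewrite !mulrE3 !mxE /= ?h1 ?h2 ?h3 ?h4 !(mulr0, mul0r, addr0, add0r) //; exact: mulrC.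
Qed.

Lemma perp_parP (y : M) :
  reflect [/\ y 0 0 + y 2 2 = 0, y 1 0 = 0, y 2 0 = 0, y 1 1 = 0 & y 2 1 = 0] (y \in perp C).
Proof.
apply: (iffP (perpP _ _)) => [h|[h1 h2 h3 h4 h5] x /mem_parP[e1 e2 e3 e4]].
  have g a1 a2 a3 a4 a5 : a1 * (y 0 0 + y 2 2) + a2 * y 1 0 + a3 * y 2 0 + a4 * y 1 1 + a5 * y 2 1 = 0.
    have := h (mat9 a1 a2 a3 0 a4 a5 0 0 a1); rewrite /mxtrace sum3 !mulrE3 !mxE /= !(mul0r, addr0, add0r).
    by move=> <-; [ring | apply/mem_parP; rewrite !mxE].
  move: (g 1 0 0 0 0) (g 0 1 0 0 0) (g 0 0 1 0 0) (g 0 0 0 1 0) (g 0 0 0 0 1).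
  by rewrite !(mul0r, mul1r, addr0, add0r).
have -> : \tr (x * y) = x 0 0 * (y 0 0 + y 2 2).
  rewrite /mxtrace sum3 !mulrE3 e1 e2 e3 e4 h2 h3 h4 h5 !(mul0r, mulr0, addr0, add0r); ring.
by rewrite h1 mulr0.
Qed.

Lemma perp_par (s x y : M) : s \in C -> (s * x - y * s \in perp C) <->
  [/\ s 0 0 * x 2 0 = y 2 0 * s 0 0,
      s 1 1 * x 1 0 + s 1 2 * x 2 0 = y 1 0 * s 0 0,
      s 0 0 * x 2 1 = y 2 0 * s 0 1 + y 2 1 * s 1 1,
      s 1 1 * x 1 1 + s 1 2 * x 2 1 = y 1 0 * s 0 1 + y 1 1 * s 1 1 &
      s 0 0 * (x 0 0 + x 2 2) + s 0 1 * x 1 0 + s 0 2 * x 2 0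
        = (y 0 0 + y 2 2) * s 0 0 + y 2 0 * s 0 2 + y 2 1 * s 1 2].
Proof.
move=> /mem_parP[h1 h2 h3 h4].
have E : (s * x - y * s) 0 0 + (s * x - y * s) 2 2 =
  (s 0 0 * (x 0 0 + x 2 2) + s 0 1 * x 1 0 + s 0 2 * x 2 0)
   - ((y 0 0 + y 2 2) * s 0 0 + y 2 0 * s 0 2 + y 2 1 * s 1 2).
  by rewrite !subrE3 !mulrE3 h1 h2 h3 h4; ring.
split=> [/perp_parP|[e1 e2 e3 e4 e5]].
  rewrite E !subrE3 !mulrE3 h1 h2 h3 !(mul0r, mulr0, addr0, add0r) => -[] /subr0_eq e1 /subr0_eq e2.
  by rewrite h4 => /subr0_eq e3 /subr0_eq e4 /subr0_eq e5; split.
apply/perp_parP; rewrite E e5 subrr !subrE3 !mulrE3 h1 h2 h3 h4 !(mul0r, mulr0, addr0, add0r).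
by rewrite e1 e2 e3 e4 !subrr.
Qed.

Lemma stab_alg (x s t : M) : s \in stab C x -> t \in stab C x ->
  [/\ s + t \in stab C x, s * t \in stab C x & forall a, a *: s \in stab C x].
Proof.
move=> /stabP[sC sp] /stabP[tC tp]; split.
- apply/stabP; split; first exact: centD.
  by rewrite mulrDl mulrDr opprD addrACA; apply: perp_centD.
- apply/stabP; split; first exact: centM.
  have -> : s * t * x - x * (s * t) = s * (t * x - x * t) + (s * x - x * s) * t.
    by rewrite mulrBr mulrBl !mulrA addrA subrK.
  by apply: perp_centD; [apply: perp_centMl|apply: perp_centMr].
move=> a; apply/stabP; split; first exact: centZ.
by rewrite -scalerAl -scalerAr -scalerBr; apply: perp_centZ.
Qed.

(* A commutative algebra containing a cyclic matrix is its centraliser. *)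
Lemma stab_cyclic (x B : M) : cyclic_mx B -> B \in stab C x ->
  {in stab C x &, forall s t, s * t = t * s} -> stab C x = cent B.
Proof.
move=> cB BS comm; apply/setP => s; apply/idP/idP => [sS|].
  by apply/centP; apply: comm.
have one : 1 \in stab C x.
  by apply/stabP; split; [exact: cent1 | rewrite mul1r mulr1 subrr; exact: perp_cent0].
have SZ (y : M) a : y \in stab C x -> a *: y \in stab C x by move=> h; have [] := stab_alg h h.
have SD (y z : M) : y \in stab C x -> z \in stab C x -> y + z \in stab C x.
  by move=> h k; have [] := stab_alg h k.
move=> /(cyclic_cent cB)[p sp ->]; rewrite horner_mx_sum3 //.
have B2 : B ^+ 2 \in stab C x by rewrite expr2; have [] := stab_alg BS BS.
exact: (SD _ _ (SD _ _ (SZ _ _ one) (SZ _ _ BS)) (SZ _ _ B2)).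
Qed.

Lemma ut_char a b e f g h : char_poly (mat9 a b e 0 f g 0 0 h : M) = lin a * lin f * lin h.
Proof. by rewrite /char_poly det3 !mxE /= ; ring. Qed.

Lemma stab_par (s x : M) : s \in C -> (s \in stab C x) <->
  [/\ (s 0 0 - s 1 1) * x 1 0 = s 1 2 * x 2 0, (s 0 0 - s 1 1) * x 2 1 = s 0 1 * x 2 0 &
      s 0 1 * x 1 0 = s 1 2 * x 2 1].
Proof.
move=> sC; split=> [/stabP[_ /(perp_par _ _ sC)[_ e1 e2 e3 _]]|[e1 e2 e3]].
  split.
  - by rewrite mulrBl [s 0 0 * _]mulrC -e1; ring.
  - by rewrite mulrBl e2; ring.
  have -> : s 0 1 * x 1 0 = (x 1 0 * s 0 1 + x 1 1 * s 1 1) - x 1 1 * s 1 1 by ring.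
  by rewrite -e3; ring.
apply/stabP; split=> //; apply/(perp_par _ _ sC); split.
- exact: mulrC.
- by rewrite -e1; ring.
- by rewrite mulrC [x 2 0 * _]mulrC -e2; ring.
- by rewrite -e3; ring.
by rewrite e3; ring.
Qed.

Definition jtau (x : M) := if x 2 0 != 0 then tyM else if x 1 0 != 0 then tyN else tyJ.

Lemma typedM (x : M) : st x + x = 0 -> x 2 0 != 0 -> typed c st tyM (stab C x).
Proof.
move=> sx p0; have [[e1 e2 e3 e4] [e5 e6 e7]] := wskew_entries sx.
set p := x 2 0 in p0 e7 *.
(* The values of [g] and [b] are forced by [stab_par]. The summand [d] in [e] keeps the rank of [B]
   equal to 2, so that the double eigenvalue 0 is not semisimple. *)
pose g := - d * x 1 0 / p; pose b := - d * x 2 1 / p; pose e := d + b * g / d.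
pose B : M := mat9 0 b e 0 d g 0 0 0.
have cg : c g = - b by rewrite /g !rmorphM rmorphN fmorphV e6 e7 cd invrN /b; ring.
have cb : c b = - g by rewrite /b !rmorphM rmorphN fmorphV e4 e7 cd invrN /g; ring.
have ce : c e = - e.
  rewrite /e; move: (b) (g) cb cg => b' g' cb cg.
  by rewrite rmorphD rmorphM fmorphV rmorphM cb cg cd invrN; ring.
have BC : B \in C by apply/mem_parP; rewrite !mxE.
have cB : cyclic_mx B.
  exists (\row_j (if val j == 0%N then 1 else if val j == 1%N then (1 - b) / d else 0)).
  rewrite unitmxE unitfE.
  suff -> : \det (krylov (\row_j (if val j == 0%N then 1 else if val j == 1%N then (1 - b) / d else 0)) B) = - d ^+ 2.
    by rewrite oppr_eq0 expf_neq0.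
  by rewrite det3 !mxE /= !sum3 !mxE /= !sum3 !mxE /= /e; field.
exists B; split.
- by apply: wskew_mat9; rewrite ?rmorph0 ?oppr0.
- rewrite /matrix_type cyclic_minpoly // ut_char; exists d, 0; split; rewrite ?oppr0 //.
  + by apply/(gu1P c).
  + by apply/(gu1P c); apply: sk0.
  rewrite expr2; ring.
apply: stab_cyclic => //.
  by apply/(stab_par _ BC); rewrite !mxE /=; split; rewrite /g /b -?/p; field.
move=> s t sS tS.
have sC : s \in C by case/stabP: sS.
have tC : t \in C by case/stabP: tS.
have [k1 k2 _] := proj1 (stab_par _ sC) sS; have [l1 l2 _] := proj1 (stab_par _ tC) tS.
have s12 : s 1 2 = (s 0 0 - s 1 1) * x 1 0 / p by rewrite k1 mulfK.
have s01 : s 0 1 = (s 0 0 - s 1 1) * x 2 1 / p by rewrite k2 mulfK.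
have t12 : t 1 2 = (t 0 0 - t 1 1) * x 1 0 / p by rewrite l1 mulfK.
have t01 : t 0 1 = (t 0 0 - t 1 1) * x 2 1 / p by rewrite l2 mulfK.
have [h1 h2 h3 h4] := elimT (mem_parP _) sC; have [m1 m2 m3 m4] := elimT (mem_parP _) tC.
by apply: mat9_eq; rewrite !mulrE3 ?h1 ?h2 ?h3 ?h4 ?m1 ?m2 ?m3 ?m4 ?s12 ?s01 ?t12 ?t01; ring.
Qed.

Lemma typedN (x : M) : st x + x = 0 -> x 2 0 = 0 -> x 1 0 != 0 -> typed c st tyN (stab C x).
Proof.
move=> sx p0 x0; have [[e1 e2 e3 e4] [e5 e6 e7]] := wskew_entries sx.
pose B : M := mat9 0 (x 2 1) 0 0 0 (x 1 0) 0 0 0.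
have BC : B \in C by apply/mem_parP; rewrite !mxE.
have y0 : x 2 1 != 0 by rewrite -oppr_eq0 -e6 fmorph_eq0.
have cB : cyclic_mx B.
  exists (\row_j (if val j == 0%N then 1 else 0)); rewrite unitmxE unitfE.
  suff -> : \det (krylov (\row_j (if val j == 0%N then 1 else 0)) B) = x 2 1 ^+ 2 * x 1 0.
    by rewrite mulf_neq0 // expf_neq0.
  by rewrite det3 !mxE /= !sum3 !mxE /= !sum3 !mxE /=; ring.
exists B; split.
- by apply: wskew_mat9; rewrite ?rmorph0 ?oppr0.
- rewrite /matrix_type cyclic_minpoly // ut_char; exists 0; first by apply/(gu1P c); apply: sk0.
  by rewrite !subr0; ring.
apply: stab_cyclic => //.
  by apply/(stab_par _ BC); rewrite !mxE /= p0; split; ring.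
move=> s t sS tS.
have sC : s \in C by case/stabP: sS.
have tC : t \in C by case/stabP: tS.
have [k1 _ k2] := proj1 (stab_par _ sC) sS; have [l1 _ l2] := proj1 (stab_par _ tC) tS.
have s01 : s 0 1 = s 1 2 * x 2 1 / x 1 0 by rewrite -k2 mulfK.
have t01 : t 0 1 = t 1 2 * x 2 1 / x 1 0 by rewrite -l2 mulfK.
have s11 : s 1 1 = s 0 0.
  by move/eqP: k1; rewrite p0 mulr0 mulf_eq0 (negPf x0) orbF subr_eq0 => /eqP.
have t11 : t 1 1 = t 0 0.
  by move/eqP: l1; rewrite p0 mulr0 mulf_eq0 (negPf x0) orbF subr_eq0 => /eqP.
have [h1 h2 h3 h4] := elimT (mem_parP _) sC; have [m1 m2 m3 m4] := elimT (mem_parP _) tC.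
by apply: mat9_eq; rewrite !mulrE3 ?h1 ?h2 ?h3 ?h4 ?m1 ?m2 ?m3 ?m4 ?s11 ?t11 ?s01 ?t01; ring.
Qed.

Lemma B1_type : mtype tyJ B1.
Proof.
exists 0; first by apply/(gu1P c); apply: sk0.
have BB : B1 * B1 = 0 by apply: mat9_eq; rewrite !mulrE3 !mxE /= !(mul0r, mulr0, addr0).
apply: mxminpoly_eq; first by rewrite rpredX ?monicXsubC.
  by rewrite subr0 rmorphXn /= horner_mx_X expr2.
rewrite size_exp_XsubC size_mxminpoly ltnS ltnNge mxminpoly_linear_is_scalar.
apply/negP => /is_scalar_mxP[a /matrixP/(_ 0 2)]; rewrite !mxE /= => /eqP.
exact/negP.
Qed.

Lemma wtyped_unique Y Y' (S0 : {set M}) : typed c st Y S0 -> typed c st Y' S0 -> Y = Y'.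
Proof.
have [P uP wE] := wstar_conj Q.
have sk x : st x + x = 0 -> star (P * x * P^-1) + P * x * P^-1 = 0.
  by move=> sx; apply/(st_conj_skew _ uP); rewrite -wE.
move=> [B [sB mB SE]] [B' [sB' mB' SE']].
apply: (type_unique Q (sk _ sB) (sk _ sB') (proj2 (mtype_conj c uP _ _) mB) (proj2 (mtype_conj c uP _ _) mB')).
by apply/setP => x; rewrite -(conjVK uP x) !(cent_conj uP) -SE -SE'.
Qed.

Lemma rowJ_type (x : M) : st x + x = 0 -> typed c st (jtau x) (stab C x).
Proof.
move=> sx; rewrite /jtau; case: eqP => /= [p0|/eqP p0]; last exact: typedM.
case: eqP => /= [x0|/eqP x0]; last exact: typedN.
have [[e1 e2 e3 e4] [e5 e6 e7]] := wskew_entries sx.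
have y0 : x 2 1 = 0 by apply: oppr_inj; rewrite -e6 x0 rmorph0 oppr0.
exists B1; split; [exact: B1_skew|exact: B1_type|].
apply/setP => s; apply/idP/idP => [/stabP[]//|sC].
by apply/(stab_par _ sC); rewrite p0 x0 y0 !mulr0.
Qed.

Lemma rowJ_typed Y (x : M) : (x \in typed_set c st C Y) <-> st x + x = 0 /\ Y = jtau x.
Proof.
split=> [/typed_setP[sx tx]|[sx ->]].
  by split=> //; exact: wtyped_unique tx (rowJ_type sx).
by apply/typed_setP; split=> //; exact: rowJ_type.
Qed.

(** The corner, the trace and a 2 by 2 minor are invariant modulo the orthogonal of [C]. For type J
    the minor is zero and the middle entry replaces it. *)
Definition jinv (x : M) : F * F * F := (x 2 0, x 0 0 + x 1 1 + x 2 2,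
  if (x 2 0 == 0) && (x 1 0 == 0) then x 1 1 else x 1 1 * x 2 0 - x 1 0 * x 2 1).

Lemma par_unit (h : M) : h \in C -> h \is a GRing.unit -> h 0 0 != 0 /\ h 1 1 != 0.
Proof.
move=> /mem_parP[h1 h2 h3 h4]; rewrite unitmxE unitfE det3 h1 h2 h3 h4.
rewrite !(mulr0, subr0, addr0) => n.
by split; apply: contraNneq n => ->; rewrite !(mul0r, mulr0, subr0).
Qed.

Lemma jinv_equiv (x y : M) : st x + x = 0 -> st y + y = 0 -> equiv st C x y -> jinv x = jinv y.
Proof.
move=> sx sy [h [hu hC] hp]; have [a0 f0] := par_unit hC (uni_unit hu).
move: hp => /(perp_par _ _ hC)[e1 e2 e3 e4 e5].
move: (h 0 0) (h 1 1) (h 0 1) (h 1 2) (h 0 2) a0 f0 e1 e2 e3 e4 e5 => a f b g e a0 f0 e1 e2 e3 e4 e5.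
have p : y 2 0 = x 2 0 by apply: (mulIf a0); rewrite -e1 mulrC.
have tE : x 0 0 + x 1 1 + x 2 2 = y 0 0 + y 1 1 + y 2 2.
  apply: (mulfI (mulf_neq0 a0 f0)).
  have -> : a * f * (x 0 0 + x 1 1 + x 2 2) = f * (a * (x 0 0 + x 2 2) + b * x 1 0 + e * x 2 0)
      + a * (f * x 1 1 + g * x 2 1) - b * (f * x 1 0 + g * x 2 0) - f * e * x 2 0
      - g * (a * x 2 1) + b * g * x 2 0 by ring.
  by rewrite e5 e4 e2 e3 p; ring.
rewrite /jinv p tE; congr pair.
have [p0|p0] := eqVneq (x 2 0) 0; last first.
  apply: (mulfI (mulf_neq0 a0 f0)); rewrite /=.
  have -> : a * f * (x 1 1 * x 2 0 - x 1 0 * x 2 1) = a * x 2 0 * (f * x 1 1 + g * x 2 1)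
      - (f * x 1 0 + g * x 2 0) * (a * x 2 1) by ring.
  by rewrite e4 e2 e3 p; ring.
have x1 : f * x 1 0 = y 1 0 * a by rewrite -e2 p0 mulr0 addr0.
have x2 : a * x 2 1 = y 2 1 * f by rewrite e3 p p0 mul0r add0r.
have -> : (y 1 0 == 0) = (x 1 0 == 0).
  by rewrite -(mulIr_eq0 _ (mulIf a0)) -x1 mulf_eq0 (negPf f0).
have [z0|z0] := eqVneq (x 1 0) 0; rewrite /=; last first.
  rewrite p0 !mulr0 !sub0r; congr (- _); apply: (mulfI (mulf_neq0 a0 f0)).
  have -> : a * f * (x 1 0 * x 2 1) = (f * x 1 0) * (a * x 2 1) by ring.
  by rewrite x1 x2; ring.
have y0 : y 1 0 = 0 by apply: (mulIf a0); rewrite -x1 z0 mulr0 mul0r.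
have w0 : x 2 1 = 0.
  by have [_ [_ e6 _]] := wskew_entries sx; apply: oppr_inj; rewrite -e6 z0 rmorph0 oppr0.
by apply: (mulfI f0); move: e4; rewrite w0 y0 mulr0 addr0 mul0r add0r [RHS]mulrC.
Qed.

(** Elements of a Borel subgroup of the unitary group of the antidiagonal form; the corner is chosen
    so that it and its conjugate sum to [- c g * g]. *)
Lemma par_uni (f g : F) : c f * f = 1 ->
  st (mat9 1 (- (c g * f)) (- (c g * g) / 2%:R) 0 f g 0 0 1)
    * mat9 1 (- (c g * f)) (- (c g * g) / 2%:R) 0 f g 0 0 1 = 1.
Proof.
move=> ff; have two := q2 Q.
have cg : c (- (c g * f)) = - (g * c f) by rewrite rmorphN rmorphM cK.
have ce : c (- (c g * g) / 2%:R) = - (c g * g) / 2%:R.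
  by rewrite rmorphM rmorphN rmorphM cK fmorphV rmorph_nat (mulrC g).
apply: mat9_eq; rewrite !mulrE3 !mxE /= ?cg ?ce ?rmorph1 ?rmorph0 ?(mul0r, mulr0, mul1r, mulr1, addr0, add0r) //.
- by rewrite addrC subrr.
- by field.
- by rewrite [g * _]mulrC subrr.
Qed.

Lemma equiv_jinv (x y : M) : st x + x = 0 -> st y + y = 0 -> jtau x = jtau y ->
  jinv x = jinv y -> equiv st C x y.
Proof.
move=> sx sy; have two := q2 Q.
have [[_ _ _ x21] [x11 x10 x20]] := wskew_entries sx.
have [[_ _ _ y21] [y11 y10 y20]] := wskew_entries sy.
(* The equations of [perp_par] for these unitary elements; the corner of [H] cancels because [x] and
   [y] have the same lower left entry. *)
have wit f g (H := mat9 1 (- (c g * f)) (- (c g * g) / 2%:R) 0 f g 0 0 1 : M) : c f * f = 1 ->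
  [/\ x 2 0 = y 2 0, f * x 1 0 + g * x 2 0 = y 1 0,
     x 2 1 = - y 2 0 * (c g * f) + y 2 1 * f,
      f * x 1 1 + g * x 2 1 = - y 1 0 * (c g * f) + y 1 1 * f &
      x 0 0 + x 2 2 - c g * f * x 1 0 = y 0 0 + y 2 2 + y 2 1 * g] -> equiv st C x y.
  move=> ff [e1 e2 e3 e4 e5]; have HC : H \in C by apply/mem_parP; rewrite !mxE.
  exists H; first by split; [exact: par_uni | exact: HC].
  apply/(perp_par _ _ HC); rewrite /H !mxE /=; split.
  - by rewrite mul1r mulr1.
  - by rewrite e2 mulr1.
  - by rewrite mul1r e3; ring.
  - by rewrite e4; ring.
  rewrite -e1; move: (- (c g * g) / 2%:R) => E0.
  have -> : 1 * (x 0 0 + x 2 2) + - (c g * f) * x 1 0 + E0 * x 2 0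
     = (x 0 0 + x 2 2 - c g * f * x 1 0) + E0 * x 2 0 by ring.
  by rewrite e5; ring.
rewrite /jtau => + [pE tE]; rewrite -pE.
have [p0|p0] := eqVneq (x 2 0) 0 => /=; last first.
  (* With [f = 1], the equation [x 1 0 + g * x 2 0 = y 1 0] determines [g]; the rest follows from
     the invariants. *)
  move=> _ dE; apply: (wit 1 ((y 1 0 - x 1 0) / x 2 0)); first by rewrite rmorph1 mulr1.
  have -> : c ((y 1 0 - x 1 0) / x 2 0) = (y 2 1 - x 2 1) / x 2 0.
    by rewrite rmorphM fmorphV rmorphB x10 y10 x20 invrN; ring.
  rewrite -pE !mulr1 !mul1r; split=> //; try by field.
    apply: (mulfI p0).
    have -> : x 2 0 * (x 1 1 + (y 1 0 - x 1 0) / x 2 0 * x 2 1) =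
       (x 1 1 * x 2 0 - x 1 0 * x 2 1) + y 1 0 * x 2 1 by field.
    by rewrite dE; field.
  have -> : x 0 0 + x 2 2 = (y 0 0 + y 1 1 + y 2 2) - x 1 1 by rewrite -tE; ring.
  have -> : x 1 1 = (y 1 1 * x 2 0 - y 1 0 * y 2 1 + x 1 0 * x 2 1) / x 2 0.
    by rewrite -dE subrK mulfK.
  by field.
have [z0|z0] := eqVneq (x 1 0) 0 => /=; last first.
  case: (eqVneq (y 1 0) 0) => // w0 _ /=; rewrite -?pE p0 !mulr0 !sub0r => /oppr_inj dE.
  have y21' : y 2 1 != 0 by rewrite -oppr_eq0 -y10 fmorph_eq0.
  (* Here the corner is zero. The quotient [f] has norm one because the products [x 1 0 * x 2 1] and
     [y 1 0 * y 2 1] agree; [g] then carries [x 1 1] to [y 1 1]. *)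
  pose f := y 1 0 / x 1 0; pose g := (y 1 1 - x 1 1) / (2%:R * y 2 1).
  have cf : c f = y 2 1 / x 2 1 by rewrite /f rmorphM fmorphV x10 y10 invrN; ring.
  have x21' : x 2 1 != 0 by rewrite -oppr_eq0 -x10 fmorph_eq0.
  have fE : y 2 1 * f = x 2 1.
    by apply: (mulIf z0); rewrite /f mulrA mulfVK // [LHS]mulrC [RHS]mulrC.
  have ff : c f * f = 1 by rewrite cf mulrAC fE divff.
  have cg : c g = (y 1 1 - x 1 1) / (2%:R * y 1 0).
    by rewrite /g rmorphM fmorphV rmorphM rmorph_nat rmorphB x11 y11 y21 mulrN invrN; ring.
  apply: (wit f g ff); rewrite cg -?pE p0 oppr0 mul0r add0r mulr0 addr0; split=> //.
  - by rewrite /f mulfVK.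
  - rewrite -fE /g; apply/eqP; rewrite -subr_eq0; apply/eqP.
    have -> : y 1 1 = x 1 1 + (y 1 1 - x 1 1) by rewrite addrC subrK.
    by field; rewrite two y21' w0.
  have -> : x 0 0 + x 2 2 = (y 0 0 + y 1 1 + y 2 2) - x 1 1 by rewrite -tE; ring.
  by rewrite /g /f; field; rewrite two y21' w0 z0.
case: (eqVneq (y 1 0) 0) => // w0 _ /=; rewrite ?eqxx /= => xy.
have xz : x 2 1 = 0 by apply: oppr_inj; rewrite -x10 z0 rmorph0 oppr0.
have yz : y 2 1 = 0 by apply: oppr_inj; rewrite -y10 w0 rmorph0 oppr0.
apply: (wit 1 0); first by rewrite rmorph1 mulr1.
rewrite rmorph0 xz yz z0 w0 -?pE p0 xy !(mul0r, mulr0, addr0, mul1r, mulr1, oppr0, subr0); rewrite ?oppr0 ?(mul0r, addr0, add0r, subr0); split=> //.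
by apply: (addIr (y 1 1)); rewrite addrAC [RHS]addrAC -tE xy.
Qed.

Definition jset Y : {set F * F * F} :=
  match Y with
  | tyM => setX (setX (sk :\ 0) sk) kp
  | tyN => setX (setX [set 0] sk) (kp :\ 0)
  | tyJ => setX (setX [set 0] sk) sk
  | _ => set0
  end.

Lemma jinv_image Y : jinv @: typed_set c st C Y = jset Y.
Proof.
have two := q2 Q.
apply/setP => t; apply/imsetP/idP => [[x /rowJ_typed[sx ->] ->]|].
  have [[e1 e2 e3 e4] [e5 e6 e7]] := wskew_entries sx.
  have ts : x 0 0 + x 1 1 + x 2 2 \in sk.
    by apply/(gu1P c); rewrite /gu1 /= !rmorphD e1 e5; have := cK (x 2 2); rewrite e1 rmorphN => <-; ring.
  have ps : x 2 0 \in sk by rewrite skE e7.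
  have fs : x 1 1 \in sk by rewrite skE e5.
  have mk : x 1 1 * x 2 0 - x 1 0 * x 2 1 \in kp.
    by rewrite kpE rmorphB !rmorphM e5 e7 e6 e4; apply/eqP; ring.
  rewrite /jtau /jinv; have [p0|p0] := eqVneq (x 2 0) 0; last first.
    by rewrite /=; apply/setXP; split; [apply/setXP; split; [apply/setD1P|]|].
  have [z0|z0] := eqVneq (x 1 0) 0 => /=.
    by apply/setXP; split; [apply/setXP; split; [apply/set1P|]|].
  have x21' : x 2 1 != 0 by rewrite -oppr_eq0 -e6 fmorph_eq0.
  rewrite p0 in mk *.
  apply/setXP; split; [apply/setXP; split; [exact/set1P|exact: ts]|].
  by apply/setD1P; split; [rewrite mulr0 sub0r oppr_eq0 mulf_neq0|].
have half (a : F) : a / 2%:R + a / 2%:R = a by field.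
have hs a : a \in sk -> a / 2%:R \in sk.
  by move=> h; apply: sk_kpM => //; rewrite kpE fmorphV rmorph_nat.
have c0 : c 0 = - 0 by rewrite rmorph0 oppr0.
case: t => [[p a] m]; case: Y => //=; rewrite ?in_set0 //.
- move=> /setXP[/setXP[/set1P -> as_] ms]; pose h := (a - m) / 2%:R.
  have hS : h \in sk by apply: hs; rewrite skD ?skN.
  move: (ms) (hS); rewrite !skE => /eqP cm /eqP ch.
  exists (mat9 h 0 0 0 m 0 0 0 h : M); last by rewrite /jinv !mxE /= !eqxx /= addrAC half subrK.
  apply/rowJ_typed; split; last by rewrite /jtau !mxE /= !eqxx.
  exact: wskew_mat9.
- move=> /setXP[/setXP[/setD1P[p0 ps] as_] mk]; pose f := m / p; pose h := (a - f) / 2%:R.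
  have fS : f \in sk by rewrite /f mulrC sk_kpM // skV.
  have hS : h \in sk by apply: hs; rewrite skD ?skN.
  move: (fS) (hS) (ps); rewrite !skE => /eqP cf /eqP ch /eqP cp.
  exists (mat9 h 0 0 0 f 0 p 0 h : M); last first.
    by rewrite /jinv !mxE /= (negPf p0) /= addrAC half subrK /f mulfVK // mulr0 subr0.
  apply/rowJ_typed; split; last by rewrite /jtau !mxE /= p0.
  exact: wskew_mat9.
move=> /setXP[/setXP[/set1P -> as_] /setD1P[m0 mk]]; pose h := a / 2%:R.
have hS := hs _ as_; have [l lE] := norm_kp Q mk m0.
have l0 : l != 0 by apply: contraNneq m0 => l0; rewrite lE l0 mul0r.
move: (hS); rewrite skE => /eqP ch.
exists (mat9 h 0 0 l 0 0 0 (- c l) h : M); last first.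
  by rewrite /jinv !mxE /= eqxx (negPf l0) /= addr0 half mulr0 sub0r mulrN opprK -lE.
apply/rowJ_typed; split; last by rewrite /jtau !mxE /= eqxx /= l0.
by apply: wskew_mat9 => //; rewrite ?opprK // rmorphN cK.
Qed.

Lemma card_jset Y : (6 * #|jset Y|)%:Z = (count6 tyJ Y).[q%:Z].
Proof.
have ks : #|sk :\ 0| = q.-1 by have := cardsD1 0 sk; rewrite (sk0 c) (card_sk Q) => ->.
have kk : #|kp :\ 0| = q.-1 by have := cardsD1 0 kp; rewrite (card_kp Q) kpE rmorph0 eqxx => ->.
have q1 := q_gt1 Q.
case: Y => //=; rewrite ?horner0 ?cards0 // !cardsX ?cards1 ?ks ?kk ?(card_sk Q) ?(card_kp Q).
- by rewrite horner6Xn mul1n mulnn.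
- rewrite hornerZ hornerD hornerN !hornerXn !PoszM; case: (q) q1 => // k _ /=.
  by rewrite -[k.+1]addn1 PoszD; ring.
- rewrite hornerZ hornerD hornerN hornerXn hornerX !PoszM; case: (q) q1 => // k _ /=.
  by rewrite -[k.+1]addn1 PoszD; ring.
Qed.

Lemma row_par : row c q st C tyJ.
Proof.
split=> [x sx|Y]; first by exists (jtau x); exact: rowJ_type.
exists #|jinv @: typed_set c st C Y|; last by rewrite jinv_image card_jset.
exists (F * F * F)%type, jinv; split; last by [].
move=> x y /rowJ_typed[sx Yx] /rowJ_typed[sy Yy].
by split; [exact: jinv_equiv | apply: equiv_jinv => //; rewrite -Yx].
Qed.

End Fixed.

Lemma row_J B : star B + B = 0 -> mtype tyJ B -> row c q star (cent B) tyJ.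
Proof.
move=> sB mB; have [d ds d0] := ex_delta Q; have [P uP wE] := wstar_conj Q.
have wE' : st = st_conj P star by apply: boolp.funext.
pose B1 : M := mat9 0 0 d 0 0 0 0 0 0.
have s1 : star (P * B1 * P^-1) + P * B1 * P^-1 = 0.
  by apply/(st_conj_skew _ uP); rewrite -wE; exact: B1_skew.
have m1 : mtype tyJ (P * B1 * P^-1) by apply: (proj2 (mtype_conj c uP _ _)); exact: B1_type.
apply: (row_similar Q (B := P * B1 * P^-1)); first exact: (mtype_cent_similar Q s1 sB m1 mB).
apply: (row_conj uP (S' := cent B1)); first by move=> x; exact: cent_conj.
by rewrite -wE'; apply: row_par.
Qed.

Theorem row_all X B : star B + B = 0 -> mtype X B -> row c q star (cent B) X.
Proof.
move=> sB mB; case: (boolP (regular_type X)) => rX; first exact: row_regular.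
case: X rX mB => // _ mB; [exact: row_scalar|exact: row_L|exact: row_J].
Qed.

End RowJ.

(** * Perturbations of rank one matrices that keep the centraliser *)

Section StabFull.
Variables (F : finFieldType) (c : {rmorphism F -> F}) (q : nat).
Hypothesis Q : qext c q.
Let cK := qcK Q.
Local Notation M := 'M[F]_3.
Local Notation sk := (sk c).
Local Notation star := (@conjmx F c 3).
Let S : star_axiom c star := conjmx_star cK.
Local Notation rk1 := (rank1 c).
Local Notation vst := (vstar c).

Lemma vstE (v : 'rV[F]_3) (z : 'cV[F]_3) : v *m z = 0 -> map_mx c z^T *m vst v = 0.
Proof.
by move=> h; rewrite /vstar -map_trmx -trmx_mul -map_mxM h map_mx0 trmx0.
Qed.

Lemma rowvec_right_inverse (v : 'rV[F]_3) : v != 0 -> exists u : 'cV[F]_3, v *m u = 1%:M.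
Proof.
move=> v0; have [j vj] : exists j, v 0 j != 0.
  apply/existsP; rewrite -negb_forall; apply: contraNN v0 => /forallP h.
  by apply/eqP/rowP => j; rewrite mxE; apply/eqP.
exists ((v 0 j)^-1 *: delta_mx j 0); rewrite -scalemxAr -colE; apply/matrixP => i k.
by rewrite !ord1 !mxE /= mulVf.
Qed.

(* The stabiliser is everything exactly when x is orthogonal to all commutators of
   the centraliser; products z y with v z = 0 and y v* = 0 already force the shape. *)
Lemma stab_full_rk1 a e v (x : M) (C := cent (a%:M + rk1 e v)) :
  e \in sk -> e != 0 -> v != 0 -> star x + x = 0 -> stab C x = C ->
  exists al w, al \in sk /\ x = al%:M + e *: (vst v *m w + vst w *m v).
Proof.
move=> es e0 v0 sx full.
have [y1 [z1 [_ [yv vz _ [yz _ _]]]]] := rk1_frame c v0.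
have two := q2 Q.
pose al := (y1 *m x *m z1) 0 0.
(* Orthogonality of the commutator of [z *m y1] and [x] to [z1 *m y] reads [y x z = al (y z)]. *)
have comm (y : 'rV[F]_3) (z : 'cV[F]_3) : y *m vst v = 0 -> v *m z = 0 ->
    (y *m x *m z) 0 0 = al * (y *m z) 0 0.
  move=> hy hz.
  have tC : z1 *m y \in C by apply: cent_rk1.
  have sC : z *m y1 \in C by apply: cent_rk1.
  have : z *m y1 \in stab C x by rewrite full.
  case/stabP => _ /perpP/(_ _ tC).
  rewrite mulrBr trB => /subr0_eq.
  have -> : \tr (z1 *m y * (z *m y1 * x) : M) = (y *m z) 0 0 * al.
    rewrite -!mulmxE -!mulmxA mxtrace_mulC trace_mx11.
    have -> : y *m (z *m (y1 *m x)) *m z1 = (y *m z) *m (y1 *m x *m z1) by rewrite !mulmxA.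
    by rewrite mxE big_ord1.
  have -> : \tr (z1 *m y * (x * (z *m y1)) : M) = (y *m x *m z) 0 0.
    rewrite -!mulmxE -!mulmxA mxtrace_mulC trace_mx11.
    have -> : y *m (x *m (z *m y1)) *m z1 = (y *m x *m z) *m (y1 *m z1) by rewrite !mulmxA.
    by rewrite yz mulmx1 !mulmxA.
  by move=> <-; rewrite mulrC.
have sxE : star x = - x by apply/eqP; rewrite -addr_eq0 sx.
have als : al \in sk.
  have cy : map_mx c z1^T *m vst v = 0 by apply: vstE.
  have cz : v *m (map_mx c y1)^T = 0.
    have -> : v = (map_mx c (vst v))^T by apply/rowP => j; rewrite !mxE cK.
    by rewrite -trmx_mul -map_mxM yv map_mx0 trmx0.
  have := comm _ _ cy cz; have -> : map_mx c z1^T *m x *m (map_mx c y1)^T = - map_mx c (y1 *m x *m z1)^T.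
    rewrite -[x in LHS]opprK -sxE mulmxN mulNmx; congr (- _).
    by rewrite !trmx_mul !map_mxM -!map_trmx /conjmx mulmxA map_trmx.
  have -> : map_mx c z1^T *m (map_mx c y1)^T = 1%:M.
    by rewrite -map_trmx -trmx_mul -map_mxM yz map_scalar_mx rmorph1 tr_scalar_mx.
  have e1 (W : 'M[F]_1) : (- map_mx c W^T) 0 0 = - c (W 0 0) by rewrite !mxE.
  have e2 : (1%:M : 'M[F]_1) 0 0 = 1 by rewrite mxE.
  by rewrite e1 e2 mulr1 -/al => h; rewrite skE -eqr_oppLR h.
pose X := x - al%:M.
have X0 (y : 'rV[F]_3) (z : 'cV[F]_3) : y *m vst v = 0 -> v *m z = 0 -> y *m X *m z = 0.
  move=> hy hz; rewrite /X mulmxBr mulmxBl mul_mx_scalar -scalemxAl.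
  by rewrite [y *m z]mx11_scalar scale_scalar_mx [y *m x *m z]mx11_scalar comm // subrr.
have [u vu] := rowvec_right_inverse v0.
pose u' := map_mx c u^T.
have uv' : u' *m vst v = 1%:M.
  by rewrite /u' /vstar -map_trmx -trmx_mul -map_mxM vu map_scalar_mx rmorph1 tr_scalar_mx.
(* The left factor has rows orthogonal to [v*] and the right one has columns killed by [v], so [X]
   vanishes between them; expanding gives [X = v* w1 + w2 v]. *)
have P0 : (1%:M - vst v *m u') *m X *m (1%:M - u *m v) = 0.
  apply/matrixP => i j; rewrite [RHS]mxE.
  have h1 : matrix.row i (1%:M - vst v *m u') *m vst v = 0.
    by rewrite -row_mul mulmxBl mul1mx -mulmxA uv' mulmx1 subrr row0.
  have h2 : v *m col j (1%:M - u *m v) = 0.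
    by rewrite colE mulmxA mulmxBr mulmx1 mulmxA vu mul1mx subrr mul0mx.
  have := X0 _ _ h1 h2; rewrite colE mulmxA -!row_mul -colE => /matrixP/(_ 0 0).
  by rewrite !mxE.
pose w1 := u' *m X *m (1%:M - u *m v); pose w2 := X *m u.
have XE : X = vst v *m w1 + w2 *m v.
  have : (1%:M - vst v *m u') *m X *m (1%:M - u *m v) = X - X *m u *m v - vst v *m w1.
    rewrite /w1; move: (X) => X1.
    by rewrite !mulmxBl mul1mx mulmxBr mulmx1 !mulmxA.
  by rewrite P0 => /esym/eqP; rewrite -addrA -opprD subr_eq0 /w2 addrC => /eqP.
have sX : star X + X = 0.
  by rewrite /X (stB S) addrACA sx -opprD (skew_scalar Q als) subr0.
have ce : c e = - e by apply/eqP; rewrite -skE.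
pose w2' := map_mx c w2^T; pose dd := w1 - w2'.
have w2E : w2 = vst w2'.
  by apply/colP => j; rewrite !mxE cK.
have vd : vst dd = vst w1 - vst w2'.
  by rewrite /dd /vstar map_mxB linearB.
have u2 : 2%:R \is a @GRing.unit F by rewrite unitfE.
(* A skew [X] is half of [X - star X], which only involves [dd = w1 - w2']; dividing by the skew [e]
   turns the difference into the required sum. *)
exists al, ((2%:R * e)^-1 *: dd); split; first exact: als.
have -> : x = al%:M + X by rewrite addrC subrK.
congr (_ + _).
rewrite vstZ fmorphV rmorphM rmorph_nat ce mulrN invrN scaleNr mulNmx -scalemxAr -scalemxAl.
rewrite -scalerBr scalerA (_ : e * _ = 2%:R^-1); last by field; rewrite two e0.
rewrite -[LHS](half_skew u2 sX) {1 2}XE (stD S) (star_outer cK) w2E (star_outer cK).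
rewrite vd /dd mulmxBr mulmxBl; congr (_ *: _).
by rewrite opprB [vst w1 *m v + _]addrC opprD addrACA.
Qed.
End StabFull.

(** * Centralisers modulo powers of the uniformizer *)

(** All that lifting needs from the ring extension. The uniformizer [p] comes from the small ring,
    so [circ] fixes it and division by [p ^+ l] preserves skewness. *)
Record local_ext (O : idomainType) (circ : {rmorphism O -> O}) (p : O)
    (F : finFieldType) (rd : {rmorphism O -> F}) (c : {rmorphism F -> F}) (q : nat) : Prop := {
  ldK : involutive circ;
  ldp : circ p = p;
  ldp0 : p != 0;
  ld0 : forall x, rd x = 0 <-> exists y, x = p * y;
  ldS : forall y, exists x, rd x = y;
  ldc : forall x, rd (circ x) = c (rd x);
  ldU : forall x, rd x != 0 -> x \is a GRing.unit;
  ldQ : qext c q }.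

Lemma comm_pm (R : pzRingType) (K : R) : (1 + K) * (1 - K) = (1 - K) * (1 + K).
Proof.
rewrite mulrBr mulr1 mulrDl mul1r opprD addrA addrK.
by rewrite mulrDr mulr1 mulrBl mul1r addrA subrK.
Qed.

Lemma cayley_uni (R : comUnitRingType) (c : {rmorphism R -> R}) (st : 'M[R]_3 -> 'M[R]_3) (K : 'M[R]_3) :
  star_axiom c st -> st K + K = 0 -> 1 + K \is a GRing.unit ->
  st ((1 - K) * (1 + K)^-1) * ((1 - K) * (1 + K)^-1) = 1.
Proof.
move=> S /eqP; rewrite addr_eq0 => /eqP sK uK.
have sD : st (1 + K) = 1 - K by rewrite (stD S) (st1 S) sK.
have sB : st (1 - K) = 1 + K by rewrite (stB S) (st1 S) sK opprK.
have uB : 1 - K \is a GRing.unit by rewrite -sD (st_unit S).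
have comm : (1 + K) * (1 - K) = (1 - K) * (1 + K).
  exact: comm_pm.
by rewrite (stM S) (stV S) // sD sB -mulrA [(1 + K) * _]mulrA comm !mulrA mulVr // mul1r divrr.
Qed.

Section Local.
Variables (O : idomainType) (circ : {rmorphism O -> O}) (p : O).
Variables (F : finFieldType) (rd : {rmorphism O -> F}) (c : {rmorphism F -> F}) (q : nat).
Hypothesis L : local_ext circ p rd c q.
Let Q := ldQ L.
Let cK := qcK Q.
Local Notation MO := 'M[O]_3.
Local Notation M := 'M[F]_3.
Local Notation sk := (sk c).
Local Notation star := (@conjmx F c 3).
Local Notation starO := (@conjmx O circ 3).
Let S : star_axiom c star := conjmx_star cK.
Let SO : star_axiom circ starO := conjmx_star (ldK L).
Local Notation rdm := (map_mx rd).
Implicit Types (A B X Y Z W : MO) (x y s h : M) (l m : nat).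

Definition dv l Z := exists W, Z = p ^+ l *: W.

Lemma dv_0 Z : dv 0 Z. Proof. by exists Z; rewrite expr0 scale1r. Qed.
Lemma dv0 l : dv l 0. Proof. by exists 0; rewrite scaler0. Qed.
Lemma dvD l X Y : dv l X -> dv l Y -> dv l (X + Y).
Proof. by move=> [V ->] [W ->]; exists (V + W); rewrite scalerDr. Qed.
Lemma dvN l X : dv l X -> dv l (- X).
Proof. by move=> [V ->]; exists (- V); rewrite scalerN. Qed.
Lemma dvB l X Y : dv l X -> dv l Y -> dv l (X - Y).
Proof. by move=> hX hY; apply: dvD => //; apply: dvN. Qed.
Lemma dvMl l X Y : dv l Y -> dv l (X * Y).
Proof. by move=> [V ->]; exists (X * V); rewrite scalerAr. Qed.
Lemma dvMr l X Y : dv l X -> dv l (X * Y).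
Proof. by move=> [V ->]; exists (V * Y); rewrite scalerAl. Qed.
Lemma dvZ l a X : dv l X -> dv l (a *: X).
Proof. by move=> [V ->]; exists (a *: V); rewrite !scalerA mulrC. Qed.
Lemma dv_ge l m X : (l <= m)%N -> dv m X -> dv l X.
Proof. by move=> lm [V ->]; exists (p ^+ (m - l) *: V); rewrite scalerA -exprD subnKC. Qed.
Lemma dv_pow l m X : (l <= m)%N -> dv l (p ^+ m *: X).
Proof. by move=> lm; apply: dv_ge lm _; exists X. Qed.
Lemma dv_add l m X : dv m X -> dv (l + m) (p ^+ l *: X).
Proof. by move=> [V ->]; exists V; rewrite scalerA exprD. Qed.
Lemma c_pow l : circ (p ^+ l) = p ^+ l. Proof. by rewrite rmorphXn (ldp L). Qed.
Lemma dv_st l X : dv l X -> dv l (starO X).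
Proof. by move=> [V ->]; exists (starO V); rewrite (stZ SO) c_pow. Qed.
Lemma p_neq0 l : p ^+ l != 0. Proof. by rewrite expf_neq0 // (ldp0 L). Qed.
Lemma powI l X Y : p ^+ l *: X = p ^+ l *: Y -> X = Y.
Proof.
move=> /matrixP e; apply/matrixP => i j; have := e i j; rewrite !mxE.
exact: mulfI (p_neq0 l) _ _.
Qed.
Lemma dv_cancel l m X : dv (l + m) (p ^+ l *: X) -> dv m X.
Proof. by move=> [V]; rewrite exprD -scalerA => /powI ->; exists V. Qed.

Lemma rd_p : rd p = 0. Proof. by apply/(ld0 L); exists 1; rewrite mulr1. Qed.

Lemma rdmP Z : rdm Z = 0 <-> dv 1 Z.
Proof.
split=> [/matrixP h|[W ->]]; last first.
  by apply/matrixP => i j; rewrite !mxE expr1 rmorphM rd_p mul0r.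
have h1 (ij : 'I_3 * 'I_3) : exists y : O, Z ij.1 ij.2 = p * y.
  by apply/(ld0 L); have := h ij.1 ij.2; rewrite !mxE.
have [f fE] := fin_all_exists h1; exists (\matrix_(i, j) f (i, j)).
by apply/matrixP => i j; rewrite !mxE expr1 -(fE (i, j)).
Qed.

Lemma rdm_eq X Y : rdm X = rdm Y <-> dv 1 (X - Y).
Proof.
rewrite -rdmP map_mxB; split=> [->|/subr0_eq //]; exact: subrr.
Qed.

Lemma rdm_surj x : exists X, rdm X = x.
Proof.
have h1 (ij : 'I_3 * 'I_3) : exists y : O, rd y = x ij.1 ij.2 by apply: (ldS L).
have [f fE] := fin_all_exists h1; exists (\matrix_(i, j) f (i, j)).
by apply/matrixP => i j; rewrite !mxE fE.
Qed.

Lemma rdm_st X : rdm (starO X) = star (rdm X).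
Proof. by apply/matrixP => i j; rewrite !mxE (ldc L). Qed.
Lemma rdmM X Y : rdm (X * Y) = rdm X * rdm Y. Proof. exact: map_mxM. Qed.
Lemma rdmD X Y : rdm (X + Y) = rdm X + rdm Y. Proof. exact: map_mxD. Qed.
Lemma rdmB X Y : rdm (X - Y) = rdm X - rdm Y. Proof. exact: map_mxB. Qed.
Lemma rdm1 : rdm (1 : MO) = 1 :> M. Proof. exact: map_mx1. Qed.
Lemma rdmZ a X : rdm (a *: X) = rd a *: rdm X. Proof. exact: map_mxZ. Qed.
Lemma rdm_unit X : rdm X \is a GRing.unit -> X \is a GRing.unit.
Proof.
by rewrite !unitmxE det_map_mx unitfE; apply: (ldU L).
Qed.
Lemma rdmV X : rdm X \is a GRing.unit -> rdm X^-1 = (rdm X)^-1.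
Proof.
move=> u; apply: (mulrI u); rewrite mulrV // -rdmM mulrV ?rdm1 //; exact: rdm_unit.
Qed.

Lemma twoU : (2%:R : O) \is a GRing.unit.
Proof. by apply: (ldU L); rewrite rmorph_nat (q2 Q). Qed.

Lemma skew_lift x : star x + x = 0 -> exists2 X, starO X + X = 0 & rdm X = x.
Proof.
move=> sx; have [Y YE] := rdm_surj x.
exists ((2%:R^-1 : O) *: (Y - starO Y)); first exact: (skew_half SO _ twoU).
rewrite rdmZ rdmB rdm_st YE rmorphV ?twoU // rmorph_nat.
by apply: half_skew => //; rewrite unitfE (q2 Q).
Qed.

Definition cm A Y := Y * A - A * Y.
Lemma cmD A X Y : cm A (X + Y) = cm A X + cm A Y.
Proof. by rewrite /cm mulrDl mulrDr opprD addrACA. Qed.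
Lemma cmB A X Y : cm A (X - Y) = cm A X - cm A Y.
Proof. by rewrite /cm mulrBl mulrBr !opprB addrACA [RHS]addrACA; congr (_ + _); rewrite addrC. Qed.
Lemma cmZ A a Y : cm A (a *: Y) = a *: cm A Y.
Proof. by rewrite /cm -scalerAl -scalerAr scalerBr. Qed.
Lemma cmDl A B Y : cm (A + B) Y = cm A Y + cm B Y.
Proof. by rewrite /cm mulrDr mulrDl opprD addrACA. Qed.
Lemma cmZl A a Y : cm (a *: A) Y = a *: cm A Y.
Proof. by rewrite /cm -scalerAl -scalerAr scalerBr. Qed.
Lemma cmM A X Y : cm A (X * Y) = X * cm A Y + cm A X * Y.
Proof. by rewrite /cm mulrBr mulrBl !mulrA addrA subrK. Qed.
Lemma cm1 A : cm A 1 = 0. Proof. by rewrite /cm mul1r mulr1 subrr. Qed.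
Lemma cmV A Y : Y \is a GRing.unit -> cm A Y^-1 = - (Y^-1 * cm A Y * Y^-1).
Proof.
by move=> u; rewrite /cm mulrBr mulrBl !mulrA mulVr // mul1r mulrK // opprB.
Qed.
Lemma cm_st A Y : starO A + A = 0 -> cm A (starO Y) = starO (cm A Y).
Proof.
move=> /eqP; rewrite addr_eq0 => /eqP sA.
by rewrite /cm (stB SO) !(stM SO) sA mulNr mulrN opprK addrC.
Qed.

(* The image mod p of the centraliser of A mod p^l. Both components of the shadow
   are cut out of it, so no exact centralisers are needed. *)
Definition Sl l A : {set M} := [set s | `[< exists2 Y, rdm Y = s & dv l (cm A Y) >]].
Lemma SlP l A s : reflect (exists2 Y, rdm Y = s & dv l (cm A Y)) (s \in Sl l A).
Proof. by rewrite inE; exact: asboolP. Qed.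

(* The leading terms of commutators [X, A] in p^l M with X = 0 mod p. Counting the
   pairs in Pl in two ways gives #|Sl| * #|Kl| = #|M|, whence Kl = perp Sl. *)
Definition Kl l A : {set M} := [set y | `[< exists X Y, [/\ dv 1 X, rdm Y = y & cm A X = p ^+ l *: Y] >]].
Lemma KlP l A y : reflect (exists X Y, [/\ dv 1 X, rdm Y = y & cm A X = p ^+ l *: Y]) (y \in Kl l A).
Proof. by rewrite inE; exact: asboolP. Qed.

(** Pairs [(X, Y)] mod [p] with [[X, A] = p^l Y], packed into one 3 by 6 matrix so that both
    projections are additive maps of a finite group. *)
Definition Pl l A : {set 'M[F]_(3, 3 + 3)} :=
  [set w | `[< exists X Y, [/\ rdm X = lsubmx w, rdm Y = rsubmx w & cm A X = p ^+ l *: Y] >]].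
Lemma PlP l A (w : 'M[F]_(3, 3 + 3)) : reflect (exists X Y, [/\ rdm X = lsubmx w, rdm Y = rsubmx w & cm A X = p ^+ l *: Y])
  (w \in Pl l A).
Proof. by rewrite inE; exact: asboolP. Qed.

Lemma Sl_ext l A A' : dv l (A - A') -> Sl l A = Sl l A'.
Proof.
move=> h; apply/setP => s; apply/SlP/SlP => -[Y YE hY]; exists Y => //.
  have -> : A' = A - (A - A') by rewrite opprB addrC subrK.
  rewrite cmDl; apply: dvD => //; apply: dvB; [apply: dvMl; exact: dvN|apply: dvMr; exact: dvN].
have -> : A = A' + (A - A') by rewrite addrC subrK.
rewrite cmDl; apply: dvD => //; apply: dvB; [exact: dvMl|exact: dvMr].
Qed.

Lemma Sl_le l m A : (l <= m)%N -> Sl m A \subset Sl l A.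
Proof.
by move=> lm; apply/subsetP => s /SlP[Y YE h]; apply/SlP; exists Y => //; exact: dv_ge h.
Qed.

Lemma Sl_0 A : Sl 0 A = setT.
Proof.
by apply/setP => s; rewrite in_setT; apply/SlP; have [Y YE] := rdm_surj s; exists Y => //; exact: dv_0.
Qed.

Lemma Sl0 l A : 0 \in Sl l A.
Proof. by apply/SlP; exists 0; rewrite ?map_mx0 // /cm mul0r mulr0 subrr; exact: dv0. Qed.
Lemma SlB l A : {in Sl l A &, forall x y, x - y \in Sl l A}.
Proof.
move=> x y /SlP[X XE hX] /SlP[Y YE hY]; apply/SlP; exists (X - Y); first by rewrite rdmB XE YE.
by rewrite cmB; apply: dvB.
Qed.
Lemma SlZ l A a x : x \in Sl l A -> a *: x \in Sl l A.
Proof.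
move=> /SlP[X XE hX]; have [b bE] := ldS L a; apply/SlP; exists (b *: X).
  by rewrite rdmZ XE bE.
by rewrite cmZ; apply: dvZ.
Qed.

Lemma Pl0 l A : 0 \in Pl l A.
Proof.
apply/PlP; exists 0, 0; split; try by rewrite linear0 map_mx0.
by rewrite scaler0 /cm mul0r mulr0 subrr.
Qed.
Lemma PlB l A (x y : 'M[F]_(3, 3 + 3)) : x \in Pl l A -> y \in Pl l A -> x - y \in Pl l A.
Proof.
move=> /PlP[X [X' [h1 h2 h3]]] /PlP[Y [Y' [k1 k2 k3]]]; apply/PlP; exists (X - Y), (X' - Y').
by split; [rewrite rdmB h1 k1 linearB|rewrite rdmB h2 k2 linearB|rewrite cmB h3 k3 scalerBr].
Qed.

(** The projection to [X] has image [Sl l A], and its kernel consists of the leading terms with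
    [X = 0] mod [p]. *)
Lemma card_Pl_l l A : #|Pl l A| = (#|Sl l A| * #|Kl l A|)%N.
Proof.
rewrite (@card_additive _ _ (Pl l A) (lsubmx : 'M[F]_(3, 3 + 3) -> M) (Pl0 l A) (@PlB l A)); last first.
  by move=> x y _ _; exact: linearB.
congr (_ * _)%N.
  apply: eq_card => s; apply/imsetP/SlP => [[w /PlP[X [Y [h1 h2 h3]]] ->]|[X XE [Y YE]]].
    by exists X => //; exists Y.
  exists (row_mx s (rdm Y)); last by rewrite row_mxKl.
  by apply/PlP; exists X, Y; rewrite row_mxKl row_mxKr.
rewrite -(card_in_imset (f := rsubmx : 'M[F]_(3, 3 + 3) -> M)); last first.
  move=> w v /setIdP[_ /eqP hw] /setIdP[_ /eqP hv] e.
  by rewrite -(hsubmxK w) -(hsubmxK v) hw hv e.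
apply: eq_card => y; apply/imsetP/KlP => [[w /setIdP[/PlP[X [Y [h1 h2 h3]]] /eqP h4] ->]|[X [Y [h1 h2 h3]]]].
  by exists X, Y; split=> //; apply/rdmP; rewrite h1 h4.
exists (row_mx 0 y); last by rewrite row_mxKr.
apply/setIdP; rewrite row_mxKl; split=> //; apply/PlP; exists X, Y.
by rewrite row_mxKl row_mxKr; split=> //; apply/rdmP.
Qed.

(** The projection to [Y] has image [Kl l.+1 A], since [X] can be replaced by [p X]; its kernel is
    [Sl l.+1 A], since [Y = 0] mod [p] raises the level by one. *)
Lemma card_Pl_r l A : #|Pl l A| = (#|Kl l.+1 A| * #|Sl l.+1 A|)%N.
Proof.
rewrite (@card_additive _ _ (Pl l A) (rsubmx : 'M[F]_(3, 3 + 3) -> M) (Pl0 l A) (@PlB l A)); last first.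
  by move=> x y _ _; exact: linearB.
congr (_ * _)%N.
  apply: eq_card => y; apply/imsetP/KlP => [[w /PlP[X [Y [h1 h2 h3]]] ->]|[X [Y [[T ->] YE]]]].
    exists (p *: X), Y; split; [by exists X; rewrite expr1|by []|].
    by rewrite cmZ h3 scalerA exprS.
  rewrite expr1 cmZ exprS -scalerA -{1 2}[p]expr1 => /powI h.
  exists (row_mx (rdm T) y); last by rewrite row_mxKr.
  by apply/PlP; exists T, Y; rewrite row_mxKl row_mxKr.
rewrite -(card_in_imset (f := lsubmx : 'M[F]_(3, 3 + 3) -> M)); last first.
  move=> w v /setIdP[_ /eqP hw] /setIdP[_ /eqP hv] e.
  by rewrite -(hsubmxK w) -(hsubmxK v) hw hv e.
apply: eq_card => s; apply/imsetP/SlP => [[w /setIdP[/PlP[X [Y [h1 h2 h3]]] /eqP h4] ->]|[X XE [Y YE]]].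
  exists X => //; rewrite h3; have [Z ->] : dv 1 Y by apply/rdmP; rewrite h2.
  by exists Z; rewrite scalerA -exprD addn1.
exists (row_mx s 0); last by rewrite row_mxKl.
apply/setIdP; rewrite row_mxKr; split=> //; apply/PlP; exists X, (p *: Y).
rewrite row_mxKl row_mxKr YE scalerA exprSr; split=> //.
by rewrite rdmZ rd_p scale0r.
Qed.

Lemma card_SK l A : (#|Sl l A| * #|Kl l A|)%N = #|[set: M]|.
Proof.
elim: l => [|l IH]; last by rewrite mulnC -card_Pl_r card_Pl_l IH.
rewrite Sl_0 (_ : Kl 0 A = [set 0]) ?cards1 ?muln1 //.
apply/setP => y; rewrite in_set1; apply/KlP/eqP => [[X [Y [hX <-]]]|->].
  by rewrite expr0 scale1r => <-; apply/rdmP; apply: dvB; [exact: dvMr|exact: dvMl].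
exists 0, 0; split; [exact: dv0|exact: map_mx0|by rewrite /cm mul0r mulr0 subrr scaler0].
Qed.

(** The identity [tr (W [X, A]) = - tr ([W, A] X)], with [X] divisible by [p] and [[W, A]] by [p^l],
    gives one inclusion; equality follows as both sides have the same cardinality by [card_SK] and
    [card_perp]. *)
Lemma Kl_perp l A : Kl l A = perp (Sl l A).
Proof.
apply/eqP; rewrite eqEcard; apply/andP; split; last first.
  have := card_perp (Sl0 l A) (@SlB l A) (@SlZ l A); rewrite -(card_SK l A) => /eqP.
  rewrite eqn_pmul2l => [/eqP -> //|].
  by apply/card_gt0P; exists 0; exact: Sl0.
apply/subsetP => y /KlP[X [Y [[T XE] YE h]]]; apply/perpP => s /SlP[W WE [Z hZ]].
have e : \tr (W * cm A X) = - \tr (cm A W * X).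
  have trO (U V : MO) : \tr (U * V) = \tr (V * U) by exact: mxtrace_mulC.
  have trOB (U V : MO) : \tr (U - V) = \tr U - \tr V by exact: raddfB.
  by rewrite /cm mulrBr mulrBl !trOB opprB !mulrA -(mulrA A) (trO A).
move: e; rewrite h hZ -scalerAr -scalerAl !mxtraceZ -mulrN => /(mulfI (p_neq0 l)) e.
rewrite -WE -YE -rdmM trace_map_mx e XE -scalerAr mxtraceZ rmorphN rmorphM expr1 rd_p.
by rewrite mul0r oppr0.
Qed.

(** By hypothesis each [s] in [S] has a representative [Y0] commuting with [A] mod [p^(l+1)]. Its
    commutator with [p^l X] can be cancelled by changing [Y0] within its residue class exactly when
    that commutator mod [p] is a leading term, that is, lies in [perp S]. *)
Lemma stab_lift l A X : Sl l.+1 A = Sl l A ->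
  Sl l.+1 (A + p ^+ l *: X) = stab (Sl l A) (rdm X).
Proof.
move=> good; apply/setP => s; apply/SlP/stabP => [[Y YE hY]|[sS hp]].
  have hA : dv l (cm A Y).
    have -> : cm A Y = cm (A + p ^+ l *: X) Y - p ^+ l *: cm X Y by rewrite cmDl cmZl addrK.
    by apply: dvB; [apply: dv_ge hY | exact: dv_pow].
  have sS : s \in Sl l A by apply/SlP; exists Y.
  split=> //; have : s \in Sl l.+1 A by rewrite good.
  case/SlP => Y0 Y0E [Z0 hZ0]; move: hY => [Z hZ].
  rewrite -Kl_perp; apply/KlP; exists (Y0 - Y), (cm X Y + p *: (Z0 - Z)); split.
  - by apply/rdm_eq; rewrite Y0E YE.
  - by rewrite rdmD rdmZ rd_p scale0r addr0 /cm rdmB !rdmM YE.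
  rewrite cmB hZ0; move: hZ; rewrite cmDl cmZl => /(canRL (addrK _)) ->.
  move: (cm X Y) => U; by rewrite [RHS]scalerDr [in RHS]scalerA -exprSr [in RHS]scalerBr opprB addrCA.
have : s \in Sl l.+1 A by rewrite good.
case/SlP => Y0 Y0E hY0; move: hp; rewrite -Kl_perp => /KlP[T [Y [hT YE hY]]].
exists (Y0 - T); first by rewrite rdmB (proj2 (rdmP T) hT) subr0.
have -> : cm (A + p ^+ l *: X) (Y0 - T) = cm A Y0 + (p ^+ l *: (cm X Y0 - Y) - p ^+ l *: cm X T).
  rewrite cmDl cmB cmZl cmB hY; move: (cm A Y0) (cm X Y0) (cm X T) => U0 U1 U2.
  by rewrite !scalerBr -!addrA; congr (_ + _); rewrite addrCA.
apply: dvD => //; rewrite -addn1; apply: dvB; apply: dv_add; last by apply: dvB; [exact: dvMr|exact: dvMl].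
by apply/rdm_eq; rewrite /cm rdmB !rdmM Y0E YE.
Qed.

(* The Cayley transform turns unitary into skew elements, whose congruences lift
   exactly; the norm-one factor la avoids the eigenvalue -1. *)
Lemma uni_lift l A h : starO A + A = 0 -> h \in Sl l A -> star h * h = 1 ->
  exists g, [/\ starO g * g = 1, rdm g = h & dv l (cm A g)].
Proof.
move=> sA /SlP[Y YE hY] hu.
have [la [ll uD [w w0 lE]]] := norm1_unit Q h.
have [W WE] := ldS L w.
have uW : W \is a GRing.unit by apply: (ldU L); rewrite WE.
have ucW : circ W \is a GRing.unit by rewrite rmorph_unit.
pose lam := W / circ W.
have ulam : lam \is a GRing.unit by rewrite unitrM uW unitrV.
have rl : rd lam = la by rewrite /lam rmorphM rmorphV // (ldc L) WE lE.
have cl : circ lam^-1 = lam.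
  by rewrite /lam invrM ?unitrV // invrK rmorphM rmorphV // (ldK L).
have l0 : la != 0 by apply/eqP => l0; move: ll; rewrite l0 mul0r => /eqP; rewrite eq_sym oner_eq0.
have clE : c la = la^-1 by apply: (mulfI l0); rewrite ll divff.
pose D := 1 + lam *: Y.
have rD : rdm D = 1 + la *: h by rewrite /D rdmD rdm1 rdmZ rl YE.
have uDD : D \is a GRing.unit by apply: rdm_unit; rewrite rD.
(* The residue [la *: h] is unitary, so its Cayley transform is already skew; the skew part [K'] has
   the same residue. Transforming back and dividing by [lam] gives an exactly unitary lift of
   [h]. *)
pose K := (1 - lam *: Y) * D^-1; pose K' := (2%:R^-1 : O) *: (K - starO K).
have rK : rdm K = (1 - la *: h) * (1 + la *: h)^-1.
  by rewrite /K rdmM rdmB rdm1 rdmZ rl YE rdmV ?rD.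
have uh := uni_unit hu.
have sh : star h = h^-1 by rewrite (uni_inv hu).
have comm1 : (1 + la *: h) * (1 - la *: h) = (1 - la *: h) * (1 + la *: h).
  exact: comm_pm.
have skK : star (rdm K) + rdm K = 0.
  have e1 : star (1 + la *: h) * (la *: h) = 1 + la *: h.
    rewrite (stD S) (st1 S) (stZ S) sh clE mulrDl mul1r -scalerAl -scalerAr scalerA mulVf // scale1r.
    by rewrite mulVr // addrC.
  have e2 : star (1 - la *: h) * (la *: h) = - (1 - la *: h).
    rewrite (stB S) (st1 S) (stZ S) sh clE mulrBl mul1r -scalerAl -scalerAr scalerA mulVf // scale1r.
    by rewrite mulVr // opprB.
  have ulh : la *: h \is a GRing.unit by rewrite scaler_unit ?unitfE.
  rewrite rK (stM S) (stV S) //.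
  have -> : star (1 + la *: h) = (1 + la *: h) * (la *: h)^-1 by apply: (mulIr ulh); rewrite e1 mulrVK.
  have -> : star (1 - la *: h) = - (1 - la *: h) * (la *: h)^-1 by apply: (mulIr ulh); rewrite e2 mulrVK.
  have ulV : (la *: h)^-1 \is a GRing.unit by rewrite unitrV.
  rewrite invrM // invrK !mulNr mulrN -(mulrA (la *: h)) .
  have -> : (1 + la *: h)^-1 * ((1 - la *: h) / (la *: h)) = (1 - la *: h) * (1 + la *: h)^-1 / (la *: h).
    by rewrite mulrA; congr (_ * _); apply: (mulrI uD); rewrite mulVKr // !mulrA comm1 mulrK.
  have -> : la *: h * ((1 - la *: h) * (1 + la *: h)^-1 / (la *: h)) = (1 - la *: h) * (1 + la *: h)^-1.
    have cc : la *: h * ((1 - la *: h) * (1 + la *: h)^-1) = (1 - la *: h) * (1 + la *: h)^-1 * (la *: h).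
      apply: (mulIr uD); rewrite -!mulrA mulVr // mulr1.
      have -> : la *: h * (1 + la *: h) = (1 + la *: h) * (la *: h) by rewrite mulrDl mulrDr mul1r mulr1.
      by rewrite mulKr // mulrBl mulrBr mul1r mulr1.
    by rewrite mulrA cc mulrK.
  by rewrite addNr.
have sK' : starO K' + K' = 0 by exact: (skew_half SO _ twoU).
have rK' : rdm K' = rdm K.
  rewrite /K' rdmZ rdmB rdm_st rmorphV ?twoU // rmorph_nat.
  by apply: half_skew => //; rewrite unitfE (q2 Q).
have r1K : rdm (1 + K') = (2%:R : F) *: (1 + la *: h)^-1.
  rewrite rdmD rdm1 rK' rK.
  transitivity ((1 + la *: h) / (1 + la *: h) + (1 - la *: h) / (1 + la *: h)); first by rewrite (mulrV uD).
  by rewrite -mulrDl addrACA subrr addr0 -mulr2n mulrnAl mul1r scaler_nat.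
have u2 : (2%:R : F) != 0 := q2 Q.
have u1K : 1 + K' \is a GRing.unit.
  by apply: rdm_unit; rewrite r1K scaler_unit ?unitfE // unitrV.
exists (lam^-1 *: ((1 - K') * (1 + K')^-1)); split.
- rewrite (stZ SO) cl -scalerAl -scalerAr scalerA mulrV // scale1r.
  exact: (cayley_uni SO).
- rewrite rdmZ rmorphV // rl rdmM rdmV ?r1K; last by rewrite scaler_unit ?unitfE // unitrV.
  have -> : rdm (1 - K') = (2%:R : F) *: ((la *: h) * (1 + la *: h)^-1).
    rewrite rdmB rdm1 rK' rK.
    transitivity ((1 + la *: h) / (1 + la *: h) - (1 - la *: h) / (1 + la *: h)); first by rewrite (mulrV uD).
    by rewrite -mulrBl opprB addrC addrA subrK -mulr2n mulrnAl scaler_nat.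
  have two_inv (H E : M) : E \is a GRing.unit -> (2%:R : F) *: (H * E^-1) * ((2%:R : F) *: E^-1)^-1 = H.
    move=> uE; rewrite invrZ ?unitfE ?unitrV // invrK -scalerAl -scalerAr scalerA divff // scale1r.
    by rewrite mulrVK.
  by rewrite two_inv // scalerA mulVf // scale1r.
have hcK : dv l (cm A K).
  rewrite /K cmM cmV // mulrN; apply: dvD.
    have hD : dv l (cm A D) by rewrite /D cmD cm1 add0r cmZ; apply: dvZ.
    by apply: dvN; apply: dvMl; apply: dvMr; apply: dvMl.
  by apply: dvMr; rewrite cmB cm1 sub0r cmZ; apply: dvN; apply: dvZ.
have hK' : dv l (cm A K').
  by rewrite /K' cmZ cmB (cm_st _ sA); apply: dvZ; apply: dvB => //; apply: dv_st.
rewrite cmZ cmM cmV // mulrN; apply: dvZ; apply: dvD.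
  by apply: dvN; apply: dvMl; apply: dvMr; apply: dvMl; rewrite cmD cm1 add0r.
by apply: dvMr; rewrite cmB cm1 sub0r; apply: dvN.
Qed.

End Local.

Section CentSub.
Variables (F : finFieldType) (c : {rmorphism F -> F}) (q : nat).
Hypothesis Q : qext c q.
Local Notation M := 'M[F]_3.
Local Notation rk1 := (rank1 c).
Local Notation vst := (vstar c).

(* The bicommutant of a + e v* v consists of the combinations of 1 and v* v. *)
Lemma rk1_cent_sub a e v (B : M) : e != 0 -> v != 0 ->
  cent (a%:M + rk1 e v) \subset cent B -> ~~ is_scalar_mx B -> cent (a%:M + rk1 e v) = cent B.
Proof.
move=> e0 v0 /subsetP sub nB.
have [y1 [z1 [_ [yv vz _ [yz _ _]]]]] := rk1_frame c v0.
have com (y : 'rV[F]_3) (z : 'cV[F]_3) : y *m vst v = 0 -> v *m z = 0 -> z *m y *m B = B *m z *m y.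
  by move=> hy hz; have /sub/centP := cent_rk1 a e hz hy; rewrite -!mulmxE !mulmxA.
pose al := (y1 *m B *m z1) 0 0.
have Bz (z : 'cV[F]_3) : v *m z = 0 -> B *m z = al *: z.
  move=> hz; have := congr1 (mulmx^~ z1) (com _ _ yv hz).
  rewrite -(mulmxA _ y1 z1) yz mulmx1 -!mulmxA (mulmxA y1) [y1 *m B *m z1]mx11_scalar -/al.
  by rewrite mul_mx_scalar => <-.
have yB (y : 'rV[F]_3) : y *m vst v = 0 -> y *m B = al *: y.
  move=> hy; have := congr1 (mulmx y1) (com _ _ hy vz).
  by rewrite !mulmxA yz mul1mx [y1 *m B *m z1]mx11_scalar -/al mul_scalar_mx.
pose X := B - al%:M.
have Xz (z : 'cV[F]_3) : v *m z = 0 -> X *m z = 0.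
  by move=> hz; rewrite /X mulmxBl Bz // mul_scalar_mx subrr.
have yX (y : 'rV[F]_3) : y *m vst v = 0 -> y *m X = 0.
  by move=> hy; rewrite /X mulmxBr yB // mul_mx_scalar subrr.
have BE : B = al%:M + X by rewrite addrC subrK.
clearbody X; have [u vu] := rowvec_right_inverse v0; pose u' := map_mx c u^T.
have uv' : u' *m vst v = 1%:M.
  by rewrite /u' /vstar -map_trmx -trmx_mul -map_mxM vu map_scalar_mx rmorph1 tr_scalar_mx.
have X1 : X = X *m u *m v.
  apply/eqP; rewrite -subr_eq0 -mulmxA -[X in X - _]mulmx1 -mulmxBr; apply/eqP/matrixP => i j.
  have h2 : v *m col j (1%:M - u *m v) = 0.
    by rewrite colE mulmxA mulmxBr mulmx1 mulmxA vu mul1mx subrr mul0mx.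
  by have := Xz _ h2; rewrite colE mulmxA -colE => /matrixP/(_ i 0); rewrite !mxE.
have X2 : X = vst v *m (u' *m X).
  apply/eqP; rewrite -subr_eq0 mulmxA -[X in X - _]mul1mx -mulmxBl; apply/eqP/matrixP => i j.
  have h1 : matrix.row i (1%:M - vst v *m u') *m vst v = 0.
    by rewrite -row_mul mulmxBl mul1mx -mulmxA uv' mulmx1 subrr row0.
  by have := yX _ h1; rewrite -row_mul => /matrixP/(_ 0 j); rewrite !mxE.
have XE : X = rk1 ((u' *m X *m u) 0 0) v.
  rewrite {1}X2 {1}X1 /rank1 -!mulmxA (mulmxA u') (mulmxA (u' *m X)) [in LHS](mx11_scalar (u' *m X *m u)).
  by rewrite mul_scalar_mx -scalemxAr !mulmxA.
move: ((u' *m X *m u) 0 0) XE => k XE.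
have k0 : k != 0.
  apply: contraNneq nB => k0; rewrite BE XE k0 /rank1 scale0r addr0; exact: scalar_mx_is_scalar.
apply/setP => s; rewrite BE XE /rank1; apply/centP/centP; rewrite -!mulmxE !mulmxDr !mulmxDl !scalar_mxC;
  move=> /addrI; rewrite -!scalemxAl -!scalemxAr => /scalerI h; rewrite h //.
Qed.

End CentSub.

(** * Lifting conjugacy and the shapes of integral skew matrices *)

Section Lifting.
Variables (O : idomainType) (circ : {rmorphism O -> O}) (p : O).
Variables (F : finFieldType) (rd : {rmorphism O -> F}) (c : {rmorphism F -> F}) (q : nat).
Hypothesis L : local_ext circ p rd c q.
Let Q := ldQ L.
Let cK := qcK Q.
Local Notation MO := 'M[O]_3.
Local Notation M := 'M[F]_3.
Local Notation sk := (sk c).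
Local Notation star := (@conjmx F c 3).
Local Notation starO := (@conjmx O circ 3).
Let S : star_axiom c star := conjmx_star cK.
Let SO : star_axiom circ starO := conjmx_star (ldK L).
Local Notation rdm := (map_mx rd).
Local Notation dv := (dv p).
Local Notation Sl := (Sl p rd).
Local Notation mtype := (matrix_type c).
Implicit Types (A B X Y Z W : MO) (x y s h : M) (l m : nat).

Lemma halfP Y : starO ((2%:R^-1 : O) *: (Y - starO Y)) + (2%:R^-1 : O) *: (Y - starO Y) = 0.
Proof. exact: (skew_half SO _ (twoU L)). Qed.

Lemma rdm_half Y : star (rdm Y) + rdm Y = 0 -> rdm ((2%:R^-1 : O) *: (Y - starO Y)) = rdm Y.
Proof.
move=> sY; rewrite rdmZ rdmB (rdm_st L) rmorphV ?(twoU L) // rmorph_nat.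
by apply: half_skew => //; rewrite unitfE (q2 Q).
Qed.

Lemma skew_comm_lift l A h : starO A + A = 0 -> h \in Sl l A -> star h + h = 0 ->
  exists Y, [/\ starO Y + Y = 0, rdm Y = h & dv l (cm A Y)].
Proof.
move=> sA /SlP[Y YE hY] sh; exists ((2%:R^-1 : O) *: (Y - starO Y)); split.
- exact: halfP.
- by rewrite rdm_half YE.
by rewrite cmZ cmB (cm_st L _ sA); apply: dvZ; apply: dvB => //; apply: (dv_st L).
Qed.

(** For the converse, [h] is lifted to a unitary [g0] commuting with [A] mod [p^l]. The remaining
    error lies in [perp S], hence is a leading term of some [[T, A]] with [T] skew and zero mod [p];
    the Cayley transform of [T] removes it. *)
Lemma conj_lift l A X X' B : starO A + A = 0 -> starO X + X = 0 -> starO X' + X' = 0 ->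
  Sl l.+1 A = Sl l A -> Sl l A = cent (rdm B) ->
  (exists2 g, starO g * g = 1 & dv l.+1 (g * (A + p ^+ l *: X) - (A + p ^+ l *: X') * g))
  <-> equiv star (Sl l A) (rdm X) (rdm X').
Proof.
move=> sA sX sX' good SB; split=> [[g gu [Z hZ]]|[h [hu hS] hp]].
  have uE : star (rdm g) * rdm g = 1 by rewrite -(rdm_st L) -rdmM gu rdm1.
  have E : cm A g = p ^+ l.+1 *: Z - p ^+ l *: (g * X - X' * g).
    rewrite -hZ /cm !mulrDr !mulrDl -!scalerAl -!scalerAr scalerBr opprD.
    move: (g * A) (A * g) (p ^+ l *: (g * X)) (p ^+ l *: (X' * g)) => a b d e.
    by rewrite [a + d + _]addrACA addrK.
  have gS : rdm g \in Sl l A.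
    by apply/SlP; exists g => //; rewrite E; apply: dvB; exact: dv_pow.
  exists (rdm g) => //; have : rdm g \in Sl l.+1 A by rewrite good.
  case/SlP => Y0 Y0E [Z0 hZ0].
  rewrite -(Kl_perp L); apply/KlP; exists (Y0 - g), (g * X - X' * g + p *: (Z0 - Z)); split.
  - by apply/(rdm_eq L).
  - by rewrite rdmD rdmZ (rd_p L) scale0r addr0 rdmB !rdmM.
  rewrite cmB hZ0 E; move: (g * X - X' * g) => U.
  by rewrite [RHS]scalerDr [in RHS]scalerA -exprSr [in RHS]scalerBr opprB addrCA.
have : h \in Sl l.+1 A by rewrite good.
case/(uni_lift L sA)/(_ hu) => g0 [g0u g0E hg0].
have uh := uni_unit hu; have hV := uni_inv hu.
have two : (2%:R : F) != 0 := q2 Q.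
(* The factor 1/2 compensates [(1 + T) / (1 - T)] being [1 + 2 T] to first order. *)
pose y := (2%:R^-1 : F) *: (rdm X' - h * rdm X * h^-1).
have sx Z : starO Z + Z = 0 -> star (rdm Z) = - rdm Z.
  by move=> sZ; apply/eqP; rewrite -addr_eq0 -(rdm_st L) -rdmD sZ map_mx0.
have yS : y \in perp (Sl l A).
  have -> : y = (- 2%:R^-1 : F) *: ((h * rdm X - rdm X' * h) * h^-1).
    by rewrite mulrBl mulrK // scaleNr -scalerN opprB.
  rewrite SB; apply: perp_centZ; apply: perp_centMr; rewrite -?SB //.
  by rewrite SB; apply: centV; rewrite -SB.
have sy : star y + y = 0.
  rewrite /y (stZ S) fmorphV rmorph_nat -scalerDr (stB S) hV !(stM S) (stK S) !sx //.
  by rewrite mulNr mulrN opprK mulrA addrACA addNr add0r subrr scaler0.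
move: yS; rewrite -(Kl_perp L) => /KlP[T0 [W0 [hT0 W0E hW0]]].
pose T := (2%:R^-1 : O) *: (T0 - starO T0); pose W := (2%:R^-1 : O) *: (W0 - starO W0).
have sT : starO T + T = 0 by exact: halfP.
have dT : dv 1 T by apply: dvZ; apply: dvB => //; apply: (dv_st L).
have rW : rdm W = y by rewrite rdm_half W0E.
have hT : cm A T = p ^+ l *: W.
  rewrite /T cmZ cmB (cm_st L _ sA) hW0 (stZ SO) (c_pow L) -scalerBr /W.
  by rewrite !scalerA mulrC.
have rT : rdm T = 0 by apply/(rdmP L).
clearbody T W.
have sN : starO (- T) + - T = 0 by rewrite (stN SO) -opprD sT oppr0.
have r1T : rdm (1 - T) = 1 by rewrite rdmB rdm1 rT subr0.
have u1T : 1 - T \is a GRing.unit by apply: (rdm_unit L); rewrite r1T unitr1.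
pose V := (1 - T)^-1.
have rV : rdm V = 1 by rewrite /V (rdmV L) r1T ?invr1 // unitr1.
pose g1 := (1 + T) * V.
have r1 : rdm g1 = 1 by rewrite /g1 rdmM rV mulr1 rdmD rdm1 rT addr0.
have g1u : starO g1 * g1 = 1.
  by have := cayley_uni SO sN u1T; rewrite opprK.
have hg1 : cm A g1 = p ^+ l *: ((1 + T) * (V * W * V) + W * V).
  have hcV : cm A V = p ^+ l *: (V * W * V).
    by rewrite /V cmV // -/V cmB cm1 sub0r hT mulrN mulNr opprK -scalerAr -scalerAl.
  by rewrite /g1 cmM hcV cmD cm1 add0r hT -scalerAr -scalerAl -scalerDr.
clearbody g1; clearbody V; exists (g1 * g0).
  by rewrite (stM SO) -mulrA (mulrA (starO g1)) g1u mul1r.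
have -> : g1 * g0 * (A + p ^+ l *: X) - (A + p ^+ l *: X') * (g1 * g0) =
  g1 * cm A g0 + p ^+ l *: (((1 + T) * (V * W * V) + W * V) * g0 + g1 * g0 * X - X' * (g1 * g0)).
  move: hg1; move: ((1 + T) * (V * W * V) + W * V) => U hg1.
  have -> : p ^+ l *: (U * g0 + g1 * g0 * X - X' * (g1 * g0)) =
      cm A g1 * g0 + p ^+ l *: (g1 * g0 * X) - p ^+ l *: (X' * (g1 * g0)).
    by rewrite hg1 -scalerAl scalerBr scalerDr.
  rewrite /cm mulrDr mulrDl mulrBr mulrBl -scalerAl -scalerAr !mulrA.
  move: (g1 * g0 * A) (g1 * A * g0) (A * g1 * g0) (p ^+ l *: (g1 * g0 * X)) (p ^+ l *: (X' * g1 * g0)) => a b d e f.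
  by rewrite opprD !addrA subrK; congr (_ - _); rewrite addrAC.
apply: dvD; first exact: dvMl.
rewrite -addn1; apply: dv_add; apply/(rdmP L).
rewrite rdmB rdmD !rdmM rdmD !rdmM rdmD rdm1 rT addr0 rV r1 rW g0E !(mul1r, mulr1).
by rewrite -mulr2n -scaler_nat /y scalerA divff // scale1r mulrBl mulrVK // subrK subrr.
Qed.

(* Every skew A has one of three shapes mod p^l, and each shape exhibits a lift of
   A mod p^l whose residual centraliser does not shrink at level l + 1. *)
Definition str_scalar l A := exists2 a, circ a = - a & dv l (A - a%:A).
Definition str_rank1 l A := exists a e v m, [/\ circ a = - a, circ e = - e, rd e != 0,
  map_mx rd v != 0 & (m < l)%N /\ dv l (A - (a%:A + p ^+ m *: rank1 circ e v))].
Definition str_regular l A := exists B, [/\ starO B + B = 0, cyclic_mx (rdm B),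
  Sl l A = cent (rdm B) & exists a b d, dv l (A - (a%:A + b *: B + d *: B ^+ 2))].
Definition str l A := [\/ str_scalar l A, str_rank1 l A | str_regular l A].

Lemma cm_scal a Y : cm (a%:A) Y = 0.
Proof. by rewrite /cm -scalerAl -scalerAr mul1r mulr1 subrr. Qed.

Lemma Sl_scalar l a : Sl l (a%:A) = [set: M].
Proof.
apply/setP => s; rewrite in_setT; have [Y YE] := rdm_surj L s.
by apply/SlP; exists Y => //; rewrite cm_scal; exact: dv0.
Qed.

Lemma sk_lift al : al \in sk -> exists2 a, circ a = - a & rd a = al.
Proof.
rewrite skE => /eqP ca; have [b bE] := ldS L al.
have c2 : circ 2%:R^-1 = 2%:R^-1 by rewrite rmorphV ?(twoU L) // rmorph_nat.
exists (2%:R^-1 * (b - circ b)); first by rewrite rmorphM c2 rmorphB (ldK L) -mulrN opprB.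
rewrite rmorphM rmorphB (ldc L) bE ca opprK rmorphV ?(twoU L) // rmorph_nat.
by have two := q2 Q; field.
Qed.

Lemma vec_lift n k (v : 'M[F]_(n, k)) : exists V, map_mx rd V = v.
Proof.
have h1 (ij : 'I_n * 'I_k) : exists y : O, rd y = v ij.1 ij.2 by apply: (ldS L).
have [f fE] := fin_all_exists h1; exists (\matrix_(i, j) f (i, j)).
by apply/matrixP => i j; rewrite !mxE fE.
Qed.

Lemma rdm_rk1 e v : rdm (rank1 circ e v) = rank1 c (rd e) (map_mx rd v).
Proof.
rewrite /rank1 map_mxZ map_mxM; congr (_ *: (_ *m _)).
by apply/matrixP => i j; rewrite !mxE (ldc L).
Qed.

Lemma rk1_skew e v : circ e = - e -> starO (rank1 circ e v) + rank1 circ e v = 0.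
Proof.
move=> ce; rewrite /rank1 (stZ SO) (star_outer (ldK L)) ce scaleNr; exact: addNr.
Qed.

Lemma scal_skew a : circ a = - a -> starO a%:A + a%:A = 0.
Proof. by move=> ca; rewrite (st_scal SO) ca scaleNr addNr. Qed.

Lemma vec_unit (v : 'rV[O]_3) : map_mx rd v != 0 -> exists u : 'cV[O]_3, v *m u = 1%:M.
Proof.
move=> v0; have [j vj] : exists j, rd (v 0 j) != 0.
  apply/existsP; rewrite -negb_forall; apply: contraNN v0 => /forallP h.
  by apply/eqP/rowP => j; rewrite !mxE; apply/eqP.
exists ((v 0 j)^-1 *: delta_mx j 0); rewrite -scalemxAr -colE; apply/matrixP => i k.
by rewrite !ord1 !mxE /= mulVr // (ldU L).
Qed.

(** Commuting with [v* v] mod [p] means [v s = la v] and [s v* = la v*]. Any lift of [s] is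
    corrected so that both hold exactly over the integers. *)
Lemma rk1_comm_lift e (v : 'rV[O]_3) s : rd e != 0 -> map_mx rd v != 0 ->
  s \in cent (rdm (rank1 circ e v)) -> exists2 Y, rdm Y = s & cm (rank1 circ e v) Y = 0.
Proof.
move=> e0 v0 sC; have [u vu] := vec_unit v0.
pose w := vstar circ v; pose u' : 'rV[O]_3 := map_mx circ u^T.
have uw : u' *m w = 1%:M.
  by rewrite /u' /w /vstar -map_trmx -trmx_mul -map_mxM vu map_scalar_mx rmorph1 tr_scalar_mx.
have hs : s *m (map_mx rd w *m map_mx rd v) = (map_mx rd w *m map_mx rd v) *m s.
  move/centP: sC; rewrite /rank1 -/w map_mxZ map_mxM -!mulmxE -scalemxAl -scalemxAr => /scalerI; exact.
have uwb : map_mx rd u' *m map_mx rd w = 1%:M by rewrite -map_mxM uw map_mx1.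
have vub : map_mx rd v *m map_mx rd u = 1%:M by rewrite -map_mxM vu map_mx1.
pose la := (map_mx rd u' *m s *m map_mx rd w) 0 0.
have vs : map_mx rd v *m s = la *: map_mx rd v.
  have := congr1 (mulmx (map_mx rd u')) hs.
  by rewrite !mulmxA uwb mul1mx => <-; rewrite [_ *m s *m _ in LHS]mx11_scalar mul_scalar_mx.
have sw : s *m map_mx rd w = la *: map_mx rd w.
  have := congr1 (mulmx^~ (map_mx rd u)) hs.
  rewrite -!mulmxA vub mulmx1 => ->; rewrite (mulmxA _ s) vs -scalemxAl vub.
  by rewrite scalemx1 mul_mx_scalar.
have [la' laE] := ldS L la; have [Y0 Y0E] := rdm_surj L s.
pose Y1 := Y0 - u *m (v *m Y0 - la' *: v).
have v1 : v *m Y1 = la' *: v.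
  by rewrite /Y1 mulmxBr mulmxA vu mul1mx opprB addrC subrK.
have r1 : map_mx rd (v *m Y0 - la' *: v) = 0.
  by rewrite map_mxB map_mxM map_mxZ laE Y0E vs subrr.
have Y1E : rdm Y1 = s by rewrite rdmB map_mxM r1 mulmx0 subr0 Y0E.
(* This enforces the column equation; the row equation survives because [v] kills the correction. *)
pose Y2 := Y1 - (Y1 *m w - la' *: w) *m u'.
have w2 : Y2 *m w = la' *: w.
  by rewrite /Y2 mulmxBl -mulmxA uw mulmx1 opprB addrC subrK.
have r2 : map_mx rd (Y1 *m w - la' *: w) = 0.
  by rewrite map_mxB map_mxM map_mxZ laE Y1E sw subrr.
have v2 : v *m Y2 = la' *: v.
  have vR : v *m (Y1 *m w - la' *: w) = 0.
    by rewrite mulmxBr (mulmxA v) v1 -scalemxAl -scalemxAr subrr.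
  by rewrite /Y2 mulmxBr (mulmxA v) vR mul0mx subr0.
exists Y2; first by rewrite rdmB map_mxM r2 mul0mx subr0 Y1E.
rewrite /cm /rank1 -/w -!mulmxE -scalemxAr -scalemxAl mulmxA w2 -mulmxA v2.
by rewrite -scalemxAl -scalemxAr subrr.
Qed.

(** The factor [p ^+ m] cancels and leaves a condition mod [p^(l-m)] with [l - m > 0]; so the result
    does not depend on [l]. *)
Lemma Sl_rank1 l m a e v : (m < l)%N -> rd e != 0 -> map_mx rd v != 0 ->
  Sl l (a%:A + p ^+ m *: rank1 circ e v) = cent (rdm (rank1 circ e v)).
Proof.
move=> ml e0 v0; apply/setP => s; apply/SlP/idP => [[Y YE]|sC].
  rewrite cmDl cm_scal add0r cmZl -(subnKC (ltnW ml)) => /(dv_cancel L) h.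
  have /(rdmP L) : dv 1 (cm (rank1 circ e v) Y) by apply: dv_ge h; rewrite subn_gt0.
  by rewrite /cm rdmB !rdmM YE => /subr0_eq h1; apply/centP.
have [Y YE hY] := rk1_comm_lift e0 v0 sC; exists Y => //.
by rewrite cmDl cm_scal add0r cmZl hY scaler0; exact: dv0.
Qed.

Lemma str_typed l A : starO A + A = 0 -> str l A ->
  exists (X : sh_type) B, [/\ starO B + B = 0, mtype X (rdm B) & Sl l A = cent (rdm B)].
Proof.
have sr B : starO B + B = 0 -> star (rdm B) + rdm B = 0.
  by move=> sB; rewrite -(rdm_st L) -rdmD sB map_mx0.
move=> sA [[a ca h]|[a [e [v [m [ca ce e0 v0 [ml h]]]]]]|[B [sB cB SE _]]].
- exists tyG, 0; split; first by rewrite (st0 SO) addr0.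
    by rewrite map_mx0 -(raddf0 (@scalar_mx F 3)); apply: skew_mtype_scalar; exact: sk0.
  rewrite (Sl_ext _ h) Sl_scalar map_mx0; apply/setP => s; rewrite in_setT; symmetry; apply/centP.
  by rewrite mulr0 mul0r.
- exists (if hnorm c (map_mx rd v) == 0 then tyJ else tyL), (rank1 circ e v).
  split; [exact: rk1_skew| |by rewrite (Sl_ext _ h) Sl_rank1].
  rewrite rdm_rk1; have es : rd e \in sk by rewrite skE -(ldc L) ce rmorphN.
  by have := skew_mtype_rk1 Q (sk0 c) es e0 v0; rewrite raddf0 add0r.
have [X _ mX] := skew_mtype_cyclic Q S (sr _ sB) cB.
by exists X, B.
Qed.

Lemma str_good l A : starO A + A = 0 -> str l A ->
  exists A0, [/\ starO A0 + A0 = 0, dv l (A - A0) & Sl l.+1 A0 = Sl l A0].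
Proof.
move=> sA [[a ca h]|[a [e [v [m [ca ce e0 v0 [ml h]]]]]]|[B [sB cB SE [a [b [d h]]]]]].
- by exists a%:A; split; [exact: scal_skew|by []|rewrite !Sl_scalar].
- exists (a%:A + p ^+ m *: rank1 circ e v); split=> //.
    rewrite (stD SO) (stZ SO (p ^+ m)) (c_pow L) addrACA -scalerDr rk1_skew // scaler0 addr0.
    exact: scal_skew.
  by rewrite !Sl_rank1 // ltnW.
pose A1 := a%:A + b *: B + d *: B ^+ 2.
(* The skew part of the polynomial in [B] is congruent to [A] and commutes with [B] exactly, so
   every polynomial in [B] centralises it at all levels. *)
pose A0 := (2%:R^-1 : O) *: (A1 - starO A1).
have sAE : starO A = - A by apply/eqP; rewrite -addr_eq0 sA.
have h0 : dv l (A - A0).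
  have -> : A - A0 = (2%:R^-1 : O) *: ((A - A1) - starO (A - A1)).
    have -> : (A - A1) - starO (A - A1) = (A - starO A) - (A1 - starO A1).
      by rewrite (stB SO) !opprD addrACA.
    by rewrite scalerBr (half_skew (twoU L) sA).
  by apply: dvZ; apply: dvB => //; apply: (dv_st L).
have cB1 : cm A1 B = 0.
  by rewrite /A1 /cm !mulrDr !mulrDl -!scalerAr -!scalerAl mulr1 mul1r -exprS -exprSr subrr.
have sBE : starO B = - B by apply/eqP; rewrite -addr_eq0 sB.
have cB0 : cm A0 B = 0.
  rewrite /A0 cmZl cmDl cB1 add0r /cm mulrN mulNr opprK.
  have := congr1 starO cB1; rewrite /cm (stB SO) !(stM SO) (st0 SO) sBE mulrN mulNr opprK.
  by move/eqP; rewrite addrC subr_eq0 => /eqP ->; rewrite addNr scaler0.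
exists A0; split; [exact: halfP|exact: h0|].
have SE0 : Sl l A0 = cent (rdm B) by rewrite -(Sl_ext _ h0).
apply/eqP; rewrite eqEsubset; apply/andP; split; first exact: Sl_le (leqnSn l).
rewrite SE0; apply/subsetP => s.
case/(cyclic_cent cB) => f sf ->; rewrite horner_mx_sum3 //.
have [f0 f0E] := ldS L f`_0; have [f1 f1E] := ldS L f`_1; have [f2 f2E] := ldS L f`_2.
apply/SlP; exists (f0%:A + f1 *: B + f2 *: B ^+ 2).
  by rewrite !rdmD !rdmZ expr2 rdmM rdm1 f0E f1E f2E expr2.
by rewrite !cmD !cmZ cm1 expr2 cmM cB0 !(mulr0, mul0r, addr0, scaler0); exact: dv0.
Qed.

(** The cyclic [x] lifts to a skew [B] commuting with [A] mod [p^l], and [krylov_poly] then makes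
    [A] a polynomial in [B] mod [p^l]. *)
Lemma str_regular_of l A x : starO A + A = 0 -> star x + x = 0 -> cyclic_mx x ->
  Sl l A = cent x -> str_regular l A.
Proof.
move=> sA sx cx SE; have xS : x \in Sl l A by rewrite SE cent_self.
have [B [sB BE hB]] := skew_comm_lift sA xS sx; exists B; rewrite BE; split=> //.
have [t0 K0] := cx; have [t tE] := vec_lift t0.
have K : krylov t B \in unitmx.
  apply: (rdm_unit L); suff -> : rdm (krylov t B) = krylov t0 x by [].
  apply/matrixP => i j; rewrite !mxE -tE -BE.
  by case: ifP => _; [rewrite !mxE|case: ifP => _; rewrite -!map_mxM !mxE].
have [a [b [d E]]] := krylov_poly A K; exists a, b, d; rewrite E; apply: dvMl.
have [Z1 h1] : dv l (B * A - A * B) by [].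
have [Z2 h2] : dv l (B ^+ 2 * A - A * B ^+ 2).
  have -> : B ^+ 2 * A - A * B ^+ 2 = cm A (B * B) by [].
  by rewrite cmM; apply: dvD; [exact: dvMl|exact: dvMr].
exists (rows3 0 (t *m Z1) (t *m Z2)); rewrite h1 h2 -!scalemxAr.
by apply/matrixP => i j; rewrite !mxE; case: ifP => _; [rewrite mxE mulr0|case: ifP => _; rewrite !mxE].
Qed.

Lemma rk1_expand e k (v w : 'rV[O]_3) : rank1 circ e (v + p ^+ k *: w) =
  rank1 circ e v + p ^+ k *: (e *: (vstar circ v *m w + vstar circ w *m v)) + p ^+ (k + k) *: rank1 circ e w.
Proof.
rewrite /rank1 vstD vstZ (c_pow L) mulmxDl !mulmxDr -!scalemxAr -!scalemxAl scalerA -exprD.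
rewrite !scalerDr !scalerA [p ^+ k * e]mulrC [p ^+ (k + k) * e]mulrC -!addrA; congr (_ + _).
Qed.

(** The new residual centraliser is a stabiliser in the old one. If it belongs to a cyclic matrix,
    the regular shape appears; otherwise the perturbation is so restricted that it can be absorbed
    into the parameters of a scalar or rank one shape. *)
Lemma str_step l A : starO A + A = 0 -> str l A -> str l.+1 A.
Proof.
move=> sA strA.
have [A0 [sA0 [X EX] good]] := str_good sA strA.
have AE : A = A0 + p ^+ l *: X by rewrite -EX addrC subrK.
have sX : starO X + X = 0.
  apply: (powI L (l := l)); rewrite scaler0 scalerDr -{1}(c_pow L l) -(stZ SO) -EX (stB SO).
  by rewrite addrACA sA -opprD sA0 subr0.
pose x := rdm X.
have sx : star x + x = 0 by rewrite -(rdm_st L) -rdmD sX map_mx0.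
have S1 : Sl l.+1 A = stab (Sl l A0) x by rewrite AE (stab_lift L _ good).
have S0 : Sl l A0 = Sl l A by apply/esym/Sl_ext; rewrite EX; exists X.
have regular b : star b + b = 0 -> cyclic_mx b -> stab (Sl l A0) x = cent b -> str l.+1 A.
  by move=> sb cb e; constructor 3; apply: (str_regular_of sA sb cb); rewrite S1.
have lead (Y Z : MO) : A - (A0 + p ^+ l *: Y) = p ^+ l *: (X - Y).
  by rewrite {1}AE opprD addrACA subrr add0r scalerBr.
case: strA => [[a ca h]|[a [e [v [m [ca ce e0 v0 [ml h]]]]]]|[B [sB cB SE _]]].
- have AaE : exists W, A = a%:A + p ^+ l *: W /\ starO W + W = 0.
    have [W hW] := h; exists W; split; first by rewrite -hW addrC subrK.
    apply: (powI L (l := l)); rewrite scaler0 scalerDr -{1}(c_pow L l) -(stZ SO) -hW (stB SO).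
    by rewrite addrACA sA -opprD scal_skew // subr0.
  have [W [{}AE sW]] := AaE; pose w := rdm W.
  have sw : star w + w = 0 by rewrite -(rdm_st L) -rdmD sW map_mx0.
  have S2 : Sl l.+1 A = cent w.
    by rewrite AE (stab_lift L) !Sl_scalar ?stab_setT.
  have cong V : dv 1 (W - V) -> dv l.+1 (A - (a%:A + p ^+ l *: V)).
    move=> hV; rewrite {1}AE opprD addrACA subrr add0r -scalerBr -addn1; exact: dv_add.
  case: (skew_trichotomy Q sw) => [[al als wE]|[al [e [v [als es e0 v0 wE]]]]|cw].
  + have [b cb bE] := sk_lift als.
    constructor 1; exists (a + p ^+ l * b).
      by rewrite rmorphD rmorphM (c_pow L) ca cb mulrN opprD.
    rewrite scalerDl -scalerA; apply: cong; apply/(rdm_eq L); rewrite -/w wE rdmZ rdm1 bE.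
    by rewrite scalemx1.
  + have [b cb bE] := sk_lift als; have [f cf fE] := sk_lift es; have [V VE] := vec_lift v.
    constructor 2; exists (a + p ^+ l * b), f, V, l.
    rewrite fE VE; split=> //; first by rewrite rmorphD rmorphM (c_pow L) ca cb mulrN opprD.
    split=> //; rewrite scalerDl -scalerA -addrA -scalerDr; apply: cong; apply/(rdm_eq L).
    by rewrite -/w wE rdmD rdmZ rdm1 bE rdm_rk1 fE VE scalemx1.
  by constructor 3; apply: (str_regular_of sA sw cw).
- pose C := rank1 circ e v; pose A1 := a%:A + p ^+ m *: C; have [W hW] := h.
  have sA1 : starO A1 + A1 = 0.
    rewrite /A1 (stD SO) (stZ SO (p ^+ m)) (c_pow L) addrACA -scalerDr rk1_skew // scaler0 addr0.
    exact: scal_skew.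
  have sW : starO W + W = 0.
    apply: (powI L (l := l)); rewrite scaler0 scalerDr -{1}(c_pow L l) -(stZ SO) -hW (stB SO).
    by rewrite addrACA sA -opprD sA1 subr0.
  pose w := rdm W; have sw : star w + w = 0 by rewrite -(rdm_st L) -rdmD sW map_mx0.
  have Ch : Sl l A1 = cent (rdm C) by rewrite Sl_rank1.
  have AE1 : A = A1 + p ^+ l *: W by rewrite -hW addrC subrK.
  have S2 : Sl l.+1 A = stab (cent (rdm C)) w.
    by rewrite AE1 (stab_lift L) Ch // Sl_rank1 // ltnW.
  have es : rd e \in sk by rewrite skE -(ldc L) ce rmorphN.
  have sC : star (rdm C) + rdm C = 0 by rewrite -(rdm_st L) -rdmD rk1_skew // map_mx0.
  have CE : rdm C = 0%:M + rank1 c (rd e) (map_mx rd v) by rewrite raddf0 add0r rdm_rk1.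
  have mC : exists T : sh_type, mtype T (rdm C).
    by exists (if hnorm c (map_mx rd v) == 0 then tyJ else tyL); rewrite CE; apply: (skew_mtype_rk1 Q (sk0 c)).
  have [T mT] := mC; have [Y [B' [sB' mB' SB']]] := proj1 (row_all Q sC mT) w sw.
  have [rY|rY] := boolP (regular_type Y).
    constructor 3; apply: (str_regular_of sA sB' (mtype_reg_inv Q sB' mB' rY)).
    by rewrite S2.
  (* A stabiliser of non-regular type cannot be smaller: it is everything, or the centraliser of a
     rank one matrix contained in another such centraliser. *)
  have full : stab (cent (rdm C)) w = cent (rdm C).
    have sub : stab (cent (rdm C)) w \subset cent (rdm C) by apply/subsetP => s /stabP[].
    have [YG|Y3] : Y = tyG \/ type_deg Y = 3%N by case: (Y) rY; auto.
      rewrite YG in mB'; have [b _ bE] := mtypeG_inv Q sB' mB'.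
      apply/eqP; rewrite eqEsubset sub /=; apply/subsetP => s _.
      by rewrite SB' bE cent_scalar in_setT.
    have [a' [e' [v' [as' es' e0' v0' [BE _]]]]] := mtypeLJ_inv Q sB' mB' Y3.
    rewrite SB' BE in sub *.
    apply: (rk1_cent_sub e0' v0' sub); rewrite CE; exact: rk1_nonscalar.
  rewrite CE in full.
  have [al [u [als wE]]] := stab_full_rk1 Q es e0 v0 sw full.
  have [b cb bE] := sk_lift als; have [U UE] := vec_lift u.
  pose N := e *: (vstar circ v *m U + vstar circ U *m v).
  have [W1 hW1] : dv 1 (W - (b%:A + N)).
    have vE (y : 'rV[O]_3) : map_mx rd (vstar circ y) = vstar c (map_mx rd y).
      by apply/colP => j; rewrite !mxE (ldc L).
    apply/(rdm_eq L); rewrite -/w wE rdmD !rdmZ rdm1 bE rdmD !map_mxM !vE UE.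
    by rewrite scalemx1.
  (* Replacing [v] by [v + p^k U] changes [p^m v* v] to first order at level [m + k = l]; the
     quadratic error sits at level [m + 2k = l + k], at least [l + 1]. *)
  pose k := (l - m)%N; have lk : (m + k)%N = l by rewrite subnKC // ltnW.
  have k0 : (0 < k)%N by rewrite subn_gt0.
  constructor 2; exists (a + p ^+ l * b), e, (v + p ^+ k *: U), m.
  split=> //; first by rewrite rmorphD rmorphM (c_pow L) ca cb mulrN opprD.
    by rewrite map_mxD map_mxZ rmorphXn /= (rd_p L) expr0n -[k == 0%N]negbK -lt0n k0 scale0r addr0.
  split; first exact: ltnW.
  have -> : A - ((a + p ^+ l * b)%:A + p ^+ m *: rank1 circ e (v + p ^+ k *: U)) =
      p ^+ l *: (W - (b%:A + N)) - p ^+ (m + (k + k)) *: rank1 circ e U.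
    rewrite rk1_expand -/N -/C {1}AE1 /A1; move: (N) (C) => N1 C1.
    rewrite !scalerDr !scalerN !scalerDr scalerDl -!(scalerA (p ^+ l) b) (scalerA (p ^+ m) (p ^+ k)).
    rewrite (scalerA (p ^+ m) (p ^+ (k + k))) -!exprD lk.
    move: (a%:A) (p ^+ m *: C1) (p ^+ l *: W) (p ^+ l *: b%:A) (p ^+ l *: N1) (p ^+ (m + (k + k)) *: _).
    by move=> t1 t2 t3 t4 t5 t6; apply/matrixP => i j; rewrite !mxE; ring.
  rewrite hW1; apply: dvB; first by rewrite scalerA -exprD addn1; exact: dv_pow.
  by apply: dv_pow; rewrite addnA lk -addn1 leq_add2l.
by apply: (regular (rdm B)) => //; [rewrite -(rdm_st L) -rdmD sB map_mx0 | rewrite S0 SE; exact: stab_cyclic_comm].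
Qed.

Lemma str_all l A : starO A + A = 0 -> str l A.
Proof.
move=> sA; elim: l => [|l]; last exact: str_step.
by constructor 1; exists 0; [rewrite rmorph0 oppr0 | exact: dv_0].
Qed.

End Lifting.

(* Imported late because its set notations hide those of finset. *)
From mathcomp Require Import all_classical.

(** * The residue field *)

Section Residue.
Variable O : dvrType.

Definition res (x : O) : residue O := \pi_(residue O)%qT x.

Lemma res_eq x y : res x = res y <-> exists z, x - y = uniformizer * z.
Proof.
split=> [/vquotP/videalP[z ->]|[z e]]; first by exists z; rewrite expr1.
by apply/vquotP/videalP; exists z; rewrite expr1.
Qed.

Lemma res_is_additive : zmod_morphism res.
Proof.
move=> x y; apply: (addIr (res y)); rewrite subrK.
by rewrite /res -(vquot_piD 1) subrK.
Qed.
Lemma res_is_multiplicative : monoid_morphism res.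
Proof. by split=> [|x y]; [|exact: vquot_piM]. Qed.
HB.instance Definition _ := GRing.isZmodMorphism.Build O (residue O) res res_is_additive.
HB.instance Definition _ := GRing.isMonoidMorphism.Build O (residue O) res res_is_multiplicative.

Lemma res_surj y : exists x, res x = y.
Proof. by elim/generic_quotient.quotW: y => x; exists x. Qed.

Lemma res_unit x : res x != 0 -> x \is a GRing.unit.
Proof.
rewrite -notin_videal1; apply: contraNN => h; apply/eqP.
by rewrite -[RHS](rmorph0 res); apply/vquotP; rewrite subr0.
Qed.

Lemma res_eq0 x : res x = 0 <-> exists z, x = uniformizer * z.
Proof.
by rewrite -[X in _ = X <-> _](rmorph0 res) res_eq subr0.
Qed.
End Residue.

Section FiniteResidue.
Variables (O : dvrType) (n : nat) (f : residue O -> 'I_n) (g : 'I_n -> residue O).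
Hypotheses (fK : cancel f g) (gK : cancel g f).

Lemma res_enumP : Finite.axiom (map g (enum 'I_n)).
Proof.
apply: Finite.uniq_enumP.
  by rewrite map_inj_uniq ?enum_uniq //; exact: can_inj gK.
by move=> x; rewrite -(fK x) map_f ?mem_enum.
Qed.

(** The residue field with a finite structure obtained from a bijection with an ordinal; its field
    operations are unchanged. *)
Definition resF : finFieldType := HB.pack (residue O)
  (PCanIsCountable (can_pcan fK)) (isFinite.Build (residue O) res_enumP).

Lemma card_resF : #|resF| = n.
Proof.
rewrite -[RHS]card_ord; apply: (bij_eq_card (f := f : resF -> 'I_n)).
by exists g.
Qed.
End FiniteResidue.

Lemma half_decomp (K : fieldType) (x y w : K) : 2%:R != 0 :> K -> w != 0 ->
  2%:R^-1 * (x + y) + w * (2%:R^-1 * w^-1 * (x - y)) = x.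
Proof. by move=> h2 hw; field; rewrite hw h2. Qed.

Section Quadratic.
Variables (o O : dvrType) (iota : {rmorphism o -> O}) (circ : {rmorphism O -> O}).
Hypothesis H : unramified_quadratic iota circ.
Let p := iota uniformizer.

(** Cayley-Hamilton for multiplication by [x] on the basis [b1, b2]: the characteristic polynomial
    kills both basis elements, hence 1. *)
Lemma circ_quadratic x : exists t n, x ^+ 2 - iota t * x + iota n = 0.
Proof.
have [b1 [b2 fr]] := uq_free H.
have [[a b] [e1 _]] := fr (x * b1); have [[d e] [e2 _]] := fr (x * b2).
have [[k1 k2] [e3 _]] := fr 1; exists (a + e), (a * e - b * d).
move: e1 e2 e3; rewrite /= => e1 e2 e3.
rewrite -[LHS]mulr1 e3 rmorphD rmorphB !rmorphM.
have z1 : (x ^+ 2 - (iota a + iota e) * x + (iota a * iota e - iota b * iota d)) * b1 = 0.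
  have -> : (x ^+ 2 - (iota a + iota e) * x + (iota a * iota e - iota b * iota d)) * b1 =
    (x - iota e) * (x * b1) - iota a * (x * b1) + iota a * iota e * b1 - iota b * iota d * b1 by ring.
  rewrite e1.
  have -> : (x - iota e) * (iota a * b1 + iota b * b2) - iota a * (iota a * b1 + iota b * b2) + iota a * iota e * b1 - iota b * iota d * b1 =
    iota a * (x * b1) + iota b * (x * b2) - iota e * iota b * b2 - iota a * (iota a * b1 + iota b * b2) - iota b * iota d * b1 by ring.
  by rewrite e1 e2; ring.
have z2 : (x ^+ 2 - (iota a + iota e) * x + (iota a * iota e - iota b * iota d)) * b2 = 0.
  have -> : (x ^+ 2 - (iota a + iota e) * x + (iota a * iota e - iota b * iota d)) * b2 =
    (x - iota a) * (x * b2) - iota e * (x * b2) + iota a * iota e * b2 - iota b * iota d * b2 by ring.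
  rewrite e2.
  have -> : (x - iota a) * (iota d * b1 + iota e * b2) - iota e * (iota d * b1 + iota e * b2) + iota a * iota e * b2 - iota b * iota d * b2 =
    iota d * (x * b1) + iota e * (x * b2) - iota a * iota d * b1 - iota e * (iota d * b1 + iota e * b2) - iota b * iota d * b2 by ring.
  by rewrite e1 e2; ring.
rewrite mulrDr mulrCA z1 mulr0 add0r mulrCA z2 mulr0 //.
Qed.

(** [circ x] is a root of the same quadratic with coefficients from [o], so it is [x] or
    [iota t - x], and a second application returns to [x]. *)
Lemma circK : involutive circ.
Proof.
move=> x; have [t [n e]] := circ_quadratic x.
have e' : circ x ^+ 2 - iota t * circ x + iota n = 0.
  by have := congr1 circ e; rewrite rmorph0 rmorphD rmorphB rmorphXn rmorphM !(uq_fix H).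
have : (circ x - x) * (circ x - (iota t - x)) = 0.
  have -> : (circ x - x) * (circ x - (iota t - x)) =
    (circ x ^+ 2 - iota t * circ x + iota n) - (x ^+ 2 - iota t * x + iota n) by ring.
  by rewrite e e' subrr.
move/eqP; rewrite mulf_eq0 !subr_eq0 => /orP[/eqP h|/eqP h]; first by rewrite !h.
by rewrite h rmorphB (uq_fix H) h subKr.
Qed.

Lemma p_unif : exists2 u : O, u \is a GRing.unit & p = u * uniformizer.
Proof. by have [u uU uE] := uq_unramified H; exists u. Qed.

Lemma p_n0 : p != 0.
Proof.
have [u uU ->] := p_unif; rewrite mulf_neq0 ?uniformizer_neq0 //.
by apply: contraTneq uU => ->; rewrite unitr0.
Qed.

Lemma res0p x : res x = 0 <-> exists y, x = p * y.
Proof.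
have [u uU uE] := p_unif; rewrite res_eq0 uE; split=> [[z ->]|[z ->]].
  by exists (u^-1 * z); rewrite mulrACA mulrV // mul1r.
by exists (u * z); rewrite mulrA [uniformizer * u]mulrC.
Qed.

Lemma res_circ x : circ_res circ (res x) = res (circ x).
Proof. exact: (vquot_mapE H). Qed.

Lemma circ_res_additive : zmod_morphism (circ_res circ).
Proof.
move=> x y; have [a <-] := res_surj x; have [b <-] := res_surj y.
by rewrite -rmorphB !res_circ !rmorphB.
Qed.
Lemma circ_res_multiplicative : monoid_morphism (circ_res circ).
Proof.
split=> [|x y]; first by rewrite -(rmorph1 (@res O)) res_circ !rmorph1.
have [a <-] := res_surj x; have [b <-] := res_surj y.
by rewrite -rmorphM !res_circ !rmorphM.
Qed.
Definition circ_resR : {rmorphism residue O -> residue O} := HB.pack_for {rmorphism residue O -> residue O}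
  (circ_res circ) (GRing.isZmodMorphism.Build _ _ (circ_res circ) circ_res_additive)
  (GRing.isMonoidMorphism.Build _ _ (circ_res circ) circ_res_multiplicative).

Hypothesis H2 : 2%N \notin [pchar (residue o)].

Lemma two_res : (2%:R : residue O) != 0.
Proof.
have : (2%:R : residue o) != 0 by apply: contraNneq H2 => h; rewrite inE /= h eqxx.
rewrite -(rmorph_nat (@res o)) => /res_unit u2.
have : (2%:R : O) \is a GRing.unit by rewrite -(rmorph_nat iota) rmorph_unit.
by move/(rmorph_unit (@res O)); rewrite rmorph_nat unitfE.
Qed.

(** A nonzero difference [circ x - x] is skew; dividing by a power of the fixed [p] leaves a skew
    unit. As 2 is invertible, the induced automorphism of the residue field is therefore not
    trivial. *)
Lemma res_skew_unit : exists2 w : residue O, w != 0 & circ_res circ w = - w.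
Proof.
have [x nx] := uq_nontrivial H; pose z := circ x - x.
have cz : circ z = - z by rewrite rmorphB circK opprB.
have z0 : z != 0 by rewrite subr_eq0.
have [v [n [vU zE]]] := dvr_factor z z0.
have [u uU uE] := p_unif.
pose w := v / u ^+ n.
have wE : z = w * p ^+ n by rewrite uE exprMn mulrA divrK ?unitrX // -zE.
have cw : circ w = - w.
  have cp : circ (p ^+ n) = p ^+ n by rewrite rmorphXn (uq_fix H).
  by move: cz; rewrite wE rmorphM cp -mulNr => /(mulIf (expf_neq0 n p_n0)).
have wU : w \is a GRing.unit by rewrite unitrM vU unitrV unitrX.
exists (res w); last by rewrite res_circ cw rmorphN.
by have := rmorph_unit (@res O) wU; rewrite unitfE.
Qed.

Lemma iota_unit a : (iota a \is a GRing.unit) = (a \is a GRing.unit).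
Proof.
apply/idP/idP => [h|]; last exact: rmorph_unit.
rewrite -notin_videal1; apply/negP => /videalP[y]; rewrite expr1 => e.
move: h; rewrite e rmorphM unitrM -/p => /andP[pU _].
have [u uU uE] := p_unif; move: pU; rewrite uE unitrM uU /=.
by rewrite (negPf (uniformizer_nonunit)).
Qed.

Lemma res_iota a b : res (iota a) = res (iota b) <-> res a = res b.
Proof.
have h x : res (iota x) = 0 <-> res x = 0.
  split=> e; apply/eqP; apply: contraT => /res_unit.
    by rewrite -iota_unit => /(rmorph_unit (@res O)); rewrite unitfE => /eqP h; case: h.
  by rewrite iota_unit => /(rmorph_unit (@res o)); rewrite unitfE => /eqP h; case: h.
split=> e; apply/eqP; rewrite -subr_eq0 -rmorphB; apply/eqP.
  by apply/h; rewrite !rmorphB; apply/eqP; rewrite subr_eq0; apply/eqP.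
by rewrite -rmorphB; apply/h; rewrite rmorphB; apply/eqP; rewrite subr_eq0; apply/eqP.
Qed.

(** The reductions of [b1, b2] form a basis over the residue field of [o]: uniqueness of
    coordinates, applied to multiples of [p], gives independence mod [p]. *)
Lemma res_card q : ([set: residue o] #= `I_q)%card ->
  exists (f : residue O -> 'I_(q ^ 2)) (g : 'I_(q ^ 2) -> residue O), cancel f g /\ cancel g f.
Proof.
move=> /card_set_bijP[phi [phiF phiI phiS]].
have q0 x : (phi x < q)%N by exact: phiF.
pose f0 x : 'I_q := Ordinal (q0 x).
have f0S (i : 'I_q) : exists x, f0 x = i.
  by have [x _ xE] := phiS i (ltn_ord i); exists x; apply: val_inj.
have [g0 g0E] := choice f0S.
have gK0 : cancel f0 g0.
  move=> x; apply: phiI; rewrite ?in_setT ?inE //.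
  by have := congr1 val (g0E (f0 x)).
have [rp rpE] := choice (@res_surj o).
have [b1 [b2 fr]] := uq_free H.
pose th (z : 'I_q * 'I_q) : residue O := res (iota (rp (g0 z.1)) * b1 + iota (rp (g0 z.2)) * b2).
have thS x : exists z, th z = x.
  have [y <-] := res_surj x; have [[a b] [/= e _]] := fr y; exists (f0 (res a), f0 (res b)).
  have h a' : res (iota (rp (g0 (f0 (res a'))))) = res (iota a') by apply/res_iota; rewrite gK0 rpE.
  by rewrite /th /= e !(rmorphD, rmorphM) /= !h.
have thI : injective th.
  move=> [i j] [i' j'] /eqP; rewrite -subr_eq0 -rmorphB => /eqP /res0p[y] /=.
  have [[a b] [/= e _]] := fr y.
  set a1 := rp _; set a2 := rp _; set a3 := rp _; set a4 := rp _ => E.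
  have E' : iota (a1 - a3) * b1 + iota (a2 - a4) * b2 = iota (uniformizer * a) * b1 + iota (uniformizer * b) * b2.
    rewrite !rmorphB !rmorphM -/p; transitivity (p * y); last by rewrite e; ring.
    by rewrite -E; ring.
  have [z [_ zU]] := fr (iota (a1 - a3) * b1 + iota (a2 - a4) * b2).
  have := zU (a1 - a3, a2 - a4) erefl; rewrite (zU (uniformizer * a, uniformizer * b) E') => -[h1 h2].
  have k1 : res a1 = res a3 by apply/res_eq; exists a.
  have k2 : res a2 = res a4 by apply/res_eq; exists b.
  move: k1 k2; rewrite /a1 /a2 /a3 /a4 !rpE => k1 k2.
  by rewrite -(g0E i) -(g0E i') -(g0E j) -(g0E j') k1 k2.
have [ps psE] := choice thS.
have cardE : #|{: 'I_q * 'I_q}| = (q ^ 2)%N by rewrite card_prod card_ord mulnn.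
exists (fun x => cast_ord cardE (enum_rank (ps x))), (fun i => th (enum_val (cast_ord (esym cardE) i))).
split=> x; first by rewrite cast_ordK enum_rankK psE.
have -> : ps (th (enum_val (cast_ord (esym cardE) x))) = enum_val (cast_ord (esym cardE) x) by apply: thI; rewrite psE.
by rewrite enum_valK cast_ordKV.
Qed.

Lemma ext_local q (f : residue O -> 'I_(q ^ 2)) g (fK : cancel f g) (gK : cancel g f) (F := resF fK gK) :
  local_ext circ p (@res O : {rmorphism O -> F}) (circ_resR : {rmorphism F -> F}) q.
Proof.
have cE x : (circ_resR : {rmorphism F -> F}) x = circ_res circ x by [].
split.
- exact: circK.
- exact: (uq_fix H).
- exact: p_n0.
- exact: res0p.
- exact: res_surj.
- by move=> x; rewrite cE res_circ.
- exact: res_unit.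
have ccK : involutive (circ_resR : {rmorphism F -> F}).
  by move=> x; have [a <-] := res_surj x; rewrite /= !res_circ circK.
have cF : #|F| = (q ^ 2)%N by exact: card_resF.
have [w w0 cw] := res_skew_unit.
have two := two_res.
split=> //; pose K : {set F} := finset (fun x : F => (circ_resR : {rmorphism F -> F}) x == x).
have -> : #|[pred x : F | (circ_resR : {rmorphism F -> F}) x == x]| = #|K|.
  by apply: eq_card => x; rewrite finset.in_set.
(* With the skew unit [w], the residue field is the direct sum of the fixed field [K] and [w K]. *)
suff : (#|K| ^ 2 = q ^ 2)%N by move/eqP; rewrite eqn_exp2r // => /eqP.
rewrite -cF -mulnn -cardsX -cardsT.
pose h (z : F * F) : F := z.1 + (w : F) * z.2.
have KP (x : F) : (x \in K) = ((circ_resR : {rmorphism F -> F}) x == x) by rewrite finset.in_set.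
rewrite -(card_in_imset (f := h)); last first.
  move=> [a b] [a' b'] /setXP[aK bK] /setXP[aK' bK']; rewrite /h /= => e.
  move: aK bK aK' bK'; rewrite !KP => /eqP ca /eqP cb /eqP ca' /eqP cb'.
  have := congr1 (circ_resR : {rmorphism F -> F}) e.
  rewrite !rmorphD !rmorphM ca cb ca' cb' [(circ_resR : {rmorphism F -> F}) w]cw => e'.
  have aa : (2%:R : F) * a = (2%:R : F) * a'.
    have -> : (2%:R : F) * a = (a + (w : F) * b) + (a + - (w : F) * b) by ring.
    by rewrite e e'; ring.
  have {}aa : a = a' by exact: (mulfI (two : (2%:R : F) != 0)).
  by move: e; rewrite aa => /addrI /(mulfI (w0 : (w : F) != 0)) ->.
apply: eq_card => x; rewrite finset.in_setT; apply/imsetP.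
have c2 : (circ_resR : {rmorphism F -> F}) 2%:R^-1 = 2%:R^-1 by rewrite fmorphV rmorph_nat.
have [y yE] : exists y : F, (circ_resR : {rmorphism F -> F}) x = y by exists ((circ_resR : {rmorphism F -> F}) x).
have cx : (circ_resR : {rmorphism F -> F}) y = x by rewrite -yE; exact: ccK.
have cw' : (circ_resR : {rmorphism F -> F}) (w : F) = - (w : F) by exact: cw.
have m1 : (circ_resR : {rmorphism F -> F}) ((2%:R : F)^-1 * (x + y)) = (2%:R : F)^-1 * (x + y).
  by rewrite rmorphM c2 rmorphD cx yE addrC.
have m2 : (circ_resR : {rmorphism F -> F}) ((2%:R : F)^-1 * (w : F)^-1 * (x - y)) = (2%:R : F)^-1 * (w : F)^-1 * (x - y).
  by rewrite !rmorphM c2 rmorphB fmorphV cx yE cw' invrN; ring.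
exists ((2%:R : F)^-1 * (x + y), (2%:R : F)^-1 * (w : F)^-1 * (x - y)).
  by apply/setXP; rewrite !KP; split; apply/eqP; [exact: m1 | exact: m2].
exact: (esym (half_decomp x y (two : (2%:R : F) != 0) (w0 : (w : F) != 0))).
Qed.
End Quadratic.

(** * Classes and shadows *)

Lemma mul1_unit (R : comUnitRingType) (h g : 'M[R]_3) : h * g = 1 ->
  [/\ g \is a GRing.unit, g^-1 = h & g * h = 1].
Proof.
move=> e; have ug : g \is a GRing.unit by have /mulmx1_unit[] : h *m g = 1%:M by [].
have hV : g^-1 = h by apply: (mulIr ug); rewrite mulVr.
by split=> //; rewrite -hV mulrV.
Qed.

Section Reduction.
Variables (o O : dvrType) (iota : {rmorphism o -> O}) (circ : {rmorphism O -> O}).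
Hypothesis H : unramified_quadratic iota circ.
Local Notation p := (iota uniformizer).
Local Notation MO := 'M[O]_3.
Local Notation starO := (@conjmx O circ 3).
Implicit Types (A B X Y g : MO) (l : nat).

Lemma dvP l A B : redmx l A = redmx l B <-> dv p l (A - B).
Proof.
have [u uU uE] := p_unif H.
have pl : p ^+ l = u ^+ l * uniformizer ^+ l by rewrite uE exprMn.
have ul : u ^+ l \is a GRing.unit by rewrite unitrX.
split=> [/matrixP e|[Z e]].
  have h (ij : 'I_3 * 'I_3) : exists y, (A - B) ij.1 ij.2 = p ^+ l * y.
    have := e ij.1 ij.2; rewrite !mxE => /vquotP/videalP[y ->]; exists ((u ^+ l)^-1 * y).
    by rewrite pl mulrACA mulrV // mul1r.
  have [f fE] := fin_all_exists h; exists (\matrix_(i, j) f (i, j)).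
  by apply/matrixP => i j; rewrite [RHS]mxE [_ i j in RHS]mxE -fE.
apply/matrixP => i j; rewrite !mxE; apply/vquotP/videalP; exists (u ^+ l * Z i j).
by have /matrixP/(_ i j) := e; rewrite !mxE pl => ->; rewrite mulrA [uniformizer ^+ l * _]mulrC.
Qed.

Lemma redmxM l A B : redmx l (A * B) = redmx l A *m redmx l B.
Proof.
apply/matrixP => i j; rewrite !mxE !sum3 !mxE.
by rewrite !vquot_piD !vquot_piM.
Qed.

Lemma redmx_star l A : conjmx (@vquot_map O circ l) (redmx l A) = redmx l (starO A).
Proof. by apply/matrixP => i j; rewrite !mxE (vquot_mapE H). Qed.

Lemma redmxD l A B : redmx l (A + B) = redmx l A + redmx l B.
Proof. by apply/matrixP => i j; rewrite !mxE vquot_piD. Qed.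

Lemma redmx0 l : redmx l (0 : MO) = 0.
Proof. by apply/matrixP => i j; rewrite !mxE vquot_pi0. Qed.

Lemma redmx_surj l (A' : 'M[vquot O l]_3) : exists A, redmx l A = A'.
Proof.
exists (map_mx generic_quotient.repr A').
by apply/matrixP => i j; rewrite !mxE generic_quotient.reprK.
Qed.

Lemma red_red l A : map_mx (@vquot_red O l) (redmx l.+1 A) = redmx l A.
Proof. by apply/matrixP => i j; rewrite !mxE vquot_redE. Qed.

Lemma GUP g : GU circ (n := 3) g <-> starO g * g = 1.
Proof.
split=> [[_ h]//|h]; split=> //; by have [] := mul1_unit h.
Qed.

Lemma adGUE l g A : adGU g (redmx l A) = redmx l (g * A * g^-1).
Proof. by rewrite /adGU !redmxM. Qed.

Definition cls l A : set 'M[vquot O l]_3 := [set adGU g (redmx l A) | g in GU circ (n := 3)]%classic.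

Arguments cls l A _ : clear implicits.

Let SO : star_axiom circ starO := conjmx_star (circK H).

Lemma uni_mul g h : starO g * g = 1 -> starO h * h = 1 -> starO (g * h) * (g * h) = 1.
Proof. by move=> gu hu; rewrite (stM SO) -mulrA (mulrA (starO g)) gu mul1r. Qed.

Lemma uni_invu g : starO g * g = 1 -> starO g^-1 * g^-1 = 1.
Proof.
move=> gu; have [ug _ _] := mul1_unit gu.
by rewrite (stV SO) // -invrM ?(st_unit SO) // (let: And3 _ _ e := mul1_unit gu in e) invr1.
Qed.

Lemma skew_conj g A : starO g * g = 1 -> starO A + A = 0 -> starO (g * A * g^-1) + g * A * g^-1 = 0.
Proof.
move=> gu sA; have [_ hV _] := mul1_unit gu.
by rewrite hV !(stM SO) (stK SO) mulrA -mulrDl -mulrDr sA mulr0 mul0r.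
Qed.

Lemma cls_sub l A A' : (exists2 g, starO g * g = 1 & dv p l (g * A - A' * g)) -> (cls l A `<=` cls l A')%classic.
Proof.
move=> [g gu hg] _ [h /GUP hu <-]; have [ug _ _] := mul1_unit gu.
exists (h * g^-1); first by apply/GUP/uni_mul => //; exact: uni_invu.
rewrite !adGUE; apply/dvP; have [uh _ _] := mul1_unit hu.
rewrite invrM ?unitrV // invrK.
have -> : h * g^-1 * A' * (g * h^-1) - h * A * h^-1 = - (h * g^-1 * (g * A - A' * g) * h^-1).
  by rewrite mulrBr mulrBl opprB !mulrA (mulrVK ug).
by apply: dvN; apply: dvMr; apply: dvMl.
Qed.

Lemma clsP l A A' : cls l A = cls l A' <-> exists2 g, starO g * g = 1 & dv p l (g * A - A' * g).
Proof.
split=> [e|[g gu hg]].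
  have : cls l A (redmx l A).
    exists 1; first by apply/GUP; rewrite (st1 SO) mulr1.
    by rewrite adGUE mul1r invr1 mulr1.
  rewrite e => -[g /GUP gu]; rewrite adGUE => /dvP h; have [ug _ _] := mul1_unit gu.
  exists g^-1; first exact: uni_invu.
  have -> : g^-1 * A - A' * g^-1 = - (g^-1 * (g * A' * g^-1 - A)).
    by rewrite mulrBr opprB !mulrA mulVr // mul1r.
  by apply: dvN; apply: dvMl.
apply/seteqP; split; first by apply: cls_sub; exists g.
have [ug _ _] := mul1_unit gu.
apply: cls_sub; exists g^-1; first exact: uni_invu.
have -> : g^-1 * A' - A * g^-1 = - (g^-1 * (g * A - A' * g) * g^-1).
  by rewrite mulrBr mulrBl opprB !mulrA mulVr // mul1r -[g^-1 * A' * g * _]mulrA mulrV // mulr1.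
by apply: dvN; apply: dvMr; apply: dvMl.
Qed.

Lemma cls_eq l A A' : dv p l (A - A') -> cls l A = cls l A'.
Proof. by move=> h; apply/clsP; exists 1; rewrite ?(st1 SO) ?mulr1 // mul1r. Qed.

Lemma above_cls l A A' : above (cls l.+1 A) (cls l A') <-> cls l A = cls l A'.
Proof.
suff E : [set map_mx (@vquot_red O l) B | B in cls l.+1 A]%classic = cls l A by rewrite /above E.
apply/seteqP; split=> [_ [_ [g gu <-] <-]|_ [g gu <-]].
  by rewrite adGUE red_red -adGUE; exists g.
by exists (adGU g (redmx l.+1 A)); [exists g | rewrite adGUE red_red adGUE].
Qed.

End Reduction.
Arguments cls {O} circ l A.

Section Shadows.
Variables (o O : dvrType) (iota : {rmorphism o -> O}) (circ : {rmorphism O -> O}).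
Hypothesis H : unramified_quadratic iota circ.
Hypothesis H2 : 2%N \notin [pchar (residue o)].
Variables (q : nat) (f : residue O -> 'I_(q ^ 2)) (g : 'I_(q ^ 2) -> residue O).
Hypotheses (fK : cancel f g) (gK : cancel g f).
Local Notation p := (iota uniformizer).
Local Notation F := (resF fK gK).
Local Notation rd := (@res O : {rmorphism O -> F}).
Local Notation cc := (circ_resR H : {rmorphism F -> F}).
Let L : local_ext circ p rd cc q := ext_local H H2 fK gK.
Let Q := ldQ L.
Local Notation MO := 'M[O]_3.
Local Notation M := 'M[F]_3.
Local Notation starO := (@conjmx O circ 3).
Local Notation star := (@conjmx F cc 3).
Let S : star_axiom cc star := conjmx_star (qcK Q).
Let SO : star_axiom circ starO := conjmx_star (circK H).
Local Notation mtype := (matrix_type cc).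
Local Notation Sl := (Sl p rd).
Local Notation cls := (cls circ).

Definition upart (W : {set M}) : set M := fun s => s \in W /\ star s * s = 1.
Definition spart (W : {set M}) : set M := fun s => s \in W /\ star s + s = 0.

Lemma redmx1 (A : MO) : redmx 1 A = map_mx rd A :> M. Proof. by []. Qed.

Lemma shGU_E l (A : MO) : starO A + A = 0 -> shGU circ (redmx l A) = upart (Sl l A).
Proof.
move=> sA; apply/seteqP; split=> [_ [h [/GUP hu hA] <-]|s [sS su]].
  split; last by rewrite redmx1 -(rdm_st L) -rdmM hu rdm1.
  apply/SlP; exists h => //; apply/(dvP H).
  by rewrite !redmxM.
have [h [hu hE hA]] := uni_lift L sA sS su; exists h; last exact: hE.
by split; [apply/GUP | rewrite -!redmxM; apply/(dvP H)].
Qed.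

Lemma shgu_E l (A : MO) : starO A + A = 0 -> shgu circ (redmx l A) = spart (Sl l A).
Proof.
move=> sA; apply/seteqP; split=> [_ [h [hu hA] <-]|s [sS su]].
  split; last by rewrite redmx1 -(rdm_st L) -rdmD; rewrite /= in hu; rewrite hu map_mx0.
  apply/SlP; exists h => //; apply/(dvP H).
  by rewrite !redmxM.
have [h [hu hE hA]] := skew_comm_lift L sA sS su; exists h; last exact: hE.
by split; [exact: hu | rewrite -!redmxM; apply/(dvP H)].
Qed.

Lemma centGU_E (B : M) : centGU circ B = upart (cent B).
Proof.
apply/seteqP; split=> s; first by case=> [[_ su] sB]; split; [apply/centP | exact: su].
by move=> [/centP sB su]; split; [split; [exact: uni_unit su | exact: su] | exact: sB].
Qed.

Lemma centgu_E (B : M) : centgu circ B = spart (cent B).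
Proof.
apply/seteqP; split=> s; first by case=> [su sB]; split; [apply/centP | exact: su].
by move=> [/centP sB su]; split; [exact: su | exact: sB].
Qed.

Lemma res_shadowP (B : M) z : res_shadow circ B z <->
  exists2 h : M, star h * h = 1 & z = (centGU circ (h * B * h^-1), centgu circ (h * B * h^-1)).
Proof.
split=> [[_ [h [_ hu] <-] <-]|[h hu ->]]; first by exists h.
by exists (h * B * h^-1); first exact: (ex_intro2 _ _ h (conj (uni_unit hu) hu) erefl).
Qed.

Lemma Sl_conj l (A : MO) (h : MO) (B : M) : starO h * h = 1 -> Sl l A = cent B ->
  Sl l (h * A * h^-1) = cent (map_mx rd h * B * (map_mx rd h)^-1).
Proof.
move=> hu SB; have [uh _ _] := mul1_unit hu.
have urh : map_mx rd h \is a GRing.unit.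
  have e : star (map_mx rd h) * map_mx rd h = 1 by rewrite -(rdm_st L) -rdmM hu rdm1.
  exact: uni_unit e.
apply/setP => s; rewrite -(conjVK urh s) (cent_conj urh) -SB.
set t := (map_mx rd h)^-1 * s * map_mx rd h.
have cmE Y : cm (h * A * h^-1) (h * Y * h^-1) = h * cm A Y * h^-1.
  by rewrite /cm mulrBr mulrBl !mulrA !(mulrVK uh).
apply/SlP/SlP => [[Y YE hY]|[Y YE hY]].
  exists (h^-1 * Y * h); first by rewrite !rdmM (rdmV L) // YE (conjK urh).
  have -> : cm A (h^-1 * Y * h) = h^-1 * cm (h * A * h^-1) Y * h.
    by rewrite /cm mulrBr mulrBl !mulrA mulVr // mul1r (mulrVK uh).
  by apply: dvMr; apply: dvMl.
exists (h * Y * h^-1); first by rewrite !rdmM (rdmV L) // YE.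
by rewrite cmE; apply: dvMr; apply: dvMl.
Qed.

Lemma shadow_cls l (A : MO) (B : M) : starO A + A = 0 -> Sl l A = cent B ->
  shadow circ (cls l A) = res_shadow circ B.
Proof.
move=> sA SB.
have E h : starO h * h = 1 -> (shGU circ (redmx l (h * A * h^-1)), shgu circ (redmx l (h * A * h^-1))) =
    (centGU circ (map_mx rd h * B * (map_mx rd h)^-1), centgu circ (map_mx rd h * B * (map_mx rd h)^-1)).
  move=> hu; have sA' := skew_conj H hu sA.
  by rewrite shGU_E // shgu_E // centGU_E centgu_E (Sl_conj hu SB).
apply/seteqP; split=> [_ [_ [h /GUP hu <-] <-]|z /res_shadowP[b bu ->]].
  rewrite adGUE (E h hu); apply/res_shadowP; exists (map_mx rd h); last by [].
  by rewrite -(rdm_st L) -rdmM hu rdm1.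
(* At level 0 the residual centraliser is everything, so [uni_lift] lifts an arbitrary unitary
   matrix over [F]. *)
have sS : b \in Sl 0 (0 : MO) by rewrite (Sl_0 L) finset.in_setT.
have s0 : starO 0 + 0 = 0 :> MO by rewrite (st0 SO) addr0.
have [h [hu hE _]] := uni_lift L s0 sS bu.
exists (redmx l (h * A * h^-1)); first by exists h; [apply/GUP | rewrite adGUE].
by rewrite (E h hu) hE.
Qed.

Lemma centpair (B B' : M) : cent B = cent B' ->
  (centGU circ B, centgu circ B) = (centGU circ B', centgu circ B').
Proof. by move=> e; rewrite !centGU_E !centgu_E e. Qed.

(** A star-stable algebra is the sum of its skew part and a skew scalar multiple of it, so the Lie
    algebra component of a shadow recovers the whole centraliser. *)
Lemma spart_inj (B B' : M) : star B + B = 0 -> star B' + B' = 0 ->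
  spart (cent B) = spart (cent B') -> cent B = cent B'.
Proof.
have sub (B1 B2 : M) : star B1 + B1 = 0 -> spart (cent B1) = spart (cent B2) -> cent B1 \subset cent B2.
  move=> sB e; apply/fintype.subsetP => x xB; have [d ds d0] := ex_delta Q.
  have cd : cc d = - d by apply/eqP; rewrite -skE.
  have two := q2 Q; have u2 : (2%:R : F) \is a GRing.unit by rewrite unitfE.
  have st1 : star x \in cent B1 by apply: (cent_st S sB).
  have h (y : M) : y \in cent B1 -> star y + y = 0 -> y \in cent B2.
    by move=> yB sy; have : spart (cent B1) y by []; rewrite e => -[].
  have m1 : (2%:R^-1 : F) *: (x - star x) \in cent B2.
    by apply: h; [apply: centZ; apply: centB | exact: (skew_half S x u2)].
  have m2 : d *: ((2%:R^-1 : F) *: (x + star x)) \in cent B2.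
    apply: h; first by apply: centZ; apply: centZ; apply: centD.
    rewrite !(stZ S) (stD S) (stK S) fmorphV rmorph_nat cd scaleNr.
    by rewrite [star x + x]addrC addNr.
  have -> : x = (2%:R^-1 : F) *: (x - star x) + d^-1 *: (d *: ((2%:R^-1 : F) *: (x + star x))).
    rewrite [d^-1 *: _]scalerA mulVf // scale1r -scalerDr addrACA addNr addr0 -mulr2n -scaler_nat.
    by rewrite scalerA mulVf // scale1r.
  by apply: centD => //; apply: centZ.
by move=> sB sB' e; apply/eqP; rewrite finset.eqEsubset !sub.
Qed.

Lemma res_shadow_type (B B' : M) X X' : star B + B = 0 -> star B' + B' = 0 -> mtype X B -> mtype X' B' ->
  res_shadow circ B = res_shadow circ B' -> X = X'.
Proof.
move=> sB sB' mB mB' e.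
have : res_shadow circ B (centGU circ B, centgu circ B).
  apply/res_shadowP; exists 1; first by rewrite (st1 S) mulr1.
  by rewrite mul1r invr1 mulr1.
rewrite e => /res_shadowP[h hu [_ e2]]; have uh := uni_unit hu.
have hV : h^-1 = star h by apply: uni_inv.
have sC : star (h * B' * h^-1) + h * B' * h^-1 = 0.
  by rewrite hV !(stM S) (stK S) mulrA -mulrDl -mulrDr sB' mulr0 mul0r.
have mC : mtype X' (h * B' * h^-1) by apply: (proj2 (mtype_conj cc uh X' B')).
apply: (type_unique Q sB sC mB mC); apply: spart_inj => //.
by rewrite -!centgu_E.
Qed.

Lemma res_shadow_eq (B B' : M) X : star B + B = 0 -> star B' + B' = 0 -> mtype X B -> mtype X B' ->
  res_shadow circ B = res_shadow circ B'.
Proof.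
move=> sB sB' mB mB'.
suff sub (B1 B2 : M) : star B1 + B1 = 0 -> star B2 + B2 = 0 -> mtype X B1 -> mtype X B2 ->
    (res_shadow circ B2 `<=` res_shadow circ B1)%classic by apply/seteqP; split; apply: sub.
move=> sB1 sB2 m1 m2; have [B3 [k [_ C3 ku kE]]] := mtype_cent_similar Q sB1 sB2 m1 m2.
have uk := uni_unit ku.
have B3E : B3 = k * B1 * k^-1 by rewrite kE mulrK.
move=> z /res_shadowP[h hu ->]; apply/res_shadowP; have uh := uni_unit hu.
have hk : star (h * k) * (h * k) = 1.
  by rewrite (stM S) -mulrA (mulrA (star h)) hu mul1r.
exists (h * k); first exact: hk.
apply: centpair; have -> : (h * k) * B1 * (h * k)^-1 = h * B3 * h^-1.
  by rewrite B3E invrM // !mulrA.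
by apply/setP => s; rewrite -(conjVK uh s) !(cent_conj uh) C3.
Qed.

(** Skew matrices mod [p^l] lift to skew integral matrices: the skew part of any lift has the same
    reduction. *)
Lemma class_rep l (C : set 'M[vquot O l]_3) : is_class circ C <-> exists2 A : MO, starO A + A = 0 & C = cls l A.
Proof.
split=> [[A' gA' ->]|[A sA ->]]; last first.
  by exists (redmx l A) => //; rewrite /gu_quot /gu /= (redmx_star H) -redmxD sA redmx0.
have [Y YE] := redmx_surj A'.
have two := twoU L; exists ((2%:R^-1 : O) *: (Y - starO Y)); first exact: (skew_half SO _ two).
suff <- : redmx l ((2%:R^-1 : O) *: (Y - starO Y)) = A' by [].
rewrite -YE; apply/(dvP H).
have : dv p l (starO Y + Y).
  rewrite -[starO Y + Y]subr0; apply/(dvP H); rewrite redmxD -(redmx_star H) YE redmx0; exact: gA'.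
have -> : (2%:R^-1 : O) *: (Y - starO Y) - Y = - ((2%:R^-1 : O) *: (starO Y + Y)).
  apply/eqP; rewrite -addr_eq0 addrAC -scalerDr [starO Y + Y]addrC addrACA addNr addr0.
  by rewrite -mulr2n -scaler_nat scalerA mulVr // scale1r subrr.
by move=> h; apply: dvN; apply: dvZ.
Qed.

(** The number of unitary classes of each type is a polynomial in [q] that is nonzero for
    [q > 2]. *)
Lemma type_realized X : exists2 B : M, star B + B = 0 & mtype X B.
Proof.
have := card_class_inv Q X.
have h2 := q_gt2 Q; case: (set_0Vmem (skew_of_type cc X)) => [->|[B]]; last first.
  by move=> /skew_of_typeP[sB mB] _; exists B.
rewrite imset0 cards0 muln0 => e; exfalso; move: e.
have qn : (q%:Z) = (q - 3)%N%:Z + 3%:Z by rewrite -PoszD subnK.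
move: (q - 3)%N qn => k ->; case: X => /=; rewrite !hornerE ?hornerXn; lia.
Qed.

Lemma Sl_1 (A : MO) : Sl 1 A = cent (map_mx rd A).
Proof.
apply/setP => s; have [Y0 YE0] := rdm_surj L s.
apply/SlP/centP => [[Y <- /(rdmP L)]|e].
  by rewrite /cm rdmB !rdmM => /subr0_eq.
by exists Y0 => //; apply/(rdmP L); rewrite /cm rdmB !rdmM YE0 e subrr.
Qed.

Lemma ShP s : Sh circ s <-> exists X (B : M), [/\ star B + B = 0, mtype X B & s = res_shadow circ B].
Proof.
split=> [[l [C [/class_rep[A sA ->] ->]]]|[X [B [sB mB ->]]]].
  have [X [B [sB mB SB]]] := str_typed L sA (str_all L l sA).
  exists X, (map_mx rd B); split=> //; last exact: shadow_cls.
  by rewrite -(rdm_st L) -rdmD sB map_mx0.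
have [A sA AE] := skew_lift L sB.
exists 1%N, (cls 1 A); split; first by apply/class_rep; exists A.
by symmetry; apply: shadow_cls => //; rewrite Sl_1 AE.
Qed.

Lemma has_typeP X (B : M) Y : star B + B = 0 -> mtype Y B -> has_type circ X (res_shadow circ B) <-> X = Y.
Proof.
move=> sB mB; split=> [[B' [sB' mB' e]]|->]; last by exists B.
by symmetry; apply: (res_shadow_type sB (sB' : star B' + B' = 0) mB mB' e).
Qed.

End Shadows.

(** * Counting classes above a class *)

Section Counting.
Variables (o O : dvrType) (iota : {rmorphism o -> O}) (circ : {rmorphism O -> O}).
Hypothesis H : unramified_quadratic iota circ.
Hypothesis H2 : 2%N \notin [pchar (residue o)].
Variables (q : nat) (f : residue O -> 'I_(q ^ 2)) (g : 'I_(q ^ 2) -> residue O).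
Hypotheses (fK : cancel f g) (gK : cancel g f).
Local Notation p := (iota uniformizer).
Local Notation F := (resF fK gK).
Local Notation rd := (@res O : {rmorphism O -> F}).
Local Notation cc := (circ_resR H : {rmorphism F -> F}).
Let L : local_ext circ p rd cc q := ext_local H H2 fK gK.
Let Q := ldQ L.
Local Notation MO := 'M[O]_3.
Local Notation M := 'M[F]_3.
Local Notation starO := (@conjmx O circ 3).
Local Notation star := (@conjmx F cc 3).
Let S : star_axiom cc star := conjmx_star (qcK Q).
Let SO : star_axiom circ starO := conjmx_star (circK H).
Local Notation mtype := (matrix_type cc).
Local Notation Sl := (Sl p rd).
Local Notation cls := (cls circ).

Definition lifts_above (A0 : MO) l (t : shadow_type O) : set (set 'M[vquot O l.+1]_3) :=
  fun C' => [/\ is_class circ C', shadow circ C' = t & above C' (cls l A0)].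

Arguments lifts_above A0 l t _ : clear implicits.

(** The classes above are those of [A0 + p^l Z] with [Z] skew: [stab_lift] reads off their type and
    [conj_lift] their conjugacy from [Z] mod [p], which leaves the count provided by [row_all]. *)
Lemma count_above l (A : MO) X Y (B Bt : M) : starO A + A = 0 ->
  star B + B = 0 -> mtype X B -> Sl l A = cent B -> star Bt + Bt = 0 -> mtype Y Bt ->
  exists2 N, (lifts_above A l (res_shadow circ Bt) #= `I_N)%card &
    (6 * N)%:Z = (count6 X Y).[q%:Z].
Proof.
move=> sA sB mB SB sBt mBt.
have [A0 [sA0 hA0 good]] := str_good L sA (str_all L l sA).
have clA : cls l A = cls l A0 by exact: (cls_eq H hA0).
have SB0 : Sl l A0 = cent B by rewrite -(Sl_ext _ hA0).
have [Bl BlE] := rdm_surj L B.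
have [_ /(_ Y)[N [T [I [hI cI]]] NE]] := row_all Q sB mB.
exists N; last exact: NE.
(* The choice of lifts has to be total; matrices that are not skew get the irrelevant value 0. *)
have lift0 (x : M) : exists Z : MO, star x + x = 0 -> starO Z + Z = 0 /\ map_mx rd Z = x.
  have [sx|nx] := pselect (star x + x = 0); last by exists 0.
  by have [Z sZ ZE] := skew_lift L sx; exists Z.
have [lf lfP] := choice lift0.
pose cl (x : M) := cls l.+1 (A0 + p ^+ l *: lf x).
have sk_sum Z : starO Z + Z = 0 -> starO (A0 + p ^+ l *: Z) + (A0 + p ^+ l *: Z) = 0.
  by move=> sZ; rewrite (stD SO) (stZ SO (p ^+ l)) (c_pow L) addrACA sA0 -scalerDr sZ scaler0 addr0.
have tP (x : M) : x \in typed_set cc star (cent B) Y -> star x + x = 0 /\ typed cc star Y (stab (cent B) x).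
  by move/typed_setP.
have clin x : x \in typed_set cc star (cent B) Y -> lifts_above A l (res_shadow circ Bt) (cl x).
  move=> /tP[sx [B' [sB' mB' SB']]]; have [sZ ZE] := lfP x sx; split.
  - by apply/(class_rep H H2 fK gK); exists (A0 + p ^+ l *: lf x); [exact: sk_sum|].
  - have SE : Sl l.+1 (A0 + p ^+ l *: lf x) = cent B'.
      by rewrite (stab_lift L _ good) ZE SB0 SB'.
    rewrite (shadow_cls H H2 (sk_sum _ sZ) SE); exact: (res_shadow_eq H2 sB' sBt mB' mBt).
  apply/above_cls; rewrite clA; apply: (cls_eq H); exists (lf x); by rewrite addrC addKr.
have cleq x x' : x \in typed_set cc star (cent B) Y -> x' \in typed_set cc star (cent B) Y ->
    cl x = cl x' <-> I x = I x'.
  move=> xT xT'; have [sx _] := tP _ xT; have [sx' _] := tP _ xT'.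
  have [sZ ZE] := lfP x sx; have [sZ' ZE'] := lfP x' sx'.
  have SBl : Sl l A0 = cent (map_mx rd Bl) by rewrite BlE.
  have CL := conj_lift L sA0 sZ sZ' good SBl.
  rewrite SB0 ZE ZE' in CL; have IE := hI _ _ xT xT'.
  split=> [/(clsP H) h|h]; first exact: (proj1 IE (proj1 CL h)).
  by apply/(clsP H); exact: (proj2 CL (proj2 IE h)).
have clsurj C' : lifts_above A l (res_shadow circ Bt) C' ->
    exists2 x, x \in typed_set cc star (cent B) Y & C' = cl x.
  move=> [/(class_rep H H2 fK gK)[A1 sA1 ->] sh /above_cls]; rewrite clA => /(clsP H)[h hu hd].
  have [uh hV _] := mul1_unit hu.
  pose A2 := h * A1 * h^-1.
  have sA2 : starO A2 + A2 = 0 by exact: (skew_conj H hu sA1).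
  have cl2 : cls l.+1 A1 = cls l.+1 A2.
    apply/(clsP H); exists h => //; rewrite /A2 (mulrVK uh) subrr; exact: dv0.
  have [Z hZ] : dv p l (A2 - A0).
    have -> : A2 - A0 = (h * A1 - A0 * h) * h^-1 by rewrite mulrBl mulrK.
    exact: dvMr.
  have A2E : A2 = A0 + p ^+ l *: Z by rewrite -hZ addrC subrK.
  have sZ : starO Z + Z = 0.
    apply: (powI L (l := l)); rewrite scaler0 scalerDr -{1}(c_pow L l) -(stZ SO) -hZ (stB SO).
    by rewrite addrACA sA2 -opprD sA0 subr0.
  pose x : M := map_mx rd Z.
  have sx : star x + x = 0 by rewrite -(rdm_st L) -rdmD sZ map_mx0.
  have SE : Sl l.+1 A2 = stab (cent B) x by rewrite A2E (stab_lift L _ good) SB0.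
  have [Y' [B' [sB' mB' SB']]] := str_typed L sA2 (str_all L l.+1 sA2).
  have srB' : star (map_mx rd B') + map_mx rd B' = 0 by rewrite -(rdm_st L) -rdmD sB' map_mx0.
  have YY : Y = Y'.
    apply: (res_shadow_type H2 sBt srB' mBt mB'); rewrite -sh cl2; exact: (shadow_cls H H2 sA2 SB').
  exists x.
    by apply/typed_setP; split=> //; exists (map_mx rd B'); rewrite YY -SE SB'.
  have [sZ' ZE'] := lfP x sx; rewrite cl2 /cl; apply: (cls_eq H).
  rewrite A2E opprD addrACA subrr add0r -scalerBr -addn1; apply: dv_add.
  by apply/(rdm_eq L); rewrite ZE'.
have pick0 (t : T) : exists x : M, t \in I @: typed_set cc star (cent B) Y ->
    x \in typed_set cc star (cent B) Y /\ I x = t.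
  have [/imsetP[x xT ->]|nt] := boolP (t \in I @: typed_set cc star (cent B) Y); first by exists x.
  by exists 0.
have [pk pkP] := choice pick0.
(* One representative is picked for each value of the invariant; listing them gives the bijection
   with the first [N] natural numbers. *)
pose E := enum (I @: typed_set cc star (cent B) Y).
have szE : size E = N by rewrite -cI cardE.
pose reps := map pk E.
have repP i : (i < N)%N -> nth 0 reps i \in typed_set cc star (cent B) Y /\ (nth 0 reps i) \in reps.
  move=> iN; have m : nth 0 reps i \in reps by rewrite mem_nth // size_map szE.
  by split=> //; have /mapP[t] := m; rewrite mem_enum => /pkP[h _] ->.
have IE : map I reps = E.
  rewrite -map_comp -[RHS]map_id; apply/eq_in_map => t; rewrite mem_enum => /pkP[_ h]; exact: h.
have sz : size reps = N by rewrite size_map.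
rewrite card_eq_sym; apply/card_set_bijP; exists (fun i => cl (nth 0 reps i)); split.
- by move=> i /= iN; apply: clin; have [] := repP i iN.
- move=> i j /set_mem iN /set_mem jN /= e.
  have [iT _] := repP i iN; have [jT _] := repP j jN.
  have := proj1 (cleq _ _ iT jT) e; rewrite -!(nth_map 0 (I 0)) ?sz // IE => /eqP.
  by rewrite nth_uniq ?szE ?enum_uniq // => /eqP.
move=> C' /clsurj[x xT ->].
have tE : I x \in E by rewrite mem_enum; apply/imsetP; exists x.
have iN : (index (I x) E < N)%N by rewrite -szE index_mem.
exists (index (I x) E); first exact: iN.
have [jT _] := repP _ iN; apply/(cleq _ _ jT xT).
by rewrite -(nth_map 0 (I 0)) ?sz // IE nth_index.
Qed.

Definition type_list := [:: tyG; tyL; tyJ; tyT1; tyT2; tyT3; tyM; tyN].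

Lemma type_listP X : exists2 i, (i < 8)%N & nth tyG type_list i = X.
Proof.
by case: X; [exists 0%N|exists 1%N|exists 2%N|exists 3%N|exists 4%N|exists 5%N|exists 6%N|exists 7%N].
Qed.

Definition type_index X : nat :=
  match X with tyG => 0 | tyL => 1 | tyJ => 2 | tyT1 => 3 | tyT2 => 4 | tyT3 => 5 | tyM => 6 | tyN => 7 end.

Lemma type_list_inj i j : (i < 8)%N -> (j < 8)%N -> nth tyG type_list i = nth tyG type_list j -> i = j.
Proof.
have K k : (k < 8)%N -> type_index (nth tyG type_list k) = k.
  by case: k => [|[|[|[|[|[|[|[|//]]]]]]]].
by move=> hi hj e; rewrite -(K i hi) -(K j hj) e.
Qed.

Lemma shadows_by_type :
  [/\ (Sh circ #= `I_8)%card,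
      (forall s, Sh circ s -> exists! X, has_type circ X s)
    & (forall X, exists! s, Sh circ s /\ has_type circ X s)].
Proof.
have ex0 X : exists B : M, star B + B = 0 /\ mtype X B.
  by have [B sB mB] := type_realized H H2 fK gK X; exists B.
have [b bP] := choice ex0.
split=> [|s /(ShP H H2 fK gK _)[X [B [sB mB ->]]]|X].
- rewrite card_eq_sym; apply/card_set_bijP.
  exists (fun i => res_shadow circ (b (nth tyG type_list i))); split.
  + move=> i _; apply/(ShP H H2 fK gK _); exists (nth tyG type_list i), (b (nth tyG type_list i)).
    by have [h1 h2] := bP (nth tyG type_list i).
  + move=> i j /set_mem iN /set_mem jN e; apply: type_list_inj => //.
    have [h1 h2] := bP (nth tyG type_list i); have [h3 h4] := bP (nth tyG type_list j).
    exact: (res_shadow_type H2 h1 h3 h2 h4 e).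
  move=> s /(ShP H H2 fK gK _)[X [B [sB mB ->]]]; have [i iN iE] := type_listP X.
  exists i; first exact: iN.
  have [h1 h2] := bP (nth tyG type_list i); rewrite iE in h1 h2 *.
  exact: (res_shadow_eq H2 h1 sB h2 mB).
- exists X; split; first by apply/(has_typeP H2 _ sB mB).
  by move=> Y /(has_typeP H2 _ sB mB).
have [sB mB] := bP X; exists (res_shadow circ (b X)); split.
  by split; [apply/(ShP H H2 fK gK _); exists X, (b X) | apply/(has_typeP H2 _ sB mB)].
move=> s [/(ShP H H2 fK gK _)[Y [B [sB' mB' ->]]] /(has_typeP H2 _ sB' mB') XY].
by apply: (res_shadow_eq H2 sB sB' mB); rewrite XY.
Qed.

Lemma count_classes s t X Y l (C : set 'M[vquot O l]_3) : Sh circ t ->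
  has_type circ X s -> has_type circ Y t -> is_class circ C -> shadow circ C = s ->
  exists2 N, ([set C' : set 'M[vquot O l.+1]_3 |
     [/\ is_class circ C', shadow circ C' = t & above C' C]]%classic #= `I_N)%card &
    (6 * N)%:Z = (count6 X Y).[q%:Z].
Proof.
move=> St tX tY isC shC; have [A sA CE] := proj1 (class_rep H H2 fK gK C) isC.
have [X' [B [sB mB SB]]] := str_typed L sA (str_all L l sA).
have sB' : star (map_mx rd B) + map_mx rd B = 0 by rewrite -(rdm_st L) -rdmD sB map_mx0.
have XX : X = X'.
  by apply/(has_typeP H2 _ sB' mB); rewrite -(shadow_cls H H2 sA SB) -CE shC.
have [Y' [Bt [sBt mBt tE]]] := proj1 (ShP H H2 fK gK t) St.
have YY : Y = Y' by apply/(has_typeP H2 _ sBt mBt); rewrite -tE.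
rewrite XX YY tE CE; exact: (count_above sA sB' mB SB sBt mBt).
Qed.

End Counting.

(** * The polynomials with denominator 6 and the final statement *)

Definition a_poly X Y : {poly rat} := 6%:R^-1 *: map_poly intr (count6 X Y).

Lemma a_polyE X Y q N : (6 * N)%:Z = (count6 X Y).[q%:Z] -> N%:R = (a_poly X Y).[q%:R].
Proof.
move=> e; rewrite /a_poly hornerZ -[q%:R]/((q%:Z)%:~R) horner_map -e /= PoszM intrM mulrA.
by rewrite mulVf ?mul1r.
Qed.

Lemma a_polyZ X Y : Zinv6_poly (a_poly X Y).
Proof.
move=> i; exists 1%N; rewrite expr1 coefZ coef_map mulrA divff // mul1r; exact: Num.Theory.intr_int.
Qed.
Local Open Scope classical_set_scope.
Local Open Scope card_scope.

Theorem theorem3p12 :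
  exists2 a : sh_type -> sh_type -> {poly rat},
    (forall X Y, Zinv6_poly (a X Y)) &
  forall (o : dvrType) (q : nat) (O : dvrType) (iota : {rmorphism o -> O})
    (circ : {rmorphism O -> O}),
    vcompact o ->
    [set: residue o] #= `I_q ->
    2%N \notin [pchar (residue o)] ->
    unramified_quadratic iota circ ->
    [/\ Sh circ #= `I_8,
        (forall s, Sh circ s -> exists! X, has_type circ X s)
      & (forall X, exists! s, Sh circ s /\ has_type circ X s)]
    /\
    (forall s t, Sh circ s -> Sh circ t ->
     forall X Y, has_type circ X s -> has_type circ Y t ->
     forall (l : nat) (C : set 'M[vquot O l]_3), (0 < l)%N ->
       is_class circ C -> shadow circ C = s ->
       exists2 N : nat,
         [set C' : set 'M[vquot O l.+1]_3 |
           [/\ is_class circ C', shadow circ C' = t & above C' C]] #= `I_N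
         & N%:R = (a X Y).[q%:R]).
Proof.
exists a_poly => [X Y|o q O iota circ _ cq H2 H]; first exact: a_polyZ.
have [f [g [fK gK]]] := res_card H cq.
split; first exact: (shadows_by_type H H2 fK gK).
move=> s t _ St X Y tX tY l C _ isC shC.
have [N cN NE] := count_classes H H2 fK gK St tX tY isC shC.
by exists N; [exact: cN | exact: a_polyE].
Qed.
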